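(* Let $\mathcal X_n$ be the point process of eigenvalues of $G_n$ and let $U\subseteq\mathbb D$ be an open set such that there exists a sequence of open sets $U_n$ with $\overline U\subset U_n\subseteq\mathbb D$ for all $n$ and such that the balayage measures $\nu_n$ on $\partial U_n$ converge weakly to the balayage measure $\nu$ on $\partial U$. Then $$\lim_{n\to\infty}\frac1{n^2}\log\mathbf P\big[\mathcal X_n(\sqrt n\,U)=0\big]=R_\emptyset-R_U.$$
   Context: $\mathbb D$ is the open unit disk, $m$ Lebesgue measure on $\mathbb C$. $G_n$ is an $n\times n$ random matrix with i.i.d. standard complex Gaussian entries (density $\frac1\pi e^{-|z|^2}$); $\mathcal X(A)$ denotes the number of points of $\mathcal X$ in $A$, and $\sqrt nU=\{\sqrt nz:z\in U\}$. For $E\subseteq\mathbb C$, $\mathcal P(E)$ is the set of compactly supported Borel probability measures with support in $E$. $R_\mu=\iint\log\frac1{|z-w|}d\mu(z)d\mu(w)+\int|z|^2d\mu(z)$, $R_U=\inf_{\mu\in\mathcal P(\mathbb C\setminus U)}R_\mu$ and $R_\emptyset=\inf_{\mu\in\mathcal P(\mathbb C)}R_\mu$ $(=3/4)$. A Borel set $B$ is polar if $\iint\log\frac1{|z-w|}d\mu d\mu=+\infty$ for every compactly supported probability measure $\mu$ supported in $B$; ''q.e.'' means outside a Borel polar set. For a bounded open set $V$, the balayage measure on $\partial V$ is the unique positive Borel measure $\nu$ on $\partial V$ with $\nu(B)=0$ for every Borel polar $B$ and $\int\log\frac1{|z-w|}d\nu(w)=\frac1\pi\int_V\log\frac1{|z-w|}dm(w)$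 for q.e. $z\in\mathbb C\setminus V$. *)

(* Defs.v *)
(* The complex plane C is modelled as R * R
   (with its product topology / product Borel sigma-algebra); the matrix
   entries live in the field R[i] = complex R of mathcomp-real-closed. *)
From HB Require Import structures.
From mathcomp Require Import all_boot all_order all_algebra.
From mathcomp Require Import all_classical all_reals all_analysis.
From mathcomp Require Import complex.

Set Implicit Arguments.
Unset Strict Implicit.
Unset Printing Implicit Defensive.

Import Order.TTheory GRing.Theory Num.Theory.
Import numFieldNormedType.Exports.

Local Open Scope classical_set_scope.
Local Open Scope ring_scope.

Section GinibreDefs.
Variable R : realType.

Definition sqnorm (z : R * R) : R := z.1 ^+ 2 + z.2 ^+ 2.
Definition edist (z w : R * R) : R :=
  Num.sqrt ((z.1 - w.1) ^+ 2 + (z.2 - w.2) ^+ 2).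

Definition unit_disk : set (R * R) := [set z | sqnorm z < 1].

Definition logker (z w : R * R) : \bar R :=
  if z == w then +oo%E else (- ln (edist z w))%:E.

Definition lebC := (@lebesgue_measure R \x @lebesgue_measure R)%E.

Definition supp (mu : set (R * R) -> \bar R) : set (R * R) :=
  [set x | forall e : R, 0 < e -> (0 < mu (ball x e))%E].

Definition probs_in (E : set (R * R)) : set (probability (R * R)%type R) :=
  [set mu | compact (supp mu) /\ supp mu `<=` E].

Definition log_energy (mu : probability (R * R)%type R) : \bar R :=
  (\int[mu]_z \int[mu]_w logker z w)%E.

Definition Rmu (mu : probability (R * R)%type R) : \bar R :=
  (log_energy mu + \int[mu]_z (sqnorm z)%:E)%E.

Definition R_U (U : set (R * R)) : \bar R :=
  ereal_inf [set Rmu mu | mu in probs_in (~` U)].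

Definition R_empty : \bar R := ereal_inf [set Rmu mu | mu in probs_in setT].

Definition polar (B : set (R * R)) : Prop :=
  measurable B /\ forall mu, probs_in B mu -> log_energy mu = +oo%E.

Definition qe_on (A : set (R * R)) (P : R * R -> Prop) : Prop :=
  exists N, polar N /\ forall z, A z -> ~ N z -> P z.

Definition boundary (V : set (R * R)) : set (R * R) :=
  closure V `\` interior V.

Definition is_balayage (V : set (R * R))
    (nu : {measure set (R * R) -> \bar R}) : Prop :=
  nu (~` boundary V) = 0%E /\
  (forall B, polar B -> nu B = 0%E) /\
  qe_on (~` V) (fun z =>
    (\int[nu]_w logker z w = (pi^-1)%:E * \int[lebC]_(w in V) logker z w)%E).

Definition weak_cvg (nu_ : nat -> {measure set (R * R) -> \bar R})
    (nu : {measure set (R * R) -> \bar R}) : Prop :=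
  forall f : R * R -> R, continuous f -> (exists M : R, forall x, `|f x| <= M) ->
    (\int[nu_ n]_x (f x)%:E)%E @[n --> \oo] --> (\int[nu]_x (f x)%:E)%E.

(* iterated integral against k i.i.d. standard complex Gaussians, the k
   complex variables being the coordinates 0..k-1 of x : nat -> C;
   density of each entry w.r.t. m is (1/pi) exp(-|z|^2). *)
Fixpoint gauss_iter (k : nat) (F : (nat -> R * R) -> \bar R)
    : (nat -> R * R) -> \bar R :=
  match k with
  | 0 => F
  | k'.+1 => fun x =>
      (\int[lebC]_z ((pi^-1 * expR (- sqnorm z))%:E *
          gauss_iter k' F (fun i => if i == k' then z else x i)))%E
  end.

Definition mx_of (n : nat) (x : nat -> R * R) : 'M[R[i]]_n :=
  \matrix_(i < n, j < n) ((x (i * n + j)%N).1 +i* (x (i * n + j)%N).2)%C.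

Definition ginibre_prob (n : nat) (E : set 'M[R[i]]_n) : \bar R :=
  gauss_iter (n * n) (fun x => (\1_E (mx_of n x))%:E) (fun _ => (0, 0)).

Definition scaled_set (n : nat) (U : set (R * R)) : set R[i] :=
  [set z | exists2 u, U u &
     complex.Re z = Num.sqrt n%:R * u.1 /\ complex.Im z = Num.sqrt n%:R * u.2].

Definition no_eigs_in (n : nat) (U : set (R * R)) : set 'M[R[i]]_n :=
  [set A | forall z, scaled_set n U z -> ~~ root (char_poly A) z].

End GinibreDefs.

(* Main.v *)
(** Eigenvalues are removed one at a time: a matrix with blocks [[a, w], [c, D]] is parametrised by an
 eigenvalue l instead of a, where a = P(l)/Q(l) is (n+1)-to-one in l, and by u with c = (l - D) u. This
 gives P[no eigenvalue in sqrt n U] = Z_n(U) / Z_n(0), with Z_n(U) the integral over (C \ U)^n of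
 prod |z_i - z_j|^2 exp(- n sum |z_i|^2). Put K(z,w) = -ln|z - w| + (|z|^2 + |w|^2)/2 >= 0, so that R_mu
 is the double integral of K. Upper bound for Z_n(U): otherwise there are n-tuples off U of energy below
 n^2 c/2 with c < R_U; most of their points lie in a fixed box, and an ultralimit of the distributions of
 their quaternary codes is the law of a random point off U of energy at most c. Lower bound: Jensen's
 inequality for a smearing, by a small disc, of a minimiser for U_n. That minimiser is the circular law
 with its part on U_n swept to the boundary, and its energy depends only on second moments, so that weak
 convergence of the balayage measures gives R_{U_n} -> R_U. *)
From HB Require Import structures.
From mathcomp Require Import all_boot all_order all_algebra.
From mathcomp Require Import fingroup perm all_classical all_reals all_analysis.
From mathcomp Require Import measurable_realfun measurable_fun_approximation complex ring lra zify.
From mathcomp Require Import separable spectral sesquilinear.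
Require Import Defs.

Set Implicit Arguments.
Unset Strict Implicit.
Unset Printing Implicit Defensive.
Import Order.TTheory GRing.Theory Num.Theory.
Import numFieldNormedType.Exports.
Local Open Scope classical_set_scope.
Local Open Scope ring_scope.

(** The only substitutions made are affine maps of vectors and rational maps of one complex
    variable. Their Jacobian constants depend on [u] in an unknown way, but are the same for all
    functions of the characteristic polynomial, so they drop out on comparing [U] with the empty
    set, where the probability is 1.

    Adding the quadratic terms to the logarithm makes the kernel nonnegative: Tonelli then applies
    everywhere and infinite energies are allowed. A balayage measure is known only through its
    potential off a polar set; its mass is read off from the potential far away, and polar sets are
    shown to be null for area and for compactly supported laws of finite energy. That the swept
    measure is optimal rests on positive definiteness of the kernel, which is reduced to that of
    Gaussian kernels.

    Smearing needs room between the measure and [U]; this is why the minimiser is taken for some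
    [U_n]. The limit is computed separately for [U] and for the empty set, whose balayage is 0. *)

Local Notation measT := (measurable_fun setT).
Local Notation mfst := (@measurable_fst _ _ _ _).
Local Notation msnd := (@measurable_snd _ _ _ _).
Local Ltac efin := apply/measurable_EFinP.
Local Ltac le_meas := apply: le_measure; rewrite ?inE.
Local Ltac null_le := apply/eqP; rewrite eq_le measure_ge0 andbT.
Local Ltac mx_ext := apply/matrixP => i j; rewrite !mxE.

(** * Lebesgue measure on the plane *)

Section leb.
Variable R : realType.
Notation MR := (measurableTypeR R).

(** Lebesgue measure on the measurable structure of [R] itself, which has the same sigma-algebra as
    [measurableTypeR R]; its square then lives on [R * R] as it occurs in the definitions. *)
Definition leb1 (A : set R) : \bar R := @lebesgue_measure R A.

Let leb1_0 : leb1 set0 = 0%E. Proof. exact: (@measure0 _ MR _ lebesgue_measure). Qed.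
Let leb1_ge0 A : (0 <= leb1 A)%E. Proof. exact: (@measure_ge0 _ MR _ lebesgue_measure). Qed.
Let leb1_add : semi_sigma_additive leb1.
Proof. exact: (@measure_semi_sigma_additive _ MR _ lebesgue_measure). Qed.
HB.instance Definition _ := isMeasure.Build _ _ _ leb1 leb1_0 leb1_ge0 leb1_add.
Let leb1_sf : sigma_finite setT leb1.
Proof. exact: (@sigma_finiteT _ MR _ lebesgue_measure). Qed.
HB.instance Definition _ := Measure_isSigmaFinite.Build _ _ _ leb1 leb1_sf.

Definition leb2 (A : set (R * R)) : \bar R := ((leb1 : {sigma_finite_measure set R -> \bar R}) \x leb1)%E A.
Let leb2m : {measure set (R * R)%type -> \bar R} := ((leb1 : {sigma_finite_measure set R -> \bar R}) \x leb1)%E.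
Let leb2_0 : leb2 set0 = 0%E. Proof. exact: (@measure0 _ _ _ leb2m). Qed.
Let leb2_ge0 A : (0 <= leb2 A)%E. Proof. exact: (@measure_ge0 _ _ _ leb2m). Qed.
Let leb2_add : semi_sigma_additive leb2.
Proof. exact: (@measure_semi_sigma_additive _ _ _ leb2m). Qed.
HB.instance Definition _ := isMeasure.Build _ _ _ leb2 leb2_0 leb2_ge0 leb2_add.
Let leb2_sf : sigma_finite setT leb2.
Proof.
have /sigma_finiteP[F [TF ndF Foo]] := sigma_finiteT leb1.
exists (fun n => F n `*` F n).
 rewrite -setXTT TF predeqE => -[x y]; split.
  move=> [/= [n _ Fnx] [k _ Gky]]; exists (maxn n k) => //; split.
  - by move: x Fnx; exact/subsetPset/ndF/leq_maxl.
  - by move: y Gky; exact/subsetPset/ndF/leq_maxr.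
 by move=> [n _ []/= ? ?]; split; exists n.
move=> k; have [? ?] := Foo k.
split; first exact: measurableX.
by rewrite /leb2 product_measure1E// lte_mul_pinfty// ge0_fin_numE.
Qed.
HB.instance Definition _ := Measure_isSigmaFinite.Build _ _ _ leb2 leb2_sf.

End leb.
Arguments leb1 {R}.
Arguments leb2 {R}.

Section tonelli.
Context d1 d2 (T1 : measurableType d1) (T2 : measurableType d2) (R : realType).
Variables (m1 : {sigma_finite_measure set T1 -> \bar R}) (m2 : {sigma_finite_measure set T2 -> \bar R}).
Variable f : T1 -> T2 -> \bar R.
Hypothesis mf : measT (fun z : T1 * T2 => f z.1 z.2).
Hypothesis f0 : forall x y, (0 <= f x y)%E.

Lemma meas_int_curry : measT (fun x => \int[m2]_y f x y)%E.
Proof. exact: (measurable_fun_fubini_tonelli_F _ mf (fun z => f0 _ _)). Qed.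

Lemma meas_int_curry' : measT (fun y => \int[m1]_x f x y)%E.
Proof. exact: (measurable_fun_fubini_tonelli_G _ mf (fun z => f0 _ _)). Qed.

Lemma int_swap : (\int[m1]_x \int[m2]_y f x y = \int[m2]_y \int[m1]_x f x y)%E.
Proof. exact: (fubini_tonelli _ mf (fun z => f0 _ _)). Qed.

Lemma meas_curry x : measT (f x).
Proof. exact: (measurableT_comp mf (measurable_pair1 x)). Qed.

Lemma meas_curry' y : measT (f ^~ y).
Proof. exact: (measurableT_comp mf (measurable_pair2 y)). Qed.
End tonelli.

Section leb_facts.
Variable R : realType.
Notation MR := (measurableTypeR R).
Local Notation leb1 := (@leb1 R).
Local Notation leb2 := (@leb2 R).

Lemma meas_id1 : measT (id : MR -> R).
Proof. by move=> _ Y mY; rewrite setTI. Qed.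
Lemma meas_id2 : measT (id : (MR * MR)%type -> (R * R)%type).
Proof. by move=> _ Y mY; rewrite setTI. Qed.

Lemma int_transfer d1 d2 (T1 : measurableType d1) (T2 : measurableType d2) (phi : T1 -> T2)
 (mphi : measT phi) (m1 : {measure set T1 -> \bar R}) (m2 : {measure set T2 -> \bar R})
 (D : set T2) (f : T2 -> \bar R) : (forall A, measurable A -> m2 A = m1 (phi @^-1` A)) ->
 measurable D -> measurable_fun D f ->
 (\int[m2]_(x in D) f x = \int[m1]_(x in phi @^-1` D) f (phi x))%E.
Proof.
move=> m12 mD mf.
have H (g : T2 -> \bar R) : measurable_fun D g -> (forall x, 0 <= g x)%E ->
 (\int[m2]_(x in D) g x = \int[m1]_(x in phi @^-1` D) g (phi x))%E.
 move=> mg g0; rewrite -[RHS](ge0_integral_pushforward mphi)//.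
 by apply: eq_measure_integral => A mA _; rewrite m12.
rewrite integralE [RHS]integralE; congr (_ - _)%E.
 by rewrite H; [apply: eq_integral => x _; rewrite !funeposE|exact: measurable_funepos|].
by rewrite H; [apply: eq_integral => x _; rewrite !funenegE|exact: measurable_funeneg|].
Qed.

Lemma int_leb1 (D : set R) (f : R -> \bar R) : measurable D -> measurable_fun D f ->
 (\int[@lebesgue_measure R]_(x in D) f x = \int[leb1]_(x in D) f x)%E.
Proof.
by move=> mD mf; rewrite [RHS](@int_transfer _ _ _ _ _ meas_id1 lebesgue_measure).
Qed.

Lemma int_lebC (D : set (R * R)) (f : R * R -> \bar R) : measurable D -> measurable_fun D f ->
 (\int[@lebC R]_(x in D) f x = \int[leb2]_(x in D) f x)%E.
Proof.
move=> mD mf; rewrite [RHS](@int_transfer _ _ _ _ _ meas_id2 (lebesgue_measure \x lebesgue_measure)%E)//.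
move=> A mA.
transitivity (((leb1 : {sigma_finite_measure set R -> \bar R}) \x leb1)%E A); first by [].
pose m' : {measure set (R * R)%type -> \bar R} := pushforward ((lebesgue_measure : {sigma_finite_measure set MR -> \bar R}) \x lebesgue_measure)%E (id : (MR * MR)%type -> (R * R)%type).
rewrite (@product_measure_unique _ _ _ _ R leb1 leb1 (m' meas_id2))//.
move=> X Y mX mY.
exact: (@product_measure1E _ _ MR MR _ lebesgue_measure lebesgue_measure X Y mX mY).
Qed.

Lemma leb2E (f : R * R -> \bar R) : measT f -> (forall x, 0 <= f x)%E ->
 (\int[leb2]_z f z = \int[leb1]_x \int[leb1]_y f (x,y))%E.
Proof. by move=> mf f0; rewrite -[RHS](@fubini_tonelli1 _ _ _ _ _ leb1 leb1 f mf f0). Qed.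

Lemma leb2E' (f : R * R -> \bar R) : measT f -> (forall x, 0 <= f x)%E ->
 (\int[leb2]_z f z = \int[leb1]_y \int[leb1]_x f (x,y))%E.
Proof. by move=> mf f0; rewrite -[RHS](@fubini_tonelli2 _ _ _ _ _ leb1 leb1 f mf f0). Qed.

Lemma leb1_itv (i : interval R) : leb1 [set` i] = (if i.1 < i.2 then (i.2 : \bar R) - i.1 else 0)%E.
Proof. exact: lebesgue_measure_itv. Qed.

Lemma leb1_unique (mu : {measure set R -> \bar R}) :
 (forall a b : R, a < b -> mu `]a, b]%classic = (b - a)%:E) -> forall A : set R, measurable A -> leb1 A = mu A.
Proof.
move=> H A mA.
have mid : measT (id : R -> MR) by move=> _ Y mY; rewrite setTI.
pose mu'0 : {measure set MR -> \bar R} := pushforward mu (id : R -> MR).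
pose mu' := mu'0 mid.
have -> : mu A = mu' A by [].
apply: (@lebesgue_measure_unique R mu') => // X [[c d]] _ <- /=.
rewrite /mu' /= /pushforward preimage_id.
have [cd|dc] := ltP c d.
 by rewrite H// lebesgue_measure_itv/= lte_fin cd EFinB.
by rewrite set_itv_ge ?bnd_simp -?leNgt// !measure0.
Qed.

Lemma leb1_affine (a b : R) : a != 0 -> forall A : set R, measurable A ->
 leb1 A = (`|a|%:E * leb1 ((fun x : R => (a * x + b)%R) @^-1` A))%E.
Proof.
move=> a0 A mA.
have mg : measT (fun x : R => a * x + b).
 by apply: measurable_funD => //; apply: measurable_funM.
have na : 0 <= `|a| by [].
pose pf : {measure set R -> \bar R} := pushforward leb1 (fun x : R => a * x + b).
pose mu : {measure set R -> \bar R} := mscale (NngNum na) (pf mg).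
apply: (@leb1_unique mu) => // c d cd.
rewrite /mu /= /mscale /= /pushforward.
have [ap|an|a0'] := ltgtP a 0; last by rewrite a0' eqxx in a0.
 have -> : (fun x : R => a * x + b) @^-1` `]c, d]%classic = `[(d - b) / a, (c - b) / a[%classic.
  apply/seteqP; split => x /=; rewrite !in_itv /= ler_ndivrMr// ltr_ndivlMr//; move/andP => [? ?]; apply/andP; split; lra.
 rewrite leb1_itv /= lte_fin ltr_ndivrMr// mulfVK ?lt_eqF//.
 have -> : c - b < d - b by lra.
 by rewrite -EFinB -EFinM ltr0_norm//; congr EFin; field; rewrite lt_eqF.
have -> : (fun x : R => a * x + b) @^-1` `]c, d]%classic = `](c - b) / a, (d - b) / a]%classic.
 apply/seteqP; split => x /=; rewrite !in_itv /= ler_pdivlMr// ltr_pdivrMr//; move/andP => [? ?]; apply/andP; split; lra.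
rewrite leb1_itv /= lte_fin ltr_pdivrMr// mulfVK ?gt_eqF//.
have -> : c - b < d - b by lra.
by rewrite -EFinB -EFinM gtr0_norm//; congr EFin; field; rewrite gt_eqF.
Qed.

Lemma int_leb1_affine (a b : R) (f : R -> \bar R) : a != 0 -> measT f -> (forall x, 0 <= f x)%E ->
 (`|a|%:E * \int[leb1]_x f (a * x + b)%R = \int[leb1]_x f x)%E.
Proof.
move=> a0 mf f0.
have mg : measT (fun x : R => a * x + b).
 by apply: measurable_funD => //; apply: measurable_funM.
have na : 0 <= `|a| by [].
pose pf : {measure set R -> \bar R} := pushforward leb1 (fun x : R => a * x + b).
pose mu : {measure set R -> \bar R} := mscale (NngNum na) (pf mg).
rewrite [RHS](@eq_measure_integral _ _ _ _ mu); last by move=> A mA _; exact: leb1_affine.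
rewrite [RHS]ge0_integral_mscale//=; congr (_ * _)%E.
by rewrite [RHS]ge0_integral_pushforward//.
Qed.

Lemma leb2_shift (v : R * R) (f : R * R -> \bar R) : measT f -> (forall x, 0 <= f x)%E ->
 (\int[leb2]_z f (z.1 + v.1, z.2 + v.2)%R = \int[leb2]_z f z)%E.
Proof.
move=> mf f0.
have mg : measT (fun z : R * R => (z.1 + v.1, z.2 + v.2)).
 by apply/measurable_fun_pairP; split; apply: measurable_funD => //.
rewrite (leb2E mf f0) (leb2E (f := fun z => f (z.1 + v.1, z.2 + v.2)) (measurableT_comp mf mg) (fun z => f0 _)).
have H (g : R -> \bar R) w : measT g -> (forall x, 0 <= g x)%E ->
 (\int[leb1]_x g (x + w)%R = \int[leb1]_x g x)%E.
 move=> mg' g0; rewrite -[RHS](@int_leb1_affine 1 w)// normr1 mul1e.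
 by under [RHS]eq_integral do rewrite mul1r.
under eq_integral => x _.
 rewrite (H (fun y => f (x + v.1, y)%R)); [over| |by move=> ?; exact: f0].
 exact: (measurableT_comp mf (measurable_pair1 _)).
rewrite (H (fun x => \int[leb1]_y f (x, y))%E)//.
 exact: measurable_fun_fubini_tonelli_F.
by move=> x; apply: integral_ge0.
Qed.

(** An open set is the union of the rational rectangles that it contains, and these are countably
    many. This ties the product sigma-algebra to the topology. *)
Lemma open_measurable2 (A : set (R * R)) : open A -> measurable A.
Proof.
move=> oA.
pose I (p : (rat * rat) * (rat * rat)) : set (R * R) :=
 [set z | (ratr p.1.1 < z.1 < ratr p.1.2) /\ (ratr p.2.1 < z.2 < ratr p.2.2)].
have mI p : measurable (I p).
 have -> : I p = `]ratr p.1.1, ratr p.1.2[%classic `*` `]ratr p.2.1, ratr p.2.2[%classic.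
  by apply/seteqP; split => z /=; rewrite !in_itv.
 exact: measurableX.
have -> : A = \bigcup_(p in [set p | I p `<=` A]) I p.
 apply/seteqP; split; last by move=> z [p /= pA /pA].
 move=> z Az.
 have /nbhs_ballP [e /= e0 eA] : nbhs z A by move: oA; rewrite openE; exact.
 have [a1 /[!in_itv]/= /andP[h1 h2]] := @rat_in_itvoo R (z.1 - e) z.1 ltac:(lra).
 have [a2 /[!in_itv]/= /andP[h3 h4]] := @rat_in_itvoo R z.1 (z.1 + e) ltac:(lra).
 have [b1 /[!in_itv]/= /andP[h5 h6]] := @rat_in_itvoo R (z.2 - e) z.2 ltac:(lra).
 have [b2 /[!in_itv]/= /andP[h7 h8]] := @rat_in_itvoo R z.2 (z.2 + e) ltac:(lra).
 exists ((a1, a2), (b1, b2)) => /=; last by rewrite /I /= h2 h3 h6 h7.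
 move=> w /= [/andP[w1 w2] /andP[w3 w4]]; apply: eA; split => /=;
  rewrite /ball /= ltr_norml; apply/andP; split; lra.
rewrite bigcup_mkcond; apply: countable_bigcupT_measurable => [|p]; first exact: countableP.
by case: ifP.
Qed.

Lemma continuous_meas (f : R * R -> R) : continuous f -> measT f.
Proof.
move=> cf; apply: (measurability (@RGenOpens.G R)).
 exact: RGenOpens.measurableE.
move=> _ [_ [a [b ->]] <-]; rewrite setTI; apply: open_measurable2.
apply: open_comp; last exact: interval_open.
by move=> x _; exact: cf.
Qed.
Lemma closed_measurable2 (A : set (R * R)) : closed A -> measurable A.
Proof.
by move=> cA; rewrite -(setCK A); apply: measurableC; apply: open_measurable2; rewrite openC.
Qed.

Definition cmul2 (a z : R * R) : R * R := (a.1 * z.1 - a.2 * z.2, a.1 * z.2 + a.2 * z.1).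

Lemma meas_pairR d (T : measurableType d) (f g : T -> R) : measT f -> measT g ->
 measT (fun x => (f x, g x)).
Proof. by move=> mf mg; apply/measurable_fun_pairP; split. Qed.

Lemma meas_cmul2 a : measT (cmul2 a).
Proof.
by apply: meas_pairR; [apply: measurable_funB|apply: measurable_funD]; apply: measurable_funM.
Qed.

(** For [a = (p, q)] with [p <> 0], multiplication by [a] factors through two one-dimensional affine
    maps: [x] becomes [p x - q y] at fixed [y], then [y] becomes [c y + (q / p) x] at fixed [x],
    with [c = (p^2 + q^2) / p]. For [p = 0] the axes are exchanged. *)
Lemma leb2_cscale (a : R * R) (f : R * R -> \bar R) : a != 0 ->
 measT f -> (forall x, 0 <= f x)%E ->
 ((sqnorm a)%:E * \int[leb2]_z f (cmul2 a z) = \int[leb2]_z f z)%E.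
Proof.
case: a => p q a0 mf f0.
have mh := measurableT_comp mf (meas_cmul2 (p, q)).
have msec (x : R) : measT (fun y : R => f (x, y)).
 exact: (measurableT_comp mf (measurable_pair1 _)).
rewrite (leb2E mf f0) (leb2E' mh (fun z => f0 _)) /sqnorm /=.
have [p0|p0] := eqVneq p 0.
 have q0 : q != 0 by apply: contraNneq a0 => ->; rewrite p0.
 subst p; rewrite expr0n add0r.
 have q0' : - q != 0 by rewrite oppr_eq0.
 have E := @int_leb1_affine (- q) 0 (fun x => \int[leb1]_y f (x, y))%E q0'
  (measurable_fun_fubini_tonelli_F _ mf f0)
  ltac:(by move=> x; exact: integral_ge0).
 rewrite -[RHS]E.
 have -> : q ^+ 2 = `|- q| * `|q| by rewrite normrN -expr2 real_normK// num_real.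
 rewrite EFinM -muleA; congr (_ * _)%E.
 rewrite -ge0_integralZl//; last 2 first.
  - exact: (measurable_fun_fubini_tonelli_G _ mh (fun z => f0 _)).
  - by move=> x _; apply: integral_ge0.
 apply: eq_integral => y _.
 rewrite -[RHS](@int_leb1_affine q 0)//; congr (_ * _)%E.
 by apply: eq_integral => x _; rewrite /cmul2 /= !mul0r sub0r add0r !addr0 mulNr.
have pq : p ^+ 2 + q ^+ 2 != 0.
 by rewrite paddr_eq0 ?sqr_ge0// negb_and !sqrf_eq0 p0.
have -> : p ^+ 2 + q ^+ 2 = `|(p ^+ 2 + q ^+ 2) / p| * `|p|.
 rewrite normrM normfV mulfVK ?normr_eq0// ger0_norm// addr_ge0// sqr_ge0//.
pose c := (p ^+ 2 + q ^+ 2) / p.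
have c0 : c != 0 by rewrite mulf_neq0 ?invr_eq0.
pose h (z : R * R) := f (z.1, c * z.2 + q / p * z.1).
have mhh : measT h.
 apply: (measurableT_comp mf); apply: meas_pairR => //.
 by apply: measurable_funD; apply: measurable_funM.
rewrite EFinM -muleA.
transitivity (`|c|%:E * \int[leb1]_y \int[leb1]_x h (x, y))%E.
 congr (_ * _)%E.
 rewrite -ge0_integralZl//; last 2 first.
  - exact: (measurable_fun_fubini_tonelli_G _ mh (fun z => f0 _)).
  - by move=> x _; apply: integral_ge0.
 apply: eq_integral => y _.
 rewrite -[RHS](@int_leb1_affine p (- q * y))//; last 2 first.
  - exact: (measurableT_comp mhh (measurable_pair2 _)).
  - by move=> x; exact: f0.
 congr (_ * _)%E; apply: eq_integral => x _; rewrite /h /cmul2 /c /=.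
 by congr (f (_, _)); [ring|field].
rewrite -(leb2E' mhh (fun z => f0 _)) (leb2E mhh (fun z => f0 _)).
rewrite -ge0_integralZl//; last 2 first.
 - exact: (measurable_fun_fubini_tonelli_F _ mhh (fun z => f0 _)).
 - by move=> x _; apply: integral_ge0 => ? _; exact: f0.
apply: eq_integral => x _.
by rewrite -[RHS](@int_leb1_affine c (q / p * x)).
Qed.
End leb_facts.

Lemma meas_comp d1 d2 d3 (T1 : measurableType d1) (T2 : measurableType d2) (T3 : measurableType d3)
 (g : T2 -> T3) (f : T1 -> T2) : measT g -> measT f ->
 measT (fun x => g (f x)).
Proof. exact: measurableT_comp. Qed.

Lemma meas_expN d (T : measurableType d) (R : realType) (f : T -> R) : measT f -> measT (fun x => expR (- f x)).
Proof. by move=> mf; apply: (meas_comp (@measurable_expR R)); exact: measurableT_comp. Qed.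

Lemma meas_pair d1 d2 d3 (T1 : measurableType d1) (T2 : measurableType d2) (T3 : measurableType d3)
 (f : T1 -> T2) (g : T1 -> T3) : measT f -> measT g ->
 measT (fun x => (f x, g x)).
Proof. by move=> mf mg; apply/measurable_fun_pairP; split. Qed.

Lemma meas_ext d1 d2 (T1 : measurableType d1) (T2 : measurableType d2) (f g : T1 -> T2) :
 measT f -> f =1 g -> measT g.
Proof. by move=> mf /funext <-. Qed.

(** * Iterated integrals over complex vectors *)

Section iint.
Variable R : realType.
Local Notation leb2 := (@leb2 R).

(** The cylinder sigma-algebra serves both vectors indexed by ['I_n] and the sequences on which
    [gauss_iter] acts. *)
Definition cyl (I : Type) : set (set (I -> R * R)) :=
 [set A | exists i B, measurable B /\ A = [set x | B (x i)]].
Definition cfg (I : Type) := g_sigma_algebraType (cyl (I := I)).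

Lemma meas_eval (I : Type) (i : I) : measT (fun x : cfg I => x i : R * R).
Proof.
move=> _ B mB; rewrite setTI; apply: sub_sigma_algebra.
by exists i, B.
Qed.

Lemma meas_cfg (I : Type) d (T : measurableType d) (f : T -> cfg I) :
 (forall i, measT (fun t => f t i : R * R)) -> measT f.
Proof.
move=> H; apply: (@measurability _ _ T (cfg I) setT f (cyl (I := I))); first by [].
by move=> _ [_ [i [B [mB ->]]] <-]; exact: H.
Qed.

Variable I : eqType.
Local Notation E := (cfg I).
Definition upd (x : E) (i : I) (z : R * R) : E := fun j => if j == i then z else x j.

Lemma upd_upd x i j z w : i != j -> upd (upd x i z) j w = upd (upd x j w) i z.
Proof.
move=> ij; apply/funext => k; rewrite /upd; case: eqVneq => // ->.
by rewrite eq_sym (negbTE ij).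
Qed.

Lemma meas_upd i : measT (fun p : E * (R * R) => upd p.1 i p.2).
Proof.
apply: meas_cfg => j; rewrite /upd; case: (j == i); first exact: msnd.
exact: (measurableT_comp (meas_eval j) mfst).
Qed.

Lemma meas_upd1 x i : measT (fun z : R * R => upd x i z).
Proof. exact: (measurableT_comp (meas_upd i) (measurable_pair1 x)). Qed.

(** Coordinates outside [s] stay frozen at their values in [x], as in [gauss_iter]; reordering or
    renaming variables becomes an operation on lists. *)
Fixpoint iint (s : seq I) (F : E -> \bar R) (x : E) : \bar R :=
 if s is i :: s' then (\int[leb2]_z iint s' F (upd x i z))%E else F x.

Implicit Types F G : E -> \bar R.

Lemma iint_ge0 s F : (forall x, 0 <= F x)%E -> forall x, (0 <= iint s F x)%E.
Proof. by move=> F0; elim: s => //= i s IH x; exact: integral_ge0. Qed.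

Lemma iint_meas s F : measT F -> (forall x, 0 <= F x)%E -> measT (iint s F).
Proof.
move=> mF F0; elim: s => //= i s IH.
apply: (@meas_int_curry _ _ _ _ _ leb2 (fun x z => iint s F (upd x i z))).
 exact: (measurableT_comp IH (meas_upd i)).
by move=> *; exact: iint_ge0.
Qed.

Lemma iint_swap i j s F x : i != j -> measT F -> (forall x, 0 <= F x)%E ->
 iint (i :: j :: s) F x = iint (j :: i :: s) F x.
Proof.
move=> ij mF F0 /=.
rewrite (@int_swap _ _ _ _ _ leb2 leb2 (fun z w => iint s F (upd (upd x i z) j w))); last 2 first.
 - apply: (measurableT_comp (iint_meas s mF F0)).
  apply: meas_cfg => k; rewrite /upd; case: (k == j); first exact: msnd.
  by case: (k == i); [exact: mfst|exact: measurable_cst].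
 - by move=> *; exact: iint_ge0.
by apply: eq_integral => w _; apply: eq_integral => z _; rewrite upd_upd.
Qed.

Lemma iint_congr s F G x : (forall y, (forall j, j \notin s -> y j = x j) -> F y = G y) ->
 iint s F x = iint s G x.
Proof.
elim: s x => [|i s IH] x H /=; first exact: H.
apply: eq_integral => z _; apply: IH => y yH; apply: H => j.
by rewrite inE negb_or => /andP[ji js]; rewrite yH// /upd (negbTE ji).
Qed.

Lemma iint_front i s t F x : i \notin s -> measT F -> (forall x, 0 <= F x)%E ->
 iint (s ++ i :: t) F x = iint (i :: s ++ t) F x.
Proof.
move=> + mF F0; elim: s x => //= j s IH x; rewrite inE negb_or => /andP[ij si].
rewrite -[RHS](@iint_swap j i (s ++ t)) 1?eq_sym//=.
by apply: eq_integral => z _; exact: IH.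
Qed.

Lemma iint_perm s t F x : uniq s -> perm_eq s t -> measT F -> (forall x, 0 <= F x)%E ->
 iint s F x = iint t F x.
Proof.
move=> + + mF F0; elim: s t x => [|i s IH] t x us st.
 by move: st; rewrite perm_sym => /perm_nilP ->.
have it : i \in t by rewrite -(perm_mem st) mem_head.
have ut : uniq t by rewrite -(perm_uniq st).
case/splitPr: it st ut => t1 t2 st ut.
have it1 : i \notin t1.
 by move: ut; rewrite cat_uniq/= => /and3P[_ /norP[]].
rewrite iint_front//=; apply: eq_integral => z _; apply: IH; first by case/andP: us.
by move: st; rewrite perm_sym -cat1s perm_catCA/= perm_cons perm_sym.
Qed.

Lemma iint_scale s (c : \bar R) F G x : (0 <= c)%E -> measT F -> (forall x, 0 <= F x)%E ->
 (forall y, (forall j, j \notin s -> y j = x j) -> G y = (c * F y)%E) ->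
 iint s G x = (c * iint s F x)%E.
Proof.
move=> c0 mF F0; elim: s x => [|i s IH] x H /=; first exact: H.
rewrite -ge0_integralZl//.
- apply: eq_integral => z _; apply: IH => y yH; apply: H => j.
 by rewrite inE negb_or => /andP[ji js]; rewrite yH// /upd (negbTE ji).
- exact: (measurableT_comp (iint_meas s mF F0) (meas_upd1 x i)).
- by move=> z _; exact: iint_ge0.
Qed.

End iint.

Lemma iint_rename (R : realType) (I J : eqType) (f : I -> J) s (F : cfg R I -> \bar R) (x : cfg R J) :
 injective f ->
 iint [seq f i | i <- s] (fun y : cfg R J => F (fun i => y (f i))) x = iint s F (fun i => x (f i)).
Proof.
move=> fI; elim: s x => //= i s IH x; apply: eq_integral => z _; rewrite IH.
by congr (iint s F _); apply/funext => j; rewrite /upd (inj_eq fI).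
Qed.

Section complexplane.
Variable R : realType.
Local Notation C := (R[i]).
Definition tc (z : R * R) : C := (z.1 +i* z.2)%C.
Definition ct (c : C) : R * R := (complex.Re c, complex.Im c).
Lemma tcK : cancel tc ct. Proof. by case. Qed.
Lemma ctK : cancel ct tc. Proof. by case. Qed.
Definition nsq (c : C) : R := sqnorm (ct c).
Lemma nsq_ge0 c : 0 <= nsq c.
Proof. by rewrite /nsq /sqnorm addr_ge0// sqr_ge0. Qed.
Lemma nsqE c : (nsq c)%:C%C = c * c^*%C.
Proof. by case: c => a b; rewrite /nsq /sqnorm /=; simpc; congr (_ +i* _)%C; ring. Qed.
Lemma nsqM c d : nsq (c * d) = nsq c * nsq d.
Proof. by case: c => a b; case: d => e f; rewrite /nsq /sqnorm; simpc => /=; ring. Qed.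
Lemma nsq1 : nsq 1 = 1.
Proof. by rewrite /nsq /sqnorm /= expr1n expr0n addr0. Qed.
Lemma nsq0 : nsq 0 = 0.
Proof. by rewrite /nsq /sqnorm /= expr0n addr0. Qed.
Lemma nsq_eq0 c : (nsq c == 0) = (c == 0).
Proof.
case: c => a b; rewrite /nsq /sqnorm /= paddr_eq0 ?sqr_ge0// !sqrf_eq0.
by rewrite eq_complex.
Qed.
Lemma nsqX c n : nsq (c ^+ n) = nsq c ^+ n.
Proof. by elim: n => [|n IH]; rewrite ?expr0 ?nsq1// !exprS nsqM IH. Qed.
Lemma nsqN c : nsq (- c) = nsq c.
Proof. by case: c => a b; rewrite /nsq /sqnorm /= !sqrrN. Qed.
Lemma nsqV c : nsq (c^-1) = (nsq c)^-1.
Proof.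
have [->|c0] := eqVneq c 0; first by rewrite invr0 nsq0 invr0.
apply: (mulIf (x := nsq c)); first by rewrite nsq_eq0.
by rewrite -nsqM !mulVf ?nsq1 ?nsq_eq0.
Qed.

Lemma int_caffine (a b : C) (f : R * R -> \bar R) : a != 0 ->
 measT f -> (forall x, 0 <= f x)%E ->
 ((nsq a)%:E * \int[leb2]_z f (ct (a * tc z + b)%R) = \int[leb2]_z f z)%E.
Proof.
move=> a0 mf f0; rewrite -(leb2_shift (ct b) mf f0).
rewrite -(@leb2_cscale _ (ct a) (fun z => f (z.1 + (ct b).1, z.2 + (ct b).2)%R))//.
- congr (_ * _)%E; apply: eq_integral => z _; congr (f _).
 by case: a {a0} => p q; case: b => r s; case: z => x y; rewrite /tc/ct/cmul2; simpc.
- by apply: contra_neq a0 => h; rewrite -(ctK a) h.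
- apply: (measurableT_comp mf); apply: meas_pairR; exact: measurable_funD.
Qed.
End complexplane.

(** * Integrals over complex vectors and linear changes of variables *)

Section vint.
Variable R : realType.
Local Notation C := (R[i]).

Definition colof n (y : cfg R 'I_n) : 'cV[C]_n := \col_k tc (y k).
Definition vmeas n (G : 'cV[C]_n -> \bar R) := measT (fun y : cfg R 'I_n => G (colof y)).
Definition vint n (G : 'cV[C]_n -> \bar R) : \bar R :=
 iint (enum 'I_n) (fun y : cfg R 'I_n => G (colof y)) (fun => (0, 0)).

Definition ccons n (z : R * R) (y : cfg R 'I_n) : cfg R 'I_n.+1 :=
 fun k => if unlift ord0 k is Some j then y j else z.

Lemma colof_cons n z (y : cfg R 'I_n) : colof (ccons z y) = col_mx (tc z)%:M (colof y) :> 'cV[C]_(1 + n).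
Proof.
apply/colP => k; rewrite !mxE /ccons.
case: (split_ordP k) => j ->.
 by rewrite (ord1 j) (_ : lshift n 0 = ord0) ?unlift_none ?mxE//; apply/val_inj.
by rewrite (_ : rshift 1 j = lift ord0 j) ?liftK ?mxE//; apply/val_inj.
Qed.

Lemma meas_ccons n : measT (fun p : (R * R) * cfg R 'I_n => ccons p.1 p.2).
Proof.
apply: meas_cfg => k; rewrite /ccons; case: unliftP => [j _|_]; last exact: mfst.
exact: (measurableT_comp (meas_eval j) msnd).
Qed.

Lemma vintS n (G : 'cV[C]_(1 + n) -> \bar R) :
 vint G = (\int[leb2]_z vint (fun v : 'cV_n => G (col_mx (tc z)%:M v)))%E.
Proof.
rewrite /vint enum_ordSl /=; apply: eq_integral => z _.
rewrite -[RHS](@iint_rename _ _ _ (lift ord0) _ (fun y => G (col_mx (tc z)%:M (colof y)))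
 (upd (fun=> (0, 0)) ord0 z)) ?map_id; last exact: lift_inj.
apply: iint_congr => y Hy; rewrite -colof_cons; congr (G (colof _)).
apply/funext => k; rewrite /ccons; case: unliftP => [j ->//|->].
rewrite Hy ?/upd ?eqxx//; apply/negP => /mapP [j _] /eqP.
by rewrite (negbTE (neq_lift _ _)).
Qed.

Lemma vint_ge0 n (G : 'cV[C]_n -> \bar R) : (forall v, 0 <= G v)%E -> (0 <= vint G)%E.
Proof. by move=> G0; apply: iint_ge0. Qed.

Lemma meas_iint_param n d (T : measurableType d) (G : T -> 'cV[C]_n -> \bar R) (s : seq 'I_n) :
 measT (fun p : T * cfg R 'I_n => G p.1 (colof p.2)) -> (forall t v, 0 <= G t v)%E ->
 measT (fun p : T * cfg R 'I_n => iint s (fun y : cfg R 'I_n => G p.1 (colof y)) p.2).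
Proof.
move=> mG G0; elim: s => [|i s mIH] //=.
apply: (@meas_int_curry _ _ _ _ _ leb2 (fun p z => iint s (fun y : cfg R 'I_n => G p.1 (colof y)) (upd p.2 i z))) => [|*]; last exact: iint_ge0.
apply: (meas_comp mIH (f := fun q : (T * cfg R 'I_n) * (R * R) => (q.1.1, upd q.1.2 i q.2))).
apply/measurable_fun_pairP; split => /=; first exact: (meas_comp mfst mfst).
apply: (meas_comp (meas_upd i) (f := fun q : (T * cfg R 'I_n) * (R * R) => (q.1.2, q.2))).
by apply/measurable_fun_pairP; split; [exact: (meas_comp msnd mfst)|exact: msnd].
Qed.

Lemma meas_vint n d (T : measurableType d) (G : T -> 'cV[C]_n -> \bar R) :
 measT (fun p : T * cfg R 'I_n => G p.1 (colof p.2)) ->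
 (forall t v, 0 <= G t v)%E -> measT (fun t => vint (G t)).
Proof.
move=> mG G0; have mp : measT (fun t : T => (t, (fun=> (0, 0)) : cfg R 'I_n)).
 by apply: meas_pair; [exact: measurable_id|exact: measurable_cst].
exact: (meas_comp (meas_iint_param (enum 'I_n) mG G0) mp).
Qed.

Lemma vint_swap n d (T : measurableType d) (m : {sigma_finite_measure set T -> \bar R})
  (G : T -> 'cV[C]_n -> \bar R) :
 measT (fun p : T * cfg R 'I_n => G p.1 (colof p.2)) ->
 (forall t v, 0 <= G t v)%E ->
 (\int[m]_t vint (G t) = vint (fun v => \int[m]_t G t v))%E.
Proof.
move=> mG G0; rewrite /vint; elim: (enum 'I_n) (fun=> (0, 0)) => [|i s IH] x //=.
rewrite (@int_swap _ _ _ _ _ m leb2 (fun t z => iint s (fun y : cfg R 'I_n => G t (colof y)) (upd x i z))); last 2 first.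
- have mf : measT (fun q : T * (R * R) => (q.1, upd x i q.2)).
  by apply: meas_pair; [exact: mfst|exact: (meas_comp (meas_upd1 x i) msnd)].
 exact: (meas_comp (meas_iint_param s mG G0) mf).
- by move=> *; apply: iint_ge0.
by apply: eq_integral => z _; exact: IH.
Qed.

Lemma vint_scale n (c : \bar R) (G : 'cV[C]_n -> \bar R) : (0 <= c)%E -> vmeas G -> (forall v, 0 <= G v)%E ->
 vint (fun v => c * G v)%E = (c * vint G)%E.
Proof. by move=> c0 mG G0; apply: iint_scale. Qed.

Lemma eq_vint n (G H : 'cV[C]_n -> \bar R) : G =1 H -> vint G = vint H.
Proof. by move=> /funext ->. Qed.
End vint.

Section lin.
Variable R : realType.
Local Notation C := (R[i]).

Definition cfgof n (v : 'cV[C]_n) : cfg R 'I_n := fun k => ct (v k 0).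
Lemma cfgofK n : cancel (@cfgof n) (@colof R n).
Proof. by move=> v; apply/colP => k; rewrite !mxE ctK. Qed.
(** The translation [b] belongs to the property so that, in a triangular matrix, off-diagonal
    entries act on the remaining coordinates as mere translations. *)
Definition LIN n (A : 'M[C]_n) := forall (b : 'cV[C]_n) (G : 'cV[C]_n -> \bar R),
 vmeas G -> (forall v, 0 <= G v)%E ->
 ((nsq (\det A))%:E * vint (fun v => G (A *m v + b)%R) = vint G)%E.

Definition cmeas d (T : measurableType d) (f : T -> C) := measT (fun t => ct (f t)).

Lemma cmeas_ext d (T : measurableType d) (f g : T -> C) : cmeas f -> f =1 g -> cmeas g.
Proof. by move=> mf /funext <-. Qed.

Section cmeas.
Context d (T : measurableType d).
Implicit Types f g : T -> C.
Lemma cmeasP f : cmeas f <-> measT (fun t => complex.Re (f t)) /\ measT (fun t => complex.Im (f t)).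
Proof.
split=> [mf|[m1 m2]]; last exact: meas_pairR.
by split; [exact: (meas_comp mfst mf)|exact: (meas_comp msnd mf)].
Qed.
Lemma cmeas_cst c : cmeas (fun _ : T => c). Proof. exact: measurable_cst. Qed.
Lemma cmeasD f g : cmeas f -> cmeas g -> cmeas (fun t => f t + g t).
Proof.
move=> /cmeasP[f1 f2] /cmeasP[g1 g2]; apply/cmeasP; split.
 by under eq_fun do rewrite raddfD; exact: measurable_funD.
by under eq_fun do rewrite raddfD; exact: measurable_funD.
Qed.
Lemma cmeasN f : cmeas f -> cmeas (fun t => - f t).
Proof.
move=> /cmeasP[f1 f2]; apply/cmeasP; split.
 by under eq_fun do rewrite raddfN; exact: measurableT_comp.
by under eq_fun do rewrite raddfN; exact: measurableT_comp.
Qed.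
Lemma cmeasM f g : cmeas f -> cmeas g -> cmeas (fun t => f t * g t).
Proof.
move=> /cmeasP[f1 f2] /cmeasP[g1 g2]; apply/cmeasP; split.
 rewrite (_ : (fun t => _) = fun t => complex.Re (f t) * complex.Re (g t) - complex.Im (f t) * complex.Im (g t)).
  by apply: measurable_funB; exact: measurable_funM.
 by apply/funext => t; case: (f t); case: (g t).
rewrite (_ : (fun t => _) = fun t => complex.Re (f t) * complex.Im (g t) + complex.Im (f t) * complex.Re (g t)).
 by apply: measurable_funD; exact: measurable_funM.
by apply/funext => t; case: (f t); case: (g t).
Qed.
Lemma cmeas_sum (I : Type) (s : seq I) (P : pred I) (F : I -> T -> C) :
 (forall i, cmeas (F i)) -> cmeas (fun t => \sum_(i <- s | P i) F i t).
Proof.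
move=> mF; elim: s => [|i s IH].
 by under eq_fun do rewrite big_nil; exact: cmeas_cst.
under eq_fun do rewrite big_cons.
by case: (P i) => //; exact: cmeasD.
Qed.
Lemma cmeas_prod (I : Type) (s : seq I) (P : pred I) (F : I -> T -> C) :
 (forall i, cmeas (F i)) -> cmeas (fun t => \prod_(i <- s | P i) F i t).
Proof.
move=> mF; elim: s => [|i s IH].
 by under eq_fun do rewrite big_nil; exact: cmeas_cst.
under eq_fun do rewrite big_cons.
by case: (P i) => //; exact: cmeasM.
Qed.
Lemma cmeas_det n (F : T -> 'M[C]_n) : (forall i j, cmeas (fun t => F t i j)) -> cmeas (fun t => \det (F t)).
Proof.
move=> mF; rewrite /determinant; apply: cmeas_sum => s; apply: cmeasM; first exact: cmeas_cst.
by apply: cmeas_prod.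
Qed.
Lemma cmeas_nsq f : cmeas f -> measT (fun t => nsq (f t)).
Proof.
move=> /cmeasP[f1 f2]; rewrite /nsq /sqnorm /=.
by apply: measurable_funD; exact: measurable_funX.
Qed.
Lemma meas_colof n (F : T -> 'cV[C]_n) : (forall i, cmeas (fun t => F t i 0)) ->
 measT (fun t => cfgof (F t)).
Proof. by move=> mF; apply: meas_cfg => i; exact: mF. Qed.
Lemma vmeas_comp n (G : 'cV[C]_n -> \bar R) (F : T -> 'cV[C]_n) :
 vmeas G -> (forall i, cmeas (fun t => F t i 0)) -> measT (fun t => G (F t)).
Proof.
move=> mG mF.
have := meas_comp mG (meas_colof mF).
by under eq_fun do rewrite cfgofK.
Qed.
End cmeas.
Lemma cmeas_mulmx d (T : measurableType d) m n p (F : T -> 'M[C]_(m, n)) (H : T -> 'M[C]_(n, p)) i j :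
 (forall i j, cmeas (fun t => F t i j)) -> (forall i j, cmeas (fun t => H t i j)) ->
 cmeas (fun t => (F t *m H t) i j).
Proof.
move=> mF mH; under eq_fun do rewrite mxE.
by apply: cmeas_sum => k; exact: cmeasM.
Qed.
Lemma cmeas_tc : cmeas (@tc R).
Proof.
rewrite /cmeas (_ : (fun t => _) = id); first exact: measurable_id.
by apply/funext => z; rewrite tcK.
Qed.
Lemma cmeas_ev (I : Type) (i : I) : cmeas (fun y : cfg R I => tc (y i)).
Proof.
rewrite /cmeas (_ : (fun t => _) = fun t => t i); first exact: meas_eval.
by apply/funext => z; rewrite tcK.
Qed.
Lemma cmeas_comp d1 d2 (T1 : measurableType d1) (T2 : measurableType d2) (f : T2 -> C) (g : T1 -> T2) :
 cmeas f -> measT g -> cmeas (fun t => f (g t)).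
Proof. by move=> mf mg; exact: (meas_comp mf mg). Qed.

Lemma cmeas_colof n (k : 'I_n) j : cmeas (fun y : cfg R 'I_n => colof y k j).
Proof. by rewrite (_ : (fun y => _) = fun y : cfg R 'I_n => tc (y k)); [exact: cmeas_ev|apply/funext => y; rewrite mxE]. Qed.

Lemma cmeas_affine n (A : 'M[C]_n) b i : cmeas (fun y : cfg R 'I_n => (A *m colof y + b) i 0).
Proof.
apply: (@cmeas_ext _ _ (fun y : cfg R 'I_n => (A *m colof y) i 0 + b i 0)); last by move=> y; rewrite [RHS]mxE.
apply: cmeasD; last exact: cmeas_cst.
by apply: cmeas_mulmx => *; [exact: cmeas_cst|exact: cmeas_colof].
Qed.

Lemma vmeas_affine n (A : 'M[C]_n) b (G : 'cV[C]_n -> \bar R) : vmeas G -> vmeas (fun v => G (A *m v + b)).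
Proof. by move=> mG; apply: (vmeas_comp mG) => i; exact: cmeas_affine. Qed.

Lemma LIN_mul n (A B : 'M[C]_n) : LIN A -> LIN B -> LIN (A *m B).
Proof.
move=> lA lB b G mG G0; rewrite det_mulmx nsqM mulrC EFinM -muleA.
rewrite -[RHS](lA b G mG G0) -[in RHS](lB 0 (fun u => G (A *m u + b)%R))//; last exact: vmeas_affine.
rewrite muleCA; congr (_ * (_ * _))%E; apply: eq_vint => v.
by rewrite mulmxDr mulmx0 addr0 mulmxA.
Qed.

Lemma meas_colmx n (G : 'cV[C]_(1 + n) -> \bar R) d (T : measurableType d) (f : T -> C) (g : T -> 'cV[C]_n) :
 vmeas G -> cmeas f -> (forall i, cmeas (fun t => g t i 0)) ->
 measT (fun t => G (col_mx (f t)%:M (g t))).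
Proof.
move=> mG mf mg; apply: (vmeas_comp mG) => i.
case: (split_ordP i) => j ->.
 by apply: (cmeas_ext mf) => t; rewrite col_mxEu mxE (ord1 j) eqxx mulr1n.
by apply: (cmeas_ext (mg j)) => t; rewrite col_mxEd.
Qed.

Lemma meas_affine_cons n (A : 'M[C]_(1 + n)) b (G : 'cV[C]_(1 + n) -> \bar R) : vmeas G ->
 measT (fun p : (R * R) * cfg R 'I_n => G (A *m col_mx (tc p.1)%:M (colof p.2) + b)).
Proof.
move=> mG; apply: (meas_ext (f := fun p : (R * R) * cfg R 'I_n => (fun v => G (A *m v + b)) (col_mx (tc p.1)%:M (colof p.2)))) => //.
apply: (@meas_colmx n (fun v => G (A *m v + b))); first exact: vmeas_affine.
 exact: (cmeas_comp cmeas_tc mfst).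
by move=> i; exact: (cmeas_comp (cmeas_colof _ _) msnd).
Qed.

(** The first coordinate undergoes a one-dimensional affine map. Once it is fixed at [z], the others
    undergo [D v + (c z + b1)], to which the induction hypothesis applies. *)
Lemma LIN_lower n (A : 'M[C]_n) : (forall i j : 'I_n, (i < j)%N -> A i j = 0) -> \det A != 0 -> LIN A.
Proof.
elim: n A => [|n IH] A lA dA b G mG G0.
 by rewrite det_mx00 nsq1 mul1e; apply: eq_vint => v; rewrite [v]flatmx0; congr G; rewrite [LHS]flatmx0.
pose a : C := (A : 'M[C]_(1 + n)) 0 0.
pose c := dlsubmx (A : 'M[C]_(1 + n)).
pose D := drsubmx (A : 'M[C]_(1 + n)).
have eA : A = block_mx a%:M 0 c D :> 'M[C]_(1 + n).
 rewrite -[LHS](@submxK _ 1 n 1 n); congr (block_mx _ _ _ _).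
  mx_ext; rewrite !ord1 eqxx mulr1n; congr (A _ _); exact/val_inj.
 by mx_ext; rewrite lA//= !ord1.
pose b0 : C := (b : 'cV[C]_(1 + n)) 0 0; pose b1 := dsubmx (b : 'cV[C]_(1 + n)).
have eb : b = col_mx b0%:M b1 :> 'cV[C]_(1 + n).
 rewrite -[LHS](@vsubmxK _ 1 n); congr (col_mx _ _).
 mx_ext; rewrite !ord1 eqxx mulr1n; congr (b _ _); exact/val_inj.
have detA : \det A = a * \det D.
 transitivity (\det (block_mx a%:M 0 c D : 'M[C]_(1 + n))); first by rewrite -eA.
 by rewrite det_lblock det_scalar expr1.
move: dA; rewrite detA mulf_eq0 negb_or => /andP[a0 D0].
have lD : LIN D.
 by apply: IH => // i j ij; rewrite !mxE lA.
rewrite nsqM EFinM -muleA (@vintS _ n) (@vintS _ n G).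
have mH : measT (fun z : R * R => vint (fun v : 'cV_n => G (col_mx (tc z)%:M v))).
 apply: meas_vint => // ; apply: meas_colmx => // [|i].
  exact: (cmeas_comp cmeas_tc mfst).
 exact: (cmeas_comp (cmeas_colof _ _) msnd).
rewrite -(@int_caffine R a b0 (fun z => vint (fun v : 'cV_n => G (col_mx (tc z)%:M v))))//; last first.
 by move=> z; apply: vint_ge0.
congr (_ * _)%E.
have N0 : (0 <= (nsq (\det D))%:E)%E by rewrite lee_fin nsq_ge0.
rewrite -ge0_integralZl//; last 2 first.
- by apply: (meas_vint (G := fun (z : R * R) (v : 'cV[C]_n) => G (A *m col_mx (tc z)%:M v + b))) => //; exact: meas_affine_cons.
- by move=> z _; apply: vint_ge0.
apply: eq_integral => z _.
rewrite ctK -(lD (c *m (tc z)%:M + b1) (fun v => G (col_mx (a * tc z + b0)%:M v)))//; last first.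
 by apply: meas_colmx => // [|i]; [exact: cmeas_cst|exact: cmeas_colof].
congr (_ * _)%E; apply: eq_vint => v; congr G.
transitivity ((block_mx a%:M 0 c D : 'M[C]_(1 + n)) *m col_mx (tc z)%:M v + col_mx b0%:M b1).
 by rewrite -eA -eb.
rewrite mul_block_col mul0mx addr0 add_col_mx -scalar_mxM -raddfD/=.
by rewrite (addrC (c *m _)) -addrA.
Qed.

(** Here the first coordinate is translated by the other ones, so it is integrated innermost; this
    takes one exchange of integrals on each side. *)
Lemma LIN_upper n (A : 'M[C]_n) : (forall i j : 'I_n, (j < i)%N -> A i j = 0) -> \det A != 0 -> LIN A.
Proof.
elim: n A => [|n IH] A lA dA b G mG G0.
 by rewrite det_mx00 nsq1 mul1e; apply: eq_vint => v; rewrite [v]flatmx0; congr G; rewrite [LHS]flatmx0.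
pose a : C := (A : 'M[C]_(1 + n)) 0 0.
pose c := ursubmx (A : 'M[C]_(1 + n)).
pose D := drsubmx (A : 'M[C]_(1 + n)).
have eA : A = block_mx a%:M c 0 D :> 'M[C]_(1 + n).
 rewrite -[LHS](@submxK _ 1 n 1 n); congr (block_mx _ _ _ _).
  mx_ext; rewrite !ord1 eqxx mulr1n; congr (A _ _); exact/val_inj.
 by mx_ext; rewrite lA//= !ord1.
pose b0 : C := (b : 'cV[C]_(1 + n)) 0 0; pose b1 := dsubmx (b : 'cV[C]_(1 + n)).
have eb : b = col_mx b0%:M b1 :> 'cV[C]_(1 + n).
 rewrite -[LHS](@vsubmxK _ 1 n); congr (col_mx _ _).
 mx_ext; rewrite !ord1 eqxx mulr1n; congr (b _ _); exact/val_inj.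
have detA : \det A = a * \det D.
 transitivity (\det (block_mx a%:M c 0 D : 'M[C]_(1 + n))); first by rewrite -eA.
 by rewrite det_ublock det_scalar expr1.
move: dA; rewrite detA mulf_eq0 negb_or => /andP[a0 D0].
have lD : LIN D.
 by apply: IH => // i j ij; rewrite !mxE lA.
have mG1 : measT (fun p : (R * R) * cfg R 'I_n => G (col_mx (tc p.1)%:M (colof p.2))).
 apply: meas_colmx => // [|i]; first exact: (cmeas_comp cmeas_tc mfst).
 exact: (cmeas_comp (cmeas_colof _ _) msnd).
pose H (v : 'cV[C]_n) := (\int[leb2]_z G (col_mx (tc z)%:M v))%E.
have H0 v : (0 <= H v)%E by apply: integral_ge0.
have mH : vmeas H.
 by apply: (@meas_int_curry' _ _ _ _ _ leb2 (fun z y => G (col_mx (tc z)%:M (colof y)))).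
rewrite nsqM mulrC EFinM -muleA (@vintS _ n) (@vintS _ n G) (@vint_swap _ _ _ _ leb2 (fun z v => G (col_mx (tc z)%:M v)) mG1)// -(lD b1 H mH H0).
congr (_ * _)%E.
have mAG : measT (fun p : (R * R) * cfg R 'I_n => G (A *m col_mx (tc p.1)%:M (colof p.2) + b)).
 exact: meas_affine_cons.
rewrite (@vint_swap _ _ _ _ leb2 (fun z v => G (A *m col_mx (tc z)%:M v + b)))// -vint_scale//; last 3 first.
- by rewrite lee_fin nsq_ge0.
- by apply: (@meas_int_curry' _ _ _ _ _ leb2 (fun z y => G (A *m col_mx (tc z)%:M (colof y) + b))).
- by move=> v; apply: integral_ge0.
apply: eq_vint => v.
rewrite /H -[RHS](@int_caffine R a ((c *m v) 0 0 + b0) (fun z => G (col_mx (tc z)%:M (D *m v + b1))))//; last first.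
 by apply: meas_colmx => // [|i]; [exact: cmeas_tc|exact: cmeas_cst].
congr (_ * _)%E; apply: eq_integral => z _; congr G.
transitivity ((block_mx a%:M c 0 D : 'M[C]_(1 + n)) *m col_mx (tc z)%:M v + col_mx b0%:M b1).
 by rewrite -eA -eb.
have E1 : a%:M *m (tc z)%:M + c *m v + b0%:M = (a * tc z + ((c *m v) 0 0 + b0))%:M :> 'M[C]_1.
 by rewrite -scalar_mxM {1}[c *m v]mx11_scalar -!raddfD/= addrA.
by rewrite ctK mul_block_col mul0mx add0r add_col_mx E1.
Qed.

Lemma LIN1 n : LIN (1%:M : 'M[C]_n).
Proof.
apply: LIN_lower; last by rewrite det1 oner_eq0.
by move=> i j ij; rewrite mxE -val_eqE /= ltn_eqF.
Qed.

Lemma vint_shift n b (G : 'cV[C]_n -> \bar R) : vmeas G -> (forall v, 0 <= G v)%E ->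
 vint (fun v => G (v + b)) = vint G.
Proof.
move=> mG G0; have := LIN1 b mG G0; rewrite det1 nsq1 mul1e => <-.
by apply: eq_vint => v; rewrite mul1mx.
Qed.

Lemma LIN_perm n (s : 'S_n) : LIN (perm_mx s : 'M[C]_n).
Proof.
move=> b G mG G0.
have -> : nsq (\det (perm_mx s : 'M[C]_n)) = 1.
 by rewrite det_perm; case: (s : bool); rewrite ?expr1 ?expr0 ?nsqN nsq1.
rewrite mul1e -(vint_shift b mG G0).
pose F (y : cfg R 'I_n) := G (colof y + b).
have mF : measT F.
 by apply: (meas_ext (vmeas_affine 1%:M b mG)) => y; rewrite mul1mx.
have -> : vint (fun v => G (v + b)) = iint (enum 'I_n) F (fun i => (0, 0)) by [].
have := @iint_rename R _ _ s (enum 'I_n) F (fun i => (0, 0)) (@perm_inj _ s) => <-.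
rewrite -(@iint_perm _ _ (enum 'I_n)) ?enum_uniq//.
- apply: iint_congr => y _; rewrite /F; congr (G (_ + _)).
 by rewrite -row_permE; apply/colP => k; rewrite !mxE.
- apply: uniq_perm; rewrite ?enum_uniq ?(map_inj_uniq perm_inj) ?enum_uniq//.
 move=> i; rewrite mem_enum; apply/esym/mapP; exists ((s^-1)%g i); rewrite ?mem_enum ?permKV//.
- apply: (vmeas_comp (F := fun y : cfg R 'I_n => colof (fun i => y (s i)) + b) mG) => i.
 apply: (@cmeas_ext _ _ (fun y : cfg R 'I_n => tc (y (s i)) + b i 0)); last by move=> y; rewrite !mxE.
 by apply: cmeasD; [exact: cmeas_ev|exact: cmeas_cst].
- by move=> x; exact: G0.
Qed.

(** LUP decomposition, the three kinds of factors being settled above. *)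
Lemma LIN_unit n (A : 'M[C]_n) : \det A != 0 -> LIN A.
Proof.
case: n A => [|n] A dA; first by apply: LIN_lower => // -[].
have := cormen_lup_correct A; have := cormen_lup_perm A.
have := @cormen_lup_lower _ n A; have := @cormen_lup_upper _ n A; have := cormen_lup_detL A.
case: (cormen_lup A) => [[P L] U] /= dL Uu Ll /is_perm_mxP [s ->] E.
have E' : A = perm_mx (s^-1)%g *m (L *m U).
 by rewrite -[L *m U]E mulmxA -perm_mxM mulVg perm_mx1 mul1mx.
rewrite E'; apply: LIN_mul; first exact: LIN_perm.
apply: LIN_mul.
 apply: LIN_lower; last by rewrite dL oner_eq0.
 by move=> i j ij; rewrite Ll ?(ltnW ij)// -val_eqE /= ltn_eqF.
apply: LIN_upper => //.
by move: dA; rewrite E' !det_mulmx dL mul1r mulf_eq0 negb_or => /andP[].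
Qed.
End lin.

(** * Regularity of measures and comparison of areas under Lipschitz maps *)

Section regularity.
Variable R : realType.
Implicit Types A B O F : set (R * R).

(** An induction principle: the product sigma-algebra is generated by preimages of Borel sets under
    the two coordinate maps, which are continuous. *)
Lemma borel2_sub (G : set (set (R * R))) : sigma_algebra setT G -> (forall O, open O -> G O) ->
 forall A, measurable A -> G A.
Proof.
move=> sG oG.
have H (f : R * R -> R) : continuous f -> forall B : set R, measurable B -> G (f @^-1` B).
 move=> cf B mB.
 pose G' := [set B : set R | G (f @^-1` B)].
 suff : G' B by [].
 have sG' : sigma_algebra setT G'.
  have [s0 sC sU] := sG; split.
  - by rewrite /G' /= preimage_set0.
  - by move=> X GX; rewrite /G' /= (_ : f @^-1` _ = setT `\` f @^-1` X) //; exact: sC.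
  - by move=> X GX; rewrite /G' /= preimage_bigcup; exact: sU.
 have : @measurable _ R `<=` G'.
  have -> : @measurable _ R = <<s RGenOpens.G (R:=R) >> by exact: RGenOpens.measurableE.
  apply: smallest_sub => //.
  move=> _ [a [b ->]]; apply: oG; apply: open_comp; last exact: interval_open.
  by move=> x _; exact: cf.
 exact.
move=> A.
have : @measurable _ (R * R)%type `<=` G.
 apply: smallest_sub => //; rewrite subUset; split.
 - by move=> _ [B mB <-]; rewrite setTI; apply: H => // x; exact: cvg_fst.
 - by move=> _ [B mB <-]; rewrite setTI; apply: H => // x; exact: cvg_snd.
exact.
Qed.

(** A closed exhaustion of [O] with a uniform margin; the double counting arguments below spend that
    margin. *)
Definition inballs O (n : nat) : set (R * R) := [set x | ball x n.+1%:R^-1 `<=` O].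

Lemma inballs_closed O n : closed (inballs O n).
Proof.
rewrite -[inballs O n]setCK; apply: open_closedC.
rewrite openE => x /= /existsNP [y /not_implyP[bxy Oy]].
rewrite /interior /=.
have h : 0 < n.+1%:R^-1 - `|x - y| by rewrite subr_gt0; move: bxy; rewrite -ball_normE.
apply/nbhs_ballP; exists (n.+1%:R^-1 - `|x - y|) => //= z bz /(_ y); apply/not_implyP.
split=> //; move: bz; rewrite -!ball_normE /= => bz.
have -> : z - y = (z - x) + (x - y) by rewrite addrA subrK.
apply: le_lt_trans (ler_normD _ _) _; rewrite -ltrBrDr distrC; exact: bz.
Qed.

Lemma inballs_bigcup O : open O -> \bigcup_n inballs O n = O.
Proof.
move=> oO; apply/seteqP; split => [x [n _]|x Ox].
 by apply; apply: ballxx.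
have /nbhs_ballP [e /= e0 eO] : nbhs x O by move: oO; rewrite openE; exact.
have [n ne] : exists n : nat, n.+1%:R^-1 < e.
 by exists (Num.trunc e^-1); rewrite invf_plt ?posrE//; exact: truncnS_gt.
exists n => //; apply: subset_trans eO; exact/le_ball/ltW.
Qed.

Lemma inballs_nd O : nondecreasing_seq (inballs O).
Proof.
move=> m n mn; apply/subsetPset => x; apply: subset_trans; apply: le_ball.
by rewrite lef_pV2 ?posrE// ler_nat ltnS.
Qed.

Definition regular_set (mu : {measure set (R * R)%type -> \bar R}) A := forall e : R, 0 < e ->
 exists F O, [/\ closed F, open O, F `<=` A, A `<=` O & (mu (O `\` F) <= e%:E)%E].

(** The regular sets form a sigma-algebra containing the open sets. For a countable union the closed
    approximant is a finite subunion, which is where finiteness of [mu] enters. *)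
Lemma measure_regular (mu : {measure set (R * R)%type -> \bar R}) A : (mu setT < +oo)%E ->
 measurable A -> regular_set mu A.
Proof.
move=> fmu; apply: borel2_sub; first split.
- move=> e e0; exists set0, set0; split => //; first exact: closed0.
 by rewrite setDv measure0 lee_fin ltW.
- move=> X rX e e0; have [F [ O [cF oO FX XO h]]] := rX e e0.
 exists (~` O), (~` F); rewrite !setTD; split => //.
 + exact: open_closedC.
 + exact: closed_openC.
 + exact: subsetC.
 + exact: subsetC.
 + by rewrite setDE setCK setIC -setDE.
- move=> X rX e e0.
 have /choice [FO FOP] : forall n, exists FO : set (R * R) * set (R * R),
   [/\ closed FO.1, open FO.2, FO.1 `<=` X n, X n `<=` FO.2 & (mu (FO.2 `\` FO.1) <= (e / 2 / (2 ^ n.+1)%:R)%:E)%E].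
  move=> n; have [|F [ O h]] := rX n (e / 2 / (2 ^ n.+1)%:R); last by exists (F, O).
  by rewrite !divr_gt0// ltr0n expn_gt0.
 pose O := \bigcup_n (FO n).2.
 pose FN N := \bigcup_(n in `I_N) (FO n).1.
 have oO : open O by apply: bigcup_open => n _; have [] := FOP n.
 have cF N : closed (FN N).
  rewrite /FN bigcup_mkord; apply: (big_ind closed) => [||n _]; [exact: closed0|exact: closedU|by have [] := FOP n].
 have mO : measurable O by exact: open_measurable2.
 have mF N : measurable (FN N) by exact: closed_measurable2.
 pose Foo := \bigcup_n (FO n).1.
 have mFoo : measurable Foo.
  by apply: bigcupT_measurable => n; apply: closed_measurable2; have [] := FOP n.
 have fin B : measurable B -> (mu B < +oo)%E.
  by move=> mB; apply: le_lt_trans fmu; le_meas.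
 have hoo : (mu (O `\` Foo) <= (e / 2)%:E)%E.
  have sub : O `\` Foo `<=` \bigcup_n ((FO n).2 `\` (FO n).1).
   move=> x [[n _ On] nF]; exists n => //; split => // Fn; apply: nF; by exists n.
  apply: le_trans (measure_sigma_subadditive mu _ (measurableD mO mFoo) sub) _.
   move=> n; have [c o _ _ _] := FOP n.
   by apply: measurableD; [exact: open_measurable2|exact: closed_measurable2].
  have H n : (mu ((FO n).2 `\` (FO n).1) <= (e / 2 / (2 ^ n.+1)%:R)%:E)%E by have [] := FOP n.
  apply: le_trans (lee_nneseries _ _) _; [by move=> *; exact: measure_ge0|by move=> n _; exact: (H n)|].
  by apply: epsilon_trick0; rewrite divr_ge0 // ltW.
 have cvF : mu (O `\` FN N) @[N --> \oo] --> mu (O `\` Foo).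
  have -> : O `\` Foo = \bigcap_N (O `\` FN N).
   rewrite /Foo; apply/seteqP; split => x.
    move=> [Ox nF] N _; split => //; move=> [n _ Fn]; apply: nF; by exists n.
   move=> H; split; first by have [] := H 0%N I.
   move=> [n _ Fn]; by have [_] := H n.+1 I; apply; exists n => /=.
  apply: nonincreasing_cvg_mu.
  - exact/fin/measurableD.
  - by move=> N; exact: measurableD.
  - by apply: bigcap_measurable => // N _; exact: measurableD.
  - move=> m n mn; apply/subsetPset => x [Ox nF]; split => //; apply: contra_not nF.
   by move=> [k /= km Fk]; exists k => //=; exact: leq_trans mn.
 have hlt : (mu (O `\` Foo) < e%:E)%E.
  by apply: le_lt_trans hoo _; rewrite lte_fin ltr_pdivrMr// ltr_pMr// ltr1n.
 have := cvF (fun x => x < e%:E)%E; case/(_ _).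
  by apply: open_nbhs_nbhs; split => //; exact: open_ereal_lt_ereal.
 move=> N _ /(_ N (leqnn N)) /= hN.
 exists (FN N), O; split => //; last exact: ltW.
 + move=> x [n _ Fn]; exists n => //; by have [_ _ h _ _] := FOP n; exact: h.
 + move=> x [n _ Xn]; exists n => //; by have [_ _ _ h _] := FOP n; exact: h.
- move=> O oO e e0.
 have mO : measurable O by exact: open_measurable2.
 have mI n : measurable (inballs O n) by apply: closed_measurable2; exact: inballs_closed.
 have cv : mu (O `\` inballs O n) @[n --> \oo] --> mu (\bigcap_n (O `\` inballs O n)).
  apply: nonincreasing_cvg_mu.
  - by apply: le_lt_trans fmu; le_meas => //; exact: measurableD.
  - by move=> n; exact: measurableD.
  - by apply: bigcap_measurable => // n _; exact: measurableD.
  - move=> m n mn; apply/subsetPset => x [Ox nI]; split => //; apply: contra_not nI.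
   by have /subsetPset := inballs_nd O mn; exact.
 have E0 : \bigcap_n (O `\` inballs O n) = set0.
  apply/seteqP; split => // x Hx.
  have [Ox _] := Hx 0%N I; move: Ox; rewrite -{1}(inballs_bigcup oO) => -[n _ In].
  by have [_] := Hx n I; apply.
 rewrite E0 measure0 in cv.
 have := cv (fun x => x < e%:E)%E; case/(_ _).
  by apply: open_nbhs_nbhs; split; [exact: open_ereal_lt_ereal|rewrite /= lte_fin].
 move=> N _ /(_ N (leqnn N)) /= hN.
 exists (inballs O N), O; split => //; last exact: ltW.
 + exact: inballs_closed.
 + by rewrite -{2}(inballs_bigcup oO) => x; exists N.
Qed.

Lemma leb2_box (I J : interval R) : leb2 ([set` I] `*` [set` J]) = (leb1 [set` I] * leb1 [set` J])%E.
Proof.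
transitivity ((((@leb1 R) : {sigma_finite_measure set R -> \bar R}) \x (@leb1 R))%E ([set` I] `*` [set` J])); first by [].
by rewrite product_measure1E.
Qed.

Lemma ball2P (z w : R * R) (r : R) : ball z r w <-> `|z.1 - w.1| < r /\ `|z.2 - w.2| < r.
Proof. by []. Qed.

Lemma ballE2 (z : R * R) (r : R) : ball z r = `]z.1 - r, z.1 + r[%classic `*` `]z.2 - r, z.2 + r[%classic.
Proof.
apply/seteqP; split => w /=; rewrite !in_itv /= /ball /= /prod_ball /ball /= !ltr_norml.
 by move=> [/andP[? ?] /andP[? ?]]; split; apply/andP; split; lra.
by move=> [/andP[? ?] /andP[? ?]]; split; apply/andP; split; lra.
Qed.

Lemma measurable_ball2 (z : R * R) (r : R) : measurable (ball z r).
Proof. by rewrite ballE2; exact: measurableX. Qed.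

Lemma leb2_ball (z : R * R) (r : R) : 0 <= r -> leb2 (ball z r) = ((2 * r) ^+ 2)%:E.
Proof.
move=> r0; rewrite ballE2 leb2_box !leb1_itv /= !lte_fin.
move: r0; rewrite le_eqVlt => /orP[/eqP <-|r0].
 by rewrite !subr0 !addr0 !ltxx mule0 mulr0 expr0n.
have -> : z.1 - r < z.1 + r by lra.
have -> : z.2 - r < z.2 + r by lra.
by rewrite -!EFinB -EFinM; congr EFin; ring.
Qed.

(** In the norm of [R * R] balls are squares, and a set of diameter [d] lies in a square of side
    [d]. No constant is lost, which matters because local comparisons of areas must have ratios
    tending to 1. *)
Lemma leb2_diam A (d : R) : 0 <= d -> measurable A -> (forall x y, A x -> A y -> `|x - y| <= d) ->
 (leb2 A <= (d ^+ 2)%:E)%E.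
Proof.
move=> d0 mA H.
have [->|/set0P[x0 Ax0]] := eqVneq A set0; first by rewrite measure0 lee_fin sqr_ge0.
have P (f : R * R -> R) : (forall x y, `|f x - f y| <= `|x - y|) -> exists a, forall x, A x -> a <= f x <= a + d.
 move=> fL; exists (inf (f @` A)) => x Ax.
 have lb : has_lbound (f @` A).
  exists (f x0 - d) => _ [y Ay <-].
  have := le_trans (fL x0 y) (H _ _ Ax0 Ay); rewrite ler_norml => /andP[? ?]; lra.
 apply/andP; split; first by apply: ge_inf => //; exists x.
 rewrite -lerBlDr; apply: lb_le_inf; first by exists (f x0), x0.
 move=> _ [y Ay <-].
 have := le_trans (fL x y) (H _ _ Ax Ay); rewrite ler_norml => /andP[? ?]; lra.
have Hn (z : R * R) : `|z| = Num.max `|z.1| `|z.2| by [].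
have [a Ha] : exists a, forall x, A x -> a <= x.1 <= a + d.
 by apply: P => x y; rewrite Hn le_max lexx.
have [b Hb] : exists a, forall x, A x -> a <= x.2 <= a + d.
 by apply: P => x y; rewrite Hn le_max lexx orbT.
apply: (@le_trans _ _ (leb2 (`[a, a + d]%classic `*` `[b, b + d]%classic))).
 le_meas => //; first exact: measurableX.
 by move=> x Ax /=; rewrite !in_itv /= Ha// Hb.
rewrite leb2_box !leb1_itv /= !lte_fin !ltrDl.
move: d0; rewrite le_eqVlt => /orP[/eqP <-|->]; first by rewrite ltxx mule0 expr0n.
by rewrite -!EFinB -EFinM lee_fin !(addrC _ d) !addrK expr2.
Qed.

(** Double counting of the pairs [(x, y)] with [y] within [s] of [psi x]. At fixed [x] they fill a
    square of side [2 s] inside [O]; at fixed [y] the admissible [x] form a set of diameter at most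
    [2 L s]. Dividing by [(2 s)^2] gives the bound. *)
Lemma colip_open (X O : set (R * R)) (psi : R * R -> R * R) (L : R) : 0 <= L -> measurable X ->
 measT psi -> open O ->
 (forall x y, X x -> X y -> `|x - y| <= L * `|psi x - psi y|) ->
 (leb2 (X `&` psi @^-1` O) <= (L ^+ 2)%:E * leb2 O)%E.
Proof.
move=> L0 mX mpsi oO HL.
have mO : measurable O by exact: open_measurable2.
have mI n : measurable (inballs O n) by apply: closed_measurable2; exact: inballs_closed.
pose A n := X `&` psi @^-1` inballs O n.
have mA n : measurable (A n).
 by apply: measurableI => //; rewrite -[X in measurable X]setTI; exact: mpsi.
have -> : X `&` psi @^-1` O = \bigcup_n A n.
 by rewrite /A -setI_bigcupr -preimage_bigcup inballs_bigcup.
have cv : leb2 (A n) @[n --> \oo] --> leb2 (\bigcup_n A n).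
 apply: nondecreasing_cvg_mu => //; first exact: bigcupT_measurable.
 move=> m n mn; apply/subsetPset => x [Xx Ix]; split => //.
 by have /subsetPset := inballs_nd O mn; exact.
rewrite -(cvg_lim _ cv)//; apply: lime_le; first by apply/cvg_ex; exists (leb2 (\bigcup_n A n)).
apply: nearW => n.
pose s : R := n.+1%:R^-1.
have s0 : 0 < s by rewrite invr_gt0.
pose W : set ((R * R) * (R * R)) := [set p | A n p.1 /\ ball (psi p.1) s p.2].
have mW : measurable W.
 have -> : W = (A n `*` setT) `&` (fun p => `|(psi p.1).1 - p.2.1|) @^-1` `]-oo, s[%classic
       `&` (fun p => `|(psi p.1).2 - p.2.2|) @^-1` `]-oo, s[%classic.
  apply/seteqP; split => p.
   by move=> [? /ball2P[? ?]]; split; [split|]; rewrite /= ?in_itv.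
  by move=> [[[? _]]]; rewrite /= !in_itv /= => ? ?; split => //; apply/ball2P.
 have m1 : measT (fun p : (R * R) * (R * R) => psi p.1) by exact: (meas_comp mpsi mfst).
 apply: measurableI; first apply: measurableI.
 - exact: measurableX.
 - have mm : measT (fun p : (R * R) * (R * R) => (psi p.1).1 - p.2.1).
   apply: measurable_funB; first exact: (meas_comp mfst m1).
   exact: (meas_comp mfst msnd).
  have mn := meas_comp (@normr_measurable R setT) mm.
  by rewrite -[X in measurable X]setTI; exact: mn.
 - have mm : measT (fun p : (R * R) * (R * R) => (psi p.1).2 - p.2.2).
   apply: measurable_funB; first exact: (meas_comp msnd m1).
   exact: (meas_comp msnd msnd).
  have mn := meas_comp (@normr_measurable R setT) mm.
  by rewrite -[X in measurable X]setTI; exact: mn.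
pose f x y := (\1_W (x, y))%:E : \bar R.
have mf : measT (fun p : (R * R) * (R * R) => f p.1 p.2).
 by apply: (meas_ext (f := EFin \o \1_W)) => [|[]//]; efin.
have f0 x y : (0 <= f x y)%E by rewrite lee_fin.
have E1 : (\int[leb2]_x \int[leb2]_y f x y = ((2 * s) ^+ 2)%:E * leb2 (A n))%E.
 rewrite -[in RHS](setIT (A n)) -(integral_indic leb2 measurableT (mA n)) -ge0_integralZl//; last 2 first.
 - exact/measurable_EFinP.
 - by rewrite lee_fin sqr_ge0.
 apply: eq_integral => x _.
 have [xA|xA] := asboolP (A n x); last first.
  rewrite indicE memNset// mule0 integral0_eq// => y _.
  by rewrite /f indicE memNset//; case.
 rewrite indicE mem_set// mule1 -(leb2_ball (psi x) (ltW s0)) -[in RHS](setIT (ball _ _)).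
 rewrite -(integral_indic leb2 measurableT (measurable_ball2 _ _)).
 apply: eq_integral => y _; rewrite /f !indicE; congr (_%:R%:E); congr nat_of_bool.
 by apply/idP/idP => /set_mem h; apply/mem_set => //; case: h.
have E2 : (\int[leb2]_y \int[leb2]_x f x y <= ((L * (2 * s)) ^+ 2)%:E * leb2 O)%E.
 rewrite -[in leRHS](setIT O) -(integral_indic leb2 measurableT mO) -ge0_integralZl//; last 2 first.
 - exact/measurable_EFinP.
 - by rewrite lee_fin sqr_ge0.
 apply: ge0_le_integral => //.
 - by move=> y _; apply: integral_ge0.
 - exact: (meas_int_curry' leb2 mf).
 - by efin; exact: measurable_funM.
 move=> y _.
 have mWy : measurable [set x | W (x, y)].
  have := measurable_ysection y mW; rewrite /ysection; congr measurable.
  by apply/seteqP; split => x /=; rewrite in_setE.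
 have -> : (\int[leb2]_x f x y = leb2 [set x | W (x, y)])%E.
  rewrite -[in RHS](setIT [set x | _]) -(integral_indic leb2 measurableT mWy).
  by apply: eq_integral => x _; rewrite /f !indicE; congr (_%:R%:E); congr nat_of_bool.
 have [yO|yO] := asboolP (O y); last first.
  rewrite [X in leb2 X](_ : _ = set0); first by rewrite measure0 indicE memNset// mule0.
  by apply/seteqP; split => // x [[_ Ix] bxy]; apply: yO; exact: Ix.
 rewrite indicE mem_set// mule1; apply: leb2_diam => //.
  by rewrite mulr_ge0// mulr_ge0// ltW.
 move=> x x' [[Xx _] b1] [[Xx' _] b2]; apply: le_trans (HL _ _ Xx Xx') _.
 rewrite ler_wpM2l//.
 have -> : psi x - psi x' = (psi x - y) + (y - psi x') by rewrite addrA subrK.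
 apply: le_trans (ler_normD _ _) _; rewrite mulrDl mul1r lerD//.
  by move: b1; rewrite -ball_normE /= => /ltW.
 by move: b2; rewrite -ball_normE /= distrC => /ltW.
have := E2; rewrite -(@int_swap _ _ _ _ _ leb2 leb2 f)// E1.
have -> : (((L * (2 * s)) ^+ 2)%:E * leb2 O = ((2 * s) ^+ 2)%:E * ((L ^+ 2)%:E * leb2 O))%E.
 by rewrite muleA -EFinM; congr (_%:E * _)%E; ring.
by rewrite lee_pmul2l// lte_fin exprn_gt0// mulr_gt0.
Qed.

(** The passage from open sets to bounded measurable ones is by outer regularity of Lebesgue measure
    restricted to a ball. *)
Lemma colip_measure (X B : set (R * R)) (psi : R * R -> R * R) (L r : R) : 0 <= L -> measurable X ->
 measT psi -> measurable B -> B `<=` ball 0 r ->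
 (forall x y, X x -> X y -> `|x - y| <= L * `|psi x - psi y|) ->
 (leb2 (X `&` psi @^-1` B) <= (L ^+ 2)%:E * leb2 B)%E.
Proof.
move=> L0 mX mpsi mB Br HL.
have mb := measurable_ball2 (0 : R * R) r.
pose mu : {measure set (R * R)%type -> \bar R} := mrestr leb2 mb.
have r0 : 0 <= `|r| by [].
have fmu : (mu setT < +oo)%E.
 rewrite /mu /= /mrestr setTI; apply: (@le_lt_trans _ _ (leb2 (ball (0 : R * R) `|r|))).
  le_meas => //; first exact: measurable_ball2.
  by apply: le_ball; exact: ler_norm.
 by rewrite leb2_ball// ltry.
have mpB : measurable (X `&` psi @^-1` B).
 by apply: measurableI => //; rewrite -[X in measurable X]setTI; exact: mpsi.
apply/lee_addgt0Pr => e e0.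
have [|F [ O [cF oO FB BO h]]] := @measure_regular mu B fmu mB (e / (L ^+ 2 + 1)).
 by rewrite divr_gt0// ltr_wpDl// sqr_ge0.
pose O' := O `&` ball (0 : R * R) r.
have oO' : open O' by apply: openI => //; exact: ball_open.
have mO := open_measurable2 oO; have mF := closed_measurable2 cF.
apply: (@le_trans _ _ (leb2 (X `&` psi @^-1` O'))).
 le_meas => //.
  apply: measurableI => //; rewrite -[X in measurable X]setTI; apply: mpsi => //; exact: open_measurable2.
 by apply: setIS => x /= Bx; split; [exact: BO|exact: Br].
apply: le_trans (colip_open L0 mX mpsi oO' HL) _.
have -> : O' = B `|` (O' `\` B).
 apply/seteqP; split => [x Ox|x [Bx|[]//]]; last by split; [exact: BO|exact: Br].
 by have [?|?] := asboolP (B x); [left|right].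
have mD : measurable (O' `\` B) by apply: measurableD => //; exact: open_measurable2.
rewrite measureU//; last by apply/seteqP; split => // x [? []].
rewrite ge0_muleDr//; apply: leeD2l.
apply: (@le_trans _ _ ((L ^+ 2)%:E * (e / (L ^+ 2 + 1))%:E)%E).
 rewrite lee_wpmul2l ?lee_fin ?sqr_ge0//; apply: le_trans h.
 rewrite /mu /= /mrestr; le_meas => //.
  by apply: measurableI => //; exact: measurableD.
 by move=> x [[Ox bx] nB]; split => //; split => // Fx; apply: nB; exact: FB.
rewrite -EFinM lee_fin mulrA ler_pdivrMr ?ltr_wpDl ?sqr_ge0//.
by rewrite mulrC ler_wpM2l ?(ltW e0)// lerDl.
Qed.
End regularity.

Import Normc.

Lemma le_of_eq (R : numDomainType) (x y : R) : x = y -> x <= y.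
Proof. by move->. Qed.

(** * Strict differentiability of functions of one complex variable *)

Section sdiff.
Variable R : realType.
Local Notation C := (R[i]).
Implicit Types f g : C -> C.

Lemma normc_ge0 (c : C) : 0 <= normc c.
Proof. by case: c => a b; exact: sqrtr_ge0. Qed.
Lemma normc_nsq (c : C) : nsq c = normc c ^+ 2.
Proof. by case: c => a b; rewrite /nsq /sqnorm /= sqr_sqrtr// addr_ge0// sqr_ge0. Qed.
Lemma normc_sub (c d : C) : normc (c - d) = normc (d - c).
Proof. by rewrite -opprB normcN. Qed.
Lemma normc_tri (a b c : C) : normc (a - c) <= normc (a - b) + normc (b - c).
Proof. by rewrite (_ : a - c = (a - b) + (b - c)) ?le_normcD// addrA subrK. Qed.
Lemma normc_eq0 (c : C) : (normc c == 0) = (c == 0).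
Proof. by apply/eqP/eqP => [/eq0_normc|->]; last exact: normc0. Qed.
Lemma normc_gt0 (c : C) : (0 < normc c) = (c != 0).
Proof. by rewrite lt_neqAle eq_sym normc_ge0 andbT normc_eq0. Qed.
Lemma normc_lbD (a b : C) : normc a - normc b <= normc (a + b).
Proof. by have := le_normcD (a + b) (- b); rewrite addrK normcN; lra. Qed.
Lemma normcX (c : C) k : normc (c ^+ k) = normc c ^+ k.
Proof. by elim: k => [|k IH]; rewrite ?expr0 ?normc1// !exprS normcM IH. Qed.
Lemma normc_prod (I : Type) (s : seq I) (F : I -> C) : normc (\prod_(i <- s) F i) = \prod_(i <- s) normc (F i).
Proof. by elim: s => [|i s IH]; rewrite ?big_nil ?normc1// !big_cons normcM IH. Qed.

(* Strict differentiability, so that injectivity near a noncritical point comes for free. *)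
Definition sdiff f (l d : C) := forall e : R, 0 < e -> exists2 r : R, 0 < r &
 forall z w, normc (z - l) < r -> normc (w - l) < r -> normc (f z - f w - d * (z - w)) <= e * normc (z - w).

Lemma sdiff_cst c l : sdiff (fun=> c) l 0.
Proof. by move=> e e0; exists 1 => // z w _ _; rewrite subrr mul0r subr0 normc0 mulr_ge0 ?normc_ge0// ltW. Qed.
Lemma sdiff_id l : sdiff id l 1.
Proof. by move=> e e0; exists 1 => // z w _ _; rewrite mul1r subrr normc0 mulr_ge0 ?normc_ge0// ltW. Qed.
Lemma sdiffD f g l d e : sdiff f l d -> sdiff g l e -> sdiff (fun z => f z + g z) l (d + e).
Proof.
move=> sf sg eps e0; have e2 : 0 < eps / 2 by rewrite divr_gt0.
have [r1 r10 H1] := sf _ e2; have [r2 r20 H2] := sg _ e2.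
exists (Num.min r1 r2); first by rewrite lt_min r10.
move=> z w; rewrite !lt_min => /andP[a1 a2] /andP[b1 b2].
rewrite (_ : f z + g z - (f w + g w) - (d + e) * (z - w) = (f z - f w - d * (z - w)) + (g z - g w - e * (z - w))); last by ring.
apply: le_trans (le_normcD _ _) _.
have := H1 _ _ a1 b1; have := H2 _ _ a2 b2; lra.
Qed.
Lemma sdiff_lip f l d : sdiff f l d -> exists2 r : R, 0 < r &
 forall z w, normc (z - l) < r -> normc (w - l) < r -> normc (f z - f w) <= (normc d + 1) * normc (z - w).
Proof.
move=> sf; have [r r0 H] := sf 1 ltr01; exists r => // z w hz hw.
rewrite (_ : f z - f w = (f z - f w - d * (z - w)) + d * (z - w)); last by rewrite subrK.
apply: le_trans (le_normcD _ _) _; rewrite normcM mulrDl mul1r addrC lerD2l.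
by have := H _ _ hz hw; rewrite mul1r.
Qed.
Lemma sdiff_near f l d : sdiff f l d -> forall e : R, 0 < e -> exists2 r : R, 0 < r &
 forall z, normc (z - l) < r -> normc (f z - f l) <= e.
Proof.
move=> /sdiff_lip [r r0 H] e e0.
have k0 : 0 < normc d + 1 by rewrite ltr_wpDl// normc_ge0.
exists (Num.min r (e / (normc d + 1))); first by rewrite lt_min r0 divr_gt0.
move=> z; rewrite lt_min => /andP[h1 h2].
apply: le_trans (H _ _ h1 _) _; first by rewrite subrr normc0.
by rewrite mulrC -ler_pdivlMr// ltW.
Qed.
Lemma sdiffM f g l d e : sdiff f l d -> sdiff g l e -> sdiff (fun z => f z * g z) l (d * g l + f l * e).
Proof.
move=> sf sg eps e0.
pose M := 1 + normc d + normc e + normc (f l) + normc (g l).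
have M0 : 0 < M by rewrite /M -!addrA ltr_pwDl// !addr_ge0// normc_ge0.
pose h := Num.min 1 (eps / (4 * M)).
have h0 : 0 < h by rewrite lt_min ltr01 divr_gt0// mulr_gt0.
have h1 : h <= 1 by rewrite ge_min lexx.
have h2 : 4 * M * h <= eps by rewrite mulrC -ler_pdivlMr ?mulr_gt0// ge_min lexx orbT.
have [r1 r10 H1] := sf _ h0; have [r2 r20 H2] := sg _ h0.
have [r3 r30 H3] := sdiff_near sf h0; have [r4 r40 H4] := sdiff_near sg h0.
exists (Num.min (Num.min r1 r2) (Num.min r3 r4)); first by rewrite !lt_min r10 r20 r30.
move=> z w; rewrite !lt_min => /andP[/andP[a1 a2] /andP[a3 a4]] /andP[/andP[b1 b2] /andP[b3 b4]].
rewrite (_ : _ - _ = (f z - f w - d * (z - w)) * g z + f w * (g z - g w - e * (z - w))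
  + (d * (g z - g l) * (z - w) + e * (f w - f l) * (z - w))); last by ring.
have gz : normc (g z) <= M.
 rewrite (_ : g z = g l + (g z - g l)); last by ring.
 apply: le_trans (le_normcD _ _) _; have := H4 _ a4; have := normc_ge0 d; have := normc_ge0 e; have := normc_ge0 (f l).
 rewrite /M; lra.
have fw : normc (f w) <= M.
 rewrite (_ : f w = f l + (f w - f l)); last by ring.
 apply: le_trans (le_normcD _ _) _; have := H3 _ b3; have := normc_ge0 d; have := normc_ge0 e; have := normc_ge0 (g l).
 rewrite /M; lra.
have dM : normc d <= M by have := normc_ge0 (f l); have := normc_ge0 e; have := normc_ge0 (g l); rewrite /M; lra.
have eM : normc e <= M by have := normc_ge0 (f l); have := normc_ge0 d; have := normc_ge0 (g l); rewrite /M; lra.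
pose D := normc (z - w).
have D0 : 0 <= D by exact: normc_ge0.
apply: (@le_trans _ _ (4 * M * h * D)); last by rewrite ler_wpM2r.
have T1 : normc ((f z - f w - d * (z - w)) * g z) <= M * h * D.
 rewrite normcM (mulrC M) -(mulrA h) (mulrC M) mulrA; apply: ler_pM; rewrite ?normc_ge0//; exact: H1.
have T2 : normc (f w * (g z - g w - e * (z - w))) <= M * h * D.
 rewrite normcM -mulrA; apply: ler_pM; rewrite ?normc_ge0//; exact: H2.
have T3 : normc (d * (g z - g l) * (z - w)) <= M * h * D.
 rewrite !normcM; apply: ler_pM; rewrite ?mulr_ge0 ?normc_ge0//; apply: ler_pM; rewrite ?normc_ge0//; exact: H4.
have T4 : normc (e * (f w - f l) * (z - w)) <= M * h * D.
 rewrite !normcM; apply: ler_pM; rewrite ?mulr_ge0 ?normc_ge0//; apply: ler_pM; rewrite ?normc_ge0//; exact: H3.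
apply: le_trans (le_normcD _ _) _.
apply: le_trans (lerD (le_normcD _ _) (le_normcD _ _)) _.
rewrite (_ : 4 * M * h * D = (M * h * D + M * h * D) + (M * h * D + M * h * D)); last by ring.
by rewrite !lerD.
Qed.
Lemma sdiffV g l e : g l != 0 -> sdiff g l e -> sdiff (fun z => (g z)^-1) l (- e / g l ^+ 2).
Proof.
move=> gl0 sg eps e0.
pose m := normc (g l).
have m0 : 0 < m by rewrite normc_gt0.
pose M := normc e.
have M0 : 0 <= M by exact: normc_ge0.
(* [|1/(gz gw)| <= 4/m^2], [|gl^2 - gz gw| <= 5/2 m h] *)
pose K := 4 / m ^+ 2 + M * (10 / m ^+ 3).
have K0 : 0 < K by rewrite /K ltr_pwDl ?divr_gt0 ?exprn_gt0// mulr_ge0// divr_ge0// exprn_ge0// ltW.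
pose h := Num.min (m / 2) (eps / K).
have h0 : 0 < h by rewrite lt_min !divr_gt0.
have h1 : h <= m / 2 by rewrite ge_min lexx.
have h2 : K * h <= eps by rewrite mulrC -ler_pdivlMr// ge_min lexx orbT.
have [r2 r20 H2] := sg _ h0; have [r4 r40 H4] := sdiff_near sg h0.
exists (Num.min r2 r4); first by rewrite !lt_min r20.
move=> z w; rewrite !lt_min => /andP[a2 a4] /andP[b2 b4].
have low v : normc (v - l) < r4 -> m / 2 <= normc (g v).
 move=> hv; have := H4 _ hv; have := normc_tri (g l) (g v) 0; rewrite !subr0 normc_sub -/m; lra.
have gz := low _ a4; have gw := low _ b4.
have gz0 : g z != 0 by rewrite -normc_gt0; apply: lt_le_trans gz; rewrite divr_gt0.
have gw0 : g w != 0 by rewrite -normc_gt0; apply: lt_le_trans gw; rewrite divr_gt0.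
have gwu : normc (g w) <= 3 / 2 * m.
 rewrite (_ : g w = g l + (g w - g l)); last by ring.
 apply: le_trans (le_normcD _ _) _; have := H4 _ b4; rewrite -/m; lra.
rewrite (_ : _ - _ = - (g z - g w - e * (z - w)) * (g z * g w)^-1
  - e * (g l * (g l - g w) + (g l - g z) * g w) * ((g z * g w)^-1 * (g l ^+ 2)^-1) * (z - w)); last first.
 by field; rewrite gz0 gw0 gl0.
pose D := normc (z - w).
have D0 : 0 <= D by exact: normc_ge0.
have I1 : normc (g z * g w)^-1 <= 4 / m ^+ 2.
 rewrite normcV normcM; apply: (@le_trans _ _ ((m / 2 * (m / 2))^-1)).
  rewrite lef_pV2 ?posrE ?mulr_gt0 ?normc_gt0 ?divr_gt0//.
  by apply: ler_pM => //; rewrite divr_ge0// ltW.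
 by apply: le_of_eq; field; rewrite gt_eqF.
apply: (@le_trans _ _ (K * h * D)); last by rewrite ler_wpM2r.
apply: le_trans (le_normcD _ _) _; rewrite normcN /K (mulrDl _ _ h) (mulrDl _ _ D); apply: lerD.
 rewrite normcM normcN (_ : 4 / m ^+ 2 * h * D = (h * D) * (4 / m ^+ 2)); last by ring.
 by apply: ler_pM; rewrite ?normc_ge0//; exact: H2.
rewrite normcM ler_wpM2r// normcM (normcM e) -!mulrA ler_wpM2l// normcM.
have I2 : normc (g l * (g l - g w) + (g l - g z) * g w) <= 5 / 2 * m * h.
 apply: le_trans (le_normcD _ _) _; rewrite !normcM.
 have A1 : normc (g l) * normc (g l - g w) <= m * h.
  by apply: ler_pM; rewrite ?normc_ge0// normc_sub; exact: H4.
 have A2 : normc (g l - g z) * normc (g w) <= h * (3 / 2 * m).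
  by apply: ler_pM; rewrite ?normc_ge0// normc_sub; exact: H4.
 by apply: le_trans (lerD A1 A2) _; apply: le_of_eq; field.
have I3 : normc (g z * g w)^-1 * normc (g l ^+ 2)^-1 <= 4 / m ^+ 2 * (m ^+ 2)^-1.
 apply: ler_pM; rewrite ?normc_ge0//.
 by rewrite normcV normcX.
apply: (@le_trans _ _ (5 / 2 * m * h * (4 / m ^+ 2 * (m ^+ 2)^-1))).
 by apply: ler_pM; rewrite ?mulr_ge0 ?normc_ge0.
by apply: le_of_eq; field; rewrite gt_eqF.
Qed.

Lemma sdiff_horner (p : {poly C}) l : sdiff (fun z => p.[z]) l p^`().[l].
Proof.
elim/poly_ind: p => [|p c IH].
 have := sdiff_cst 0 l; rewrite deriv0 horner0 (_ : (fun=> _) = fun z => (0 : {poly C}).[z])//.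
 by apply/funext => z; rewrite horner0.
have := sdiffD (sdiffM IH (sdiff_id l)) (sdiff_cst c l).
rewrite derivD derivC derivM derivX mulr1 addr0 !hornerE.
by rewrite (_ : (fun z => _) = fun z => (p * 'X + c%:P).[z])//; apply/funext => z; rewrite !hornerE.
Qed.
End sdiff.

(** * Lower bounds for preimages under a Lipschitz surjection *)

Section surj.
Variable R : realType.

Lemma int_ball (z : R * R) (r : R) : 0 <= r -> (\int[leb2]_x (\1_(ball z r) x)%:E)%E = ((2 * r) ^+ 2)%:E.
Proof. by move=> r0; rewrite integral_indic//; [rewrite setIT; exact: leb2_ball|exact: measurable_ball2]. Qed.

(** The double counting of [colip_open] in the other direction. Around a preimage [z] of [b] the
    whole square of half-side [s / L] is mapped within [s] of [b]; at fixed source point the targets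
    fill at most a square of side [2 s]. The margin [rho] keeps the small squares inside [X] as soon
    as [s < L rho]. *)
Lemma surj_open (X O : set (R * R)) (g : R * R -> R * R) (L rho : R) : 0 < L -> 0 < rho -> measurable X ->
 measT g -> open O ->
 (forall b, O b -> exists z, ball z rho `<=` X /\ g z = b) ->
 (forall x y, X x -> X y -> `|g x - g y| <= L * `|x - y|) ->
 (leb2 O <= (L ^+ 2)%:E * leb2 (X `&` g @^-1` O))%E.
Proof.
move=> L0 rho0 mX mg oO surj HL.
have mO : measurable O by exact: open_measurable2.
have mI n : measurable (inballs O n) by apply: closed_measurable2; exact: inballs_closed.
have mXO : measurable (X `&` g @^-1` O).
 by apply: measurableI => //; rewrite -[X in measurable X]setTI; exact: mg.
rewrite -{1}(inballs_bigcup oO).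
have cv : leb2 (inballs O n) @[n --> \oo] --> leb2 (\bigcup_n (inballs O n)).
 by apply: nondecreasing_cvg_mu => //; [exact: bigcupT_measurable|exact: inballs_nd].
rewrite -(cvg_lim _ cv)//; apply: lime_le; first by apply/cvg_ex; exists (leb2 (\bigcup_n (inballs O n))).
have Lr : 0 < L * rho by rewrite mulr_gt0.
have [N _ HN] := near_infty_natSinv_lt (PosNum Lr).
exists N => // n /HN /= nL.
pose s : R := n.+1%:R^-1.
have s0 : 0 < s by rewrite invr_gt0.
pose W : set ((R * R) * (R * R)) := [set p | (inballs O n p.1 /\ X p.2) /\ ball (g p.2) s p.1].
have mW : measurable W.
 have m1 : measT (fun p : (R * R) * (R * R) => g p.2) by exact: (meas_comp mg msnd).
 have -> : W = (inballs O n `*` X) `&` (fun p => `|(g p.2).1 - p.1.1|) @^-1` `]-oo, s[%classic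
       `&` (fun p => `|(g p.2).2 - p.1.2|) @^-1` `]-oo, s[%classic.
  apply/seteqP; split => p.
   by move=> [[? ?] /ball2P[? ?]]; split; [split|]; rewrite /= ?in_itv.
  by move=> [[[? ?]]]; rewrite /= !in_itv /= => ? ?; split => //; apply/ball2P.
 apply: measurableI; first apply: measurableI.
 - exact: measurableX.
 - have mm : measT (fun p : (R * R) * (R * R) => (g p.2).1 - p.1.1).
   apply: measurable_funB; first exact: (meas_comp mfst m1).
   exact: (meas_comp mfst mfst).
  have mn := meas_comp (@normr_measurable R setT) mm.
  by rewrite -[X in measurable X]setTI; exact: mn.
 - have mm : measT (fun p : (R * R) * (R * R) => (g p.2).2 - p.1.2).
   apply: measurable_funB; first exact: (meas_comp msnd m1).
   exact: (meas_comp msnd mfst).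
  have mn := meas_comp (@normr_measurable R setT) mm.
  by rewrite -[X in measurable X]setTI; exact: mn.
pose f x y := (\1_W (x, y))%:E : \bar R.
have mf : measT (fun p : (R * R) * (R * R) => f p.1 p.2).
 by apply: (meas_ext (f := EFin \o \1_W)) => [|[]//]; efin.
have f0 x y : (0 <= f x y)%E by rewrite lee_fin.
have E1 : (((2 * s / L) ^+ 2)%:E * leb2 (inballs O n) <= \int[leb2]_x \int[leb2]_y f x y)%E.
 rewrite -[in leLHS](setIT (inballs O n)) -(integral_indic leb2 measurableT (mI n)) -ge0_integralZl//; last 2 first.
 - exact/measurable_EFinP.
 - by rewrite lee_fin sqr_ge0.
 apply: ge0_le_integral => //.
 - by move=> y _; rewrite -EFinM lee_fin mulr_ge0// sqr_ge0.
 - by efin; exact: measurable_funM.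
 - exact: (meas_int_curry leb2 mf).
 move=> b _.
 have [bI|bI] := asboolP (inballs O n b); last first.
  by rewrite indicE memNset// mule0; exact: integral_ge0.
 rewrite indicE mem_set// mule1.
 have [z [zX gz]] : exists z, ball z rho `<=` X /\ g z = b.
  by apply: surj; apply: bI; exact: ballxx.
 have sL : s / L < rho by rewrite ltr_pdivrMr// mulrC.
 rewrite -mulrA -(int_ball z (ltW (divr_gt0 s0 L0))).
 apply: ge0_le_integral => //.
 - by efin; apply: measurable_indic; exact: measurable_ball2.
 - by apply: (meas_curry mf b).
 move=> w _; rewrite /f lee_fin !indicE.
 have [wb|wb] := asboolP (ball z (s / L) w); last by rewrite memNset// ler0n.
 have Xw : X w by apply: zX; apply: le_ball wb; exact: ltW.
 have Xz : X z by apply: zX; exact: ballxx.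
 rewrite (mem_set (A := W)) ?ler_nat ?leq_b1//; split => //.
 rewrite -ball_normE /= -gz; apply: le_lt_trans (HL _ _ Xw Xz) _.
 by rewrite mulrC -ltr_pdivlMr//; move: wb; rewrite -ball_normE /= distrC.
have E2 : (\int[leb2]_y \int[leb2]_x f x y <= ((2 * s) ^+ 2)%:E * leb2 (X `&` g @^-1` O))%E.
 rewrite -[in leRHS](setIT (X `&` _)) -(integral_indic leb2 measurableT mXO) -ge0_integralZl//; last 2 first.
 - exact/measurable_EFinP.
 - by rewrite lee_fin sqr_ge0.
 apply: ge0_le_integral => //.
 - by move=> y _; apply: integral_ge0.
 - exact: (meas_int_curry' leb2 mf).
 - by efin; exact: measurable_funM.
 move=> z _.
 have [zI|zI] := asboolP ((X `&` g @^-1` O) z); last first.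
  rewrite indicE memNset// mule0 integral0_eq// => b _.
  rewrite /f indicE memNset// => -[[bI Xz] bb]; apply: zI; split => //.
  by apply: bI; exact: ball_sym.
 rewrite indicE mem_set// mule1.
 rewrite -(int_ball (g z) (ltW s0)).
 apply: ge0_le_integral => //.
 - by apply: (meas_curry' mf z).
 - by efin; apply: measurable_indic; exact: measurable_ball2.
 move=> b _; rewrite /f lee_fin !indicE.
 have [Wb|Wb] := asboolP (W (b, z)); last by rewrite memNset// ler0n.
 by rewrite mem_set// mem_set//; case: Wb.
move: E1; rewrite (@int_swap _ _ _ _ _ leb2 leb2 f)// => /le_trans /(_ E2).
have -> : (((2 * s) ^+ 2)%:E * leb2 (X `&` g @^-1` O) = ((2 * s / L) ^+ 2)%:E * ((L ^+ 2)%:E * leb2 (X `&` g @^-1` O)))%E.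
 by rewrite muleA -EFinM; congr (_%:E * _)%E; field; rewrite gt_eqF.
by rewrite lee_pmul2l// lte_fin exprn_gt0// divr_gt0// mulr_gt0.
Qed.

Lemma surj_measure (X O A : set (R * R)) (g : R * R -> R * R) (L rho : R) : 0 < L -> 0 < rho -> measurable X ->
 (leb2 X < +oo)%E ->
 measT g -> open O -> measurable A -> A `<=` O ->
 (forall b, O b -> exists z, ball z rho `<=` X /\ g z = b) ->
 (forall x y, X x -> X y -> `|g x - g y| <= L * `|x - y|) ->
 (leb2 A <= (L ^+ 2)%:E * leb2 (X `&` g @^-1` A))%E.
Proof.
move=> L0 rho0 mX fX mg oO mA AO surj HL.
pose mu0 : {measure set (R * R)%type -> \bar R} := pushforward (mrestr leb2 mX) g.
pose mu := mu0 mg.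
have muE B : mu B = leb2 (X `&` g @^-1` B) by rewrite /mu /= /pushforward /mrestr setIC.
have fmu : (mu setT < +oo)%E by rewrite muE preimage_setT setIT.
have fin B : measurable B -> (mu B < +oo)%E.
 by move=> mB; apply: le_lt_trans fmu; le_meas.
have L20 : 0 < L ^+ 2 by rewrite exprn_gt0.
apply/lee_addgt0Pr => e e0.
have [|F [V [cF oV FA AV h]]] := @measure_regular R mu A fmu mA (e / (L ^+ 2)).
 by rewrite divr_gt0.
have oVO : open (V `&` O) by exact: openI.
have mV := open_measurable2 oV; have mF := closed_measurable2 cF.
apply: (@le_trans _ _ (leb2 (V `&` O))).
 by le_meas => //; [exact: open_measurable2|move=> x Ax; split; [exact: AV|exact: AO]].
apply: le_trans (surj_open L0 rho0 mX mg oVO _ HL) _.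
 by move=> b [_ Ob]; exact: surj.
rewrite -!muE.
have -> : V `&` O = A `|` ((V `&` O) `\` A).
 apply/seteqP; split => [x VO|x [Ax|[]//]]; last by split; [exact: AV|exact: AO].
 by have [?|?] := asboolP (A x); [left|right].
have mD : measurable ((V `&` O) `\` A) by apply: measurableD => //; exact: open_measurable2.
rewrite measureU//; last by apply/seteqP; split => // x [? []].
rewrite ge0_muleDr//; apply: leeD2l.
apply: (@le_trans _ _ ((L ^+ 2)%:E * (e / L ^+ 2)%:E)%E).
 rewrite lee_pmul2l//; apply: le_trans h; le_meas => //; first exact: measurableD.
 by move=> x [[Vx _] nA]; split => // /FA.
by rewrite -EFinM mulrC divfK// gt_eqF.
Qed.
End surj.

Section cmeas_more.
Variable R : realType.
Local Notation C := (R[i]).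
Context d (T : measurableType d).

(** The identity [x^-1 = x exp(- ln (x^2))] also holds at 0, where both sides vanish. *)
Lemma meas_invR (f : T -> R) : measT f -> measT (fun t => (f t)^-1).
Proof.
move=> mf; apply: (meas_ext (f := fun t => f t * expR (- ln (f t ^+ 2)))).
 apply: measurable_funM => //.
 apply: meas_expN => //.
 by apply: (meas_comp (@measurable_ln R)); exact: measurable_funX.
move=> t; have [->|f0] := eqVneq (f t) 0; first by rewrite mul0r invr0.
by rewrite expRN lnK ?posrE ?exprn_even_gt0// expr2 invfM mulrA divff// mul1r.
Qed.

Lemma cmeasV (f : T -> C) : cmeas f -> cmeas (fun t => (f t)^-1).
Proof.
move=> mf; have mn := meas_invR (cmeas_nsq mf); have /cmeasP[m1 m2] := mf.
apply/cmeasP; split.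
 apply: (meas_ext (f := fun t => complex.Re (f t) * (nsq (f t))^-1)); first exact: measurable_funM.
 by move=> t; case: (f t).
apply: (meas_ext (f := fun t => - complex.Im (f t) * (nsq (f t))^-1)).
 by apply: measurable_funM => //; exact: measurableT_comp.
by move=> t; case: (f t) => a b /=; rewrite mulNr.
Qed.

Lemma cmeasX (f : T -> C) k : cmeas f -> cmeas (fun t => f t ^+ k).
Proof.
move=> mf; elim: k => [|k IH]; first by apply: (cmeas_ext (f := fun _ : T => 1)) => [|t]; [exact: cmeas_cst|rewrite expr0].
by apply: (cmeas_ext (cmeasM mf IH)) => t; rewrite exprS.
Qed.

Lemma cmeas_hornerP (p : T -> {poly C}) (f : T -> C) N : (forall i, cmeas (fun t => (p t)`_i)) ->
 (forall t, (size (p t) <= N)%N) -> cmeas f -> cmeas (fun t => (p t).[f t]).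
Proof.
move=> mp sp mf; apply: (cmeas_ext (f := fun t => \sum_(i < N) (p t)`_i * f t ^+ i)).
 by apply: cmeas_sum => i; apply: cmeasM => //; exact: cmeasX.
by move=> t; rewrite (horner_coef_wide _ (sp t)).
Qed.

Lemma cmeas_horner (p : {poly C}) (f : T -> C) : cmeas f -> cmeas (fun t => p.[f t]).
Proof. by move=> mf; apply: (@cmeas_hornerP (fun=> p) f (size p)) => // i; exact: cmeas_cst. Qed.
End cmeas_more.

(** * The degree of a rational map *)

Section local_degree.
Variable R : realType.
Local Notation C := (R[i]).

Lemma norm_le_normc (z : R * R) : `|z| <= normc (tc z).
Proof.
case: z => a b; rewrite (_ : `|(a, b)| = Num.max `|a| `|b|)// ge_max /=.
by rewrite -!sqrtr_sqr !ler_sqrt ?addr_ge0 ?sqr_ge0// lerDl lerDr !sqr_ge0.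
Qed.
Lemma normc_le_norm (z : R * R) : normc (tc z) <= 2 * `|z|.
Proof.
case: z => a b; rewrite (_ : `|(a, b)| = Num.max `|a| `|b|)//.
have -> : tc (a, b) = (a +i* 0)%C + (0 +i* b)%C by rewrite /tc; simpc.
apply: le_trans (le_normcD _ _) _; rewrite /= !expr0n addr0 add0r !sqrtr_sqr.
have h1 : `|a| <= Num.max `|a| `|b| by rewrite le_max lexx.
have h2 : `|b| <= Num.max `|a| `|b| by rewrite le_max lexx orbT.
lra.
Qed.
Lemma tcB (z w : R * R) : tc (z - w) = tc z - tc w.
Proof. by case: z; case: w => *; rewrite /tc /=; simpc. Qed.
Lemma ctB (z w : C) : ct (z - w) = ct z - ct w.
Proof. by case: z; case: w. Qed.

(** The increment of [f] over one short step from [z] is estimated twice, with slope [d] and with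
    slope [dz]; the two slopes then differ by at most [2 e]. *)
Lemma sdiff_deriv (f : C -> C) (l d z dz : C) (r e : R) : normc (z - l) < r ->
 (forall z w, normc (z - l) < r -> normc (w - l) < r -> normc (f z - f w - d * (z - w)) <= e * normc (z - w)) ->
 sdiff f z dz -> 0 < e -> normc (dz - d) <= 2 * e.
Proof.
move=> zl H sf e0; have [r' r'0 H'] := sf e e0.
pose t : R := Num.min (r' / 2) ((r - normc (z - l)) / 2).
have t0 : 0 < t by rewrite lt_min !divr_gt0// subr_gt0.
have tr' : t < r' by apply: (@le_lt_trans _ _ (r' / 2)); [rewrite ge_min lexx|lra].
have trl : t < r - normc (z - l).
 by apply: (@le_lt_trans _ _ ((r - normc (z - l)) / 2)); [rewrite ge_min lexx orbT|move: zl; lra].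
pose w : C := z - (t +i* 0)%C.
have nt : normc (t +i* 0)%C = t by rewrite /= expr0n addr0 sqrtr_sqr gtr0_norm.
have zw : z - w = (t +i* 0)%C by rewrite /w opprB addrC subrK.
have h1 := H' z w; rewrite subrr normc0 in h1; have {h1} := h1 r'0.
rewrite (normc_sub w) zw nt => /(_ tr') h1.
have h2 : normc (f z - f w - d * (z - w)) <= e * t.
 rewrite -nt -zw; apply: H => //; apply: le_lt_trans (normc_tri _ z _) _.
 by rewrite normc_sub zw nt -ltrBrDr.
rewrite zw in h2.
have : normc ((dz - d) * (t +i* 0)%C) <= 2 * e * t.
 rewrite (_ : (dz - d) * _ = (f z - f w - d * (t +i* 0)%C) + - (f z - f w - dz * (t +i* 0)%C)); last by ring.
 apply: le_trans (le_normcD _ _) _; rewrite normcN; lra.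
by rewrite normcM nt ler_pM2r.
Qed.

Variables (phi dphi : C -> C).
Local Notation phiR := (fun z : R * R => ct (phi (tc z))).
Local Notation dR := (fun z : R * R => nsq (dphi (tc z))).
Hypothesis mphi : measT phiR.
Hypothesis mdphi : measT dR.

Definition scl (d : C) (A : set (R * R)) : set (R * R) := [set b | A (ct (d * tc b))].

Lemma meas_scl_fun (d : C) : measT (fun b : R * R => ct (d * tc b)).
Proof. by apply: cmeasM; [exact: cmeas_cst|exact: cmeas_tc]. Qed.

Lemma meas_scl d A : measurable A -> measurable (scl d A).
Proof. by move=> mA; rewrite -[scl d A]setTI; exact: meas_scl_fun. Qed.

Lemma int_indic (A : set (R * R)) : measurable A -> (\int[leb2]_z (\1_A z)%:E = leb2 A)%E.
Proof. by move=> mA; rewrite integral_indic// setIT. Qed.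

Lemma leb2_scl (d : C) A : d != 0 -> measurable A -> ((nsq d)%:E * leb2 (scl d A) = leb2 A)%E.
Proof.
move=> d0 mA.
have mi : measT (fun z : R * R => (\1_A z)%:E : \bar R) by exact/measurable_EFinP.
have i0 (z : R * R) : (0 <= (\1_A z)%:E :> \bar R)%E by rewrite lee_fin.
rewrite -(int_indic mA) -(int_caffine 0 d0 mi i0) -(int_indic (meas_scl d mA)).
by congr (_ * _)%E; apply: eq_integral => z _; rewrite addr0.
Qed.

Lemma open_scl (d : C) (S : set (R * R)) : open S -> open (scl d S).
Proof.
rewrite !openE => oS x /oS; rewrite /interior -!nbhs_ballE => -[e /= e0 eS].
have k0 : 0 < 2 * normc d + 1 by have := normc_ge0 d; lra.
exists (e / (2 * normc d + 1)); first by rewrite /= divr_gt0.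
move=> y xy; apply: eS; move: xy; rewrite -!ball_normE /= -ctB -mulrBr -tcB => xy.
apply: le_lt_trans (norm_le_normc _) _; rewrite ctK normcM.
move: xy; rewrite ltr_pdivlMr// => xy.
have := normc_le_norm (x - y); have := normc_ge0 d; have := normr_ge0 (x - y); nra.
Qed.

(** By change of variables this should be the area of [A] counted with the number of preimages in
    [X]; that is what the section proves, up to factors close to 1. *)
Definition PhiX (X A : set (R * R)) : \bar R := (\int[leb2]_(z in X `&` phiR @^-1` A) (dR z)%:E)%E.

Lemma int_bounds (X : set (R * R)) (f : R * R -> R) (a b : R) : measurable X -> measT f ->
 0 <= a -> (forall z, X z -> a <= f z <= b) ->
 (a%:E * leb2 X <= \int[leb2]_(z in X) (f z)%:E)%E /\ (\int[leb2]_(z in X) (f z)%:E <= b%:E * leb2 X)%E.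
Proof.
move=> mX mf a0 H.
have f0 x : X x -> (0 <= (f x)%:E)%E by move=> /H /andP[h _]; rewrite lee_fin; exact: le_trans h.
split.
 rewrite -[leLHS]integral_cst//; apply: ge0_le_integral => //.
 - by efin; exact: measurable_funTS.
 - by move=> z /H /andP[h _]; rewrite lee_fin.
have [X0|/set0P[x Xx]] := eqVneq X set0.
 by rewrite X0 integral_set0 measure0 mule0.
rewrite -[leRHS]integral_cst//; apply: ge0_le_integral => //.
- by efin; exact: measurable_funTS.
- by move=> z /H /andP[_ h]; rewrite lee_fin.
Qed.

(** Divided by its derivative at [l], [phi] is within [2 eta] of a translation in the Lipschitz
    sense, the factor 2 coming from comparing the sup norm with the modulus. The two counting lemmas
    then compare areas with ratios tending to 1 as [eta] tends to 0. Surjectivity onto [S] is left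
    as a hypothesis; it will come from counting roots. *)
Lemma local_root (l : C) (eta : R) (r1 : R) : 0 < eta -> 2 * eta < 1 -> 0 < r1 ->
 dphi l != 0 -> sdiff phi l (dphi l) ->
 (forall z, normc (z - l) < r1 -> sdiff phi z (dphi z)) ->
 exists2 r2 : R, 0 < r2 <= r1 & forall r, 0 < r <= r2 ->
  (forall z w, normc (z - l) < r -> normc (w - l) < r -> phi z = phi w -> z = w) /\
  forall A : set (R * R), measurable A -> (exists r' : R, A `<=` ball (0 : R * R) r') ->
   (PhiX (ball (ct l) (r / 2)) A <= (((1 + 2 * eta) / (1 - 2 * eta)) ^+ 2)%:E * leb2 A)%E /\
   (forall S, open S -> A `<=` S -> (forall b, S b -> exists2 z, `|z - ct l| < r / 4 & phiR z = b) ->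
   (leb2 A <= (((1 + 2 * eta) / (1 - 2 * eta)) ^+ 2)%:E * PhiX (ball (ct l) (r / 2)) A)%E).
Proof.
move=> eta0 eta1 r10 d0 sl sz.
set d := dphi l in d0 sl *.
have nd : 0 < normc d by rewrite normc_gt0.
have e0 : 0 < eta * normc d by rewrite mulr_gt0.
have [r2 r20 H2] := sl _ e0.
exists (Num.min r1 r2); first by rewrite lt_min r10 r20 ge_min lexx.
move=> r /andP[r0]; rewrite le_min => /andP[rr1 rr2].
have H z w : normc (z - l) < r -> normc (w - l) < r ->
  normc (phi z - phi w - d * (z - w)) <= eta * normc d * normc (z - w).
 by move=> hz hw; apply: H2; exact: lt_le_trans rr2.
have L10 : 0 < 1 - 2 * eta by lra.
split.
 move=> z w hz hw pzw; have := H z w hz hw.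
 rewrite pzw subrr sub0r normcN normcM => h.
 have [//|zw] := eqVneq z w; exfalso.
 have zw0 : 0 < normc (z - w) by rewrite normc_gt0 subr_eq0.
 move: h; rewrite ler_pM2r//; nra.
move=> A mA [r' Ar'].
pose X := ball (ct l) (r / 2).
have mX : measurable X by exact: measurable_ball2.
have Xl z : X z -> normc (tc z - l) < r.
 move=> Xz; rewrite -(ctK l) -tcB; apply: le_lt_trans (normc_le_norm _) _.
 by move: Xz; rewrite /X -ball_normE /= distrC; lra.
pose g (z : R * R) : R * R := ct (d^-1 * phi (tc z)).
have mg : measT g.
 by apply: cmeasM; [exact: cmeas_cst|exact: mphi].
have gE x y : g x - g y - (x - y) = ct (d^-1 * (phi (tc x) - phi (tc y) - d * (tc x - tc y))).
 rewrite /g -ctB -[x - y]tcK -ctB tcB; congr ct.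
 by field.
have gest x y : X x -> X y -> `|g x - g y - (x - y)| <= 2 * eta * `|x - y|.
 move=> Xx Xy; rewrite gE; apply: le_trans (norm_le_normc _) _; rewrite ctK normcM normcV.
 have := H _ _ (Xl _ Xx) (Xl _ Xy); rewrite -tcB => h.
 rewrite mulrC ler_pdivrMr//; apply: le_trans h _.
 have := normc_le_norm (x - y) => h.
 rewrite (_ : 2 * eta * `|x - y| * normc d = eta * normc d * (2 * `|x - y|)); last by ring.
 by rewrite ler_pM2l.
have g1 x y : X x -> X y -> `|x - y| <= (1 - 2 * eta)^-1 * `|g x - g y|.
 move=> Xx Xy; rewrite mulrC ler_pdivlMr//.
 have := gest _ _ Xx Xy.
 have : `|x - y| <= `|g x - g y| + `|g x - g y - (x - y)|.
  rewrite -{1}(subKr (g x - g y) (x - y)).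
  exact: ler_normB.
 nra.
have g2 x y : X x -> X y -> `|g x - g y| <= (1 + 2 * eta) * `|x - y|.
 move=> Xx Xy; have := gest _ _ Xx Xy.
 have : `|g x - g y| <= `|x - y| + `|g x - g y - (x - y)|.
  rewrite -{1}(subrK (x - y) (g x - g y)) addrC.
  exact: ler_normD.
 lra.
have pre : X `&` g @^-1` (scl d A) = X `&` phiR @^-1` A.
 by congr (_ `&` _); apply/seteqP; split => z; rewrite /scl /g /= ctK mulVKf.
have mP : measurable (X `&` phiR @^-1` A).
 by apply: measurableI => //; rewrite -[Y in measurable Y]setTI; exact: mphi.
have dR_bd z : X z -> (1 - 2 * eta) ^+ 2 * nsq d <= dR z <= (1 + 2 * eta) ^+ 2 * nsq d.
 move=> Xz; have hz := Xl _ Xz.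
 have := sdiff_deriv hz H (sz _ (lt_le_trans hz rr1)) e0 => h.
 rewrite /= !normc_nsq -!exprMn.
 have lo : (1 - 2 * eta) * normc d <= normc (dphi (tc z)).
  have := normc_tri d (dphi (tc z)) 0; rewrite !subr0 normc_sub; nra.
 have hi : normc (dphi (tc z)) <= (1 + 2 * eta) * normc d.
  have := normc_tri (dphi (tc z)) d 0; rewrite !subr0; nra.
 by rewrite !ler_sqr ?nnegrE ?lo ?hi ?normc_ge0// mulr_ge0 ?normc_ge0//; lra.
have [lo hi] := @int_bounds (X `&` phiR @^-1` A) dR _ _ mP mdphi
  (mulr_ge0 (sqr_ge0 (1 - 2 * eta)) (nsq_ge0 d)) (fun z Xz => dR_bd z Xz.1).
have [s0 Hs] : exists s : R, scl d A `<=` ball (0 : R * R) s.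
 exists (2 * `|r'| / normc d + 1) => b /Ar'; rewrite -!ball_normE /= !sub0r !normrN => h.
 apply: le_lt_trans (norm_le_normc _) _; rewrite -(ltr_pM2l nd) -normcM.
 rewrite -[d * tc b]ctK; apply: le_lt_trans (normc_le_norm _) _.
 rewrite (_ : normc d * (2 * `|r'| / normc d + 1) = 2 * `|r'| + normc d); last by field; rewrite gt_eqF.
 have := ler_norm r'; move: h; lra.
rewrite /PhiX -/X; split.
 apply: le_trans hi _; rewrite -pre.
 have := @colip_measure R X (scl d A) g (1 - 2 * eta)^-1 s0 _ mX mg (meas_scl d mA) Hs g1.
 rewrite invr_ge0 => /(_ (ltW L10)) h.
 rewrite -(leb2_scl d0 mA) muleA -EFinM.
 rewrite (_ : ((1 + 2 * eta) / (1 - 2 * eta)) ^+ 2 * nsq d = (1 + 2 * eta) ^+ 2 * nsq d * ((1 - 2 * eta)^-1) ^+ 2); last by rewrite exprMn; ring.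
 rewrite [in leRHS]EFinM -muleA; apply: lee_wpmul2l => //.
 by rewrite lee_fin mulr_ge0 ?sqr_ge0// nsq_ge0.
move=> S oS AS surj.
have oS' : open (scl d S).
 exact: open_scl.
have Ssurj b : scl d S b -> exists z, ball z (r / 4) `<=` X /\ g z = b.
 move=> /surj [z zl pz]; exists z; split; last by rewrite /g -[phi _]ctK pz ctK mulKf ?tcK.
 move=> w; rewrite /X -!ball_normE /= => zw.
 rewrite (_ : ct l - w = (ct l - z) + (z - w)); last by rewrite addrA subrK.
 apply: le_lt_trans (ler_normD _ _) _; rewrite distrC in zl; lra.
have r4 : 0 < r / 4 by rewrite divr_gt0.
have fX : (leb2 X < +oo)%E by rewrite leb2_ball ?ltry// divr_ge0// ltW.
have AS' : scl d A `<=` scl d S by move=> b; exact: AS.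
have L20 : 0 < 1 + 2 * eta by lra.
have := @surj_measure R X (scl d S) (scl d A) g (1 + 2 * eta) (r / 4) L20 r4 mX fX mg oS' (meas_scl d mA) AS' Ssurj g2.
rewrite pre => h.
rewrite -(leb2_scl d0 mA).
have h2 : ((nsq d)%:E * leb2 (scl d A) <= (nsq d)%:E * (((1 + 2 * eta) ^+ 2)%:E * leb2 (X `&` phiR @^-1` A)))%E.
 by apply: lee_wpmul2l => //; rewrite lee_fin nsq_ge0.
apply: le_trans h2 _.
have q0 : (0 <= (((1 + 2 * eta) / (1 - 2 * eta)) ^+ 2)%:E)%E by rewrite lee_fin sqr_ge0.
apply: le_trans (lee_wpmul2l q0 lo).
rewrite !muleA -!EFinM.
have -> : ((1 + 2 * eta) / (1 - 2 * eta)) ^+ 2 * ((1 - 2 * eta) ^+ 2 * nsq d) = nsq d * (1 + 2 * eta) ^+ 2.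
 by rewrite exprMn exprVn; field; rewrite gt_eqF.
exact: lexx.
Qed.
End local_degree.

Section layer.
Context d (T : measurableType d) (R : realType) (mu : {sigma_finite_measure set T -> \bar R}).

(** Integrals of a composite function are thereby reduced to measures of preimages of superlevel
    sets. The weight [w] is there to hold the Jacobian. *)
Lemma layer_cake (h : T -> \bar R) (w : T -> \bar R) : measT h -> measT w ->
 (forall x, 0 <= h x)%E -> (forall x, 0 <= w x)%E ->
 (\int[mu]_x (h x * w x) = \int[@leb1 R]_t \int[mu]_(x in [set x | (0 <= t)%R /\ (t%:E < h x)%E]) w x)%E.
Proof.
move=> mh mw h0 w0.
pose W : set (T * R) := [set p | 0 <= p.2 /\ (p.2%:E < h p.1)%E].
have mW : measurable W.
 have -> : W = (setT `*` `[0, +oo[%classic) `&` (fun p => h p.1 - p.2%:E)%E @^-1` `]0%E, +oo%E]%classic.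
  have S x (y : R) : (0 < x - y%:E)%E = (y%:E < x)%E by exact: sube_gt0.
  have S2 (y : \bar R) : [set` `]0%E, +oo%E]] y = (0 < y)%E.
   by rewrite /= in_itv /= leey andbT.
  have S3 (y : R) : [set` `[0, +oo[] y = (0 <= y) by rewrite /= in_itv /= andbT.
  apply/seteqP; split => [p [p0 ph]|p [[_ p0] ph]].
   split; first by split => //; change ([set` `[0, +oo[] p.2); rewrite S3.
   by change ([set` `]0%E, +oo%E]] (h p.1 - p.2%:E)%E); rewrite S2 S.
  change ([set` `[0, +oo[] p.2) in p0; change ([set` `]0%E, +oo%E]] (h p.1 - p.2%:E)%E) in ph.
  by move: p0 ph; rewrite S3 S2 S.
 apply: measurableI; first exact: measurableX.
 rewrite -[X in measurable X]setTI; apply: emeasurable_funB => //.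
 - exact: (meas_comp mh mfst).
 - by efin; exact: msnd.
 - exact: emeasurable_itv.
pose f x t := ((\1_W (x, t))%:E * w x)%E.
have mf : measT (fun p : T * R => f p.1 p.2).
 apply: emeasurable_funM.
  have mi : measT (\1_W : T * R -> R) by exact: measurable_indic.
  apply: (meas_ext (f := fun p : T * R => (\1_W p)%:E)) => [|[]//].
  by efin.
 exact: (meas_comp mw mfst).
have f0 x t : (0 <= f x t)%E by rewrite mule_ge0// lee_fin.
transitivity (\int[mu]_x \int[@leb1 R]_t f x t)%E.
 apply: eq_integral => x _; rewrite /f.
 have mWx : measurable [set t | W (x, t)].
  have := measurable_xsection x mW; rewrite /xsection; congr measurable.
  by apply/seteqP; split => t /=; rewrite in_setE.
 have mi : measT (fun t => (\1_W (x, t))%:E : \bar R).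
  efin; apply: (meas_ext (f := (\1_[set t | W (x, t)] : R -> R))); first exact: measurable_indic.
  by move=> t; rewrite !indicE; congr (_%:R).
 rewrite ge0_integralZr//.
 congr (_ * _)%E.
 have -> : (\int[@leb1 R]_t (\1_W (x, t))%:E = leb1 [set t | W (x, t)])%E.
  rewrite -[X in leb1 X]setIT -integral_indic//; apply: eq_integral => t _.
 have := h0 x; rewrite /W /=; case: (h x) => [r r0|_|//].
  rewrite (_ : [set t | _] = [set` `[0, r[]); last first.
   by apply/seteqP; split => t /=; rewrite in_itv /= lte_fin; [move=> [-> ->]|move=> /andP[]].
  rewrite leb1_itv /= lte_fin; move: r0; rewrite lee_fin le_eqVlt => /orP[/eqP <-|->].
   by rewrite ltxx.
  by rewrite oppr0 adde0.
 rewrite (_ : [set t | _] = [set` `[0, +oo[]); first by rewrite leb1_itv /= ltry.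
 by apply/seteqP; split => t /=; rewrite in_itv /= andbT; [move=> []|move=> ->; split => //; exact: ltry].
rewrite (@int_swap _ _ _ _ _ mu leb1 f)//; apply: eq_integral => t _.
rewrite [RHS]integral_mkcond; apply: eq_integral => x _; rewrite /f patchE indicE.
case: ifPn => [/set_mem h1|/negP h1]; first by rewrite mem_set ?mul1e.
by rewrite memNset ?mul0e// => h2; apply: h1; rewrite inE.
Qed.
End layer.

Lemma lee_mul1gtP (R : realType) (x y : \bar R) : (0 <= y)%E ->
 (forall q : R, 1 < q -> (x <= q%:E * y)%E) -> (x <= y)%E.
Proof.
case: y => [y|_ _|//]; last exact: leey.
rewrite lee_fin => y0 H; apply/lee_addgt0Pr => e e0.
have y1 : 0 < y + 1 by rewrite ltr_wpDl.
have q1 : 1 < 1 + e / (y + 1) by rewrite ltrDl divr_gt0.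
apply: le_trans (H _ q1) _; rewrite -EFinM -EFinD lee_fin mulrDl mul1r lerD2l.
by rewrite mulrAC ler_pdivrMr// ler_pM2l// lerDl.
Qed.

Lemma seq_min_pos (R : realType) (T : eqType) (s : seq T) (P : T -> R -> Prop) :
 (forall t r r', t \in s -> P t r -> 0 < r' <= r -> P t r') ->
 (forall t, t \in s -> exists2 r, 0 < r & P t r) -> exists2 r : R, 0 < r & forall t, t \in s -> P t r.
Proof.
elim: s => [|a s IH] mono H; first by exists 1.
have [|t ts|r r0 Hr] := IH.
- by move=> t r r' ts; apply: mono; rewrite inE ts orbT.
- by apply: H; rewrite inE ts orbT.
have [r1 r10 H1] := H a (mem_head _ _).
exists (Num.min r r1); first by rewrite lt_min r0.
move=> t; rewrite inE => /orP[/eqP ->|ts].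
 by apply: (mono _ r1); rewrite ?mem_head// lt_min r0 r10 ge_min lexx orbT.
by apply: (mono _ r); rewrite ?inE ?ts ?orbT//; [exact: Hr|rewrite lt_min r0 r10 ge_min lexx].
Qed.

Section degree.
Variable R : realType.
Local Notation C := (R[i]).
Variables (P Q : {poly C}) (n : nat).
Hypotheses (n0 : (0 < n)%N) (mP : P \is monic) (sP : size P = n.+1) (sQ : (size Q <= n)%N) (cPQ : coprimep P Q).

(** At a zero of [Q] both [rphi] and [rdphi] take the value 0, since inverting 0 gives 0; the
    Jacobian therefore vanishes at the poles. *)
Definition rphi (z : C) : C := P.[z] / Q.[z].
Definition rW : {poly C} := P^`() * Q - P * Q^`().
Definition rdphi (z : C) : C := rW.[z] / Q.[z] ^+ 2.
Local Notation phiR := (fun z : R * R => ct (rphi (tc z))).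
Local Notation dR := (fun z : R * R => nsq (rdphi (tc z))).

Lemma meas_rphi : measT phiR.
Proof. by apply: cmeasM; [apply: cmeas_horner; exact: cmeas_tc|apply: cmeasV; apply: cmeas_horner; exact: cmeas_tc]. Qed.
Lemma meas_rdphi : measT dR.
Proof.
apply: cmeas_nsq; apply: cmeasM; first by apply: cmeas_horner; exact: cmeas_tc.
by apply: cmeasV; apply: cmeasX; apply: cmeas_horner; exact: cmeas_tc.
Qed.

Lemma sdiff_rphi z : Q.[z] != 0 -> sdiff rphi z (rdphi z).
Proof.
move=> Qz; have := sdiffM (sdiff_horner P z) (sdiffV Qz (sdiff_horner Q z)).
rewrite (_ : P^`().[z] / Q.[z] + P.[z] * (- Q^`().[z] / Q.[z] ^+ 2) = rdphi z)//.
by rewrite /rdphi /rW hornerD hornerN !hornerM; field.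
Qed.

Lemma common_rootN z : P.[z] = 0 -> Q.[z] = 0 -> False.
Proof.
move=> Pz Qz; have := coprimep_root cPQ (x := z).
by rewrite /root Pz Qz eqxx => /(_ isT).
Qed.

(** Otherwise [P] divides [P' Q], hence [P'] by coprimality, which its degree forbids. *)
Lemma rW_neq0 : rW != 0.
Proof.
apply/negP => /eqP W0.
have PQ' : P^`() * Q = P * Q^`() by apply/eqP; rewrite -subr_eq0; apply/eqP.
have : P %| P^`() * Q by rewrite PQ' dvdp_mulIl.
rewrite (Gauss_dvdpl _ cPQ) => /dvdp_leq.
have P'0 : P^`() != 0.
 apply/eqP => P0; have := coefMn 1 0 0; have : (P^`())`_n.-1 = 0 by rewrite P0 coef0.
 rewrite coef_deriv prednK// => h _.
 have lc : P`_n = 1 by move/monicP: mP; rewrite /lead_coef sP.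
 by move: h; rewrite lc => /eqP; rewrite pnatr_eq0; move: n0; case: (n).
move=> /(_ P'0); rewrite leqNgt => /negP; apply.
by rewrite lt_size_deriv// monic_neq0.
Qed.

(** At a root [l] of [P - a0 Q] the derivative of this polynomial is [rW(l) / Q(l)]. It is nonzero
    when [a0] is not a critical value, so the [n] roots are distinct. *)
Lemma noncrit_roots a0 : (forall z, rW.[z] = 0 -> rphi z <> a0) ->
 exists s : seq C, [/\ size s = n, uniq s, P - a0 *: Q = \prod_(l <- s) ('X - l%:P) &
  forall l, l \in s -> [/\ Q.[l] != 0, rphi l = a0 & rdphi l != 0]].
Proof.
move=> nc.
have saQ : (size (a0 *: Q) <= n)%N by apply: leq_trans (size_scale_leq _ _) sQ.
have mPa : P - a0 *: Q \is monic.
 by rewrite monicE lead_coefDl ?size_polyN ?sP ?ltnS// -monicE.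
have sPa : size (P - a0 *: Q) = n.+1 by rewrite size_polyDl ?sP// size_polyN ltnS.
have [s Es] := closed_field_poly_normal (P - a0 *: Q).
rewrite (monicP mPa) scale1r in Es.
have rootP l : root (P - a0 *: Q) l -> [/\ Q.[l] != 0, rphi l = a0 & rdphi l != 0].
 rewrite /root !hornerE subr_eq0 => /eqP Pl.
 have Ql : Q.[l] != 0.
  by apply/eqP => Ql; apply: (@common_rootN l) => //; rewrite Pl Ql mulr0.
 have pl : rphi l = a0 by rewrite /rphi Pl mulfK.
 split => //; rewrite /rdphi mulf_neq0 ?invr_eq0 ?expf_neq0//.
 by apply/eqP => W0; exact: (nc l).
have ss : size s = n by move: sPa; rewrite Es size_prod_XsubC => -[].
exists s; split => //.
 rewrite -separable_prod_XsubC -Es unlock /separable_poly; apply/Pdiv.ClosedField.coprimepP => l rl.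
 have [Ql pl dl] := rootP l rl.
 apply: contra dl; rewrite /root /rdphi /rW derivB derivZ !hornerE subr_eq0 => /eqP Pl.
 have -> : P.[l] = a0 * Q.[l] by rewrite -pl /rphi divfK.
 by rewrite Pl mulrAC subrr mul0r.
move=> l ls; apply: rootP; rewrite Es root_prod_XsubC//.
Qed.

Definition Phi (A : set (R * R)) : \bar R := (\int[leb2]_(z in phiR @^-1` A) (dR z)%:E)%E.

Lemma rphi_root a z : root (P - a *: Q) z -> Q.[z] != 0 /\ rphi z = a.
Proof.
rewrite /root !hornerE subr_eq0 => /eqP Pl.
have Ql : Q.[z] != 0.
 by apply/eqP => Ql; apply: (@common_rootN z) => //; rewrite Pl Ql mulr0.
by rewrite /rphi Pl mulfK.
Qed.

Lemma size_PaQ a : size (P - a *: Q) = n.+1 /\ P - a *: Q \is monic.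
Proof.
have saQ : (size (a *: Q) <= n)%N by apply: leq_trans (size_scale_leq _ _) sQ.
split; first by rewrite size_polyDl ?sP// size_polyN ltnS.
by rewrite monicE lead_coefDl ?size_polyN ?sP ?ltnS// -monicE.
Qed.

(** The modulus of the monic polynomial [P - a Q] at [l] is the product of the [n] distances from
    [l] to its roots, and it equals [|a0 - a| |Q(l)|]. This takes the place of the open mapping
    theorem. *)
Lemma near_root (l a0 a : C) (r : R) : rphi l = a0 -> Q.[l] != 0 -> 0 < r ->
 normc (a0 - a) * normc Q.[l] < r ^+ n -> exists2 t, root (P - a *: Q) t & normc (t - l) < r.
Proof.
move=> pl Ql r0 H; have [sPa mPa] := size_PaQ a.
have [s Es] := closed_field_poly_normal (P - a *: Q).
rewrite (monicP mPa) scale1r in Es.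
have ss : size s = n by move: sPa; rewrite Es size_prod_XsubC => -[].
have [/hasP[t ts tl]|/hasPn far] := boolP (has (fun t => normc (t - l) < r) s).
 by exists t => //; rewrite Es root_prod_XsubC.
exfalso; move: H; rewrite -normcM ltNge => /negP; apply.
have -> : (a0 - a) * Q.[l] = (P - a *: Q).[l].
 by rewrite !hornerE mulrBl -pl /rphi divfK.
rewrite Es horner_prod normc_prod -ss.
elim: (s) far => [|t u IH] far; first by rewrite big_nil expr0.
rewrite big_cons exprS; apply: ler_pM; rewrite ?exprn_ge0 ?(ltW r0)//; last first.
 by apply: IH => x xu; apply: far; rewrite inE xu orbT.
by rewrite !hornerE normc_sub leNgt; apply: far; rewrite mem_head.
Qed.

(** For [b] near [a0], each of the [n] disjoint discs about the preimages of [a0] contains a root of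
    [P - b Q]. As there are only [n] roots, each disc contains exactly one and there are none
    elsewhere, so the local comparisons add up to the factor [n]. *)
Lemma local_degree (a0 : C) (q : R) : 1 < q -> (forall z, rW.[z] = 0 -> rphi z <> a0) ->
 exists2 rho : R, 0 < rho & forall A, measurable A -> A `<=` ball (ct a0) rho ->
  (Phi A <= q%:E * (n%:R%:E * leb2 A))%E /\ (n%:R%:E * leb2 A <= q%:E * Phi A)%E.
Proof.
move=> q1 nc; have [s [ss us Es Hs]] := noncrit_roots nc.
(* With this choice [((1 + x) / (1 - x))^2 <= (1 + 4 x)^2 <= 1 + 16 x <= q]. *)
pose x := Num.min (2^-1) ((q - 1) / 16).
have x0 : 0 < x by rewrite lt_min invr_gt0 divr_gt0//; lra.
have x2 : x <= 2^-1 by rewrite ge_min lexx.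
have xq : x <= (q - 1) / 16 by rewrite ge_min lexx orbT.
pose eta := x / 2.
have eta0 : 0 < eta by rewrite divr_gt0.
have eE : 2 * eta = x by rewrite /eta; field.
have eta1 : 2 * eta < 1 by rewrite eE; lra.
have kq : ((1 + 2 * eta) / (1 - 2 * eta)) ^+ 2 <= q.
 rewrite eE; have h : (1 + x) / (1 - x) <= 1 + 4 * x by rewrite ler_pdivrMr; nra.
 have h0 : 0 <= (1 + x) / (1 - x) by rewrite divr_ge0//; lra.
 by nra.
pose good (l : C) (r : R) := (forall z, normc (z - l) < r -> Q.[z] != 0) /\
 (forall l', l' \in s -> normc (l' - l) < 2 * r -> l' = l) /\
  forall r', 0 < r' <= r -> forall A : set (R * R), measurable A -> (exists r' : R, A `<=` ball (0 : R * R) r') ->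
   (PhiX rphi rdphi (ball (ct l) (r' / 2)) A <= q%:E * leb2 A)%E /\
   (forall S, open S -> A `<=` S -> (forall b, S b -> exists2 z, `|z - ct l| < r' / 4 & phiR z = b) ->
   (leb2 A <= q%:E * PhiX rphi rdphi (ball (ct l) (r' / 2)) A)%E).
have [|l ls|r r0 Hr] := @seq_min_pos R _ s good.
- move=> t r r' ts [g1 [g2 g3]] /andP[r'0 r'r]; split.
  by move=> z zt; apply: g1; exact: lt_le_trans r'r.
 split; first by move=> l' l's h; apply: g2 => //; apply: lt_le_trans h _; rewrite ler_pM2l.
 by move=> r'' /andP[? h]; apply: g3; rewrite (le_trans h r'r) andbT.
- have [Ql pl dl] := Hs l ls.
 have [r1 r10 HQ] : exists2 r1 : R, 0 < r1 & forall z, normc (z - l) < r1 -> Q.[z] != 0.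
  have nQ : 0 < normc Q.[l] by rewrite normc_gt0.
  have nQ2 : 0 < normc Q.[l] / 2 by rewrite divr_gt0.
  have [r1 r10 H1] := sdiff_near (sdiff_horner Q l) nQ2.
  by exists r1 => // z /H1 h; apply/eqP => Qz; move: h; rewrite Qz sub0r normcN; lra.
 have [r2 /andP[r20 r21] H2] := @local_root R rphi rdphi meas_rphi meas_rdphi l eta r1 eta0 eta1 r10 dl (sdiff_rphi Ql) (fun z hz => sdiff_rphi (HQ z hz)).
 exists (r2 / 2); first by rewrite divr_gt0.
 split; first by move=> z hz; apply: HQ; lra.
 split.
  have [|inj _] := H2 r2; first by rewrite r20 lexx.
  move=> l' l's h; have [_ pl' _] := Hs l' l's; apply: inj; rewrite ?subrr ?normc0//; last by rewrite pl pl'.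
  by move: h; lra.
 move=> r' /andP[r'0 r'r] A mA bA.
 have [|_ H3] := H2 r'; first by rewrite r'0; lra.
 have [h1 h2] := H3 A mA bA; split.
  by apply: le_trans h1 _; apply: lee_wpmul2r; rewrite ?measure_ge0// lee_fin.
 move=> S oS AS sur; apply: le_trans (h2 S oS AS sur) _; apply: lee_wpmul2r; rewrite ?lee_fin//.
 by apply: integral_ge0 => z _; rewrite lee_fin nsq_ge0.
have [M M0 HM] : exists2 M : R, 0 < M & forall l, l \in s -> normc Q.[l] <= M.
 elim: (s) => [|t u [M M0 HM]]; first by exists 1.
 exists (M + normc Q.[t]); first by rewrite ltr_wpDr ?normc_ge0.
 move=> l; rewrite inE => /orP[/eqP ->|/HM h]; first by rewrite lerDr ltW.
 by apply: le_trans h _; rewrite lerDl normc_ge0.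
have r8 : 0 < r / 8 by rewrite divr_gt0.
(* Within [rho] in sup norm the modulus is less than [2 rho], so [|a0 - b| |Q(l)| < (r / 8)^n], as
   [near_root] requires. *)
pose rho := (r / 8) ^+ n / (2 * M).
have rho0 : 0 < rho by rewrite divr_gt0 ?exprn_gt0// mulr_gt0.
exists rho => // A mA Arho.
have nr b : ball (ct a0) rho b -> forall l, l \in s -> exists2 t, root (P - tc b *: Q) t & normc (t - l) < r / 8.
 rewrite -ball_normE /= => hb l ls; have [Ql pl _] := Hs l ls.
 apply: (near_root pl) => //.
 have h1 : normc (a0 - tc b) <= 2 * `|ct a0 - b|.
  by rewrite -{1}(ctK a0) -tcB; exact: normc_le_norm.
 apply: (@le_lt_trans _ _ (2 * `|ct a0 - b| * M)).
  by apply: ler_pM; rewrite ?normc_ge0//; exact: HM.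
 by move: hb; rewrite /rho ltr_pdivlMr ?mulr_gt0//; lra.
pose X l := ball (ct l) (r / 2) `&` phiR @^-1` A.
have mpA : measurable (phiR @^-1` A) by rewrite -[Y in measurable Y]setTI; exact: meas_rphi.
have mX l : measurable (X l) by apply: measurableI => //; exact: measurable_ball2.
have tX : trivIset [set` s] X.
 move=> l l' /= ls l's [z [[]]]; rewrite /X -!ball_normE /= => h1 _ [h2 _].
 have [_ [sep _]] := Hr l' l's; apply: sep => //.
 rewrite -(ctK l) -(ctK l') -tcB; apply: le_lt_trans (normc_le_norm _) _.
 rewrite ltr_pM2l// (_ : ct l - ct l' = (ct l - z) - (ct l' - z)); last by rewrite opprB addrA subrK.
 by apply: le_lt_trans (ler_normB _ _) _; move: h1 h2; lra.
have d0 z : (0 <= (dR z)%:E)%E by rewrite lee_fin nsq_ge0.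
have md : measT (fun z => (dR z)%:E) by efin; exact: meas_rdphi.
have E1 : Phi A = (\sum_(l <- s) PhiX rphi rdphi (ball (ct l) (r / 2)) A)%E.
 rewrite /PhiX -(@ge0_integral_bigsetU _ _ _ leb2 _ X)//; last first.
  by apply: measurable_funTS.
 rewrite /Phi [LHS]integral_mkcond [RHS]integral_mkcond; apply: eq_integral => z _.
 rewrite !patchE; case: ifPn => [/set_mem zA|/negP zA]; case: ifPn => [/set_mem zX|/negP zX] //.
  have [Qz|Qz] := eqVneq Q.[tc z] 0; first by rewrite /rdphi Qz expr0n /= invr0 mulr0 nsq0.
  exfalso; apply: zX; apply: mem_set.
  have rz : root (P - rphi (tc z) *: Q) (tc z).
   by rewrite /root !hornerE /rphi divfK// subrr.
  have [l ls lz] : exists2 l, l \in s & normc (tc z - l) < r / 8.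
   (* Otherwise [z] and the [n] roots close to the points of [s] would be [n + 1] distinct roots of
      a polynomial of degree [n]. *)
   apply: contrapT => no.
   have [f Hf] : exists f : C -> C, forall l, l \in s -> root (P - rphi (tc z) *: Q) (f l) /\ normc (f l - l) < r / 8.
    have := nr _ (Arho _ zA) => h.
    have /choice [f Hf] : forall l, exists t, l \in s -> root (P - rphi (tc z) *: Q) t /\ normc (t - l) < r / 8.
     move=> l; have [ls|ls] := boolP (l \in s); last by exists 0.
     by have [t t1 t2] := h l ls; exists t => _; split=> //; rewrite ctK in t1.
    by exists f.
   have [sPa mPa] := size_PaQ (rphi (tc z)).
   have := @max_poly_roots _ (P - rphi (tc z) *: Q) (tc z :: map f s) (monic_neq0 mPa).
   rewrite sPa /= size_map ss ltnn => h; suff: false by []; apply: h.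
    rewrite rz /=; apply/allP => _ /mapP[l ls ->].
    by have [] := Hf l ls.
   apply/andP; split.
    apply/mapP => -[l ls zf]; apply: no; exists l => //.
    by rewrite zf; have [] := Hf l ls.
   rewrite map_inj_in_uniq// => l l' ls l's fll.
   have [_ [sep _]] := Hr l' l's; apply: sep => //.
   have [_ h1] := Hf l ls; have [_ h2] := Hf l' l's; rewrite -fll in h2.
   apply: le_lt_trans (normc_tri _ (f l) _) _; rewrite (normc_sub l).
   by move: h1 h2; lra.
  rewrite -bigcup_seq; exists l => //; split=> //.
  rewrite -ball_normE /= distrC; apply: le_lt_trans (norm_le_normc _) _; rewrite tcB ctK; lra.
 by exfalso; apply: zA; apply: mem_set; move: zX; rewrite -bigcup_seq => -[l _ []].
have bA : exists r' : R, A `<=` ball (0 : R * R) r'.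
 exists (`|ct a0| + rho) => b /Arho; rewrite -!ball_normE /= sub0r normrN => h.
 rewrite (_ : b = ct a0 - (ct a0 - b)); last by rewrite opprB addrC subrK.
 by apply: le_lt_trans (ler_normB _ _) _; rewrite ltrD2l.
have r00 : 0 < r <= r by rewrite r0 lexx.
have nsum (y : \bar R) : (0 <= y)%E -> (\sum_(l <- s) y = n%:R%:E * y)%E.
 move=> y0; rewrite -ss; elim: (s) => [|t u IH]; first by rewrite big_nil mul0e.
 by rewrite big_cons IH /= -natr1 EFinD ge0_muleDl ?lee_fin// mul1e addeC.
split.
 rewrite E1 muleCA -nsum; last by rewrite mule_ge0 ?measure_ge0// lee_fin; lra.
 rewrite big_seq [leRHS]big_seq; apply: lee_sum => l ls.
 have [_ [_ H3]] := Hr l ls.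
 by have [] := H3 r r00 A mA bA.
rewrite -nsum ?measure_ge0// E1 ge0_sume_distrr; last first.
 by move=> l _; apply: integral_ge0 => z _.
rewrite big_seq [leRHS]big_seq; apply: lee_sum => l ls.
have [_ [_ H3]] := Hr l ls.
have [_ H4] := H3 r r00 A mA bA; apply: (H4 (ball (ct a0) rho)) => //.
 exact: ball_open.
move=> b hb; have [t rt tl] := nr b hb l ls; have [_ pt] := rphi_root rt.
exists (ct t); last by rewrite ctK pt tcK.
by rewrite -ctB; apply: le_lt_trans (norm_le_normc _) _; rewrite ctK; lra.
Qed.

Lemma leb2_seq (s : seq (R * R)) : measurable [set` s] /\ leb2 [set` s] = 0%E.
Proof.
have h1 (x : R * R) : measurable [set x] /\ leb2 [set x] = 0%E.
 have mx : measurable [set x].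
  by apply: closed_measurable2; apply: compact_closed; [exact: norm_hausdorff|exact: compact_set1].
 split => //; null_le; apply/lee_addgt0Pr => e e0.
 have e1 : 0 < Num.min 1 e by rewrite lt_min ltr01.
 have e2 : Num.min 1 e <= 1 by rewrite ge_min lexx.
 have e3 : Num.min 1 e <= e by rewrite ge_min lexx orbT.
 rewrite add0e; apply: (@le_trans _ _ (leb2 (ball x (Num.min 1 e / 2)))).
  le_meas => //; first exact: measurable_ball2.
  by move=> _ ->; apply: ballxx; rewrite divr_gt0.
 rewrite leb2_ball ?divr_ge0 ?(ltW e1)// lee_fin; nra.
elim: s => [|t u [IH1 IH2]].
 by rewrite set_nil; split; rewrite ?measure0.
rewrite (_ : [set` t :: u] = [set` u] `|` [set t]); last first.
 apply/seteqP; split => x /=; rewrite inE; first by move=> /orP[/eqP ->|->]; [right|left].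
 by move=> [->|->]; rewrite ?eqxx ?orbT.
have [m0 l0] := h1 t; split; first exact: measurableU.
by rewrite measureU0.
Qed.

(** Countably many rational balls, on each of which the local comparison holds with ratio [q], cover
    the noncritical values; they are made disjoint and summed. Critical values and their preimages
    are finite sets, hence null. Letting [q] tend to 1 gives equality. *)
Lemma degree_measure (A : set (R * R)) : measurable A -> Phi A = (n%:R%:E * leb2 A)%E.
Proof.
move=> mA.
have d0 z : (0 <= (dR z)%:E)%E by rewrite lee_fin nsq_ge0.
have md : measT (fun z => (dR z)%:E) by efin; exact: meas_rdphi.
have mpre (B : set (R * R)) : measurable B -> measurable (phiR @^-1` B).
 by move=> mB; rewrite -[Y in measurable Y]setTI; exact: meas_rphi.
have Phi0 B : (0 <= Phi B)%E by apply: integral_ge0 => z _.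
suff main (q : R) : 1 < q -> (Phi A <= q%:E * (n%:R%:E * leb2 A))%E /\ (n%:R%:E * leb2 A <= q%:E * Phi A)%E.
 apply/eqP; rewrite eq_le; apply/andP; split; apply: lee_mul1gtP => //.
 - by rewrite mule_ge0// lee_fin.
 - by move=> q /main[].
 - by move=> q /main[].
move=> q1.
have q0 : 0 < q by lra.
pose good (B : set (R * R)) := forall A, measurable A -> A `<=` B ->
  (Phi A <= q%:E * (n%:R%:E * leb2 A))%E /\ (n%:R%:E * leb2 A <= q%:E * Phi A)%E.
pose B (i : nat) : set (R * R) := if unpickle i is Some (x, y, k) then
  let b := ball (ratr x : R, ratr y : R) k.+1%:R^-1 in if `[< good b >] then b else set0 else set0.
have mB i : measurable (B i).
 by rewrite /B; case: (unpickle i) => // -[[x y] k]; case: ifP => // _; exact: measurable_ball2.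
have gB i : good (B i).
 rewrite /B; case: (unpickle i) => [[[x y] k]|]; first case: ifPn => [/asboolP//|_].
 - move=> A' _; rewrite subset0 => ->; rewrite /Phi preimage_set0 integral_set0 measure0 !mule0; split; exact: lexx.
 - move=> A' _; rewrite subset0 => ->; rewrite /Phi preimage_set0 integral_set0 measure0 !mule0; split; exact: lexx.
have cover b : (forall z, rW.[z] = 0 -> rphi z <> tc b) -> (\bigcup_i B i) b.
 move=> /(local_degree q1) [rho rho0]; rewrite tcK => H.
 have [k hk] : exists k : nat, k.+1%:R^-1 < rho / 2.
  exists (Num.trunc (rho / 2)^-1); rewrite invf_plt ?posrE ?divr_gt0//; exact: truncnS_gt.
 have k0 : 0 < k.+1%:R^-1 :> R by rewrite invr_gt0.
 have [e eE] : exists e : R, e = k.+1%:R^-1 by eexists.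
 rewrite -eE in hk k0.
 have l1 : b.1 - e < b.1 + e by lra.
 have l2 : b.2 - e < b.2 + e by lra.
 have [x] := @rat_in_itvoo R _ _ l1.
 have [y] := @rat_in_itvoo R _ _ l2.
 rewrite !in_itv /= => /andP[y1 y2] /andP[x1 x2].
 have gb : good (ball (ratr x : R, ratr y : R) e).
  move=> A' mA' sA; apply: H => // c /sA /ball2P /= [c1 c2]; apply/ball2P; split.
   by move: c1; rewrite !ltr_norml => /andP[c1 c1']; apply/andP; split; lra.
  by move: c2; rewrite !ltr_norml => /andP[c2 c2']; apply/andP; split; lra.
 have bb : ball (ratr x : R, ratr y : R) e b.
  by apply/ball2P; split; rewrite ltr_norml /=; apply/andP; split; lra.
 have [i iE] : exists i, unpickle i = Some (x, y, k) by exists (pickle (x, y, k)); exact: pickleK.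
 exists i; first exact: I.
 by rewrite /B iE -eE; move: gb => /asboolP gb; cbv zeta; rewrite gb.
pose F i := A `&` seqDU B i.
have mS i : measurable (seqDU B i) by apply: measurableD => //; exact: bigsetU_measurable.
have mF i : measurable (F i) by exact: measurableI.
have tF : trivIset setT F by apply: trivIset_setIl; exact: trivIset_seqDU.
have [sr srP] := closed_field_poly_normal rW.
pose crit := [seq ct (rphi z) | z <- sr].
have AF : A `\` \bigcup_i F i `<=` [set` crit].
 move=> b [Ab nb]; apply: contrapT => nc; apply: nb.
 have : (\bigcup_i B i) b.
  apply: cover => z Wz pz; apply: nc; rewrite /= -(tcK b) -pz; apply/mapP; exists z => //.
  rewrite -root_prod_XsubC -(rootZ _ _ (a := lead_coef rW)) ?lead_coef_eq0 ?rW_neq0//.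
  by rewrite -srP; apply/eqP.
 by rewrite seqDU_bigcup_eq => -[i _ Bi]; exists i.
have mU : measurable (\bigcup_i F i) by exact: bigcup_measurable.
have A1 : leb2 A = leb2 (\bigcup_i F i).
 have FA : \bigcup_i F i `<=` A by move=> b [i _ []].
 rewrite -[in LHS](setUIDK A (\bigcup_i F i)) (setIidr FA) measureU0//; first exact: measurableD.
 have [mc lc] := leb2_seq crit.
 by null_le; rewrite -lc; le_meas => //; exact: measurableD.
have A2 : Phi A = Phi (\bigcup_i F i).
 rewrite /Phi; pose crs := [seq ct t | t <- flatten [seq sval (closed_field_poly_normal (P - rphi z *: Q)) | z <- sr]].
 have [mc lc] := leb2_seq crs.
 have [Qs QsP] := closed_field_poly_normal Q.
 have mrest D : measurable D -> measT ((fun z => (dR z)%:E) \_ D).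
  by move=> mD; apply: (measurable_restrictT _ mD).1; apply: measurable_funTS; exact: md.
 have mprA := mpre _ mA; have mprU := mpre _ mU.
 have strip D : measurable D -> (\int[leb2]_(z in D) (dR z)%:E =
   \int[leb2]_(z in setT `\` [set` crs]) ((fun z => (dR z)%:E) \_ D) z)%E.
  move=> mD; rewrite integral_mkcond (ge0_negligible_integral mc measurableT (mrest _ mD) _ lc)//.
  by move=> x _; rewrite patchE; case: ifP.
 rewrite (strip _ mprA) (strip _ mprU).
 apply: eq_integral => z /set_mem [_ nz]; rewrite !patchE.
 have [Qz|Qz] := eqVneq Q.[tc z] 0.
  have -> : dR z = 0 by rewrite /rdphi Qz expr0n /= invr0 mulr0 nsq0.
  by case: ifP; case: ifP.
 case: ifPn => [/set_mem zA|/negP zA]; case: ifPn => [/set_mem zX|/negP zX] //; exfalso.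
  have /AF : (A `\` \bigcup_i F i) (phiR z) by split => // ?; apply: zX; exact: mem_set.
  move=> /= /mapP[w wr /(congr1 (@tc R))]; rewrite !ctK => zw.
  apply: nz; rewrite /= -(tcK z); apply: map_f; apply/flatten_mapP; exists w => //.
  case: (closed_field_poly_normal _) => s' /= Es'.
  have : root (P - rphi w *: Q) (tc z) by rewrite -zw /root !hornerE /rphi divfK// subrr.
  have [_ mPa] := size_PaQ (rphi w).
  by rewrite Es' (monicP mPa) scale1r root_prod_XsubC.
 by apply: zA; apply: mem_set; case: zX => i _ [].
rewrite A1 A2.
have E1 : Phi (\bigcup_i F i) = (\sum_(i <oo) Phi (F i))%E.
 rewrite /Phi preimage_bigcup ge0_integral_bigcup//; first by move=> k; exact: mpre.
  exact: measurable_funTS.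
 move=> i j _ _ [z [zi zj]]; apply: tF => //; by exists (phiR z).
have E2 : leb2 (\bigcup_i F i) = (\sum_(i <oo) leb2 (F i))%E.
 by rewrite measure_semi_bigcup.
have gF i : (Phi (F i) <= q%:E * (n%:R%:E * leb2 (F i)))%E /\ (n%:R%:E * leb2 (F i) <= q%:E * Phi (F i))%E.
 by apply: (gB i) => // b [_ []].
rewrite E1 E2; split.
 rewrite -!nneseriesZl//; last by move=> i _; rewrite mule_ge0// lee_fin.
 by apply: lee_nneseries => // i _; case: (gF i).
rewrite -!nneseriesZl//; apply: lee_nneseries => // [i _ _|i _]; first by rewrite mule_ge0// lee_fin.
by case: (gF i).
Qed.

Lemma degree_formula (h : R * R -> \bar R) : measT h -> (forall z, 0 <= h z)%E ->
 (\int[leb2]_z (h (phiR z) * (dR z)%:E) = n%:R%:E * \int[leb2]_z h z)%E.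
Proof.
move=> mh h0.
have md : measT (fun z => (dR z)%:E) by efin; exact: meas_rdphi.
have nE : (0 <= n%:R%:E :> \bar R)%E by rewrite lee_fin ler0n.
have mc : measT ((fun=> n%:R%:E) : R * R -> \bar R) by exact: measurable_cst.
transitivity (\int[leb2]_z (h z * n%:R%:E))%E; last first.
 by rewrite ge0_integralZr// muleC.
rewrite (layer_cake leb2 (meas_comp mh meas_rphi) md (fun z => h0 _)); last by move=> z; rewrite lee_fin nsq_ge0.
rewrite (layer_cake leb2 mh mc h0 (fun=> nE)).
apply: eq_integral => t _.
have mA : measurable [set x | 0 <= t /\ (t%:E < h x)%E].
 case: (leP 0 t) => t0.
  have -> : [set x | is_true true /\ (t%:E < h x)%E] = setT `&` h @^-1` `]t%:E, +oo%E]%classic.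
   by apply/seteqP; split => x /=; rewrite in_itv /= leey andbT => -[_ ?].
  by apply: mh => //; exact: emeasurable_itv.
 by rewrite (_ : [set x | _] = set0)//; apply/seteqP; split => // x /= [].
rewrite integral_cst//; have := degree_measure mA; rewrite /Phi => <-.
by [].
Qed.
End degree.

Lemma int_fin (R : realType) (s : seq (R * R)) (f g : R * R -> \bar R) : measT f -> measT g ->
 (forall x, 0 <= f x)%E -> (forall x, 0 <= g x)%E -> (forall x, x \notin s -> f x = g x) ->
 (\int[leb2]_x f x = \int[leb2]_x g x)%E.
Proof.
move=> mf mg f0 g0 H; have [ms s0] := leb2_seq s.
rewrite (ge0_negligible_integral ms measurableT mf (fun x _ => f0 x) s0).
rewrite (ge0_negligible_integral ms measurableT mg (fun x _ => g0 x) s0).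
by apply: eq_integral => x /set_mem [_ /= xs]; apply: H; apply/negP.
Qed.

(** * Vector integrals: linear bijections and exceptional sets *)

Section vint_more.
Variable R : realType.
Local Notation C := (R[i]).

Lemma vint_cat m n (G : 'cV[C]_(m + n) -> \bar R) :
 vint G = vint (fun x : 'cV_m => vint (fun y : 'cV_n => G (col_mx x y))).
Proof.
elim: m G => [|m IH] G.
 rewrite {2}/vint enum_ord0 /=; apply: eq_vint => y; congr G.
 by apply/colP => i; rewrite mxE; case: splitP => [[]//|j ij]; congr (y _ _); apply/val_inj.
have IHS (G' : 'cV[C]_(1 + (m + n)) -> \bar R) : vint G' = vint (fun x : 'cV_(1 + m) => vint (fun y : 'cV_n =>
  G' (col_mx (usubmx x) (col_mx (dsubmx x) y)))).
 rewrite vintS [RHS]vintS; apply: eq_integral => z _; rewrite IH.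
 by apply: eq_vint => x; apply: eq_vint => y; rewrite col_mxKu col_mxKd.
rewrite (IHS G); apply: eq_vint => x; apply: eq_vint => y; congr G.
apply/colP => i; rewrite !mxE.
case: splitP => [j ij|j ij]; case: splitP => [k ik|k ik]; rewrite ?mxE.
- by congr (x _ _); apply/val_inj; rewrite /= -ij.
- by exfalso; have := ltn_ord j; rewrite -ij ik; lia.
- case: splitP => [l il|l il]; rewrite ?mxE.
  by congr (x _ _); apply/val_inj; rewrite -[RHS]ik ij il.
 by exfalso; have := ltn_ord k; rewrite -ik ij il add1n ltnS ltnNge leq_addr.
- have jk : j = (m + k)%N :> nat by apply/eqP; rewrite -(eqn_add2l 1) -ij ik.
 case: splitP => [l il|l il]; rewrite ?mxE; first by exfalso; have := ltn_ord l; rewrite -il jk ltnNge leq_addr.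
 by congr (y _ _); apply/val_inj/eqP; rewrite /= -(eqn_add2l m) -il jk.
Qed.

(** Only positivity of the constant and its independence of [G] and [b] will be used. The dimensions
    need not agree syntactically; bijectivity forces equality. *)
Lemma vint_lin m n (f : 'cV[C]_m -> 'cV[C]_n) (g : 'cV[C]_n -> 'cV[C]_m) :
 (forall a u v, f (a *: u + v) = a *: f u + f v) -> cancel f g -> cancel g f ->
 exists2 k : R, 0 < k & forall b (G : 'cV[C]_n -> \bar R), vmeas G -> (forall v, 0 <= G v)%E ->
  vint (fun v => G (f v + b)%R) = (k%:E * vint G)%E.
Proof.
move=> lf fK gK.
have f0 : f 0 = 0.
 by have := lf (-1) 0 0; rewrite scaler0 addr0 scaleN1r addNr.
have fs (I : Type) (s : seq I) (a : I -> C) (u : I -> 'cV_m) : f (\sum_(i <- s) a i *: u i) = \sum_(i <- s) a i *: f (u i).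
 by elim: s => [|i s IH]; rewrite ?big_nil// !big_cons lf IH.
pose A : 'M[C]_(n, m) := \matrix_(i, j) f (delta_mx j 0) i 0.
have fA v : f v = A *m v.
 rewrite {1}(matrix_sum_delta v) exchange_big big_ord1 fs; apply/colP => i; rewrite summxE mxE.
 by apply: eq_bigr => j _; rewrite !mxE mulrC.
have lg a u v : g (a *: u + v) = a *: g u + g v.
 by apply: (can_inj fK); rewrite gK lf !gK.
pose B : 'M[C]_(m, n) := \matrix_(i, j) g (delta_mx j 0) i 0.
have gs (I : Type) (s : seq I) (a : I -> C) (u : I -> 'cV_n) : g (\sum_(i <- s) a i *: u i) = \sum_(i <- s) a i *: g (u i).
 elim: s => [|i s IH]; rewrite ?big_nil// ?big_cons ?lg ?IH//.
 by apply: (can_inj fK); rewrite gK f0.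
have gB v : g v = B *m v.
 rewrite {1}(matrix_sum_delta v) exchange_big big_ord1 gs; apply/colP => i; rewrite summxE mxE.
 by apply: eq_bigr => j _; rewrite !mxE mulrC.
have AB : A *m B = 1%:M.
 by apply/matrixP => i j; have := congr1 (fun w : 'cV_n => w i 0) (gK (delta_mx j 0)); rewrite fA gB mulmxA -colE !mxE andbT.
have BA : B *m A = 1%:M.
 by apply/matrixP => i j; have := congr1 (fun w : 'cV_m => w i 0) (fK (delta_mx j 0)); rewrite fA gB mulmxA -colE !mxE andbT.
have mn : m = n by apply/eqP; rewrite eqn_leq (mulmx1_min AB) (mulmx1_min BA).
clear gB gs lg BA fs f0; case: n / mn f g lf fK gK A fA B AB => f g lf fK gK A fA B AB.
have dA : \det A != 0 by have [] := mulmx1_unit AB; rewrite unitmxE unitfE.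
have nA : 0 < nsq (\det A) by rewrite lt_def nsq_ge0 nsq_eq0 dA.
exists (nsq (\det A))^-1; first by rewrite invr_gt0.
move=> b G mG G0; rewrite -(LIN_unit dA b mG G0) muleA -EFinM mulVf ?gt_eqF// mul1e.
by apply: eq_vint => v; rewrite fA.
Qed.

(** Averaging over the substitutions [v -> t v + v0], with [t] in the unit square and the Jacobian
    as weight, multiplies each integral by the area 4 of the square. After exchanging integrals, [t]
    varies at fixed [v]: then [G(t v + v0)] is a polynomial in [t] not vanishing at 0, so only
    finitely many [t] are exceptional. *)
Lemma vint_ae n (G : 'cV[C]_n -> C) (v0 : 'cV[C]_n) (H1 H2 : 'cV[C]_n -> \bar R) : G v0 != 0 ->
 (forall v, exists p : {poly C}, forall t, G (t *: v + v0) = p.[t]) ->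
 vmeas H1 -> vmeas H2 -> (forall v, 0 <= H1 v)%E -> (forall v, 0 <= H2 v)%E ->
 (forall v, G v != 0 -> H1 v = H2 v) -> vint H1 = vint H2.
Proof.
move=> Gv0 Gp m1 m2 H10 H20 H12.
pose del (t : R * R) : R := \1_(ball (0 : R * R) 1) t * nsq (\det ((tc t)%:M : 'M[C]_n)).
have mdel : measT del.
 apply: measurable_funM; first by apply: measurable_indic; exact: measurable_ball2.
 apply: cmeas_nsq; apply: cmeas_det => i j; apply: (cmeas_ext (f := fun t => tc t * ((i == j)%:R))).
  by apply: cmeasM; [exact: (@cmeas_tc R)|exact: cmeas_cst].
 by move=> t; rewrite mxE mulr_natr.
have del0 t : 0 <= del t by rewrite mulr_ge0 ?nsq_ge0.
pose E H := (\int[leb2]_t ((del t)%:E * vint (fun v : 'cV[C]_n => H (tc t *: v + v0)%R)))%E.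
have mJ H d (T : measurableType d) (f : T -> R * R) (g : T -> 'cV[C]_n) : vmeas H ->
 measT f -> (forall i, cmeas (fun t => g t i 0)) ->
 measT (fun x => ((del (f x))%:E * H (tc (f x) *: (g x) + v0)%R)%E).
 move=> mH mf mg; apply: emeasurable_funM; first by efin; exact: (meas_comp mdel mf).
 apply: (vmeas_comp mH) => i; apply: (cmeas_ext (f := fun t => tc (f t) * g t i 0 + v0 i 0)).
  by have h := cmeas_comp (@cmeas_tc R) mf; apply: cmeasD; [apply: cmeasM; [exact: h|exact: mg]|exact: cmeas_cst].
 by move=> t; rewrite !mxE.
have mV H t : vmeas H -> vmeas (fun v => H (tc t *: v + v0)).
 move=> mH; apply: (vmeas_comp mH) => i; apply: (cmeas_ext (f := fun y => tc t * colof y i 0 + v0 i 0)).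
  by apply: cmeasD; [apply: cmeasM; [exact: cmeas_cst|exact: cmeas_colof]|exact: cmeas_cst].
 by move=> y; rewrite !mxE.
have EE H : vmeas H -> (forall v, 0 <= H v)%E ->
  E H = vint (fun v => \int[leb2]_t ((del t)%:E * H (tc t *: v + v0)%R))%E.
 move=> mH H0; rewrite -(@vint_swap _ _ _ _ leb2 (fun t v => (del t)%:E * H (tc t *: v + v0)%R)%E); last 2 first.
 - apply: (mJ H _ _ (fst : (R * R) * cfg R 'I_n -> R * R) (fun p => colof p.2)) => //.
  by move=> i; apply: (cmeas_comp (cmeas_colof _ _) msnd).
 - by move=> t v; rewrite mule_ge0// lee_fin.
 apply: eq_integral => t _; rewrite vint_scale// ?lee_fin//; exact: mV.
have EK H : vmeas H -> (forall v, 0 <= H v)%E -> E H = (4%:E * vint H)%E.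
 move=> mH H0.
 have mi : measT (fun t => (\1_(ball (0 : R * R) 1) t)%:E : \bar R).
  by efin; apply: measurable_indic; exact: measurable_ball2.
 have vH0 : (0 <= vint H)%E by apply: vint_ge0.
 transitivity (\int[leb2]_t ((\1_(ball (0 : R * R) 1) t)%:E * vint H))%E; last first.
  rewrite ge0_integralZr//.
  by rewrite int_ball// mulr1 (_ : 2 ^+ 2 = 4 :> R)//; ring.
 apply: (@int_fin R [:: 0]).
 - apply: emeasurable_funM; first exact/measurable_EFinP.
  apply: meas_vint => //; apply: (vmeas_comp mH) => i.
  apply: (cmeas_ext (f := fun p : (R * R) * cfg R 'I_n => tc p.1 * colof p.2 i 0 + v0 i 0)).
   apply: cmeasD; last exact: cmeas_cst.
   by apply: cmeasM; [exact: (cmeas_comp (@cmeas_tc R) mfst)|exact: (cmeas_comp (cmeas_colof _ _) msnd)].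
  by move=> p; rewrite !mxE.
 - by apply: emeasurable_funM => //; exact: measurable_cst.
 - by move=> t; rewrite mule_ge0 ?lee_fin//; apply: vint_ge0.
 - by move=> t; rewrite mule_ge0 ?lee_fin.
 move=> t; rewrite inE => t0; rewrite /del EFinM -muleA; congr (_ * _)%E.
 have dt : \det ((tc t)%:M : 'M[C]_n) != 0.
  rewrite det_scalar expf_neq0//; apply: contra t0 => /eqP t0; apply/eqP.
  by rewrite -(tcK t) t0.
 rewrite -(LIN_unit dt v0 mH H0); congr (_ * _)%E; apply: eq_vint => v.
 by rewrite mul_scalar_mx.
have : (4%:E * vint H1 = 4%:E * vint H2)%E.
 rewrite -!EK// !EE//; apply: eq_vint => v.
 have [p Hp] := Gp v.
 have p0 : p != 0 by apply: contra Gv0 => /eqP p0; have := Hp 0; rewrite scale0r add0r p0 horner0 => ->.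
 have [s Es] := closed_field_poly_normal p.
 apply: (@int_fin R [seq ct t | t <- s]).
 - apply: (mJ H1 _ _ id (fun=> v)) => // i; exact: cmeas_cst.
 - apply: (mJ H2 _ _ id (fun=> v)) => // i; exact: cmeas_cst.
 - by move=> t; rewrite mule_ge0 ?lee_fin.
 - by move=> t; rewrite mule_ge0 ?lee_fin.
 move=> t ts; rewrite H12// Hp; apply: contra ts => rt; rewrite -(tcK t); apply: map_f.
 by rewrite -root_prod_XsubC -(rootZ _ _ (a := lead_coef p)) ?lead_coef_eq0// -Es.
have : (0 <= vint H1)%E by exact: vint_ge0.
have : (0 <= vint H2)%E by exact: vint_ge0.
case: (vint H1) => [x||]; case: (vint H2) => [y||] //= _ _.
- by rewrite -!EFinM => -[] h; congr EFin; lra.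
- by rewrite mulry gtr0_sg// mul1e.
- by rewrite mulry gtr0_sg// mul1e.
Qed.

Lemma vint_vswap m n (G : 'cV[C]_m -> 'cV[C]_n -> \bar R) :
 measT (fun p : cfg R 'I_m * cfg R 'I_n => G (colof p.1) (colof p.2)) ->
 (forall u v, 0 <= G u v)%E ->
 vint (fun u => vint (G u)) = vint (fun v => vint (G ^~ v)).
Proof.
elim: m G => [|m IH] G mG G0.
 by rewrite {1}/vint enum_ord0 /=; apply: eq_vint => v; rewrite /vint enum_ord0.
have mc d (T : measurableType d) (f : T -> R * R) (g : T -> cfg R 'I_m) (h : T -> cfg R 'I_n) :
  measT f -> measT g -> measT h ->
  measT (fun t => G (col_mx (tc (f t))%:M (colof (g t)) : 'cV_(1 + m)) (colof (h t))).
 move=> mf mg mh.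
 apply: (meas_ext (f := fun t => G (colof (ccons (f t) (g t))) (colof (h t)))); last by move=> t; rewrite colof_cons.
 have mcc : measT (fun t => ccons (f t) (g t)).
  exact: (meas_comp (@meas_ccons R m) (meas_pair mf mg)).
 exact: (meas_comp mG (meas_pair mcc mh)).
rewrite vintS; transitivity (\int[leb2]_z vint (fun v => vint (fun u => G (col_mx (tc z)%:M u : 'cV_(1 + m)) v)))%E.
 apply: eq_integral => z _; apply: IH => //.
 by apply: mc => //; exact: measurable_cst.
rewrite vint_swap//; first by apply: eq_vint => v; rewrite vintS.
 apply: (meas_vint (G := fun (p : (R * R) * cfg R 'I_n) u => G (col_mx (tc p.1)%:M u : 'cV_(1 + m)) (colof p.2))) => //.
 apply: (mc _ _ (fun q => q.1.1) snd (fun q => q.1.2)).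
 - exact: (meas_comp mfst mfst).
 - exact: msnd.
 - exact: (meas_comp msnd mfst).
by move=> *; exact: vint_ge0.
Qed.
End vint_more.

(** The numerator of the resolvent entry [w (X - D)^-1 c], whose denominator is the characteristic
    polynomial of [D]. *)
Definition bord_f (A : comNzRingType) n (w : 'rV[A]_n) (c : 'cV[A]_n) (D : 'M[A]_n) : {poly A} :=
 (map_mx polyC w *m \adj (char_poly_mx D) *m map_mx polyC c) 0 0.

(** * Deflation *)

Section deflation_algebra.
Variable F : fieldType.

Lemma char_poly_sim n (S S' T : 'M[F]_n) : S' *m S = 1%:M -> char_poly (S *m T *m S') = char_poly T.
Proof.
move=> SS; have SS' := mulmx1C SS.
have -> : char_poly (S *m T *m S') = \det (map_mx polyC S *m char_poly_mx T *m map_mx polyC S').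
 rewrite /char_poly /char_poly_mx !map_mxM mulmxBr mulmxBl; congr (\det (_ - _)).
 by rewrite mul_mx_scalar -scalemxAl -map_mxM SS' map_mx1 scalemx1.
by rewrite !det_mulmx mulrAC -det_mulmx -map_mxM SS' map_mx1 det1 mul1r.
Qed.

Variables (n : nat).
Implicit Types (w : 'rV[F]_n) (c u : 'cV[F]_n) (D : 'M[F]_n) (a l : F).

Definition blk a w c D : 'M[F]_(1 + n) := block_mx a%:M w c D.
Definition shearL u : 'M[F]_(1 + n) := block_mx 1%:M 0 u 1%:M.

Lemma shearLK u : shearL (- u) *m shearL u = 1%:M.
Proof. by rewrite mulmx_block !mulmx0 !mul1mx !mulmx1 !mul0mx !addr0 add0r addrC subrr -scalar_mx_block. Qed.

(** The vector [(1, u)] is an eigenvector of the left-hand side for the eigenvalue [l], and the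
    shear moves it to the first basis vector. *)
Lemma blk_shear l w u D : blk (l - (w *m u) 0 0) w (l *: u - D *m u) D =
 shearL u *m blk l w 0 (D - u *m w) *m shearL (- u).
Proof.
rewrite !mulmx_block !mulmx0 !mul1mx !mulmx1 !mul0mx !addr0 !add0r /blk; congr block_mx.
- by rewrite mulmxN; apply/matrixP => i j; rewrite !ord1 !mxE !mulr1n.
- by rewrite [u *m w + _]addrC subrK mul_mx_scalar mulmxN.
- by rewrite addrC subrK.
Qed.

Lemma char_poly_blk0 l w D : char_poly (blk l w 0 D) = ('X - l%:P) * char_poly D.
Proof.
rewrite /char_poly /char_poly_mx (scalar_mx_block 1 n) map_block_mx /= map_scalar_mx map_mx0.
rewrite opp_block_mx add_block_mx oppr0 addr0 det_ublock; congr (_ * _).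
by rewrite det_mx11 !mxE /= !mulr1n.
Qed.

(** A Schur complement, multiplied by the adjugate to stay among polynomials. The right side is
    [P - a Q] with [P] and [Q] free of [a], so the eigenvalues [l] are the solutions of
    [P(l) / Q(l) = a]. *)
Lemma char_poly_blk a w c D :
 char_poly (blk a w c D) = 'X * char_poly D - bord_f w c D - a *: char_poly D.
Proof.
set A := char_poly_mx D; set d := char_poly D.
have d0 : d != 0 by rewrite monic_neq0// char_poly_monic.
apply: (mulfI d0).
have -> : char_poly (blk a w c D) = \det (block_mx ('X - a%:P)%:M (- map_mx polyC w) (- map_mx polyC c) A : 'M[{poly F}]_(1 + n)).
 rewrite /char_poly {1}/char_poly_mx (scalar_mx_block 1 n) map_block_mx /= map_scalar_mx.
 by rewrite opp_block_mx add_block_mx !add0r -raddfB.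
pose M : 'M[{poly F}]_(1 + n) := block_mx d%:M 0 (\adj A *m map_mx polyC c) 1%:M.
have dM : \det M = d by rewrite det_lblock det_scalar expr1 det1 mulr1.
rewrite -{1}dM mulrC -det_mulmx mulmx_block !mulmx0 !mulmx1 !add0r.
have -> : - map_mx polyC c *m d%:M + A *m (\adj A *m map_mx polyC c) = 0.
 by rewrite mulmxA mul_mx_adj mul_mx_scalar mul_scalar_mx scalerN addNr.
rewrite det_ublock -/d mulrC; congr (_ * _).
rewrite det_mx11 mxE -scalar_mxM mxE mulr1n mulNmx mxE mulmxA -/(bord_f w c D).
by rewrite mulrBl -mul_polyC; ring.
Qed.

Lemma derivM_mx m p q (A : 'M[{poly F}]_(m, p)) (B : 'M[{poly F}]_(p, q)) :
 map_mx (@deriv F) (A *m B) = map_mx (@deriv F) A *m B + A *m map_mx (@deriv F) B.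
Proof.
mx_ext; rewrite raddf_sum -big_split; apply: eq_bigr => k _.
by rewrite !mxE; exact: derivM.
Qed.

Lemma map_deriv_C m p (A : 'M[F]_(m, p)) : map_mx (@deriv F) (map_mx polyC A) = 0.
Proof. by mx_ext; rewrite derivC. Qed.

(** The derivative of the resolvent is minus its square, with denominators cleared. It is obtained
    by differentiating [\adj A *m A = Q%:M]. *)
Lemma deriv_bord w c D (A := char_poly_mx D) :
 (bord_f w c D)^`() * char_poly D - bord_f w c D * (char_poly D)^`() =
 - (map_mx polyC w *m (\adj A *m \adj A) *m map_mx polyC c) 0 0.
Proof.
set Q := char_poly D; set wP := map_mx polyC w; set cP := map_mx polyC c.
have f' : (bord_f w c D)^`() = (wP *m map_mx (@deriv F) (\adj A) *m cP) 0 0.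
 have -> : (bord_f w c D)^`() = (map_mx (@deriv F) (wP *m \adj A *m cP)) 0 0 by rewrite mxE.
 by rewrite !derivM_mx !map_deriv_C !mulmx0 mul0mx add0r addr0.
have AA : \adj A *m A = Q%:M by rewrite mul_adj_mx.
have A' : map_mx (@deriv F) A = 1%:M.
 mx_ext; rewrite derivB derivC subr0 derivMn derivX.
 by case: (i == j).
have Q' : map_mx (@deriv F) (Q%:M : 'M[{poly F}]_n) = (Q^`())%:M.
 by mx_ext; case: (i == j); rewrite ?mulr1n// mulr0n deriv0.
have key : Q *: map_mx (@deriv F) (\adj A) + \adj A *m \adj A = Q^`() *: \adj A.
 rewrite -mul_mx_scalar -(mul_mx_adj A) mulmxA -mulmxDl -mul_scalar_mx -Q' -AA derivM_mx A' mulmx1.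
 by [].
have E : (wP *m (Q *: map_mx (@deriv F) (\adj A) + \adj A *m \adj A) *m cP) 0 0 = (wP *m (Q^`() *: \adj A) *m cP) 0 0.
 by rewrite key.
move: E; rewrite mulmxDr mulmxDl -!scalemxAr -!scalemxAl mxE [X in X + _]mxE [RHS]mxE -f' => E.
by rewrite mulrC [X in _ - X]mulrC /bord_f -/A -/wP -/cP -E; ring.
Qed.

(** The matrix determinant lemma, again by eliminating in a bordered matrix. *)
Lemma char_poly_rank1 (D : 'M[F]_n) u w : char_poly (D - u *m w) = char_poly D + bord_f w u D.
Proof.
set A := char_poly_mx D; set d := char_poly D.
have d0 : d != 0 by rewrite monic_neq0// char_poly_monic.
set uP := map_mx polyC u; set wP := map_mx polyC w.
pose N : 'M[{poly F}]_(1 + n) := block_mx 1%:M wP (- uP) A.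
have <- : \det N = char_poly (D - u *m w).
 pose L : 'M[{poly F}]_(1 + n) := block_mx 1%:M (- wP) 0 1%:M.
 have dL : \det L = 1 by rewrite det_ublock !det1 mulr1.
 rewrite -[LHS]mulr1 -dL -det_mulmx mulmx_block !mulmx1 !mulmx0 mul1mx addr0 addNr mulNmx mulmxN opprK addr0.
 rewrite det_lblock det1 mul1r /char_poly /char_poly_mx map_mxB map_mxM opprB addrA.
 by rewrite [uP *m wP + _]addrC -addrA.
apply: (mulIf d0).
pose M : 'M[{poly F}]_(1 + n) := block_mx d%:M 0 (\adj A *m uP) 1%:M.
have dM : \det M = d by rewrite det_lblock det_scalar expr1 det1 mulr1.
rewrite -{1}dM -det_mulmx mulmx_block !mulmx0 !mulmx1 !mul1mx !add0r.
have -> : - uP *m d%:M + A *m (\adj A *m uP) = 0.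
 by rewrite mulmxA mul_mx_adj mul_mx_scalar mul_scalar_mx scalerN addNr.
rewrite det_ublock -/d; congr (_ * _).
by rewrite det_mx11 mxE mxE mulr1n mulmxA -/(bord_f w u D).
Qed.

Lemma map_horner_char_mx l D : map_mx (horner_eval l) (char_poly_mx D) = l%:M - D.
Proof. by mx_ext; rewrite /horner_eval hornerD hornerN hornerC hornerMn hornerX. Qed.

Lemma map_horner_polyC l m p (B : 'M[F]_(m, p)) : map_mx (horner_eval l) (map_mx polyC B) = B.
Proof. by mx_ext; rewrite /horner_eval hornerC. Qed.

Lemma horner_char_poly (D : 'M[F]_n) l : (char_poly D).[l] = \det (l%:M - D).
Proof. by rewrite -map_horner_char_mx det_map_mx. Qed.

Lemma bord_f_horner l w c D : (bord_f w c D).[l] = (w *m \adj (l%:M - D) *m c) 0 0.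
Proof.
transitivity ((map_mx (horner_eval l) (map_mx polyC w *m \adj (char_poly_mx D) *m map_mx polyC c)) 0 0); first by rewrite [RHS]mxE.
by rewrite !map_mxM map_mx_adj map_horner_char_mx !map_horner_polyC.
Qed.

Lemma wronskian_bord l w c D (Q := char_poly D) (P := 'X * Q - bord_f w c D) :
 (P^`() * Q - P * Q^`()).[l] = Q.[l] ^+ 2 + (w *m (\adj (l%:M - D) *m \adj (l%:M - D)) *m c) 0 0.
Proof.
have -> : P^`() * Q - P * Q^`() = Q * Q - ((bord_f w c D)^`() * Q - bord_f w c D * Q^`()).
 by rewrite /P derivB derivM derivX; ring.
rewrite deriv_bord opprK hornerD hornerM -expr2; congr (_ + _).
transitivity ((map_mx (horner_eval l) (map_mx polyC w *m (\adj (char_poly_mx D) *m \adj (char_poly_mx D)) *m map_mx polyC c)) 0 0).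
 by rewrite [RHS]mxE.
by rewrite !map_mxM !map_mx_adj map_horner_char_mx !map_horner_polyC.
Qed.

(** In the coordinate [u] the Wronskian factors. The derivative of [P / Q] at [l] is then the
    characteristic polynomial of [D - u *m w] at [l] divided by [Q(l)], and the Jacobian of
    [c = (l - D) u] will cancel [Q(l)]. *)
Lemma rW_blk l w u D (c := l *: u - D *m u) (Q := char_poly D) (P := 'X * Q - bord_f w c D) :
 (P^`() * Q - P * Q^`()).[l] = Q.[l] * (char_poly (D - u *m w)).[l].
Proof.
have cE : c = (l%:M - D) *m u by rewrite mulmxBl mul_scalar_mx.
rewrite wronskian_bord char_poly_rank1 hornerD mulrDr -expr2; congr (_ + _).
rewrite bord_f_horner cE /Q horner_char_poly; set B := l%:M - D.
rewrite -!mulmxA (mulmxA (\adj B) B) mul_adj_mx.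
by rewrite mul_scalar_mx -!scalemxAr mxE.
Qed.
End deflation_algebra.

(** The determinant of [f(D)] is the product of the values of [f = bord_f w c D] at the eigenvalues
    of [D], that is, the resultant of [f] and the characteristic polynomial. It is polynomial in the
    entries, so nonvanishing is generic. *)
Definition bord_res (A : comNzRingType) n (w : 'rV[A]_n.+1) (c : 'cV[A]_n.+1) (D : 'M[A]_n.+1) : A :=
 \det (horner_mx D (bord_f w c D)).

Lemma map_bord_res (A B : comNzRingType) (phi : {rmorphism A -> B}) n (w : 'rV[A]_n.+1) (c : 'cV[A]_n.+1) D :
 phi (bord_res w c D) = bord_res (map_mx phi w) (map_mx phi c) (map_mx phi D).
Proof.
rewrite /bord_res -det_map_mx map_horner_mx; congr (\det (horner_mx _ _)).
have mC m p (M : 'M[A]_(m, p)) : map_mx (map_poly phi) (map_mx polyC M) = map_mx polyC (map_mx phi M).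
 by mx_ext; rewrite map_polyC.
transitivity ((map_mx (map_poly phi) (map_mx polyC w *m \adj (char_poly_mx D) *m map_mx polyC c)) 0 0).
 by rewrite [RHS]mxE.
by rewrite !map_mxM map_mx_adj map_char_poly_mx !mC.
Qed.

Section coprime_bordered.
Variable R : realType.
Local Notation C := (R[i]).
Variable n : nat.

Lemma bord_res_coprime (w : 'rV[C]_n.+1) (c : 'cV[C]_n.+1) D : bord_res w c D != 0 ->
 coprimep ('X * char_poly D - bord_f w c D) (char_poly D).
Proof.
set Q := char_poly D; set f := bord_f w c D => H; rewrite coprimep_sym.
apply/Pdiv.ClosedField.coprimepP => l Ql; apply: contra H.
rewrite /root !hornerE (eqP Ql) mulr0 sub0r oppr_eq0 => fl.
have /dvdpP [g fg] : 'X - l%:P %| f by rewrite dvdp_XsubCl.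
rewrite /bord_res -/f fg rmorphM /= -/(mulmx _ _) det_mulmx mulf_eq0; apply/orP; right.
rewrite rmorphB /= horner_mx_X horner_mx_C -opprB -scaleN1r detZ mulf_eq0 signr_eq0 /=.
by rewrite -horner_char_poly.
Qed.

Lemma bord_res_poly (w0 w : 'rV[C]_n.+1) (c0 c : 'cV[C]_n.+1) D0 D :
 exists p : {poly C}, forall t, bord_res (t *: w + w0) (t *: c + c0) (t *: D + D0) = p.[t].
Proof.
pose L m p (M0 M : 'M[C]_(m, p)) := 'X *: map_mx polyC M + map_mx polyC M0.
exists (bord_res (L _ _ w0 w) (L _ _ c0 c) (L _ _ D0 D)) => t.
have ML m p (M0 M : 'M[C]_(m, p)) : map_mx (horner_eval t) (L m p M0 M) = t *: M + M0.
 by mx_ext; rewrite /horner_eval !hornerE.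
by rewrite -[RHS]/(horner_eval t _) map_bord_res !ML.
Qed.

(** Witness: [D] diagonal with entries [0, ..., n] and all entries of [w] and [c] equal to 1. Then
    [f] is the derivative of the characteristic polynomial, nonzero at each of the simple
    eigenvalues. *)
Lemma bord_res_nz : exists w c D, bord_res (w : 'rV[C]_n.+1) (c : 'cV[C]_n.+1) D != 0.
Proof.
pose d : 'rV[C]_n.+1 := \row_j (j : nat)%:R.
have dinj i j : d 0 i = d 0 j -> i = j.
 by rewrite !mxE => /eqP; rewrite eqr_nat => /eqP h; exact: val_inj.
exists (const_mx 1), (const_mx 1), (diag_mx d).
rewrite /bord_res; set f := bord_f _ _ _; rewrite horner_mx_diag det_diag.
apply/prodf_neq0 => i _; rewrite mxE.
pose B := \adj (char_poly_mx (diag_mx d)); set Q := char_poly (diag_mx d).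
have BE j k : B j k * ('X - (d 0 k)%:P) = Q *+ (j == k).
 have : (B *m char_poly_mx (diag_mx d)) j k = Q%:M j k by rewrite mul_adj_mx.
 rewrite !mxE => <-; rewrite (bigD1 k)//= big1 ?addr0; last first.
  move=> m mk; rewrite !mxE (negbTE mk) subrr mulr0//.
 by rewrite !mxE eqxx !mulr1n.
have QE : Q = \prod_j ('X - (d 0 j)%:P).
 rewrite /Q /char_poly (_ : char_poly_mx _ = diag_mx (\row_j ('X - (d 0 j)%:P))).
  by rewrite det_diag; apply: eq_bigr => j _; rewrite mxE.
 by apply/matrixP => j k; rewrite !mxE; case: eqVneq => [->|] //; rewrite ?mulr0n ?subrr.
have Boff j k : j != k -> B j k = 0.
 move=> jk; have := BE j k; rewrite (negbTE jk) mulr0n => /eqP; rewrite mulf_eq0 polyXsubC_eq0 orbF.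
 by move/eqP.
have Bd j : B j j = \prod_(k | k != j) ('X - (d 0 k)%:P).
 have h : 'X - (d 0 j)%:P != 0 :> {poly C} by rewrite polyXsubC_eq0.
 by apply: (mulIf h); rewrite BE eqxx mulr1n QE (bigD1 j)//= mulrC.
have fE : f = \sum_j B j j.
 rewrite /f /bord_f -/B; clearbody B; rewrite mxE; apply: eq_bigr => j _; rewrite !mxE mulr1 (bigD1 j)//= !mxE mul1r.
 by rewrite big1 ?addr0// => k kj; rewrite !mxE mul1r Boff.
rewrite fE horner_sum (bigD1 i)//= big1 ?addr0; last first.
 move=> j ji; rewrite Bd horner_prod (bigD1 i) 1?eq_sym//= !hornerE subrr mul0r//.
rewrite Bd horner_prod; apply/prodf_neq0 => k ki; rewrite !hornerE subr_eq0.
by apply: contra ki => /eqP/dinj ->.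
Qed.
End coprime_bordered.

Local Open Scope sesquilinear_scope.

(** * Frobenius norm and unitary triangularisation of a shear *)

Section frobenius.
Variable R : realType.
Local Notation C := (R[i]).

Definition fnorm2 m n (M : 'M[C]_(m, n)) : R := \sum_i \sum_j nsq (M i j).

Lemma fnorm2_tr m n (M : 'M[C]_(m, n)) : ((fnorm2 M)%:C)%C = \tr (M *m M ^t*).
Proof.
rewrite /fnorm2 /mxtrace rmorph_sum /=; apply: eq_bigr => i _.
rewrite rmorph_sum mxE; apply: eq_bigr => j _.
by rewrite !mxE; exact: nsqE.
Qed.

Lemma fnorm2_unitary n (W M : 'M[C]_n) : W \is unitarymx -> fnorm2 (W *m M *m W ^t*) = fnorm2 M.
Proof.
move=> uW; apply: (@complexI R); rewrite !fnorm2_tr !trmx_mul !map_mxM trmxCK.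
rewrite !mulmxA mulmxKtV// mxtrace_mulC !mulmxA -invmx_unitary// mulVmx ?unitarymx_unit// mul1mx.
by [].
Qed.

Lemma fnorm2_block m n (a : C) (w : 'rV[C]_n) (c : 'cV[C]_m) (D : 'M[C]_(m, n)) :
 fnorm2 (block_mx a%:M w c D : 'M[C]_(1 + m, 1 + n)) = nsq a + fnorm2 w + fnorm2 c + fnorm2 D.
Proof.
rewrite /fnorm2 big_split_ord big_ord1 big_split_ord big_ord1 block_mxEul mxE eqxx mulr1n.
transitivity (nsq a + fnorm2 w + (fnorm2 c + fnorm2 D)); last by rewrite !addrA.
apply: (f_equal2 (fun x y => x + y)); first apply: (f_equal2 (fun x y => x + y)) => //.
 by rewrite /fnorm2 big_ord1; apply: eq_bigr => j _; rewrite block_mxEur.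
rewrite /fnorm2 -big_split; apply: eq_bigr => i _; rewrite big_split_ord !big_ord1 block_mxEdl; congr (_ + _).
by apply: eq_bigr => j _; rewrite block_mxEdr.
Qed.

Lemma fnorm2_vec m n (M : 'M[C]_(m, n)) : fnorm2 (mxvec M)^T = fnorm2 M.
Proof.
rewrite /fnorm2 [RHS]pair_big /= (reindex _ (curry_mxvec_bij _ _)) /=.
by apply: eq_bigr => -[i j] _; rewrite big_ord1 mxE mxvecE.
Qed.

Lemma fnorm2_col m n (a : 'cV[C]_m) (b : 'cV[C]_n) : fnorm2 (col_mx a b) = fnorm2 a + fnorm2 b.
Proof.
rewrite /fnorm2 big_split_ord; congr (_ + _); apply: eq_bigr => i _; rewrite !big_ord1.
 by rewrite col_mxEu.
by rewrite col_mxEd.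
Qed.

Lemma fnorm2_trmx m n (M : 'M[C]_(m, n)) : fnorm2 M^T = fnorm2 M.
Proof. by rewrite /fnorm2 exchange_big; do 2!apply: eq_bigr => ? _; rewrite mxE. Qed.

Lemma fnorm20 m n : fnorm2 (0 : 'M[C]_(m, n)) = 0.
Proof. by rewrite /fnorm2 big1// => i _; rewrite big1// => j _; rewrite mxE nsq0. Qed.
End frobenius.

Section triangularize.
Variable R : realType.
Local Notation C := (R[i]).
Variable n : nat.

(** Gram-Schmidt on the rows of the adjoint of the shear: its first row is a multiple of the first
    row of [W], hence orthogonal to the others, which says that the first column of [W *m shearL u]
    vanishes below its top entry. *)
Lemma unitary_shear (u : 'cV[C]_n) : exists2 W : 'M[C]_(1 + n), W \is unitarymx & dlsubmx (W *m shearL u) = 0.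
Proof.
pose S := shearL u; pose A := S ^t*; exists (schmidt A); first exact: schmidt_unitarymx.
set W := schmidt A; have uW : W \is unitarymx by exact: schmidt_unitarymx.
have [x Hx] : exists x, row 0 A = x *: row 0 W.
 have := row_schmidt_sub A 0.
 rewrite (bigD1 0)//= big1 ?addsmx0; last by move=> k /andP[]; rewrite leqn0 -val_eqE /= => /eqP ->.
 by rewrite genmxE => /sub_rVP.
have E : row 0 A *m W ^t* = x *: delta_mx 0 0.
 by rewrite Hx -scalemxAl -row_mul (unitarymxP uW) row1.
apply/matrixP => i j; rewrite (ord1 j).
have E2 : (row 0 A *m W ^t*) 0 (rshift 1 i) = 0.
 by rewrite E !mxE andTb (_ : _ == _ = false) ?mulr0//; apply/negbTE; rewrite -val_eqE.
suff h : (((W *m S) (rshift 1 i) (lshift n 0))^*)%C = 0.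
 rewrite !mxE -[LHS](@conjcK R); rewrite mxE in h; rewrite h.
 exact: (raddf0 (@conjc R)).
rewrite -E2 !mxE (raddf_sum (@conjc R)); apply: eq_bigr => k _.
have -> : row 0 A 0 k * (W ^t*) k (rshift 1 i) = ((S k (lshift n 0))^*)%C * ((W (rshift 1 i) k)^*)%C.
 have z : (0 : 'I_(1 + n)) = lshift n 0 by apply/val_inj.
 by rewrite z !mxE.
by rewrite mulrC; exact: (rmorphM (@conjc R)).
Qed.

Lemma triangularize (u : 'cV[C]_n) : exists r q P r' q' P' (W : 'M[C]_(1 + n)),
 let Rm := block_mx (r : 'M[C]_1) q 0 P : 'M[C]_(1 + n) in let R' := block_mx (r' : 'M[C]_1) q' 0 P' : 'M[C]_(1 + n) in
 [/\ W \is unitarymx, W *m shearL u = Rm, shearL (- u) *m W ^t* = R', Rm *m R' = 1%:M & R' *m Rm = 1%:M].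
Proof.
have [W uW dl0] := unitary_shear u.
pose Rm := W *m shearL u; pose R' := shearL (- u) *m W ^t*.
have RR' : Rm *m R' = 1%:M.
 rewrite /Rm /R' mulmxA -[W *m _ *m _]mulmxA; have := shearLK (- u); rewrite opprK => ->.
 by rewrite mulmx1 (unitarymxP uW).
have R'R := mulmx1C RR'.
have RmE : Rm = block_mx (ulsubmx Rm) (ursubmx Rm) 0 (drsubmx Rm) by rewrite -{1}(submxK Rm) dl0.
have R'E : R' = block_mx (ulsubmx R') (ursubmx R') 0 (drsubmx R').
 rewrite -{1}(submxK R'); congr block_mx.
 have : R' *m Rm = block_mx 1%:M 0 0 1%:M by rewrite R'R -scalar_mx_block.
 rewrite RmE -{1}(submxK R') mulmx_block !mulmx0 !addr0 => /eq_block_mx [h1 _ h3 _].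
 have r1 : ulsubmx Rm \in unitmx by have [] := mulmx1_unit h1.
 by rewrite -[LHS]mulmx1 -(mulmxV r1) mulmxA h3 mul0mx.
have [r [q [P rE]]] : exists r q P, Rm = block_mx (r : 'M[C]_1) q 0 P by do 3!eexists; exact: RmE.
have [r' [q' [P' r'E]]] : exists r q P, R' = block_mx (r : 'M[C]_1) q 0 P by do 3!eexists; exact: R'E.
by exists r, q, P, r', q', P', W; cbv zeta; rewrite -rE -r'E.
Qed.
End triangularize.

Section deflate.
Variable R : realType.
Local Notation C := (R[i]).
Implicit Types F : {poly C} -> \bar R.

Definition mxof n (v : 'cV[C]_(n * n)) : 'M[C]_n := vec_mx v^T.
Definition ofmx n (M : 'M[C]_n) : 'cV[C]_(n * n) := (mxvec M)^T.
Lemma mxofK n : cancel (@mxof n) (@ofmx n).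
Proof. by move=> v; rewrite /ofmx /mxof vec_mxK trmxK. Qed.
Lemma ofmxK n : cancel (@ofmx n) (@mxof n).
Proof. by move=> v; rewrite /ofmx /mxof trmxK mxvecK. Qed.
Lemma mxof_lin n a u v : @mxof n (a *: u + v) = a *: mxof u + mxof v.
Proof. by rewrite /mxof !linearP. Qed.
Lemma ofmx_lin n a u v : @ofmx n (a *: u + v) = a *: ofmx u + ofmx v.
Proof. by rewrite /ofmx !linearP. Qed.
Definition mcmeas d (T : measurableType d) m n (M : T -> 'M[C]_(m, n)) := forall i j, cmeas (fun t => M t i j).

(** Measurability is tested along families of matrices, so that no sigma-algebra on polynomials has
    to be chosen. *)
Definition pmeas k F := forall d (T : measurableType d) (M : T -> 'M[C]_k),
 mcmeas M -> measT (fun t => F (char_poly (M t))).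

Section mc.
Context d (T : measurableType d).
Lemma mcmeas_fnorm m n (M : T -> 'M[C]_(m, n)) : mcmeas M -> measT (fun t => fnorm2 (M t)).
Proof.
move=> mM; apply: measurable_sum => i; apply: measurable_sum => j; exact: cmeas_nsq.
Qed.
Lemma mcmeas_mul m n p (A : T -> 'M[C]_(m, n)) (B : T -> 'M[C]_(n, p)) : mcmeas A -> mcmeas B -> mcmeas (fun t => A t *m B t).
Proof. by move=> mA mB i j; apply: cmeas_mulmx. Qed.
Lemma mcmeasD m n (A B : T -> 'M[C]_(m, n)) : mcmeas A -> mcmeas B -> mcmeas (fun t => A t + B t).
Proof. by move=> mA mB i j; apply: (cmeas_ext (cmeasD (mA i j) (mB i j))) => t; rewrite mxE. Qed.
Lemma mcmeasN m n (A : T -> 'M[C]_(m, n)) : mcmeas A -> mcmeas (fun t => - A t).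
Proof. by move=> mA i j; apply: (cmeas_ext (cmeasN (mA i j))) => t; rewrite mxE. Qed.
Lemma mcmeasZ m n (c : T -> C) (A : T -> 'M[C]_(m, n)) : cmeas c -> mcmeas A -> mcmeas (fun t => c t *: A t).
Proof. by move=> mc mA i j; apply: (cmeas_ext (cmeasM mc (mA i j))) => t; rewrite mxE. Qed.
Lemma mcmeas_cst m n (A : 'M[C]_(m, n)) : mcmeas (fun _ : T => A).
Proof. by move=> i j; exact: cmeas_cst. Qed.
Lemma mcmeas_tr m n (A : T -> 'M[C]_(m, n)) : mcmeas A -> mcmeas (fun t => (A t)^T).
Proof. by move=> mA i j; apply: (cmeas_ext (mA j i)) => t; rewrite mxE. Qed.
Lemma mcmeas_block m1 m2 n1 n2 (A : T -> 'M[C]_(m1, n1)) (B : T -> 'M[C]_(m1, n2)) (D : T -> 'M[C]_(m2, n1)) (E : T -> 'M[C]_(m2, n2)) :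
 mcmeas A -> mcmeas B -> mcmeas D -> mcmeas E -> mcmeas (fun t => block_mx (A t) (B t) (D t) (E t)).
Proof.
move=> mA mB mD mE i j; case: (split_ordP i) => k ->; case: (split_ordP j) => l ->.
- by apply: (cmeas_ext (mA k l)) => t; rewrite block_mxEul.
- by apply: (cmeas_ext (mB k l)) => t; rewrite block_mxEur.
- by apply: (cmeas_ext (mD k l)) => t; rewrite block_mxEdl.
- by apply: (cmeas_ext (mE k l)) => t; rewrite block_mxEdr.
Qed.
Lemma mcmeas_scal n (c : T -> C) : cmeas c -> mcmeas (fun t => (c t)%:M : 'M[C]_n).
Proof.
move=> mc i j; apply: (cmeas_ext (cmeasM mc (cmeas_cst (i == j)%:R))) => t; rewrite mxE.
by rewrite mulr_natr.
Qed.
Lemma mcmeas_mxof n (v : T -> 'cV[C]_(n * n)) : mcmeas v -> mcmeas (fun t => mxof (v t)).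
Proof. by move=> mv i j; apply: (cmeas_ext (mv (mxvec_index i j) 0)) => t; rewrite !mxE. Qed.
Lemma mcmeas_ofmx n (M : T -> 'M[C]_n) : mcmeas M -> mcmeas (fun t => ofmx (M t)).
Proof.
move=> mM i j; case/mxvec_indexP: i => k l.
by apply: (cmeas_ext (mM k l)) => t; rewrite (ord1 j) mxE mxvecE.
Qed.
Lemma mcmeas_u m n p (v : T -> 'M[C]_(m + n, p)) : mcmeas v -> mcmeas (fun t => usubmx (v t)).
Proof. by move=> mv i j; apply: (cmeas_ext (mv (lshift n i) j)) => t; rewrite !mxE. Qed.
Lemma mcmeas_d m n p (v : T -> 'M[C]_(m + n, p)) : mcmeas v -> mcmeas (fun t => dsubmx (v t)).
Proof. by move=> mv i j; apply: (cmeas_ext (mv (rshift m i) j)) => t; rewrite !mxE. Qed.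
Lemma mcmeas_col m n p (u : T -> 'M[C]_(m, p)) (v : T -> 'M[C]_(n, p)) : mcmeas u -> mcmeas v -> mcmeas (fun t => col_mx (u t) (v t)).
Proof.
move=> mu mv i j; case: (split_ordP i) => k ->.
 by apply: (cmeas_ext (mu k j)) => t; rewrite col_mxEu.
by apply: (cmeas_ext (mv k j)) => t; rewrite col_mxEd.
Qed.
Lemma cmeas_char n (M : T -> 'M[C]_n) l : mcmeas M -> cmeas l -> cmeas (fun t => (char_poly (M t)).[l t]).
Proof.
move=> mM ml; apply: (cmeas_ext (f := fun t => \det ((l t)%:M - M t))) => [|t]; last by rewrite horner_char_poly.
by apply: cmeas_det => i j; apply: mcmeasD; [exact: mcmeas_scal|exact: mcmeasN].
Qed.
Lemma meas_exp (f : T -> R) : measT f -> measT (fun t => (expR (- f t))%:E).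
Proof.
move=> mf; efin; apply: (meas_comp (@measurable_expR R)).
exact: measurableT_comp.
Qed.
End mc.

Lemma mcmeas_colof n : mcmeas (@colof R n).
Proof. by move=> i j; exact: cmeas_colof. Qed.
Lemma mcmeas_comp d1 d2 (T1 : measurableType d1) (T2 : measurableType d2) m n (f : T2 -> 'M[C]_(m, n)) (g : T1 -> T2) :
 mcmeas f -> measT g -> mcmeas (fun t => f (g t)).
Proof. by move=> mf mg i j; exact: (cmeas_comp (mf i j) mg). Qed.

Definition gauss n (v : 'cV[C]_n) : \bar R := (expR (- fnorm2 v))%:E.

Definition Imx n F : \bar R :=
 vint (fun v : 'cV[C]_(n * n) => F (char_poly (mxof v)) * gauss v)%E.

(** The fully separated integrand: an eigenvalue [l], an independent Gaussian matrix and row packed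
    in [y], and the interaction of [l] with the remaining eigenvalues. *)
Definition Theta n F (l : C) (y : 'cV[C]_(n * n + n)) : \bar R :=
 (F (('X - l%:P) * char_poly (mxof (usubmx y)))%R * (nsq (char_poly (mxof (usubmx y))).[l] * expR (- (nsq l + fnorm2 y)))%:E)%E.

Definition Xmx n F : \bar R := (\int[leb2]_l vint (fun y => Theta (n := n) F (tc l) y))%E.

(** The integrand in the variables [(l, D, w, u)]. The matrix in the exponent has eigenvector
    [(1, u)], and [M] is what remains of it after deflation. *)
Definition Psi n F (l : C) (y : 'cV[C]_(n * n + n)) (u : 'cV[C]_n) : \bar R :=
 let D := mxof (usubmx y) in let w := (dsubmx y)^T in let M := D - u *m w in
 (F (('X - l%:P) * char_poly M)%R * (nsq (char_poly M).[l] *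
   expR (- fnorm2 (blk (l - (w *m u) 0 0) w (l *: u - D *m u) D)))%:E)%E.

Lemma pmeas_lin n F : pmeas (1 + n) F -> forall d (T : measurableType d) (l : T -> C) (M : T -> 'M[C]_n),
 cmeas l -> mcmeas M -> measT (fun t => F (('X - (l t)%:P) * char_poly (M t))).
Proof.
move=> mF d T l M ml mM; apply: (meas_ext (f := fun t => F (char_poly (blk (l t) 0 0 (M t))))).
 apply: mF; apply: mcmeas_block => //; try exact: mcmeas_cst.
 exact: mcmeas_scal.
by move=> t; rewrite char_poly_blk0.
Qed.

Lemma meas_Theta n F : pmeas (1 + n) F -> forall d (T : measurableType d) (l : T -> C) y,
 cmeas l -> mcmeas y -> measT (fun t => Theta (n := n) F (l t) (y t)).
Proof.
move=> mF d T l y ml my; have mM : mcmeas (fun t => mxof (usubmx (y t))) by apply: mcmeas_mxof; exact: mcmeas_u.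
apply: emeasurable_funM; first exact: pmeas_lin.
efin; apply: measurable_funM; first by apply: cmeas_nsq; exact: cmeas_char.
apply: meas_expN => //; apply: measurable_funD.
 exact: cmeas_nsq.
exact: mcmeas_fnorm.
Qed.

Lemma meas_Psi n F : pmeas (1 + n) F -> forall d (T : measurableType d) (l : T -> C) y u,
 cmeas l -> mcmeas y -> mcmeas u -> measT (fun t => Psi (n := n) F (l t) (y t) (u t)).
Proof.
move=> mF d T l y u ml my mu; rewrite /Psi.
have mD : mcmeas (fun t => mxof (usubmx (y t))) by apply: mcmeas_mxof; exact: mcmeas_u.
have mw : mcmeas (fun t => (dsubmx (y t))^T) by apply: mcmeas_tr; exact: mcmeas_d.
have mM : mcmeas (fun t => mxof (usubmx (y t)) - u t *m (dsubmx (y t))^T).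
 by apply: mcmeasD => //; apply: mcmeasN; exact: mcmeas_mul.
apply: emeasurable_funM; first exact: (pmeas_lin mF).
efin; apply: measurable_funM; first by apply: cmeas_nsq; exact: cmeas_char.
apply: meas_expN => //.
apply: mcmeas_fnorm; apply: mcmeas_block => //.
 apply: mcmeas_scal; apply: cmeasD => //; apply: cmeasN; exact: mcmeas_mul.
by apply: mcmeasD; [exact: mcmeasZ|apply: mcmeasN; exact: mcmeas_mul].
Qed.

(** Conjugation by the unitary [W] preserves the Gaussian weight and makes the matrix block
    triangular, with blocks [l], a row, and a conjugate of [M]. At fixed [u] these blocks are
    obtained from [(D, w)] by a linear bijection and a translation depending on [l], hence a
    constant Jacobian. It depends on [u] but not on [F], the point on which the comparison
    relies. *)
Lemma int_Psi n (u : 'cV[C]_n) : exists2 k : R, 0 < k & forall F, pmeas (1 + n) F -> (forall p, 0 <= F p)%E ->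
 (\int[leb2]_l vint (fun y => Psi (n := n) F (tc l) y u) = k%:E * Xmx n F)%E.
Proof.
have [r [q [P [r' [q' [P' [W /= [uW RE R'E RR' R'R]]]]]]]] := triangularize u.
have [rr' rq' _ PP'] : [/\ r *m r' = 1%:M, r *m q' + q *m P' = 0, (0 : 'M[C]_(n, 1)) = 0 & P *m P' = 1%:M].
 by move: RR'; rewrite mulmx_block !mulmx0 !mul0mx !addr0 !add0r (scalar_mx_block 1 n) => /eq_block_mx.
have [r'r r'q _ P'P] : [/\ r' *m r = 1%:M, r' *m q + q' *m P = 0, (0 : 'M[C]_(n, 1)) = 0 & P' *m P = 1%:M].
 by move: R'R; rewrite mulmx_block !mulmx0 !mul0mx !addr0 !add0r (scalar_mx_block 1 n) => /eq_block_mx.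
pose dM (y : 'cV[C]_(n * n + n)) := mxof (usubmx y) - u *m (dsubmx y)^T.
(* The linear part of the block coordinates; the translation [b l] supplies the contribution of [l]
   to the upper right row. *)
pose f (y : 'cV[C]_(n * n + n)) : 'cV[C]_(n * n + n) :=
 col_mx (ofmx (P *m dM y *m P')) (((r *m (dsubmx y)^T + q *m dM y) *m P')^T).
pose gw (y : 'cV[C]_(n * n + n)) := (r' *m (dsubmx y)^T + q' *m mxof (usubmx y)) *m P.
pose g (y : 'cV[C]_(n * n + n)) : 'cV[C]_(n * n + n) :=
 col_mx (ofmx (P' *m mxof (usubmx y) *m P + u *m gw y)) (gw y)^T.
pose b (l : C) : 'cV[C]_(n * n + n) := col_mx 0 ((l *: (r *m q'))^T).
have lin_f a x v : f (a *: x + v) = a *: f x + f v.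
 have dML : dM (a *: x + v) = a *: dM x + dM v.
  rewrite /dM; have -> : dsubmx (a *: x + v) = a *: dsubmx x + dsubmx v by exact: linearP.
  have -> : usubmx (a *: x + v) = a *: usubmx x + usubmx v by exact: linearP.
  have -> : (a *: dsubmx x + dsubmx v)^T = a *: (dsubmx x)^T + (dsubmx v)^T by exact: linearP.
  by rewrite mxof_lin mulmxDr -scalemxAr opprD addrACA -scalerBr.
 rewrite /f scale_col_mx add_col_mx dML -ofmx_lin !linearP /=; congr (col_mx (ofmx _) _).
  by rewrite mulmxDl -scalemxAl.
 rewrite addrACA -scalerDr; move: (r *m _ + q *m dM x) (r *m _ + q *m dM v) => X Y.
 by rewrite mulmxDl -scalemxAl linearP.
have fK : cancel f g.
 move=> y; have gwf : gw (f y) = (dsubmx y)^T.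
  rewrite /gw /f col_mxKu col_mxKd trmxK ofmxK !mulmxA -mulmxDl -mulmxA P'P mulmx1.
  by rewrite mulmxDr !mulmxA r'r mul1mx -addrA -mulmxDl r'q mul0mx addr0.
 rewrite /g gwf /f col_mxKu ofmxK !mulmxA P'P mul1mx -mulmxA P'P mulmx1 trmxK.
 by rewrite /dM subrK mxofK vsubmxK.
have gK : cancel g f.
 move=> y; have Mg : dM (g y) = P' *m mxof (usubmx y) *m P.
  by rewrite /dM /g col_mxKu col_mxKd trmxK ofmxK addrK.
 rewrite /f Mg /g col_mxKd trmxK -[RHS]vsubmxK; congr col_mx.
  by rewrite !mulmxA PP' mul1mx -mulmxA PP' mulmx1 mxofK.
 rewrite /gw !mulmxA -mulmxDl -mulmxA PP' mulmx1 mulmxDr !mulmxA rr' mul1mx -addrA -mulmxDl rq'.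
 by rewrite mul0mx addr0 trmxK.
have [k k0 Hk] := vint_lin lin_f fK gK.
exists k => // F mF F0.
have mTh l : vmeas (Theta (n := n) F l) by apply: (@meas_Theta _ _ mF _ _ (fun=> l) (@colof R _)); [exact: cmeas_cst|exact: mcmeas_colof].
have Th0 l y : (0 <= Theta (n := n) F l y)%E by rewrite mule_ge0// lee_fin mulr_ge0 ?nsq_ge0 ?expR_ge0.
rewrite -ge0_integralZl//; last 3 first.
- apply: meas_vint => //; apply: (meas_Theta mF); first exact: (cmeas_comp (@cmeas_tc R) mfst).
 exact: (mcmeas_comp (@mcmeas_colof _) msnd).
- by move=> l _; exact: vint_ge0.
- by rewrite lee_fin ltW.
apply: eq_integral => l' _; rewrite -(Hk (b (tc l')) _ (mTh (tc l')) (Th0 (tc l'))).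
apply: eq_vint => y; set l := tc l'; set w := (dsubmx y)^T; set D := mxof (usubmx y); set M := D - u *m w.
have sM : mxof (usubmx (f y + b l)) = P *m M *m P'.
 by rewrite /f /b add_col_mx col_mxKu addr0 ofmxK.
have cM : char_poly (P *m M *m P') = char_poly M by exact: char_poly_sim.
rewrite /Psi /Theta -/D -/w -/M sM cM; congr (_ * (_ * expR (- _))%:E)%E.
rewrite blk_shear -(fnorm2_unitary _ uW) -/M.
have -> : W *m (shearL u *m blk l w 0 M *m shearL (- u)) *m W ^t* =
  blk l ((l *: (r *m q')) + (r *m w + q *m M) *m P') 0 (P *m M *m P').
 rewrite !mulmxA RE -mulmxA R'E mulmx_block !mulmx0 !mul0mx !addr0 !add0r mulmx_block !mulmx0 !mul0mx !addr0 !add0r.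
 rewrite /blk; congr block_mx.
  by rewrite mul_mx_scalar -scalemxAl rr' scalemx1.
 by rewrite mul_mx_scalar -scalemxAl.
rewrite fnorm2_block fnorm20 addr0 -addrA; congr (_ + _).
rewrite /f /b add_col_mx fnorm2_col addr0 fnorm2_vec addrC; congr (_ + _).
by rewrite -linearD fnorm2_trmx addrC.
Qed.

Lemma mcmeas_adj d (T : measurableType d) n (M : T -> 'M[C]_n) : mcmeas M -> mcmeas (fun t => \adj (M t)).
Proof.
move=> mM i j; apply: (cmeas_ext (f := fun t => (-1) ^+ (j + i) * \det (row' j (col' i (M t))))); last by move=> t; rewrite mxE.
apply: cmeasM; first exact: cmeas_cst.
by apply: cmeas_det => k l; apply: (cmeas_ext (mM (lift j k) (lift i l))) => t; rewrite !mxE.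
Qed.

Definition Gmx n F (y : 'cV[C]_(n * n + n)) (c : 'cV[C]_n) (a : C) : \bar R :=
 let B := blk a (dsubmx y)^T c (mxof (usubmx y)) in (F (char_poly B) * (expR (- fnorm2 B))%:E)%E.

Lemma meas_Gmx n F : pmeas (1 + n) F -> forall d (T : measurableType d) y c (a : T -> C),
 mcmeas y -> mcmeas c -> cmeas a -> measT (fun t => Gmx (n := n) F (y t) (c t) (a t)).
Proof.
move=> mF d T y c a my mc ma; rewrite /Gmx.
have mB : mcmeas (fun t => blk (a t) (dsubmx (y t))^T (c t) (mxof (usubmx (y t)))).
 apply: mcmeas_block => //; first exact: mcmeas_scal.
  by apply: mcmeas_tr; exact: mcmeas_d.
 by apply: mcmeas_mxof; exact: mcmeas_u.
by apply: emeasurable_funM; [exact: mF|apply: meas_exp; exact: mcmeas_fnorm].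
Qed.

Lemma Gmx_ge0 n F y c a : (forall p, 0 <= F p)%E -> (0 <= Gmx (n := n) F y c a)%E.
Proof. by move=> F0; rewrite mule_ge0// lee_fin expR_ge0. Qed.

Lemma Imx_blocks n : exists2 k : R, 0 < k & forall F, pmeas (1 + n) F -> (forall p, 0 <= F p)%E ->
 (k%:E * Imx (1 + n) F = vint (fun y => vint (fun c => \int[leb2]_a Gmx (n := n) F y c (tc a))))%E.
Proof.
pose f (v : 'cV[C]_(1 + (n * n + n + n))) : 'cV[C]_((1 + n) * (1 + n)) :=
 let x := dsubmx v in let y := usubmx x in ofmx (blk (usubmx v 0 0) (dsubmx y)^T (dsubmx x) (mxof (usubmx y))).
pose g (v : 'cV[C]_((1 + n) * (1 + n))) : 'cV[C]_(1 + (n * n + n + n)) :=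
 let B := mxof v : 'M[C]_(1 + n) in col_mx (ulsubmx B) (col_mx (col_mx (ofmx (drsubmx B)) (ursubmx B)^T) (dlsubmx B)).
have lin_f a x v : f (a *: x + v) = a *: f x + f v.
 rewrite /f -ofmx_lin; congr ofmx; rewrite /blk scale_block_mx add_block_mx !linearP /= mxof_lin.
 by congr block_mx; mx_ext; case: (i == j); rewrite ?mulr1n ?mulr0n ?mulr0 ?addr0.
have fK : cancel f g.
 move=> v; rewrite /f /g ofmxK /blk block_mxKul block_mxKur block_mxKdl block_mxKdr trmxK mxofK !vsubmxK.
 by rewrite -[RHS]vsubmxK; congr col_mx; apply/matrixP => i j; rewrite !ord1 !mxE eqxx mulr1n.
have gK : cancel g f.
 move=> v; rewrite /f /g !col_mxKd !col_mxKu col_mxKd trmxK ofmxK -[RHS]mxofK -[mxof v in RHS]submxK.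
 by congr (ofmx (block_mx _ _ _ _)); apply/matrixP => i j; rewrite !ord1 !mxE eqxx mulr1n.
have [k k0 Hk] := vint_lin lin_f fK gK.
exists k => // F mF F0.
have mI : vmeas (fun v : 'cV[C]_((1 + n) * (1 + n)) => (F (char_poly (mxof v)) * gauss v)%E).
 apply: emeasurable_funM; first by apply: mF; apply: mcmeas_mxof; exact: mcmeas_colof.
 by apply: meas_exp; apply: mcmeas_fnorm; exact: mcmeas_colof.
rewrite -(Hk 0 _ mI); last by move=> v; rewrite mule_ge0// lee_fin expR_ge0.
have G0 v : (0 <= (fun v => F (char_poly (mxof v)) * gauss v) (f v + 0)%R)%E by rewrite mule_ge0// lee_fin expR_ge0.
rewrite vintS (@vint_swap _ _ _ _ leb2 (fun z v => (fun v => F (char_poly (mxof v)) * gauss v)%E (f (col_mx (tc z)%:M v) + 0)%R)) //; last first.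
 apply: (vmeas_comp mI) => i.
 apply: (mcmeasD (A := fun p : (R * R) * cfg R 'I_(n * n + n + n) => f (col_mx (tc p.1)%:M (colof p.2)))); last exact: mcmeas_cst.
 have mv : mcmeas (fun p : (R * R) * cfg R 'I_(n * n + n + n) => col_mx ((tc p.1)%:M : 'M[C]_1) (colof p.2)).
  apply: mcmeas_col; last exact: (mcmeas_comp (@mcmeas_colof _) msnd).
  by apply: mcmeas_scal; exact: (cmeas_comp (@cmeas_tc R) mfst).
 apply: mcmeas_ofmx; apply: mcmeas_block.
 - by apply: mcmeas_scal; exact: (mcmeas_u mv).
 - by apply: mcmeas_tr; apply: mcmeas_d; apply: mcmeas_u; exact: (mcmeas_d mv).
 - by apply: mcmeas_d; exact: (mcmeas_d mv).
 - by apply: mcmeas_mxof; apply: mcmeas_u; apply: mcmeas_u; exact: (mcmeas_d mv).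
rewrite vint_cat; apply: eq_vint => y; apply: eq_vint => c; apply: eq_integral => a _.
rewrite addr0 /f !(col_mxKd, col_mxKu) ofmxK /gauss fnorm2_vec /Gmx.
by rewrite mxE eqxx mulr1n.
Qed.

(** Numerator and denominator of the rational map are coprime off the zero set of [bord_res], which
    is negligible by [vint_ae]. For [n = 0] the denominator is 1. *)
Lemma vint_ae_coprime n (H1 H2 : 'cV[C]_(n * n + n) -> 'cV[C]_n -> \bar R) :
 (forall d (T : measurableType d) y c, mcmeas y -> mcmeas c -> measT (fun t : T => H1 (y t) (c t))) ->
 (forall d (T : measurableType d) y c, mcmeas y -> mcmeas c -> measT (fun t : T => H2 (y t) (c t))) ->
 (forall y c, 0 <= H1 y c)%E -> (forall y c, 0 <= H2 y c)%E ->
 (forall y c, let D := mxof (usubmx y) in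
  coprimep ('X * char_poly D - bord_f (dsubmx y)^T c D) (char_poly D) -> H1 y c = H2 y c) ->
 vint (fun y => vint (H1 y)) = vint (fun y => vint (H2 y)).
Proof.
case: n H1 H2 => [|n] H1 H2 m1 m2 H10 H20 H12.
 apply: eq_vint => y; apply: eq_vint => c; apply: H12.
 by rewrite /char_poly det_mx00 coprimep1.
pose H H' (v : 'cV[C]_(n.+1 * n.+1 + n.+1 + n.+1)) : \bar R := H' (usubmx v) (dsubmx v).
have HE H' : vint (fun y => vint (H' y)) = vint (H H').
 by rewrite [RHS]vint_cat; apply: eq_vint => y; apply: eq_vint => c; rewrite /H col_mxKu col_mxKd.
rewrite !HE.
pose G (v : 'cV[C]_(n.+1 * n.+1 + n.+1 + n.+1)) := bord_res (dsubmx (usubmx v))^T (dsubmx v) (mxof (usubmx (usubmx v))).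
have [w0 [c0 [D0 nz]]] := bord_res_nz R n.
apply: (@vint_ae _ _ G (col_mx (col_mx (ofmx D0) w0^T) c0)).
- by rewrite /G col_mxKu col_mxKd col_mxKd col_mxKu trmxK ofmxK.
- move=> v.
 have [p Hp] := bord_res_poly w0 (dsubmx (usubmx v))^T c0 (dsubmx v) D0 (mxof (usubmx (usubmx v))).
 exists p => t; rewrite -Hp /G.
 set v0 := col_mx (col_mx (ofmx D0) w0^T) c0.
 have e1 : usubmx (t *: v + v0) = t *: usubmx v + usubmx v0 by exact: linearP.
 have e2 : dsubmx (t *: v + v0) = t *: dsubmx v + dsubmx v0 by exact: linearP.
 have e3 : dsubmx (t *: usubmx v + usubmx v0) = t *: dsubmx (usubmx v) + dsubmx (usubmx v0) by exact: linearP.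
 have e4 : usubmx (t *: usubmx v + usubmx v0) = t *: usubmx (usubmx v) + usubmx (usubmx v0) by exact: linearP.
 have e5 : (t *: dsubmx (usubmx v) + dsubmx (usubmx v0))^T = t *: (dsubmx (usubmx v))^T + (dsubmx (usubmx v0))^T by exact: linearP.
 by rewrite e1 e2 e3 e4 e5 mxof_lin /v0 !(col_mxKu, col_mxKd) trmxK ofmxK.
- by apply: m1; [apply: mcmeas_u|apply: mcmeas_d]; exact: mcmeas_colof.
- by apply: m2; [apply: mcmeas_u|apply: mcmeas_d]; exact: mcmeas_colof.
- by move=> v; exact: H10.
- by move=> v; exact: H20.
- by move=> v Gv; apply: H12; exact: bord_res_coprime.
Qed.

Lemma mulf_sq (K : fieldType) (q m : K) : q != 0 -> q * m / q ^+ 2 = m / q.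
Proof. by move=> q0; field. Qed.
Lemma mulf_cancel (K : fieldType) (q m e : K) : q != 0 -> e * (m * q^-1 * q) = m * e.
Proof. by move=> q0; field. Qed.

(** The Jacobians combine as follows: [a = P(l) / Q(l)] contributes the squared modulus of
    [chi(l) / Q(l)], with [chi] the characteristic polynomial of [D - u w]; [c = (l - D) u]
    contributes that of [Q(l)]; there remains the factor [|chi(l)|^2] of [Psi]. *)
Lemma Imx_deflate n : exists2 K : R, 0 < K & forall F, pmeas (1 + n) F -> (forall p, 0 <= F p)%E ->
 (K%:E * Imx (1 + n) F = vint (fun u => \int[leb2]_l vint (fun y => Psi (n := n) F (tc l) y u)))%E.
Proof.
have [k k0 Hk] := Imx_blocks n.
have n1 : 0 < n.+1%:R :> R by rewrite ltr0n.
exists (n.+1%:R * k); first by rewrite mulr_gt0.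
move=> F mF F0; rewrite EFinM -muleA Hk//.
pose P (y : 'cV[C]_(n * n + n)) c := 'X * char_poly (mxof (usubmx y)) - bord_f (dsubmx y)^T c (mxof (usubmx y)).
pose Q (y : 'cV[C]_(n * n + n)) := char_poly (mxof (usubmx y)).
have sP y c : size (P y c) = n.+2 /\ P y c \is monic.
 have := char_poly_blk 0 (dsubmx y)^T c (mxof (usubmx y)); rewrite scale0r subr0 => PE.
 by rewrite /P -PE size_char_poly char_poly_monic.
have G0 y c a : (0 <= Gmx F y c a)%E by exact: Gmx_ge0.
pose H1 y c : \bar R := (n.+1%:R%:E * \int[leb2]_a Gmx (n := n) F y c (tc a))%E.
pose h2 y c l : \bar R := (Gmx (n := n) F y c (rphi (P y c) (Q y) l) * (nsq (rdphi (P y c) (Q y) l))%:E)%E.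
pose H2 y c : \bar R := (\int[leb2]_l h2 y c (tc l))%E.
have h20 y c l : (0 <= h2 y c l)%E by rewrite mule_ge0// lee_fin nsq_ge0.
have mhh d (T : measurableType d) y c (l : T -> C) : mcmeas y -> mcmeas c -> cmeas l ->
  measT (fun t => h2 (y t) (c t) (l t)).
 move=> my mc ml; have mD : mcmeas (fun t => mxof (usubmx (y t))) by apply: mcmeas_mxof; exact: mcmeas_u.
 have mw : mcmeas (fun t => (dsubmx (y t))^T) by apply: mcmeas_tr; exact: mcmeas_d.
 have mQ : cmeas (fun t => (Q (y t)).[l t]) by exact: cmeas_char.
 have mP0 : cmeas (fun t => (P (y t) (c t)).[l t]).
  apply: (cmeas_ext (cmeas_char (M := fun t => blk 0 (dsubmx (y t))^T (c t) (mxof (usubmx (y t)))) _ ml)).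
   by apply: mcmeas_block => //; exact: mcmeas_cst.
  by move=> t; rewrite char_poly_blk scale0r subr0.
 apply: emeasurable_funM.
  by apply: meas_Gmx => //; apply: cmeasM => //; exact: cmeasV.
 efin; apply: cmeas_nsq; apply: cmeasM; last by apply: cmeasV; exact: cmeasX.
 have ma : mcmeas (fun t => \adj ((l t)%:M - mxof (usubmx (y t)))).
  by apply: mcmeas_adj; apply: mcmeasD; [exact: mcmeas_scal|exact: mcmeasN].
 apply: (cmeas_ext (f := fun t => (Q (y t)).[l t] ^+ 2 + ((dsubmx (y t))^T *m (\adj ((l t)%:M - mxof (usubmx (y t))) *m \adj ((l t)%:M - mxof (usubmx (y t)))) *m c t) 0 0)).
  apply: cmeasD; first exact: cmeasX.
  by apply: mcmeas_mul => //; apply: mcmeas_mul => //; exact: mcmeas_mul.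
 by move=> t; apply/esym; exact: wronskian_bord.
have tc1 d1 d2 (T1 : measurableType d1) (T2 : measurableType d2) m p (v : T1 -> 'M[C]_(m, p)) : mcmeas v ->
 mcmeas (fun q : T1 * T2 => v q.1) by move=> mv; exact: (mcmeas_comp mv mfst).
have tc2 d1 (T1 : measurableType d1) : cmeas (fun q : T1 * (R * R) => tc q.2).
 exact: (cmeas_comp (@cmeas_tc R) msnd).
have mH1 d (T : measurableType d) y c : mcmeas y -> mcmeas c -> measT (fun t : T => H1 (y t) (c t)).
 move=> my mc; apply: emeasurable_funM; first exact: measurable_cst.
 apply: (@meas_int_curry _ _ _ _ _ leb2 (fun t a => Gmx F (y t) (c t) (tc a))) => //.
 by apply: (meas_Gmx mF); [exact: tc1|exact: tc1|exact: tc2].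
have mH2 d (T : measurableType d) y c : mcmeas y -> mcmeas c -> measT (fun t : T => H2 (y t) (c t)).
 move=> my mc; apply: (@meas_int_curry _ _ _ _ _ leb2 (fun t l => h2 (y t) (c t) (tc l))) => //.
 by apply: mhh; [exact: tc1|exact: tc1|exact: tc2].
have n1' : (0 <= n.+1%:R%:E :> \bar R)%E by rewrite lee_fin ltW.
have sn d1 (T1 : measurableType d1) p : mcmeas (fun q : T1 * cfg R 'I_p => colof q.2).
 exact: (mcmeas_comp (@mcmeas_colof _) msnd).
transitivity (vint (fun y => vint (fun c => H1 y c))).
 have I0 y c : (0 <= \int[leb2]_a Gmx (n := n) F y c (tc a))%E by exact: integral_ge0.
 have mI d (T : measurableType d) y c : mcmeas y -> mcmeas c ->
   measT (fun t : T => \int[leb2]_a Gmx (n := n) F (y t) (c t) (tc a))%E.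
  move=> my mc; apply: (@meas_int_curry _ _ _ _ _ leb2 (fun t a => Gmx F (y t) (c t) (tc a))) => //.
  by apply: (meas_Gmx mF); [exact: tc1|exact: tc1|exact: tc2].
 rewrite -vint_scale//; last 2 first.
 - apply: (meas_vint (G := fun y c => \int[leb2]_a Gmx (n := n) F (colof y) c (tc a))%E) => //.
  by apply: mI; [apply: tc1; exact: mcmeas_colof|exact: sn].
 - by move=> v; exact: vint_ge0.
 apply: eq_vint => y; rewrite -vint_scale//.
 by apply: mI; [exact: mcmeas_cst|exact: mcmeas_colof].
(* The degree formula in the corner entry, at fixed [(D, w, c)]. The factor [n + 1] in [H1] is the
   degree of the map. *)
transitivity (vint (fun y => vint (fun c => H2 y c))).
 apply: vint_ae_coprime => //.
 - by move=> y c; rewrite mule_ge0//; exact: integral_ge0.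
 - by move=> y c; exact: integral_ge0.
 move=> y c D cop; rewrite /H1 /H2 /h2.
 have [s1 s2] := sP y c.
 rewrite -(@degree_formula R (P y c) (Q y) n.+1 isT s2 s1 _ cop (fun a => Gmx F y c (tc a))).
 - by apply: eq_integral => l _; rewrite ctK.
 - by rewrite size_char_poly.
 - by apply: (meas_Gmx mF); [exact: mcmeas_cst|exact: mcmeas_cst|exact: cmeas_tc].
 - by [].
have Psi0 l y u : (0 <= Psi (n := n) F l y u)%E by rewrite mule_ge0// lee_fin mulr_ge0 ?nsq_ge0 ?expR_ge0.
(* At fixed [(D, w)] and [l] off the finite spectrum of [D], [c] is replaced by [u]. *)
transitivity (vint (fun y => \int[leb2]_l vint (fun u => Psi (n := n) F (tc l) y u)))%E.
 apply: eq_vint => y.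
 transitivity (\int[leb2]_l vint (fun c => h2 y c (tc l)))%E.
  rewrite (@vint_swap _ _ _ _ leb2 (fun l c => h2 y c (tc l)))//.
  by apply: mhh; [exact: mcmeas_cst|exact: sn|exact: (cmeas_comp (@cmeas_tc R) mfst)].
 set D := mxof (usubmx y); set w := (dsubmx y)^T.
 have [s Es] := closed_field_poly_normal (Q y).
 have Qm : Q y \is monic by exact: char_poly_monic.
 rewrite (monicP Qm) scale1r in Es.
 apply: (@int_fin R [seq ct t | t <- s]).
 - apply: meas_vint => //.
  by apply: mhh; [exact: mcmeas_cst|exact: sn|exact: (cmeas_comp (@cmeas_tc R) mfst)].
 - apply: meas_vint => //.
  by apply: (meas_Psi mF); [exact: (cmeas_comp (@cmeas_tc R) mfst)|exact: mcmeas_cst|exact: sn].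
 - by move=> l; exact: vint_ge0.
 - by move=> l; exact: vint_ge0.
 move=> l' ls; set l := tc l'.
 have Ql : (Q y).[l] != 0.
  apply: contra ls => rl; rewrite -(tcK l'); apply: map_f.
  by rewrite -root_prod_XsubC -Es.
 have dQ : \det (l%:M - D) = (Q y).[l] by rewrite -horner_char_poly.
 have dl : \det (l%:M - D) != 0 by rewrite dQ.
 have mh : vmeas (fun c => h2 y c l) by apply: mhh; [exact: mcmeas_cst|exact: mcmeas_colof|exact: cmeas_cst].
 have mh' : vmeas (fun c => h2 y ((l%:M - D) *m c + 0) l) by exact: (vmeas_affine (l%:M - D) 0 mh).
 rewrite -(LIN_unit dl 0 mh (fun c => h20 y c l)) -vint_scale//; last by rewrite lee_fin nsq_ge0.
 apply: eq_vint => u; rewrite addr0.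
 have cE : (l%:M - D) *m u = l *: u - D *m u by rewrite mulmxBl mul_scalar_mx.
 set M := D - u *m w.
 have fE : (bord_f w ((l%:M - D) *m u) D).[l] = (Q y).[l] * (w *m u) 0 0.
  by rewrite bord_f_horner -mulmxA (mulmxA (\adj _)) mul_adj_mx mul_scalar_mx -scalemxAr mxE dQ.
 have phiE : rphi (P y ((l%:M - D) *m u)) (Q y) l = l - (w *m u) 0 0.
  by rewrite /rphi /P -/D -/w hornerD hornerN hornerM hornerX fE -/(Q y); field.
 have rE : rdphi (P y ((l%:M - D) *m u)) (Q y) l = (char_poly M).[l] / (Q y).[l].
  by rewrite /rdphi /rW /P -/D -/w cE rW_blk -/(Q y) -/M; exact: mulf_sq.
 rewrite /h2 phiE rE cE /Gmx -/D -/w dQ /Psi -/D -/w -/M.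
 have -> : char_poly (blk (l - (w *m u) 0 0) w (l *: u - D *m u) D) = ('X - l%:P) * char_poly M.
  by rewrite blk_shear char_poly_sim ?shearLK// char_poly_blk0.
 rewrite muleC -!muleA -!EFinM; congr (_ * _%:E)%E.
 rewrite nsqM nsqV; have : nsq (Q y).[l] != 0 by rewrite nsq_eq0.
 by move=> q0; exact: mulf_cancel.
have mPsi d (T : measurableType d) (l : T -> C) y u : cmeas l -> mcmeas y -> mcmeas u ->
 measT (fun t => Psi (n := n) F (l t) (y t) (u t)) by exact: (meas_Psi mF).
transitivity (vint (fun y => vint (fun u => \int[leb2]_l Psi (n := n) F (tc l) y u)))%E.
 apply: eq_vint => y; apply: (@vint_swap _ _ _ _ leb2 (fun l u => Psi F (tc l) y u)) => //.
 by apply: mPsi; [exact: (cmeas_comp (@cmeas_tc R) mfst)|exact: mcmeas_cst|exact: sn].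
rewrite (@vint_vswap _ _ _ (fun y u => \int[leb2]_l Psi (n := n) F (tc l) y u)%E); last 2 first.
- apply: (@meas_int_curry _ _ _ _ _ leb2 (fun p l => Psi F (tc l) (colof p.1) (colof p.2))) => //.
 apply: mPsi; first exact: tc2.
  apply: (tc1 _ _ _ _ _ _ (fun q => colof q.1)); exact: (mcmeas_comp (@mcmeas_colof _) mfst).
 by apply: (tc1 _ _ _ _ _ _ (fun q => colof q.2)); exact: sn.
- by move=> *; exact: integral_ge0.
apply: eq_vint => u; rewrite (@vint_swap _ _ _ _ leb2 (fun l y => Psi F (tc l) y u))//.
by apply: mPsi; [exact: (cmeas_comp (@cmeas_tc R) mfst)|exact: sn|exact: mcmeas_cst].
Qed.

(** Both sides, multiplied by [K], are the integral over [u] of [k u] times [Xmx n F * Xmx n F'].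
    The crosswise form makes it unnecessary to know whether [k] has a finite integral. *)
Lemma Imx_Xmx n F F' : pmeas (1 + n) F -> pmeas (1 + n) F' ->
 (forall p, 0 <= F p)%E -> (forall p, 0 <= F' p)%E ->
 (Imx (1 + n) F * Xmx n F' = Imx (1 + n) F' * Xmx n F)%E.
Proof.
move=> mF mF' F0 F0'; have [K K0 HK] := Imx_deflate n.
pose k u := sval (cid2 (@int_Psi n u)).
have kE F1 u : pmeas (1 + n) F1 -> (forall p, 0 <= F1 p)%E ->
  (\int[leb2]_l vint (fun y => Psi (n := n) F1 (tc l) y u) = (k u)%:E * Xmx n F1)%E.
 by move=> m1 F10; rewrite /k; case: cid2 => /= k' _; apply.
have k0 u : (0 <= k u)%R by rewrite /k; case: cid2 => /= k' /ltW.
have Psi0 F1 l y u : (forall p, 0 <= F1 p)%E -> (0 <= Psi (n := n) F1 l y u)%E.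
 by move=> F10; rewrite mule_ge0// lee_fin mulr_ge0 ?nsq_ge0 ?expR_ge0.
have X0 F1 : (forall p, 0 <= F1 p)%E -> (0 <= Xmx n F1)%E.
 move=> F10; apply: integral_ge0 => l _; apply: vint_ge0 => y.
 by rewrite mule_ge0// lee_fin mulr_ge0 ?nsq_ge0 ?expR_ge0.
have mk F1 : pmeas (1 + n) F1 -> (forall p, 0 <= F1 p)%E -> vmeas (fun u => (k u)%:E * Xmx n F1)%E.
 move=> m1 F10; apply: (meas_ext (f := fun t => \int[leb2]_l vint (fun y => Psi (n := n) F1 (tc l) y (colof t)))%E); last first.
  by move=> t; rewrite kE.
 apply: (@meas_int_curry _ _ _ _ _ leb2 (fun t l => vint (fun y => Psi (n := n) F1 (tc l) y (colof t)))); last first.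
  by move=> t l; apply: vint_ge0 => y; exact: Psi0.
 apply: meas_vint; last by move=> *; exact: Psi0.
 apply: (meas_Psi m1).
 - exact: (cmeas_comp (cmeas_comp (@cmeas_tc R) msnd) mfst).
 - exact: (mcmeas_comp (@mcmeas_colof _) msnd).
 - exact: (mcmeas_comp (mcmeas_comp (@mcmeas_colof _) mfst) mfst).
have IE F1 F2 : pmeas (1 + n) F1 -> (forall p, 0 <= F1 p)%E -> (forall p, 0 <= F2 p)%E ->
  (K%:E * (Imx (1 + n) F1 * Xmx n F2) = vint (fun u => (k u)%:E * (Xmx n F1 * Xmx n F2)))%E.
 move=> m1 F10 F20; rewrite muleA HK// (eq_vint (fun u => kE F1 u m1 F10)) muleC.
 rewrite -vint_scale//; [|exact: X0|exact: mk|by move=> u; rewrite mule_ge0 ?lee_fin ?X0].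
 by apply: eq_vint => u; rewrite muleCA; congr (_ * _)%E; exact: muleC.
have : (K%:E * (Imx (1 + n) F * Xmx n F') = K%:E * (Imx (1 + n) F' * Xmx n F))%E.
 by rewrite !IE//; apply: eq_vint => u; congr (_ * _)%E; rewrite muleC.
have Kx (x : \bar R) : (K^-1%:E * (K%:E * x) = x)%E by rewrite muleA -EFinM mulVf ?gt_eqF// mul1e.
by move=> h; rewrite -[LHS]Kx h Kx.
Qed.
End deflate.

(** * The partition function and its ratio to the unconstrained one *)

Section zpart.
Variable R : realType.
Local Notation C := (R[i]).

(* s lists the points already integrated; the inner k integrals run over the complement of U. *)
Fixpoint Zp (beta : R) (U : set (R * R)) (k : nat) (s : seq (R * R)) : \bar R :=
 if k is k'.+1 then
  (\int[leb2]_z ((\1_(~` U) z * expR (- (beta * sqnorm z)) * \prod_(w <- s) sqnorm (z - w))%:E * Zp beta U k' (z :: s)))%E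
 else 1%E.

(** Measurable families of lists of one fixed length, the shape in which the list argument of [Zp]
    occurs under integrals. *)
Inductive mseq d (T : measurableType d) : (T -> seq (R * R)) -> Prop :=
| mseq0 : mseq (fun=> [::])
| mseqS (f : T -> R * R) s : measT f -> mseq s -> mseq (fun t => f t :: s t).

Lemma mseq_comp d1 d2 (T1 : measurableType d1) (T2 : measurableType d2) (s : T2 -> seq (R * R)) (g : T1 -> T2) :
 mseq s -> measT g -> mseq (fun t => s (g t)).
Proof.
move=> ms mg; elim: ms => [|f s' mf _ IH]; first exact: mseq0.
by apply: (mseqS (f := fun t => f (g t))) => //; exact: (meas_comp mf mg).
Qed.

Lemma mseq_cst d (T : measurableType d) s : mseq (fun _ : T => s).
Proof. by elim: s => [|x s IH]; [exact: mseq0|apply: (mseqS (f := fun=> x)) => //]. Qed.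

Lemma sqnorm_ge0 (z : R * R) : 0 <= sqnorm z. Proof. by rewrite addr_ge0 ?sqr_ge0. Qed.
Lemma nsq_tc z : nsq (tc z) = sqnorm z :> R. Proof. by rewrite /nsq tcK. Qed.

Lemma meas_sqnorm d (T : measurableType d) (f : T -> R * R) : measT f -> measT (fun t => sqnorm (f t)).
Proof.
move=> mf; apply: (meas_ext (f := fun t => nsq (tc (f t)))); last by move=> t; rewrite nsq_tc.
by apply: cmeas_nsq; exact: (cmeas_comp (@cmeas_tc R) mf).
Qed.

Lemma sqnorm_sub (z w : R * R) : sqnorm (z - w) = nsq (tc z - tc w).
Proof. by rewrite -tcB nsq_tc. Qed.

Lemma meas_prod_sq d (T : measurableType d) (f : T -> R * R) s : measT f -> mseq s ->
 measT (fun t => \prod_(w <- s t) sqnorm (f t - w)).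
Proof.
move=> mf; elim => [|g s' mg _ IH]; first by apply: (meas_ext (f := fun _ : T => 1 : R)) => // t; rewrite big_nil.
apply: (meas_ext (f := fun t => sqnorm (f t - g t) * \prod_(w <- s' t) sqnorm (f t - w))); last by move=> t; rewrite big_cons.
apply: measurable_funM => //; apply: (meas_ext (f := fun t => nsq (tc (f t) - tc (g t)))); last by move=> t; rewrite sqnorm_sub.
apply: cmeas_nsq; apply: cmeasD; first exact: (cmeas_comp (@cmeas_tc R) mf).
by apply: cmeasN; exact: (cmeas_comp (@cmeas_tc R) mg).
Qed.

Lemma prod_sq_ge0 (f : R * R) s : 0 <= \prod_(w <- s) sqnorm (f - w).
Proof. by apply: prodr_ge0 => w _; exact: sqnorm_ge0. Qed.

Definition zw beta U z s : R := \1_(~` U) z * expR (- (beta * sqnorm z)) * \prod_(w <- s) sqnorm (z - w).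

Lemma zw_ge0 beta U z s : 0 <= zw beta U z s.
Proof. by rewrite mulr_ge0 ?prod_sq_ge0// mulr_ge0 ?expR_ge0. Qed.

Lemma meas_zw beta (U : set (R * R)) d (T : measurableType d) (f : T -> R * R) s : measurable U ->
 measT f -> mseq s -> measT (fun t => zw beta U (f t) (s t)).
Proof.
move=> mU mf ms; apply: measurable_funM; last exact: meas_prod_sq.
apply: measurable_funM.
 by apply: (meas_comp (f := f) _ mf); apply: measurable_indic; exact: measurableC.
apply: meas_expN => //.
by apply: measurable_funM => //; exact: meas_sqnorm.
Qed.

Lemma Zp_ge0 beta U k s : (0 <= Zp beta U k s)%E.
Proof.
elim: k s => [|k IH] s //=; apply: integral_ge0 => z _; rewrite mule_ge0//.
by rewrite lee_fin; exact: zw_ge0.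
Qed.

Lemma meas_Zp beta (U : set (R * R)) k d (T : measurableType d) s : measurable U -> mseq s ->
 measT (fun t : T => Zp beta U k (s t)).
Proof.
move=> mU; elim: k d T s => [|k IH] d T s ms /=; first exact: measurable_cst.
have m1 : mseq (fun q : T * (R * R) => s q.1) by exact: (mseq_comp ms mfst).
apply: (@meas_int_curry _ _ _ _ _ leb2 (fun t z => (zw beta U z (s t))%:E * Zp beta U k (z :: s t))%E).
 apply: emeasurable_funM.
  by efin; apply: (meas_zw beta mU (f := snd)) => //; exact: msnd.
 by apply: IH; apply: (mseqS (f := snd)) => //; exact: msnd.
by move=> t z; rewrite mule_ge0 ?Zp_ge0// lee_fin; exact: zw_ge0.
Qed.

Lemma ZpS beta U k s : Zp beta U k.+1 s = (\int[leb2]_z ((zw beta U z s)%:E * Zp beta U k (z :: s)))%E.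
Proof. by []. Qed.

Definition scl2 (a : R) (z : R * R) : R * R := (a * z.1, a * z.2).
Lemma tc_scl2 a z : tc (scl2 a z) = (a%:C)%C * tc z.
Proof. by case: z => x y; rewrite /tc /scl2 /=; simpc. Qed.
Lemma sqnorm_scl2 a z : sqnorm (scl2 a z) = a ^+ 2 * sqnorm z.
Proof. by rewrite /sqnorm /=; ring. Qed.
Lemma scl2B a z w : scl2 a z - scl2 a w = scl2 a (z - w).
Proof. by case: z => ? ?; case: w => ? ?; rewrite /scl2 /=; congr (_, _); rewrite /= mulrBr. Qed.

Lemma int_scl2 a (f : R * R -> \bar R) : a != 0 -> measT f -> (forall z, 0 <= f z)%E ->
 (\int[leb2]_z f z = (a ^+ 2)%:E * \int[leb2]_z f (scl2 a z))%E.
Proof.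
move=> a0 mf f0.
have na : nsq (a%:C)%C = a ^+ 2 by rewrite /nsq /sqnorm /= expr0n addr0.
have aC : (a%:C)%C != 0 :> C by rewrite -nsq_eq0 na expf_neq0.
rewrite -(int_caffine 0 aC mf f0) na; congr (_ * _)%E; apply: eq_integral => z _.
by rewrite addr0 -tc_scl2 tcK.
Qed.

Lemma meas_scl2 a : measT (scl2 a).
Proof.
by apply: meas_pairR; apply: measurable_funM.
Qed.

(** Each substitution and each squared distance contributes a power of [a]. What matters is that [c]
    is uniform in [U]. *)
Lemma Zp_scale (a beta : R) k m : 0 < a -> exists2 c : R, 0 < c & forall U s, measurable U -> size s = m ->
 Zp beta [set z | U (scl2 a^-1 z)] k [seq scl2 a z | z <- s] = (c%:E * Zp (beta * a ^+ 2) U k s)%E.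
Proof.
move=> a0; elim: k m => [|k IH] m; first by exists 1 => // U s _ _; rewrite mul1e.
have [c c0 Hc] := IH m.+1.
exists (a ^+ 2 * ((a ^+ 2) ^+ m * c)); first by rewrite !mulr_gt0 ?exprn_gt0.
move=> U s mU sm; rewrite !ZpS; set U' := [set z | _].
have mU' : measurable U' by rewrite -[U']setTI; exact: meas_scl2.
have f0 z : (0 <= (zw beta U' z [seq scl2 a z0 | z0 <- s])%:E * Zp beta U' k (z :: [seq scl2 a z0 | z0 <- s]))%E.
 by rewrite mule_ge0 ?Zp_ge0// lee_fin zw_ge0.
have mf : measT (fun z => (zw beta U' z [seq scl2 a z0 | z0 <- s])%:E * Zp beta U' k (z :: [seq scl2 a z0 | z0 <- s]))%E.
 apply: emeasurable_funM; first by efin; apply: (meas_zw beta mU' (f := id)) => //; exact: mseq_cst.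
 by apply: meas_Zp => //; apply: (mseqS (f := id)) => //; exact: mseq_cst.
have an0 : a != 0 by rewrite gt_eqF.
rewrite (int_scl2 an0 mf f0) (EFinM (a ^+ 2) (_ * c)) -[RHS]muleA; congr (_ * _)%E.
rewrite -ge0_integralZl//; last 3 first.
- apply: emeasurable_funM; first by efin; apply: (meas_zw _ mU (f := id)) => //; exact: mseq_cst.
 by apply: meas_Zp => //; apply: (mseqS (f := id)) => //; exact: mseq_cst.
- by move=> z _; rewrite mule_ge0 ?Zp_ge0// lee_fin zw_ge0.
- by rewrite lee_fin mulr_ge0 ?exprn_ge0 ?sqr_ge0// ltW.
apply: eq_integral => z _; rewrite -[scl2 a z :: _]/[seq scl2 a z0 | z0 <- z :: s] Hc//; last by rewrite /= sm.
rewrite !muleA -!EFinM; congr (_%:E * _)%E.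
have -> : zw beta U' (scl2 a z) [seq scl2 a z0 | z0 <- s] = (a ^+ 2) ^+ m * zw (beta * a ^+ 2) U z s.
 rewrite /zw sqnorm_scl2 (mulrA beta) big_map.
 have -> : \1_(~` U') (scl2 a z) = \1_(~` U) z :> R.
  by rewrite !indicE; congr (_%:R); congr nat_of_bool; apply/idP/idP => /set_mem h; apply/mem_set => h'; apply: h;
   move: h'; rewrite /U' /= /scl2 /= !mulKf//; case: (z).
 have -> : \prod_(w <- s) sqnorm (scl2 a z - scl2 a w) = (a ^+ 2) ^+ m * \prod_(w <- s) sqnorm (z - w).
  rewrite -sm; elim: (s) => [|w u IHu]; first by rewrite !big_nil expr0 mul1r.
  by rewrite !big_cons IHu scl2B sqnorm_scl2 [size _]/= (exprS (a ^+ 2)) mulrACA.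
 by ring.
by ring.
Qed.

Definition nor U (p : {poly C}) : R := (`[< forall z, U z -> ~~ root p (tc z) >])%:R.
(** This class is closed under deflation: removing a root [l] from [p] yields the weight [zw] of [l]
    times the same functional with [l] added to the list, as in [Theta_FV]. *)
Definition FV U (s : seq (R * R)) (p : {poly C}) : \bar R := (nor U p * \prod_(w <- s) nsq p.[tc w])%:E.

Lemma FV_ge0 U s p : (0 <= FV U s p)%E.
Proof. by rewrite lee_fin mulr_ge0// ?ler0n// prodr_ge0// => *; exact: nsq_ge0. Qed.

Lemma monic_near_root (p : {poly C}) n c r : p \is monic -> size p = n.+1 -> 0 < r -> normc p.[c] < r ^+ n ->
 exists2 t, root p t & normc (t - c) < r.
Proof.
move=> mp sp r0 H; have [s Es] := closed_field_poly_normal p.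
rewrite (monicP mp) scale1r in Es.
have ss : size s = n by move: sp; rewrite Es size_prod_XsubC => -[].
have [/hasP[t ts tl]|/hasPn far] := boolP (has (fun t => normc (t - c) < r) s).
 by exists t => //; rewrite Es root_prod_XsubC.
exfalso; move: H; rewrite ltNge => /negP; apply.
rewrite Es horner_prod normc_prod -ss.
elim: (s) far => [|t u IH] far; first by rewrite big_nil expr0.
rewrite big_cons exprS; apply: ler_pM; rewrite ?exprn_ge0 ?(ltW r0)//; last first.
 by apply: IH => x xu; apply: far; rewrite inE xu orbT.
by rewrite !hornerE normc_sub leNgt; apply: far; rewrite mem_head.
Qed.

(** Having a root in [U] is a countable union of conditions [|p(x)| < r^k], over rational [x] and
    [r = 1 / (j + 1)] with [ball x r] inside [U]. Each condition forces a root within [r] of [x];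
    conversely, near a root in [U], [|p|] is small at some rational point. *)
Lemma meas_nor U k d (T : measurableType d) (M : T -> 'M[C]_k) : open U -> mcmeas M ->
 measT (fun t => nor U (char_poly (M t))).
Proof.
move=> oU mM.
pose S (i : nat) : set T := if unpickle i is Some (x, y, j) then
  if `[< ball (ratr x : R, ratr y : R) j.+1%:R^-1 `<=` U >] then
   [set t | nsq (char_poly (M t)).[tc (ratr x, ratr y)] < (j.+1%:R^-1 ^+ k) ^+ 2] else set0 else set0.
have mS i : measurable (S i).
 rewrite /S; case: (unpickle i) => // -[[x y] j]; case: ifP => // _.
 have mf : measT (fun t => nsq (char_poly (M t)).[tc (ratr x, ratr y)]).
  by apply: cmeas_nsq; apply: cmeas_char => //; exact: cmeas_cst.
 rewrite (_ : [set t | _] = setT `&` (fun t => nsq (char_poly (M t)).[tc (ratr x, ratr y)]) @^-1` `]-oo, (j.+1%:R^-1 ^+ k) ^+ 2[%classic).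
  by apply: mf.
 by apply/seteqP; split => t /=; rewrite in_itv /=; [move=> ?|move=> []].
have norE t : nor U (char_poly (M t)) = \1_(~` \bigcup_i S i) t.
 rewrite /nor indicE; congr (_%:R); congr nat_of_bool; apply/asboolP/idP => [H|].
  apply/mem_set => -[i _]; rewrite /S; case: (unpickle i) => // -[[x y] j]; case: ifP => // /asboolP bU /= h.
  have [||||t' rt tc'] := @monic_near_root (char_poly (M t)) k (tc (ratr x, ratr y)) j.+1%:R^-1.
  - exact: char_poly_monic.
  - exact: size_char_poly.
  - by rewrite invr_gt0.
  - by move: h; rewrite normc_nsq ltr_sqr ?nnegrE ?normc_ge0// exprn_ge0 ?invr_ge0.
  have := H (ct t'); rewrite ctK rt => /(_ _)/negP; apply => //; apply: bU.
  rewrite -ball_normE /= distrC; apply: le_lt_trans (norm_le_normc _) _.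
  by rewrite tcB ctK.
 move=> /set_mem nS z Uz; apply/negP => rz; apply: nS.
 have [e0 /= e00 eU] : exists2 e : R, 0 < e & ball z e `<=` U.
  by move: oU; rewrite openE => /(_ z Uz) /nbhs_ballP [e /= ? ?]; exists e.
 have [j hj] : exists j : nat, j.+1%:R^-1 < e0 / 2.
  exists (Num.trunc (e0 / 2)^-1); rewrite invf_plt ?posrE ?divr_gt0//; exact: truncnS_gt.
 have j0 : 0 < j.+1%:R^-1 :> R by rewrite invr_gt0.
 have [e eE] : exists e : R, e = j.+1%:R^-1 by eexists.
 rewrite -eE in hj j0.
 have ek : 0 < e ^+ k / 2 by rewrite divr_gt0// exprn_gt0.
 have [dl dl0 Hd] := sdiff_near (sdiff_horner (char_poly (M t)) (tc z)) ek.
 pose m := Num.min e (dl / 2).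
 have m0 : 0 < m by rewrite lt_min j0 divr_gt0.
 have me : m <= e by rewrite ge_min lexx.
 have md : m <= dl / 2 by rewrite ge_min lexx orbT.
 have l1 : z.1 - m < z.1 + m by lra.
 have l2 : z.2 - m < z.2 + m by lra.
 have [x] := rat_in_itvoo l1; have [y] := rat_in_itvoo l2.
 rewrite !in_itv /= => /andP[y1 y2] /andP[x1 x2].
 have zq : `|z - (ratr x, ratr y)| < m.
  have : ball z m (ratr x : R, ratr y : R).
   by apply/ball2P; split; rewrite ltr_norml /=; apply/andP; split; lra.
  by rewrite -ball_normE.
 have bU : ball (ratr x : R, ratr y : R) e `<=` U.
  move=> w; rewrite -ball_normE /= => qw; apply: eU; rewrite -ball_normE /=.
  rewrite (_ : z - w = (z - (ratr x, ratr y)) + ((ratr x, ratr y) - w)); last by rewrite addrA subrK.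
  by apply: le_lt_trans (ler_normD _ _) _; move: zq qw; lra.
 have [i iE] : exists i, unpickle i = Some (x, y, j) by exists (pickle (x, y, j)); exact: pickleK.
 exists i; first exact: I.
 rewrite /S iE -eE; move: bU => /asboolP bU; cbv zeta; rewrite bU /=.
 rewrite normc_nsq ltr_sqr ?nnegrE ?normc_ge0 ?exprn_ge0 ?(ltW j0)//.
 have := Hd (tc (ratr x, ratr y)); rewrite (eqP rz) subr0 => h.
 apply: le_lt_trans (h _) _; last by move: ek; lra.
 rewrite -tcB; apply: le_lt_trans (normc_le_norm _) _; rewrite distrC; move: zq; lra.
apply: (meas_ext (f := (\1_(~` \bigcup_i S i) : T -> R))); last by move=> t; rewrite norE.
by apply: measurable_indic; apply: measurableC; exact: bigcup_measurable.
Qed.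

Lemma meas_FV U k d (T : measurableType d) (M : T -> 'M[C]_k) s : open U -> mcmeas M -> mseq s ->
 measT (fun t => FV U (s t) (char_poly (M t))).
Proof.
move=> oU mM ms; efin; apply: measurable_funM; first exact: meas_nor.
elim: ms => [|f s' mf _ IH]; first by apply: (meas_ext (f := fun _ : T => 1 : R)) => // t; rewrite big_nil.
apply: (meas_ext (f := fun t => nsq (char_poly (M t)).[tc (f t)] * \prod_(w <- s' t) nsq (char_poly (M t)).[tc w])); last by move=> t; rewrite big_cons.
apply: measurable_funM => //; apply: cmeas_nsq; apply: cmeas_char => //.
exact: (cmeas_comp (@cmeas_tc R) mf).
Qed.

Lemma pmeas_FV U k s : open U -> pmeas k (FV U s).
Proof. by move=> oU d T M mM; apply: meas_FV => //; exact: mseq_cst. Qed.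

Lemma int_sqgauss : (\int[leb2]_z (expR (- sqnorm z))%:E = (pi : R)%:E)%E.
Proof.
have mg : measT (fun x : R => (expR (- x ^+ 2))%:E : \bar R).
 by apply: meas_exp; exact: measurable_funX.
have I1 : (\int[leb1]_x (expR (- x ^+ 2))%:E = (Num.sqrt pi : R)%:E)%E.
 by rewrite -int_leb1// -integralT_gauss.
have m2 : measT (fun z : R * R => (expR (- sqnorm z))%:E : \bar R).
 by apply: meas_exp; exact: (meas_sqnorm (f := id)).
rewrite leb2E//.
transitivity (\int[leb1]_x ((expR (- x ^+ 2))%:E * (Num.sqrt pi : R)%:E))%E.
 apply: eq_integral => x _; rewrite -I1 -ge0_integralZl//.
 by apply: eq_integral => y _; rewrite -EFinM -expRD /sqnorm /= opprD.
rewrite ge0_integralZr//.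
by rewrite I1 -EFinM -expr2 sqr_sqrtr// pi_ge0.
Qed.

Lemma vint_gauss n : vint (@gauss R n) = ((pi : R) ^+ n)%:E.
Proof.
elim: n => [|n IH].
 by rewrite /vint enum_ord0 /= /gauss /fnorm2 big_ord0 oppr0 expR0 expr0.
rewrite vintS; transitivity (\int[leb2]_z ((expR (- sqnorm z))%:E * ((pi : R) ^+ n)%:E))%E.
 have mgs : vmeas (@gauss R n) by apply: meas_exp; apply: mcmeas_fnorm; exact: mcmeas_colof.
 have gs0 (v : 'cV[C]_n) : (0 <= gauss v)%E by rewrite lee_fin expR_ge0.
 have e0 z : (0 <= (expR (- sqnorm (z : R * R)))%:E)%E by rewrite lee_fin expR_ge0.
 apply: eq_integral => z _; rewrite -IH -(vint_scale (e0 z) mgs gs0).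
 apply: eq_vint => v; rewrite /gauss -EFinM -expRD -opprD; congr (expR (- _))%:E.
 rewrite [LHS](fnorm2_col ((tc z)%:M : 'M[C]_1) v); congr (_ + _).
 by rewrite /fnorm2 !big_ord1 mxE eqxx mulr1n nsq_tc.
have msg : measT (fun z : R * R => (expR (- sqnorm z))%:E : \bar R).
 by apply: meas_exp; exact: (meas_sqnorm (f := id)).
have pn0 : (0 <= ((pi : R) ^+ n)%:E)%E by rewrite lee_fin exprn_ge0 ?pi_ge0.
rewrite ge0_integralZr//.
by rewrite int_sqgauss -EFinM exprS.
Qed.

Lemma Theta_FV n (U : set (R * R)) s l (y : 'cV[C]_(n * n + n)) :
 (Theta (FV U s) l y = (zw 1 U (ct l) s)%:E * ((FV U (ct l :: s) (char_poly (mxof (usubmx y))) * gauss (usubmx y)) * gauss (dsubmx y)))%E.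
Proof.
rewrite /Theta /FV; set p := char_poly _.
have norE : nor U (('X - l%:P) * p) = \1_(~` U) (ct l) * nor U p.
 rewrite /nor indicE -natrM mulnb; congr (_%:R); congr nat_of_bool; apply/asboolP/idP.
  move=> H; apply/andP; split.
   by apply/mem_set => Ul; have := H _ Ul; rewrite rootM ctK root_XsubC eqxx.
  by apply/asboolP => z Uz; have := H z Uz; rewrite rootM negb_or => /andP[].
 move=> /andP[/set_mem Ul /asboolP H] z Uz; rewrite rootM negb_or H// andbT root_XsubC.
 by apply/eqP => zl; apply: Ul; rewrite -zl tcK.
have prodE : \prod_(w <- s) nsq (('X - l%:P) * p).[tc w] = \prod_(w <- s) sqnorm (ct l - w) * \prod_(w <- s) nsq p.[tc w].
 rewrite -big_split; apply: eq_bigr => w _; rewrite hornerM nsqM sqnorm_sub ctK; congr (_ * _).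
 by rewrite !hornerE -opprB nsqN.
rewrite norE prodE big_cons ctK /zw mul1r /gauss -!EFinM; congr (_%:E).
have -> : expR (- (nsq l + fnorm2 y)) = expR (- sqnorm (ct l)) * (expR (- fnorm2 (usubmx y)) * expR (- fnorm2 (dsubmx y))).
 by rewrite -!expRD -{1}(vsubmxK y) fnorm2_col !opprD addrA.
by ring.
Qed.

Lemma Xmx_FV n U s : open U ->
 (Xmx n (FV U s) = ((pi : R) ^+ n)%:E * \int[leb2]_z ((zw 1 U z s)%:E * Imx n (FV U (z :: s))))%E.
Proof.
move=> oU; have mU := open_measurable2 oU.
have mF z : vmeas (fun v : 'cV[C]_(n * n) => (FV U (z :: s) (char_poly (mxof v)) * gauss v)%E).
 apply: emeasurable_funM; first by apply: pmeas_FV => //; apply: mcmeas_mxof; exact: mcmeas_colof.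
 by apply: meas_exp; apply: mcmeas_fnorm; exact: mcmeas_colof.
have F0 z (v : 'cV[C]_(n * n)) : (0 <= FV U (z :: s) (char_poly (mxof v)) * gauss v)%E.
 by rewrite mule_ge0 ?FV_ge0// lee_fin expR_ge0.
have mI : measT (fun z => Imx n (FV U (z :: s))).
 apply: meas_vint; last by move=> *; exact: F0.
 have ms : mcmeas (fun q : (R * R) * cfg R 'I_(n * n) => colof q.2) by exact: (mcmeas_comp (@mcmeas_colof _ _) msnd).
 apply: emeasurable_funM; last by apply: meas_exp; exact: mcmeas_fnorm.
 apply: meas_FV => //; first exact: mcmeas_mxof.
 by apply: (mseqS (f := fst)); [exact: mfst|exact: mseq_cst].
have z0 z : (0 <= (zw 1 U z s)%:E)%E by rewrite lee_fin zw_ge0.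
rewrite -ge0_integralZl//; last 3 first.
- by apply: emeasurable_funM => //; efin; apply: (meas_zw _ mU (f := id)) => //; exact: mseq_cst.
- by move=> z _; rewrite mule_ge0//; exact: vint_ge0.
- by rewrite lee_fin exprn_ge0 ?pi_ge0.
apply: eq_integral => z _.
rewrite (eq_vint (Theta_FV U s (tc z))) tcK vint_cat.
transitivity (vint (fun x : 'cV[C]_(n * n) => ((((pi : R) ^+ n)%:E * (zw 1 U z s)%:E) * (FV U (z :: s) (char_poly (mxof x)) * gauss x))%E)).
 apply: eq_vint => x; transitivity (vint (fun y : 'cV[C]_n => ((zw 1 U z s)%:E * (FV U (z :: s) (char_poly (mxof x)) * gauss x)) * gauss y)%E).
  by apply: eq_vint => y; rewrite col_mxKu col_mxKd muleA.
 rewrite vint_scale ?vint_gauss; first by rewrite muleC muleA.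
 - by rewrite mule_ge0.
 - by apply: meas_exp; apply: mcmeas_fnorm; exact: mcmeas_colof.
 - by move=> v; rewrite lee_fin expR_ge0.
by rewrite vint_scale// ?muleA// mule_ge0// lee_fin exprn_ge0 ?pi_ge0.
Qed.

Lemma vint_pinfty n : vint (fun _ : 'cV[C]_n => +oo%E) = +oo%E :> \bar R.
Proof.
elim: n => [|n IH]; first by rewrite /vint enum_ord0.
rewrite vintS (eq_integral (fun=> +oo%E)); last by move=> z _; exact: IH.
rewrite integral_cst// gt0_mulye//; apply: (@lt_le_trans _ _ (leb2 (ball (0 : R * R) 1))).
 by rewrite leb2_ball// lte_fin exprn_gt0.
by le_meas => //; exact: measurable_ball2.
Qed.

(** If [Xmx n F] were 0 or infinite, the integral over [u] in [Imx_deflate] would be 0 or infinite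
    too, whereas it equals a positive number. *)
Lemma Xmx_pos n F x : pmeas (1 + n) F -> (forall p, 0 <= F p)%E -> 0 < x ->
 Imx (1 + n) F = x%:E -> exists2 y : R, 0 < y & Xmx n F = y%:E.
Proof.
move=> mF F0 x0 Ix; have [K K0 HK] := Imx_deflate R n.
have H := HK F mF F0; rewrite Ix in H.
have X0 : (0 <= Xmx n F)%E.
 apply: integral_ge0 => l _; apply: vint_ge0 => y.
 by rewrite mule_ge0// lee_fin mulr_ge0 ?nsq_ge0 ?expR_ge0.
case XE : (Xmx n F) X0 => [y| |] // y0.
 exists y => //; rewrite lt_def; move: y0; rewrite lee_fin => ->; rewrite andbT; apply/eqP => y00.
 move: H; rewrite (eq_vint (H := fun=> 0%E)).
  rewrite -[X in vint X]/(fun v : 'cV[C]_n => 0%E) (_ : vint _ = (0%:E * vint (fun _ : 'cV[C]_n => 0))%E).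
   by rewrite mul0e -EFinM => -[] /eqP; rewrite mulf_eq0 !gt_eqF.
  by rewrite -vint_scale//; [apply: eq_vint => v; rewrite mul0e|exact: measurable_cst].
 by move=> u; have [k _ ->] := int_Psi u => //; rewrite XE y00 mule0.
move: H; rewrite (eq_vint (H := fun=> +oo%E)); first by rewrite vint_pinfty -EFinM.
by move=> u; have [k k0 ->] := int_Psi u => //; rewrite XE gt0_muley// lte_fin.
Qed.

Lemma Imx1 n : Imx n (FV set0 [::]) = ((pi : R) ^+ (n * n))%:E.
Proof.
rewrite -vint_gauss; apply: eq_vint => v; rewrite /FV big_nil mulr1 /nor.
by rewrite asboolT ?mul1e// => z [].
Qed.

(** Induction on the size. [Imx_Xmx] compares with the empty set and the empty list, whose integral
    is the explicit Gaussian one, so the constant is positive, finite and independent of [U] and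
    [s]. *)
Lemma Imx_Zp n : exists2 k : R, 0 < k & forall U s, open U -> Imx n (FV U s) = (k%:E * Zp 1 U n s)%E.
Proof.
elim: n => [|n [k k0 IH]].
 exists 1 => // U s oU; rewrite mul1e /Imx /vint enum_ord0 /= /gauss /fnorm2 big_ord0 oppr0 expR0 mule1.
 rewrite /FV /char_poly det_mx00 /nor asboolT; last by move=> z _; rewrite root1.
 by rewrite mul1r big1// => w _; rewrite hornerC nsq1.
have ppos m : 0 < (pi : R) ^+ m by rewrite exprn_gt0 ?pi_gt0.
have XZ U s : open U -> Xmx n (FV U s) = (((pi : R) ^+ n * k)%:E * Zp 1 U n.+1 s)%E.
 move=> oU; rewrite Xmx_FV// EFinM -muleA; congr (_ * _)%E; rewrite ZpS -ge0_integralZl//; last 3 first.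
 - have mU := open_measurable2 oU.
  apply: emeasurable_funM; first by efin; apply: (meas_zw _ mU (f := id)) => //; exact: mseq_cst.
  by apply: meas_Zp => //; apply: (mseqS (f := id)) => //; exact: mseq_cst.
 - by move=> z _; rewrite mule_ge0 ?Zp_ge0// lee_fin zw_ge0.
 - by rewrite lee_fin ltW.
 by apply: eq_integral => z _; rewrite IH// muleCA.
have [y y0 XE] := Xmx_pos (pmeas_FV [::] open0) (FV_ge0 set0 [::]) (ppos _) (Imx1 (1 + n)).
exists (pi ^+ ((1 + n) * (1 + n)) / y * (pi ^+ n * k)); first by rewrite mulr_gt0 ?divr_gt0 ?mulr_gt0.
move=> U s oU; have := @Imx_Xmx _ n _ _ (pmeas_FV s oU) (pmeas_FV [::] open0) (FV_ge0 U s) (FV_ge0 set0 [::]).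
rewrite XE Imx1 (XZ U s oU) => h.
have -> : Imx n.+1 (FV U s) = (y^-1%:E * (Imx (1 + n) (FV U s) * y%:E))%E.
 by rewrite muleC -muleA -EFinM divff ?mule1// gt_eqF.
rewrite h !muleA -!EFinM; congr (_%:E * _)%E; ring.
Qed.

Definition cdens (z : R * R) : R := pi^-1 * expR (- sqnorm z).
Lemma cdens_ge0 z : 0 <= cdens z. Proof. by rewrite mulr_ge0 ?expR_ge0// invr_ge0 pi_ge0. Qed.

Lemma meas_cdens d (T : measurableType d) (f : T -> R * R) : measT f -> measT (fun t => cdens (f t)).
Proof.
move=> mf; apply: measurable_funM => //; apply: meas_expN => //.
exact: meas_sqnorm.
Qed.

Lemma gauss_iterE k (F : cfg R nat -> \bar R) x : measT F -> (forall y, 0 <= F y)%E ->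
 gauss_iter k F x = iint (rev (iota 0 k)) (fun y => (\prod_(i < k) cdens (y i))%:E * F y)%E x.
Proof.
move=> mF F0.
have mH j : measT (fun y : cfg R nat => (\prod_(i < j) cdens (y i))%:E * F y)%E.
 apply: emeasurable_funM => //; efin; apply: measurable_prod => i _.
 by apply: meas_cdens; exact: meas_eval.
have H0 j (y : cfg R nat) : (0 <= (\prod_(i < j) cdens (y i))%:E * F y)%E.
 by rewrite mule_ge0// lee_fin prodr_ge0// => i _; exact: cdens_ge0.
elim: k x => [|k IH] x; first by rewrite /= big_ord0 mul1e.
have -> : rev (iota 0 k.+1) = k :: rev (iota 0 k) by rewrite -addn1 iotaD rev_cat.
rewrite /= int_lebC//; last first.
 apply: emeasurable_funM; first by efin; exact: (meas_cdens (f := id)).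
 apply: (meas_ext (f := fun z => iint (rev (iota 0 k)) (fun y => (\prod_(i < k) cdens (y i))%:E * F y)%E (upd x k z))); last by move=> z; rewrite IH.
 exact: (meas_comp (iint_meas _ (mH k) (H0 k)) (meas_upd1 x k)).
apply: eq_integral => z _; rewrite -/(upd x k z) IH; symmetry; apply: iint_scale => //.
 by rewrite lee_fin cdens_ge0.
move=> y Hy; rewrite big_ord_recr /= muleA -EFinM; congr (_%:E * _)%E; rewrite mulrC; congr (_ * _).
by rewrite Hy ?/upd ?eqxx// mem_rev mem_iota ltnn andbF.
Qed.

Lemma int_cdens : (\int[leb2]_z (cdens z)%:E = 1)%E.
Proof.
have msg : measT (fun z : R * R => (expR (- sqnorm z))%:E : \bar R).
 by apply: meas_exp; exact: (meas_sqnorm (f := id)).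
have p0 : (0 <= (pi^-1 : R)%:E)%E by rewrite lee_fin invr_ge0 pi_ge0.
under eq_integral do rewrite /cdens EFinM.
by rewrite ge0_integralZl// int_sqgauss -EFinM mulVf// gt_eqF// pi_gt0.
Qed.

Lemma gauss_iter1 k x : gauss_iter k (fun=> 1%E) x = 1%E :> \bar R.
Proof.
elim: k x => // k IH x /=.
rewrite int_lebC//; last first.
 apply: emeasurable_funM; first by efin; exact: (meas_cdens (f := id)).
 by apply: (meas_ext (f := fun _ : R * R => 1%E)) => // z; rewrite IH.
by rewrite -[RHS]int_cdens; apply: eq_integral => z _; rewrite IH mule1.
Qed.

Section ginibre_link.
Variable n : nat.

Lemma idx_subproof (p : 'I_n * 'I_n) : (p.1 * n + p.2 < n * n)%N.
Proof.
case: p => i j /=; have := ltn_ord i; have := ltn_ord j; nia.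
Qed.
Definition idx p : 'I_(n * n) := Ordinal (idx_subproof p).

Lemma idx_bij : bijective idx.
Proof.
apply: inj_card_bij; last by rewrite card_prod !card_ord.
move=> [i j] [i' j'] /(congr1 val) /= E.
have n0 : (0 < n)%N by exact: leq_ltn_trans (ltn_ord i).
have Ei : i = i' :> nat.
 by have := congr1 (fun x => x %/ n)%N E; rewrite !divnMDl// !divn_small// !addn0.
have Ej : j = j' :> nat by move: E; rewrite Ei => /eqP; rewrite eqn_add2l => /eqP.
by congr (_, _); exact: val_inj.
Qed.

(** [mx_of] stores the entry [(i, j)] at position [i n + j], the vector form of a matrix at
    [mxvec_index i j]. This relabelling passes from one to the other; as a linear bijection it costs
    at most a constant. *)
Definition grid (v : 'cV[C]_(n * n)) : 'cV[C]_(n * n) := ofmx (\matrix_(i, j) v (idx (i, j)) 0).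

Lemma grid_const : exists2 k : R, 0 < k & forall G : 'cV[C]_(n * n) -> \bar R, vmeas G -> (forall v, 0 <= G v)%E ->
 vint (fun v => G (grid v)) = (k%:E * vint G)%E.
Proof.
have [ii iK Ki] := idx_bij.
pose g (v : 'cV[C]_(n * n)) : 'cV[C]_(n * n) := \col_k mxof v (ii k).1 (ii k).2.
have lg a u v : grid (a *: u + v) = a *: grid u + grid v.
 by rewrite /grid -ofmx_lin; congr ofmx; mx_ext.
have gK : cancel grid g.
 by move=> v; apply/colP => k; rewrite mxE /grid ofmxK mxE -surjective_pairing Ki.
have Kg : cancel g grid.
 move=> v; rewrite -[RHS]mxofK /grid; congr ofmx; apply/matrixP => i j.
 by rewrite mxE /g mxE iK.
have [k k0 Hk] := vint_lin lg gK Kg; exists k => // G mG G0.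
by rewrite -(Hk 0)//; apply: eq_vint => v; rewrite addr0.
Qed.

Lemma ginibre_vint (E : set 'M[C]_n) :
 (forall d (T : measurableType d) (M : T -> 'M[C]_n), mcmeas M -> measT (fun t => \1_E (M t) : R)) ->
 ginibre_prob E = vint (fun v => ((pi^-1) ^+ (n * n))%:E * ((\1_E (mxof (grid v)))%:E * gauss (grid v)))%E.
Proof.
move=> mE.
have mF : measT (fun x : cfg R nat => (\1_E (mx_of n x))%:E : \bar R).
 efin; apply: mE => i j; apply: (cmeas_ext (f := fun x : cfg R nat => tc (x (i * n + j)%N))); first exact: cmeas_ev.
 by move=> t; rewrite mxE.
rewrite /ginibre_prob gauss_iterE//.
have mH : measT (fun y : cfg R nat => (\prod_(i < n * n) cdens (y i))%:E * (\1_E (mx_of n y))%:E)%E.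
 apply: emeasurable_funM => //; efin; apply: measurable_prod => i _.
 by apply: meas_cdens; exact: meas_eval.
have H0 (y : cfg R nat) : (0 <= (\prod_(i < n * n) cdens (y i))%:E * (\1_E (mx_of n y))%:E)%E.
 by rewrite mule_ge0// lee_fin// prodr_ge0// => i _; exact: cdens_ge0.
rewrite (iint_perm (t := iota 0 (n * n))) ?rev_uniq ?iota_uniq ?perm_rev// -val_enum_ord.
pose Fv (u : cfg R 'I_(n * n)) : \bar R := ((\prod_i cdens (u i))%:E * (\1_E (\matrix_(i, j) tc (u (idx (i, j)))))%:E)%E.
transitivity (iint [seq val i | i <- enum 'I_(n * n)] (fun y : cfg R nat => Fv (fun i => y (val i))) (fun _ => (0, 0))).
 apply: iint_congr => y _; have mE' : mx_of n y = \matrix_(i, j) tc (y (idx (i, j))).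
  by mx_ext.
 rewrite mE' /Fv.
 reflexivity.
rewrite (@iint_rename R _ nat val (enum 'I_(n * n)) Fv (fun _ => (0, 0)) val_inj); apply: iint_congr => y _.
have Ec : \prod_i cdens (y i) = pi^-1 ^+ (n * n) * expR (- \sum_i sqnorm (y i)).
 rewrite /cdens big_split prodr_const card_ord; congr (_ * _).
 by rewrite -sumrN expR_sum.
have Eg : fnorm2 (grid (colof y)) = \sum_i sqnorm (y i).
 rewrite /grid fnorm2_vec /fnorm2 pair_big /= [RHS](reindex idx) /=; last by apply: onW_bij; exact: idx_bij.
 by apply: eq_bigr => -[i j] _; rewrite !mxE nsq_tc.
rewrite /Fv /gauss Eg Ec -!EFinM; congr (_%:E).
rewrite /grid ofmxK (_ : \matrix_(i, j) colof y (idx (i, j)) 0 = \matrix_(i, j) tc (y (idx (i, j)))); last first.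
 by mx_ext.
by rewrite mulrAC -mulrA.
Qed.

Hypothesis n0 : (0 < n)%N.
Definition dil (U : set (R * R)) : set (R * R) := [set z | U (scl2 (Num.sqrt n%:R)^-1 z)].

Lemma open_dil U : open U -> open (dil U).
Proof.
move=> oU; rewrite (_ : dil U = scl ((Num.sqrt n%:R)^-1%:C)%C U); first exact: open_scl.
by apply/seteqP; split => z; rewrite /dil /scl /= -tc_scl2 tcK.
Qed.

Lemma no_eigsE U (M : 'M[C]_n) : \1_(no_eigs_in U) M = nor (dil U) (char_poly M).
Proof.
have s0 : Num.sqrt n%:R != 0 :> R by rewrite gt_eqF// sqrtr_gt0 ltr0n.
rewrite indicE /nor; congr (_%:R); congr nat_of_bool; apply/idP/asboolP => [/set_mem H z Uz|H].
 apply: H; exists (scl2 (Num.sqrt n%:R)^-1 z) => //=.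
 by rewrite !mulVKf.
apply/mem_set => c [u Uu [re im]]; rewrite -(ctK c); apply: H.
by rewrite /dil /= /scl2 /= re im !mulKf//; case: u Uu {re im}.
Qed.

(** All constants met so far are the same for [U] and for the empty set, for which the probability
    is 1. Dilation by [sqrt n] turns the weight [exp(- |z|^2)] into [exp(- n |z|^2)]. *)
Theorem prob_ratio U : open U ->
 exists2 x : R, 0 < x & Zp n%:R set0 n [::] = x%:E /\
  (@ginibre_prob R n (@no_eigs_in R n U) * x%:E = Zp n%:R U n [::])%E.
Proof.
move=> oU; have [k k0 Hk] := grid_const; have [kap kap0 Hkap] := Imx_Zp n.
have pn : 0 < (pi^-1 : R) ^+ (n * n) by rewrite exprn_gt0// invr_gt0 pi_gt0.
pose K := pi^-1 ^+ (n * n) * k * kap.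
have K0 : 0 < K by rewrite !mulr_gt0.
have PE V : open V -> @ginibre_prob R n (@no_eigs_in R n V) = (K%:E * Zp 1 (dil V) n [::])%E.
 move=> oV; have odV := open_dil oV.
 have mP d (T : measurableType d) (M : T -> 'M[C]_n) : mcmeas M -> measT (fun t => \1_(@no_eigs_in R n V) (M t) : R).
  by move=> mM; apply: (meas_ext (meas_nor odV mM)) => t; rewrite no_eigsE.
 rewrite ginibre_vint//.
 pose G (v : 'cV[C]_(n * n)) : \bar R := (FV (dil V) [::] (char_poly (mxof v)) * gauss v)%E.
 have GE v : ((\1_(@no_eigs_in R n V) (mxof v))%:E * gauss v = G v)%E.
  by rewrite /G /FV big_nil mulr1 no_eigsE.
 have mG : vmeas G.
  apply: emeasurable_funM; last by apply: meas_exp; apply: mcmeas_fnorm; exact: mcmeas_colof.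
  by apply: pmeas_FV => //; apply: mcmeas_mxof; exact: mcmeas_colof.
 have G0 v : (0 <= G v)%E by rewrite mule_ge0 ?FV_ge0// lee_fin expR_ge0.
 rewrite (eq_vint (H := fun v => ((pi^-1 ^+ (n * n))%:E * G (grid v))%E)); last by move=> v; rewrite GE.
 rewrite vint_scale ?lee_fin ?(ltW pn)//; last first.
  apply: (vmeas_comp mG) => i; have : mcmeas (fun y : cfg R 'I_(n * n) => grid (colof y)).
   by apply: mcmeas_ofmx => p q; apply: (cmeas_ext (cmeas_colof _ _)) => t; rewrite mxE.
  by apply.
 by rewrite Hk// -/(Imx n (FV (dil V) [::])) Hkap// /K !EFinM !muleA.
have E1 : (K%:E * Zp 1 (dil set0) n [::] = 1)%E.
 rewrite -PE; last exact: open0.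
 rewrite /ginibre_prob -[RHS](gauss_iter1 (n * n) (fun _ => (0, 0))); congr gauss_iter.
 apply/funext => x; rewrite indicE mem_set// => c [u] //.
have sn : 0 < Num.sqrt n%:R :> R by rewrite sqrtr_gt0 ltr0n.
have [c c0 Hc] := @Zp_scale (Num.sqrt n%:R) 1 n 0 sn.
have Hs V : open V -> Zp 1 (dil V) n [::] = (c%:E * Zp n%:R V n [::])%E.
 move=> oV; have := Hc V [::] (open_measurable2 oV) erefl.
 by rewrite mul1r sqr_sqrtr ?ler0n.
rewrite Hs in E1; last exact: open0.
have Kc0 : 0 < K * c by rewrite mulr_gt0.
have Z0E : Zp n%:R set0 n [::] = ((K * c)^-1)%:E.
 have : ((K * c)^-1%:E * (K%:E * (c%:E * Zp n%:R set0 n [::])) = (K * c)^-1%:E)%E by rewrite E1 mule1.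
 by rewrite !muleA -!EFinM -mulrA mulVf ?gt_eqF// mul1e.
exists (K * c)^-1; first by rewrite invr_gt0.
split => //; rewrite PE// Hs// muleAC !muleA -!EFinM.
by rewrite mulrAC mulfV ?gt_eqF// mul1e.
Qed.
End ginibre_link.
End zpart.

(** Stated with no finiteness assumption on [f]: if its integral is infinite, that of the negative
    part of [f - r] is still bounded by that of [r]. This is what separates the logarithm from the
    quadratic terms at infinite energy. *)
Lemma int_sub_ge0 d (T : measurableType d) (R : realType) (mu : {measure set T -> \bar R}) (f : T -> \bar R) (r : T -> R) :
 measT f -> (forall x, 0 <= f x)%E -> measT r -> (forall x, 0 <= r x) ->
 (\int[mu]_x (r x)%:E < +oo)%E ->
 (\int[mu]_x (f x - (r x)%:E) = \int[mu]_x f x - \int[mu]_x (r x)%:E)%E.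
Proof.
move=> mf f0 mr r0 fr.
have mr' : measT (EFin \o r) by exact/measurable_EFinP.
have ir : mu.-integrable setT (EFin \o r).
 apply/integrableP; split => //; under eq_integral do rewrite /= ger0_norm//.
 exact: fr.
have [ff|ff] := ltP (\int[mu]_x f x)%E +oo%E.
 have iif : mu.-integrable setT f.
  by apply/integrableP; split => //; under eq_integral do rewrite gee0_abs//.
 exact: integralB.
have fE : (\int[mu]_x f x = +oo)%E by apply/eqP; rewrite eq_le leey.
have rfin : (\int[mu]_x (r x)%:E)%E \is a fin_num.
 by rewrite ge0_fin_numE//; apply: integral_ge0 => x _; rewrite lee_fin.
rewrite fE addye; last by rewrite -fin_numN in rfin; case: (- _)%E rfin.
pose g x := (f x - (r x)%:E)%E.
have mg : measT g by apply: emeasurable_funB.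
have neg : (\int[mu]_x g^\- x <= \int[mu]_x (r x)%:E)%E.
 apply: ge0_le_integral => //; first exact: measurable_funeneg.
 move=> x _; rewrite funenegE /g ge_max lee_fin r0 andbT; have := f0 x; have := r0 x.
 case: (f x) => [y rx|rx _|//]; last by rewrite addye// leNye.
 by rewrite lee_fin => y0; rewrite -EFinB -EFinN lee_fin; lra.
rewrite integralE -/g.
have pos : (\int[mu]_x g^\+ x = +oo)%E.
 apply/eqP; rewrite -leye_eq; rewrite -fE leNgt; apply/negP => h.
 have : (\int[mu]_x f x <= \int[mu]_x g^\+ x + \int[mu]_x (r x)%:E)%E.
  rewrite -ge0_integralD//; last 2 first.
  - exact: measurable_funepos.
  - by move=> x _; rewrite lee_fin.
  apply: ge0_le_integral => //.
   by apply: emeasurable_funD => //; exact: measurable_funepos.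
  move=> x _; rewrite -leeBlDr//.
  by rewrite funeposE le_max lexx.
 rewrite fE leye_eq => /eqP h2; move: h; rewrite fE => h.
 have : (\int[mu]_x g^\+ x + \int[mu]_x (r x)%:E < +oo)%E by apply: lte_add_pinfty => //; exact: fr.
 by rewrite h2.
rewrite pos addye//.
have n0 : (0 <= \int[mu]_x g^\- x)%E by exact: integral_ge0.
have : (\int[mu]_x g^\- x < +oo)%E by exact: le_lt_trans fr.
by case: (\int[mu]_x g^\- x)%E n0.
Qed.

(** * Energy *)

Section kernel.
Variable R : realType.
Local Notation C := (R[i]).
Implicit Types z w : R * R.

Definition KK z w : \bar R := (logker z w + ((sqnorm z + sqnorm w) / 2)%:E)%E.

Lemma sqnorm_eq0 z : (sqnorm z == 0) = (z == 0).
Proof. by rewrite -nsq_tc nsq_eq0; apply/eqP/eqP => [h|->]; [rewrite -[z]tcK h|]. Qed.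

Lemma sqnormN z : sqnorm (- z) = sqnorm z.
Proof. by case: z => a b; rewrite /sqnorm /= !sqrrN. Qed.

Lemma sqnorm_subC z w : sqnorm (z - w) = sqnorm (w - z).
Proof. by rewrite -opprB sqnormN. Qed.

Lemma edistE z w : edist z w = Num.sqrt (sqnorm (z - w)).
Proof. by case: z; case: w. Qed.

Lemma logkerE z w : logker z w = if sqnorm (z - w) == 0 then +oo%E else (- (ln (sqnorm (z - w)) / 2))%:E.
Proof.
rewrite /logker sqnorm_eq0 subr_eq0; case: eqVneq => // zw; congr (- _)%:E.
rewrite edistE -[in RHS](sqr_sqrtr (sqnorm_ge0 (z - w))).
have s0 : 0 < Num.sqrt (sqnorm (z - w)) by rewrite sqrtr_gt0 lt_def sqnorm_ge0 sqnorm_eq0 subr_eq0 zw.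
by rewrite lnXn// mulr2n; field.
Qed.

Lemma logkerC z w : logker z w = logker w z.
Proof. by rewrite !logkerE sqnorm_subC. Qed.

Lemma KKC z w : KK z w = KK w z.
Proof. by rewrite /KK logkerC (addrC (sqnorm z)). Qed.

Lemma sqnorm_sub_le z w : sqnorm (z - w) <= 2 * (sqnorm z + sqnorm w).
Proof. case: z => a b; case: w => c d.
rewrite (_ : sqnorm ((a, b) - (c, d)) = (a - c) ^+ 2 + (b - d) ^+ 2)// /sqnorm /=.
by have := sqr_ge0 (a + c); have := sqr_ge0 (b + d); nra. Qed.

(** From [ln x <= x / 2 - 1 + ln 2 <= x / 2] at [x = |z - w|^2], together with
    [|z - w|^2 <= 2 (|z|^2 + |w|^2)]. *)
Lemma KK_ge0 z w : (0 <= KK z w)%E.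
Proof.
rewrite /KK logkerE; case: eqP => [_|/eqP h]; first by rewrite addye.
have s0 : 0 < sqnorm (z - w) by rewrite lt_def h sqnorm_ge0.
rewrite -EFinD lee_fin; have := le_ln1Dx (x := sqnorm (z - w) / 2 - 1).
have hs : 0 < sqnorm (z - w) / 2 by rewrite divr_gt0.
rewrite addrCA subrr addr0 => /(_ _) h1.
have h2 : ln (sqnorm (z - w)) <= sqnorm (z - w) / 2 - 1 + ln 2.
 rewrite {1}(_ : sqnorm (z - w) = sqnorm (z - w) / 2 * 2); last by field.
 rewrite lnM ?posrE// lerD2r; apply: h1; lra.
have h3 : ln 2 <= 1 :> R.
 by have := @le_ln1Dx R 1 ltac:(lra); rewrite (_ : 1 + 1 = 2 :> R)//; ring.
by have := sqnorm_sub_le z w; lra.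
Qed.

Lemma meas_logker d (T : measurableType d) (f g : T -> R * R) : measT f -> measT g ->
 measT (fun t => logker (f t) (g t)).
Proof.
move=> mf mg.
have ms : measT (fun t => sqnorm (f t - g t)).
 apply: (meas_ext (f := fun t => nsq (tc (f t) - tc (g t)))); last by move=> t; rewrite sqnorm_sub.
 apply: cmeas_nsq; apply: cmeasD; first exact: (cmeas_comp (@cmeas_tc R) mf).
 by apply: cmeasN; exact: (cmeas_comp (@cmeas_tc R) mg).
apply: (meas_ext (f := fun t => if sqnorm (f t - g t) == 0 then +oo%E else (- (ln (sqnorm (f t - g t)) / 2))%:E)); last by move=> t; rewrite logkerE.
apply: measurable_fun_ifT => //.
 apply: (@measurable_fun_bool _ _ _ _ true).
 rewrite (_ : _ @^-1` _ = (fun t => sqnorm (f t - g t)) @^-1` [set 0]); first exact: ms.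
 by apply/seteqP; split => t /= /eqP.
efin; apply: measurableT_comp => //; apply: measurable_funM => //.
exact: (meas_comp (@measurable_ln R)).
Qed.

Lemma meas_KK d (T : measurableType d) (f g : T -> R * R) : measT f -> measT g ->
 measT (fun t => KK (f t) (g t)).
Proof.
move=> mf mg; apply: emeasurable_funD; first exact: meas_logker.
efin; apply: measurable_funM => //; apply: measurable_funD; exact: meas_sqnorm.
Qed.

Lemma logker_KK z w : logker z w = (KK z w - ((sqnorm z + sqnorm w) / 2)%:E)%E.
Proof. by rewrite /KK addeK. Qed.

Section energy.
Variable mu : probability (R * R)%type R.
Hypothesis m2fin : (\int[mu]_z (sqnorm z)%:E < +oo)%E.

Lemma RmuE_fin : Rmu mu = (\int[mu]_z \int[mu]_w KK z w)%E.
Proof.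
have ms : measT (@sqnorm R) by exact: (meas_sqnorm (f := id)).
have ms' : measT (fun z => (sqnorm z)%:E : \bar R) by exact/measurable_EFinP.
have s0 z : (0 <= (sqnorm z)%:E :> \bar R)%E by rewrite lee_fin sqnorm_ge0.
have [m2 m2E] : exists m2 : R, (\int[mu]_z (sqnorm z)%:E)%E = m2%:E.
 have : (0 <= \int[mu]_z (sqnorm z)%:E)%E by exact: integral_ge0.
 by case: (\int[mu]_z _)%E m2fin => [x _ _|//|//]; exists x.
have m20 : 0 <= m2 by rewrite -lee_fin -m2E; exact: integral_ge0.
have hint (c : R) : 0 <= c -> (\int[mu]_w ((c + sqnorm w) / 2)%:E = ((c + m2) / 2)%:E)%E.
 move=> c0; transitivity (\int[mu]_w ((2^-1)%:E * (c%:E + (sqnorm w)%:E)))%E.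
  by apply: eq_integral => w _; rewrite -EFinD -EFinM mulrC.
 rewrite ge0_integralZl//; last 2 first.
 - by apply: emeasurable_funD => //; exact: measurable_cst.
 - by move=> w _; rewrite adde_ge0// lee_fin.
 rewrite ge0_integralD//.
 have ic : (\int[mu]__ c%:E = c%:E)%E.
  by rewrite (integral_cst mu measurableT) -[RHS]mule1; congr (_ * _)%E; exact: probability_setT.
 rewrite ic m2E -EFinD -EFinM; congr EFin; ring.
have hm (c : R) : measT (fun w : R * R => (c + sqnorm w) / 2).
 by apply: measurable_funM => //; exact: measurable_funD.
have inner z : (\int[mu]_w logker z w = \int[mu]_w KK z w - ((sqnorm z + m2) / 2)%:E)%E.
 rewrite -hint ?sqnorm_ge0// -int_sub_ge0//.
 - by apply: eq_integral => w _; rewrite logker_KK.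
 - exact: (meas_KK (f := fun=> z)).
 - by move=> w; exact: KK_ge0.
 - by move=> w; rewrite divr_ge0// addr_ge0 ?sqnorm_ge0.
 - by rewrite hint ?sqnorm_ge0// ltry.
rewrite /Rmu /log_energy; under eq_integral do rewrite inner.
have mP : measT (fun z => \int[mu]_w KK z w)%E.
 apply: (@meas_int_curry _ _ _ _ _ mu KK); last exact: KK_ge0.
 by apply: meas_KK; [exact: mfst|exact: msnd].
under eq_integral do rewrite (addrC (sqnorm _)).
rewrite int_sub_ge0//.
- rewrite hint// m2E (_ : (m2 + m2) / 2 = m2); last by field.
 by rewrite subeK.
- by move=> z; apply: integral_ge0 => w _; exact: KK_ge0.
- by move=> w; rewrite divr_ge0// addr_ge0 ?sqnorm_ge0.
- by rewrite hint// ltry.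
Qed.
End energy.
End kernel.

Section supports.
Variable R : realType.
Implicit Types mu : {measure set (R * R)%type -> \bar R}.

(** A Lindelof covering by rational balls. It is used for local properties inherited by subsets,
    such as being null. *)
Lemma rat_ball_cover (O : set (R * R)) (P : set (R * R) -> Prop) :
 (forall x, O x -> exists2 e : R, 0 < e & P (ball x e)) -> (forall A B, A `<=` B -> P B -> P A) ->
 exists B : nat -> set (R * R), [/\ forall i, measurable (B i), forall i, P (B i) \/ B i = set0 & O `<=` \bigcup_i B i].
Proof.
move=> HO mono.
pose B (i : nat) : set (R * R) := if unpickle i is Some (x, y, k) then
  let b := ball (ratr x : R, ratr y : R) k.+1%:R^-1 in if `[< P b >] then b else set0 else set0.
exists B; split.
- move=> i; rewrite /B; case: (unpickle i) => // -[[x y] k]; case: ifP => // _; exact: measurable_ball2.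
- move=> i; rewrite /B; case: (unpickle i) => [[[x y] k]|]; last by right.
 by cbv zeta; case: ifPn => [/asboolP|_]; [left|right].
move=> b /HO [rho rho0 H].
have [k hk] : exists k : nat, k.+1%:R^-1 < rho / 2.
 exists (Num.trunc (rho / 2)^-1); rewrite invf_plt ?posrE ?divr_gt0//; exact: truncnS_gt.
have k0 : 0 < k.+1%:R^-1 :> R by rewrite invr_gt0.
have [e eE] : exists e : R, e = k.+1%:R^-1 by eexists.
rewrite -eE in hk k0.
have l1 : b.1 - e < b.1 + e by lra.
have l2 : b.2 - e < b.2 + e by lra.
have [x] := rat_in_itvoo l1; have [y] := rat_in_itvoo l2.
rewrite !in_itv /= => /andP[y1 y2] /andP[x1 x2].
have gb : P (ball (ratr x : R, ratr y : R) e).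
 apply: mono H => c /ball2P /= [c1 c2]; apply/ball2P; split.
  by move: c1; rewrite !ltr_norml => /andP[c1 c1']; apply/andP; split; lra.
 by move: c2; rewrite !ltr_norml => /andP[c2 c2']; apply/andP; split; lra.
have bb : ball (ratr x : R, ratr y : R) e b.
 by apply/ball2P; split; rewrite ltr_norml /=; apply/andP; split; lra.
have [i iE] : exists i, unpickle i = Some (x, y, k) by exists (pickle (x, y, k)); exact: pickleK.
exists i; first exact: I.
by rewrite /B iE -eE; move: gb => /asboolP gb; cbv zeta; rewrite gb.
Qed.

Lemma closed_supp mu : closed (supp mu).
Proof.
rewrite -[supp mu]setCK; apply: open_closedC; rewrite openE => x /= /existsNP [e /not_implyP[e0 H]].
rewrite /interior; apply/nbhs_ballP; exists (e / 2); first by rewrite /= divr_gt0.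
move=> y xy /(_ (e / 2)); rewrite divr_gt0// => /(_ isT) h; apply: H; apply: lt_le_trans h _.
le_meas; try exact: measurable_ball2.
move=> z yz; rewrite (splitr e); exact: ball_triangle xy yz.
Qed.

Lemma suppC_null mu : mu (~` supp mu) = 0%E.
Proof.
have mC : measurable (~` supp mu) by apply: measurableC; apply: closed_measurable2; exact: closed_supp.
pose P (A : set (R * R)) := forall B, measurable B -> B `<=` A -> mu B = 0%E.
have [|A B AB PB D mD DA|B [mB PB cB]] := @rat_ball_cover (~` supp mu) P.
- move=> x /= /existsNP [e /not_implyP[e0 H]]; exists e => // D mD De.
 null_le.
 apply: le_trans (_ : mu (ball x e) <= 0)%E; last by rewrite leNgt; apply/negP.
 by le_meas => //; exact: measurable_ball2.
- by apply: PB => //; exact: subset_trans AB.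
have z i : mu (B i) = 0%E by case: (PB i) => [h|->]; [exact: h|rewrite measure0].
null_le.
have mU : measurable (\bigcup_i B i) by exact: bigcup_measurable.
apply: (@le_trans _ _ (mu (\bigcup_i B i))); first by le_meas.
apply: (@le_trans _ _ (\sum_(i <oo) mu (B i))%E); first exact: measure_sigma_subadditive.
by rewrite eseries0// => i _ _; exact: z.
Qed.

Lemma supp_sub mu F : closed F -> mu (~` F) = 0%E -> supp mu `<=` F.
Proof.
move=> cF F0 x sx; apply: contrapT => nF.
have oF : open (~` F) by exact: closed_openC.
move: (oF); rewrite openE => /(_ x nF) /nbhs_ballP [e /= e0 eF].
have := sx e e0; rewrite ltNge => /negP; apply; rewrite -F0.
by le_meas; [exact: measurable_ball2|exact: open_measurable2|].
Qed.

Lemma compact_box (M : R) (F : set (R * R)) : closed F -> (forall z, F z -> `|z| <= M) -> compact F.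
Proof.
move=> cF bF; apply: (@subclosed_compact _ _ (`[- M, M]%classic `*` `[- M, M]%classic)) => //.
 by apply: compact_setX; exact: segment_compact.
move=> [a b] /bF; rewrite (_ : `|(a, b)| = Num.max `|a| `|b|)// ge_max => /andP[h1 h2].
by split; rewrite /= in_itv /= -ler_norml.
Qed.

Lemma compact_bound (F : set (R * R)) : compact F -> exists2 M : R, 0 < M & forall z, F z -> sqnorm z <= M.
Proof.
move=> /compact_bounded [M0 [_ H]].
pose M := Num.max 1 (M0 + 1); have MM : M0 < M by rewrite lt_max ltrDl ltr01 orbT.
have M1 : 0 < M by rewrite lt_max ltr01.
exists (4 * M ^+ 2); first by rewrite mulr_gt0 ?exprn_gt0.
move=> z Fz; have := H M MM z Fz => /= h.
rewrite -nsq_tc normc_nsq; have := normc_le_norm z; have := normc_ge0 (tc z); have := normr_ge0 z; nra.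
Qed.
End supports.

Lemma sqr_le_bound (R : realType) (a b : R) : a ^+ 2 <= b -> 0 <= a -> a <= 1 + `|b|.
Proof. by move=> h a0; have := ler_norm b; have := normr_ge0 b; nra. Qed.

Section probs.
Variable R : realType.

Lemma probs_m2 (E : set (R * R)) (mu : probability (R * R)%type R) : probs_in E mu -> (\int[mu]_z (sqnorm z)%:E < +oo)%E.
Proof.
move=> [cs _]; have [M M0 HM] := compact_bound cs.
have ms : measT (fun z : R * R => (sqnorm z)%:E : \bar R) by efin; exact: (meas_sqnorm (f := id)).
have mS : measurable (supp mu) by apply: closed_measurable2; exact: closed_supp.
rewrite (@ge0_negligible_integral _ _ _ mu setT (~` supp mu))//; last 3 first.
- exact: measurableC.
- by move=> z _; rewrite lee_fin sqnorm_ge0.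
- exact: suppC_null.
rewrite setTD setCK; apply: (@le_lt_trans _ _ (\int[mu]_(z in supp mu) M%:E)%E).
 apply: ge0_le_integral => //.
 - by move=> z _; rewrite lee_fin sqnorm_ge0.
 - exact: measurable_funTS.
rewrite integral_cst//; apply: (@le_lt_trans _ _ (M%:E * 1)%E); last by rewrite mule1 ltry.
by apply: lee_wpmul2l; [rewrite lee_fin ltW|exact: probability_le1].
Qed.

Lemma RmuE (E : set (R * R)) (mu : probability (R * R)%type R) : probs_in E mu ->
 Rmu mu = (\int[mu]_z \int[mu]_w KK z w)%E.
Proof. by move=> /probs_m2; exact: RmuE_fin. Qed.

Lemma probs_inI (E F : set (R * R)) (M : R) (mu : probability (R * R)%type R) : closed F -> F `<=` E ->
 (forall z, F z -> sqnorm z <= M) -> mu (~` F) = 0%E -> probs_in E mu.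
Proof.
move=> cF FE bF F0; have sF := supp_sub cF F0; split; last exact: subset_trans FE.
apply: (@compact_box R (1 + `|M|)); first exact: closed_supp.
move=> z /sF /bF h; apply: le_trans (norm_le_normc z) _.
by apply: sqr_le_bound; [rewrite -normc_nsq nsq_tc|exact: normc_ge0].
Qed.

Lemma probs_null (E : set (R * R)) (mu : probability (R * R)%type R) A : probs_in E mu -> measurable A ->
 E `&` A = set0 -> mu A = 0%E.
Proof.
move=> [_ sE] mA EA; null_le; rewrite -(suppC_null mu); le_meas => //.
 by apply: measurableC; apply: closed_measurable2; exact: closed_supp.
by move=> z Az /sE Ez; have : (E `&` A) z by []; rewrite EA.
Qed.
End probs.

(** * The logarithm as a superposition of exponentials *)

Section frullani.
Variable R : realType.

Lemma int_expn (s : R) : 0 < s -> (\int[@leb1 R]_(t in `]0%R, +oo[) (expR (- (t * s)))%:E = (s^-1)%:E)%E.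
Proof.
move=> s0.
have mE : measT (fun t : R => (expR (- (t * s)))%:E).
 efin; apply: (meas_comp (@measurable_expR R)).
 by apply: measurableT_comp => //; exact: measurable_funM.
rewrite -int_leb1//; last exact: measurable_funTS.
rewrite integral_itv_obnd_cbnd; last exact: measurable_funTS.
have := integral_exponential_pdf s0.
have -> : (fun x => (exponential_pdf s x)%:E) = (fun x : R => s%:E * ((fun t => (expR (- (t * s)))%:E) \_ `[0%R, +oo[) x)%E.
 apply/funext => x; rewrite /exponential_pdf !patchE; case: ifP => _; last by rewrite mule0.
 by rewrite -EFinM mulNr (mulrC x).
rewrite ge0_integralZl//; last 3 first.
- by apply/(measurable_restrictT _ _).1 => //; exact: measurable_funTS.
- by move=> x _; rewrite patchE; case: ifP => // _; rewrite lee_fin expR_ge0.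
- exact: ltW.
rewrite -integral_mkcond => /(congr1 (fun y => (s^-1)%:E * y)%E).
by rewrite mule1 muleA -EFinM mulVf ?gt_eqF// mul1e.
Qed.

Definition phit (t x : R) : R := if 0 < t then (expR (- (t * x)) - expR (- t)) / t else 0.

Lemma phit_ge0 t x : x <= 1 -> 0 <= phit t x.
Proof.
move=> x1; rewrite /phit; case: ifP => // t0; rewrite divr_ge0 ?(ltW t0)// subr_ge0 ler_expR lerN2.
by rewrite ger_pMr.
Qed.

Lemma phitE t x : 0 < t -> x <= 1 -> (\int[@leb1 R]_(s in `[x, 1%R]) (expR (- (t * s)))%:E = (phit t x)%:E)%E.
Proof.
move=> t0; rewrite /phit t0 => x1'.
have cE : continuous (fun s : R => expR (- (t * s))).
 move=> s; apply: continuous_comp; last exact: continuous_expR.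
 by apply: continuousN; apply: mulrl_continuous.
rewrite -int_leb1//; last first.
 by apply: measurable_funTS; efin; apply: continuous_measurable_fun.
have D (s : R) : is_derive s (1 : R) (fun s => - (expR (- (t * s)) / t)) (expR (- (t * s))).
 apply: is_derive_eq; rewrite /GRing.scale /= ?mulr1.
 by field; rewrite gt_eqF.
move: x1'; rewrite le_eqVlt => /orP[/eqP->|x1].
 by rewrite mulr1 subrr mul0r set_itv1 (@integral_Sset1 R _ _ 1).
rewrite (@continuous_FTC2 R _ (fun s => - (expR (- (t * s)) / t)))//.
- by rewrite -EFinB; congr _%:E; rewrite mulr1 opprK mulrBl addrC.
- exact: continuous_subspaceT.
- split.
 + by move=> s _.
 + by apply: cvg_at_right_filter; apply: cvgN; apply: cvgMl; exact: cE.
 + by apply: cvg_at_left_filter; apply: cvgN; apply: cvgMl; exact: cE.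
- by move=> s _; rewrite derive1E derive_val.
Qed.

Lemma int_inv (x : R) : 0 < x -> x <= 1 -> (\int[@leb1 R]_(s in `[x, 1%R]) (s^-1)%:E = (- ln x)%:E)%E.
Proof.
move=> x0 x1'.
rewrite -int_leb1//; last first.
 by apply: measurable_funTS; efin; exact: (meas_invR (@measurable_id _ _ setT)).
move: x1'; rewrite le_eqVlt => /orP[/eqP->|x1].
 by rewrite ln1 oppr0 set_itv1 (@integral_Sset1 R _ _ 1).
have D (s : R) : 0 < s -> is_derive s (1 : R) (@ln R) (s^-1) by move=> s0; exact: is_derive1_ln.
rewrite (@continuous_FTC2 R _ (@ln R))//.
- by rewrite -EFinB ln1 sub0r.
- apply: continuous_in_subspaceT => s; rewrite inE/= in_itv/= => /andP[xs _].
 by apply: inv_continuous; rewrite gt_eqF// (lt_le_trans x0).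
- split.
 + by move=> s; rewrite in_itv/= => /andP[xs _]; have [] := D s (lt_trans x0 xs).
 + apply: cvg_at_right_filter; exact: continuous_ln.
 + apply: cvg_at_left_filter; exact: continuous_ln.
- by move=> s; rewrite in_itv/= => /andP[xs _]; rewrite derive1E; have := D s (lt_trans x0 xs) => ?; rewrite derive_val.
Qed.

Lemma meas_phit d (T : measurableType d) (f g : T -> R) : measT f -> measT g ->
 measT (fun u => phit (f u) (g u)).
Proof.
move=> mf mg; apply: measurable_fun_ifT.
- by apply: measurable_fun_ltr.
- apply: measurable_funM; last exact: meas_invR.
 apply: measurable_funB; apply: meas_expN => //.
 exact: measurable_funM.
- exact: measurable_cst.
Qed.

(** Both sides equal the integral of [exp(- t s)] over [t > 0] and [x <= s <= 1], taken in the two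
    orders. *)
Lemma frullani_pos (x : R) : 0 < x -> x <= 1 -> (\int[@leb1 R]_t (phit t x)%:E = (- ln x)%:E)%E.
Proof.
move=> x0 x1.
pose h (t s : R) : \bar R := (\1_(`[x, 1%R]%classic : set R) s * (\1_(`]0%R, +oo[%classic : set R) t * expR (- (t * s))))%:E.
have mh : measT (fun p : R * R => h p.1 p.2).
 efin; apply: measurable_funM.
  by apply: (@meas_comp _ _ _ _ _ _ (\1_(`[x, 1%R]%classic : set R) : R -> R)); [exact: measurable_indic|].
 apply: measurable_funM.
  by apply: (@meas_comp _ _ _ _ _ _ (\1_(`]0%R, +oo[%classic : set R) : R -> R)); [exact: measurable_indic|].
 apply: meas_expN => //; exact: measurable_funM.
have h0 p : (0 <= h p.1 p.2)%E by rewrite lee_fin !mulr_ge0 ?expR_ge0.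
have hE (A : set R) (f : R -> R) : (\int[@leb1 R]_t (\1_A t * f t)%:E = \int[@leb1 R]_(t in A) (f t)%:E)%E.
 rewrite [RHS]integral_mkcond; apply: eq_integral => t _; rewrite patchE indicE.
 by case: ifP => _; rewrite ?mul1r ?mul0r.
transitivity (\int[@leb1 R]_t \int[@leb1 R]_s h t s)%E.
 apply: eq_integral => t _; have [t0|t0] := ltP 0 t.
  rewrite -phitE// -hE; apply: eq_integral => s _.
  by rewrite /h [X in (_ * (X * _))%R]indicE mem_setE in_itv/= t0 mul1r.
 rewrite /phit ltNge t0/=; under eq_integral => s _.
  by rewrite /h [X in (_ * (X * _))%R]indicE mem_setE in_itv/= ltNge t0 mul0r mulr0; over.
 by rewrite integral0.
rewrite (@int_swap _ _ _ _ _ (@leb1 R) (@leb1 R) h)//; last by move=> t s; exact: (h0 (t, s)).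
transitivity (\int[@leb1 R]_s (\1_(`[x, 1%R]%classic : set R) s * s^-1)%:E)%E; last by rewrite hE int_inv.
apply: eq_integral => s _; rewrite /h indicE mem_setE in_itv/=.
have [/andP[xs _]|_] := boolP (x <= s <= 1); last first.
 by rewrite mul0r; under eq_integral do rewrite mul0r; rewrite integral0.
under eq_integral do rewrite mul1r.
by rewrite mul1r hE int_expn// (lt_le_trans x0).
Qed.

Definition negln (x : R) : \bar R := if x == 0 then +oo%E else (- ln x)%:E.

(** At 0 the integral dominates its value at [exp(- r)], which is [r], for every [r > 0]. *)
Lemma frullani (x : R) : 0 <= x -> x <= 1 -> (\int[@leb1 R]_t (phit t x)%:E = negln x)%E.
Proof.
rewrite /negln; case: eqP => [-> _ _|/eqP x0 x0']; last by apply: frullani_pos; rewrite lt_def x0 x0'.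
apply/eqyP => r r0.
apply: (@le_trans _ _ (\int[@leb1 R]_t (phit t (expR (- r)))%:E)%E).
 by rewrite frullani_pos ?expR_gt0 ?expR_le1 ?oppr_le0 ?(ltW r0)// expRK opprK.
apply: ge0_le_integral => //.
- by move=> t _; rewrite lee_fin phit_ge0// expR_le1 oppr_le0 ltW.
- by efin; exact: meas_phit.
- by efin; exact: meas_phit.
move=> t _; rewrite lee_fin /phit; case: ifP => // t0.
rewrite ler_pM2r ?invr_gt0// lerD2r ler_expR lerN2 mulr0 mulr_ge0 ?expR_ge0// ltW//.
Qed.
End frullani.

(** * Double integrals of nonnegative kernels *)

Section dblint.
Context d1 d2 (T1 : measurableType d1) (T2 : measurableType d2) (R : realType).
Variables (m1 : {sigma_finite_measure set T1 -> \bar R}) (m2 : {sigma_finite_measure set T2 -> \bar R}).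
Implicit Types f g : T1 -> T2 -> \bar R.

Definition dbl f := (\int[m1]_x \int[m2]_y f x y)%E.
Definition mk2 f := measT (fun z : T1 * T2 => f z.1 z.2) /\ forall x y, (0 <= f x y)%E.

Lemma dbl_ge0 f : mk2 f -> (0 <= dbl f)%E.
Proof. by move=> [_ f0]; apply: integral_ge0 => x _; apply: integral_ge0. Qed.

Lemma mk2_curry f x : mk2 f -> measT (f x).
Proof. by move=> [mf _]; exact: (meas_curry (f := f)). Qed.

Lemma mk2_int f : mk2 f -> measT (fun x => \int[m2]_y f x y)%E.
Proof. by move=> [mf f0]; exact: (meas_int_curry m2 (f := f)). Qed.

Lemma dblD f g : mk2 f -> mk2 g -> dbl (fun x y => f x y + g x y)%E = (dbl f + dbl g)%E.
Proof.
move=> hf hg; have [_ f0] := hf; have [_ g0] := hg; rewrite /dbl -ge0_integralD//.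
- by apply: eq_integral => x _; rewrite ge0_integralD//; exact: mk2_curry.
- by move=> x _; apply: integral_ge0.
- exact: mk2_int.
- by move=> x _; apply: integral_ge0.
- exact: mk2_int.
Qed.

Lemma dblZ (c : R) f : 0 <= c -> mk2 f -> dbl (fun x y => c%:E * f x y)%E = (c%:E * dbl f)%E.
Proof.
move=> c0 hf; have [_ f0] := hf; rewrite /dbl -ge0_integralZl//.
- by apply: eq_integral => x _; rewrite ge0_integralZl//; exact: mk2_curry.
- exact: mk2_int.
- by move=> x _; apply: integral_ge0.
Qed.

Lemma int_null d (T : measurableType d) (m : {measure set T -> \bar R}) (f g : T -> \bar R) (B : set T) : measurable B -> m (~` B) = 0%E ->
 measT f -> measT g -> (forall x, 0 <= f x)%E -> (forall x, 0 <= g x)%E ->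
 (forall x, B x -> f x = g x) -> (\int[m]_x f x = \int[m]_x g x)%E.
Proof.
move=> mB B0 mf mg f0 g0 fg; apply: ge0_ae_eq_integral => //.
exists (~` B); split => //; first exact: measurableC.
by move=> x /= h Bx; apply: h => _; exact: fg.
Qed.

Lemma dbl_null f g B1 B2 : measurable B1 -> measurable B2 -> m1 (~` B1) = 0%E -> m2 (~` B2) = 0%E ->
 mk2 f -> mk2 g -> (forall x y, B1 x -> B2 y -> f x y = g x y) -> dbl f = dbl g.
Proof.
move=> mB1 mB2 n1 n2 hf hg fg; have [_ f0] := hf; have [_ g0] := hg; apply: (@int_null _ _ m1 _ _ B1) => //.
- exact: mk2_int.
- exact: mk2_int.
- by move=> x; apply: integral_ge0.
- by move=> x; apply: integral_ge0.
- move=> x Bx; apply: (@int_null _ _ m2 _ _ B2) => //; try exact: mk2_curry.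
 by move=> y; exact: fg.
Qed.
End dblint.

Section dblprob.
Context d (T : measurableType d) (R : realType).
Implicit Types (m : probability T R) (f : T -> T -> \bar R).

Lemma int_prob_cst m (c : \bar R) : (\int[m]__ c = c)%E.
Proof. by rewrite (integral_cst m measurableT) -[RHS]mule1; congr (_ * _)%E; exact: probability_setT. Qed.

Lemma dbl_fst m1 m2 (f : T -> \bar R) : dbl m1 m2 (fun x _ => f x) = (\int[m1]_x f x)%E.
Proof. by apply: eq_integral => x _; rewrite int_prob_cst. Qed.

Lemma dbl_snd m1 m2 (f : T -> \bar R) : dbl m1 m2 (fun _ y => f y) = (\int[m2]_x f x)%E.
Proof. exact: int_prob_cst. Qed.

Lemma dbl_cst m1 m2 c : dbl m1 m2 (fun _ _ => c) = c.
Proof. by rewrite dbl_snd int_prob_cst. Qed.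

Lemma mk2_fst (f : T -> \bar R) : measT f -> (forall x, 0 <= f x)%E -> mk2 (fun x (_ : T) => f x).
Proof. by move=> mf f0; split => //; exact: (meas_comp mf). Qed.

Lemma mk2_snd (f : T -> \bar R) : measT f -> (forall x, 0 <= f x)%E -> mk2 (fun (_ : T) x => f x).
Proof. by move=> mf f0; split => //; exact: (meas_comp mf). Qed.

Lemma mk2_cst (c : R) : 0 <= c -> mk2 (fun (_ _ : T) => c%:E).
Proof. by move=> c0; split => // *; rewrite lee_fin. Qed.
End dblprob.

(** * Positive definiteness of the energy kernel *)

Section gaussker.
Variable R : realType.

Lemma ereal_cancel2 (e : R) (A B C : \bar R) : (0 <= A)%E -> (0 <= B)%E -> (0 <= C)%E ->
 (2%:E * (A + e%:E) <= B + e%:E + (C + e%:E))%E -> (2%:E * A <= B + C)%E.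
Proof.
case: A => [A| |]; case: B => [B| |]; case: C => [C| |] //= _ _ _.
- move=> h; have {}h : 2 * (A + e) <= B + e + (C + e) by rewrite -lee_fin.
 by have : 2 * A <= B + C by lra.
all: rewrite ?addye// ?addey// ?leey//.
all: by rewrite mulry gtr0_sg// mul1e.
Qed.

(** Transfers the inequality from the kernel [L] to the kernel [K] when they differ by finite terms
    depending on one variable only; infinite energies are covered by cases. *)
Lemma ereal_cancel3 (K11 K12 K22 L11 L12 L22 : \bar R) (a b c : R) :
 (0 <= K11)%E -> (0 <= K12)%E -> (0 <= K22)%E -> (0 <= L11)%E -> (0 <= L12)%E -> (0 <= L22)%E ->
 (2%:E * K22 + c%:E = L22 + (b%:E + b%:E))%E -> (2%:E * K11 + c%:E = L11 + (a%:E + a%:E))%E ->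
 (2%:E * K12 + c%:E = L12 + (a%:E + b%:E))%E -> (2%:E * L12 <= L11 + L22)%E -> (2%:E * K12 <= K11 + K22)%E.
Proof.
have i2 : (2%:E * +oo = +oo :> \bar R)%E by rewrite mulry gtr0_sg// mul1e.
case: K11 => [K11| |]//; case: K22 => [K22| |]// _ h12 _; rewrite ?addye// ?addey// ?leey// => + + +.
case: L11 => [L11| |]// _ + _; first case: L22 => [L22| |]//; rewrite ?addye// => h12' e1 e2.
 case: L12 h12' => [L12| |]// _ ; last by rewrite i2.
 case: K12 h12 => [K12| |]// _; rewrite ?i2// => e3 h.
 have {}h : 2 * L12 <= L11 + L22 by rewrite -lee_fin.
 have {}e1 : 2 * K22 + c = L22 + (b + b) by case: e1.
 have {}e2 : 2 * K11 + c = L11 + (a + a) by case: e2.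
 have {}e3 : 2 * K12 + c = L12 + (a + b) by case: e3.
 by have : 2 * K12 <= K11 + K22 by lra.
Qed.

Implicit Types (m : probability (R * R)%type R).

Lemma am_gm2 (a b : R) : 2 * (a * b) <= a * a + b * b.
Proof. by have := sqr_ge0 (a - b); lra. Qed.

Definition gk (c : R) (z w : R * R) : R := expR (- (c * sqnorm (z - w))).

Lemma meas_gk c d (T : measurableType d) (f g : T -> R * R) : measT f -> measT g ->
 measT (fun t => gk c (f t) (g t)).
Proof.
move=> mf mg; apply: meas_expN => //.
apply: measurable_funM => //; apply: meas_sqnorm.
by apply: meas_pairR; apply: measurable_funB; (apply: (meas_comp mfst) || apply: (meas_comp msnd)).
Qed.

Lemma mk2_gk c : mk2 (fun z w => (gk c z w)%:E).
Proof.
split; last by move=> z w; rewrite lee_fin expR_ge0.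
by efin; apply: meas_gk; [exact: mfst|exact: msnd].
Qed.

(** The parallelogram identity about the midpoint [m] of [z] and [w]: a Gaussian kernel is, up to a
    factor, a convolution of two narrower ones. *)
Lemma gk_conv c z w : 0 < c ->
 (\int[leb2]_y ((gk (2 * c) z y)%:E * (gk (2 * c) w y)%:E) = (pi / (4 * c) * gk c z w)%:E)%E.
Proof.
move=> c0; pose m : R * R := ((z.1 + w.1) / 2, (z.2 + w.2) / 2).
have mh : measT (fun y : R * R => (expR (- (4 * c * sqnorm y)))%:E).
 efin; apply: meas_expN => //.
 by apply: measurable_funM => //; exact: (meas_sqnorm (f := id)).
have h0 (y : R * R) : (0 <= (expR (- (4 * c * sqnorm y)))%:E)%E by rewrite lee_fin expR_ge0.
transitivity (\int[leb2]_y ((gk c z w)%:E * (expR (- (4 * c * sqnorm ((y.1 - m.1, y.2 - m.2) : R * R))))%:E))%E.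
 apply: eq_integral => y _; rewrite -!EFinM /gk -!expRD; congr (expR _)%:E.
 by rewrite /sqnorm /m /=; field.
rewrite ge0_integralZl ?lee_fin ?expR_ge0//; last first.
 apply: (@meas_comp _ _ _ _ _ _ (fun y : R * R => (expR (- (4 * c * sqnorm y)))%:E) (fun y : R * R => (y.1 - m.1, y.2 - m.2) : R * R) mh).
 by apply: meas_pairR; apply: measurable_funB.
rewrite (leb2_shift (- m) (f := fun y : R * R => (expR (- (4 * c * sqnorm y)))%:E))//.
have c4 : 0 < 4 * c by rewrite mulr_gt0.
have s0 : Num.sqrt (4 * c) != 0 by rewrite gt_eqF ?sqrtr_gt0.
have := @int_scl2 R (Num.sqrt (4 * c)) (fun y => (expR (- sqnorm y))%:E) s0.
rewrite int_sqgauss; have -> : (fun y => (expR (- sqnorm (scl2 (Num.sqrt (4 * c)) y)))%:E) = (fun y => (expR (- (4 * c * sqnorm y)))%:E).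
 by apply/funext => y; rewrite sqnorm_scl2 sqr_sqrtr ?(ltW c4).
move=> H; rewrite (mulrC _ (gk c z w)) EFinM; congr (_ * _)%E.
rewrite EFinM H; last 2 first.
- efin; apply: meas_expN => //.
 exact: (meas_sqnorm (f := id)).
- by move=> y; rewrite lee_fin expR_ge0.
by rewrite sqr_sqrtr ?(ltW c4)// muleAC -EFinM divff ?mul1e// gt_eqF.
Qed.

Lemma int_gk01 m c y : 0 < c -> exists2 a : R, 0 <= a & (\int[m]_z (gk c z y)%:E)%E = a%:E.
Proof.
move=> c0; have h1 : (\int[m]_z (gk c z y)%:E <= 1)%E.
 rewrite -(int_prob_cst m 1); apply: ge0_le_integral => //.
 - by move=> z _; rewrite lee_fin expR_ge0.
 - by efin; apply: meas_gk => //; exact: measurable_id.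
 - by move=> z _; rewrite lee_fin expR_le1 oppr_le0 mulr_ge0 ?sqnorm_ge0 ?ltW.
have h0 : (0 <= \int[m]_z (gk c z y)%:E)%E by apply: integral_ge0 => z _; rewrite lee_fin expR_ge0.
by case: (\int[m]_z _)%E h0 h1 => // a a0 _; exists a; rewrite -?lee_fin.
Qed.

(** The double integral becomes the scalar product in [L^2] of the smoothed measures; positivity is
    then the inequality [2 a b <= a^2 + b^2] under the integral. *)
Lemma dbl_gk m1 m2 c : 0 < c -> (dbl m1 m2 (fun z w => (gk c z w)%:E) =
 (4 * c / pi)%:E * \int[leb2]_y (\int[m1]_z (gk (2 * c) z y)%:E * \int[m2]_z (gk (2 * c) z y)%:E))%E.
Proof.
move=> c0; set u := gk (2 * c); have k0 : 0 <= 4 * c / pi by rewrite divr_ge0 ?pi_ge0// mulr_ge0// ltW.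
have u0 z y : (0 <= (u z y)%:E)%E by rewrite lee_fin expR_ge0.
have mu2 d (T : measurableType d) (f g : T -> R * R) : measT f -> measT g ->
  measT (fun t => (u (f t) (g t))%:E).
 by move=> mf mg; efin; exact: meas_gk.
have b0 (m : probability (R * R)%type R) y : (0 <= \int[m]_z (u z y)%:E)%E by exact: integral_ge0.
have mb (m : probability (R * R)%type R) : measT (fun y => \int[m]_z (u z y)%:E)%E.
 apply: (@meas_int_curry _ _ _ _ _ m (fun y z => (u z y)%:E)) => [|y z]; last exact: u0.
 by apply: mu2; [exact: msnd|exact: mfst].
pose F z w := (\int[leb2]_y ((u z y)%:E * (u w y)%:E))%E.
have mkF : mk2 F.
 split; last by move=> z w; apply: integral_ge0 => y _; exact: mule_ge0.
 apply: (@meas_int_curry _ _ _ _ _ (@leb2 R) (fun (p : (R * R) * (R * R)) (y : R * R) => ((u p.1 y)%:E * (u p.2 y)%:E)%E)) => [|p y]; last exact: mule_ge0.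
 apply: emeasurable_funM; apply: mu2; try exact: msnd.
  by apply: (meas_comp mfst); exact: mfst.
 by apply: (meas_comp msnd); exact: mfst.
transitivity ((4 * c / pi)%:E * dbl m1 m2 F)%E.
 rewrite -(dblZ m1 m2 k0 mkF); apply: eq_integral => z _; apply: eq_integral => w _.
 have p0 : (pi : R) != 0 by rewrite gt_eqF// pi_gt0.
 have c0' : c != 0 by rewrite gt_eqF.
 rewrite /F gk_conv// -EFinM; congr EFin; rewrite mulrA mulf_div (mulrC (4 * c)) divff ?mul1r// mulf_neq0// mulf_neq0//.
congr (_ * _)%E.
transitivity (\int[m1]_z \int[leb2]_y ((u z y)%:E * \int[m2]_w (u w y)%:E))%E.
 apply: eq_integral => z _; rewrite /F (@int_swap _ _ _ _ _ m2 (@leb2 R) (fun w y => (u z y)%:E * (u w y)%:E)%E); last 2 first.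
 - by apply: emeasurable_funM; apply: mu2.
 - by move=> w y; exact: mule_ge0.
 apply: eq_integral => y _; rewrite ge0_integralZl//; exact: (mu2 _ _ id (fun=> y)).
rewrite (@int_swap _ _ _ _ _ m1 (@leb2 R) (fun z y => (u z y)%:E * \int[m2]_w (u w y)%:E)%E); last 2 first.
- apply: emeasurable_funM; first exact: mu2.
 exact: (meas_comp (mb m2) msnd).
- by move=> z y; exact: mule_ge0.
apply: eq_integral => y _; rewrite ge0_integralZr//; exact: (mu2 _ _ id (fun=> y)).
Qed.

Lemma pd_gk m1 m2 c : 0 < c -> (2%:E * dbl m1 m2 (fun z w => (gk c z w)%:E) <=
  dbl m1 m1 (fun z w => (gk c z w)%:E) + dbl m2 m2 (fun z w => (gk c z w)%:E))%E.
Proof.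
move=> c0; have c20 : 0 < 2 * c by rewrite mulr_gt0.
rewrite !dbl_gk//; have k0 : 0 <= 4 * c / pi by rewrite divr_ge0 ?pi_ge0// mulr_ge0// ltW.
have b0 (m : probability (R * R)%type R) y : (0 <= \int[m]_z (gk (2 * c) z y)%:E)%E.
 by apply: integral_ge0 => z _; rewrite lee_fin expR_ge0.
have mb (m : probability (R * R)%type R) : measT (fun y => \int[m]_z (gk (2 * c) z y)%:E)%E.
 apply: (@meas_int_curry _ _ _ _ _ m (fun y z => (gk (2 * c) z y)%:E)) => [|y z]; last by rewrite lee_fin expR_ge0.
 by efin; apply: meas_gk; [exact: msnd|exact: mfst].
have bb (m m' : probability (R * R)%type R) y : (0 <= \int[m]_z (gk (2 * c) z y)%:E * \int[m']_z (gk (2 * c) z y)%:E)%E by exact: mule_ge0.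
have mbb (m m' : probability (R * R)%type R) : measT (fun y => \int[m]_z (gk (2 * c) z y)%:E * \int[m']_z (gk (2 * c) z y)%:E)%E.
 exact: emeasurable_funM.
rewrite muleCA -ge0_muleDr ?integral_ge0//; apply: lee_wpmul2l; first by rewrite lee_fin.
rewrite -ge0_integralZl// -ge0_integralD//; apply: ge0_le_integral => //.
- by move=> y _; rewrite mule_ge0.
- exact: emeasurable_funM.
- exact: emeasurable_funD.
move=> y _; have [a a0 ->] := int_gk01 m1 y c20; have [b b0' ->] := int_gk01 m2 y c20.
by rewrite -!EFinM -EFinD lee_fin; exact: am_gm2.
Qed.

(* On the disc of squared radius M, KK is up to the additive constant ln (4M) / 2 a superposition
  of Gaussian kernels and of functions of one variable. *)
Section pd.
Variables (m1 m2 : probability (R * R)%type R) (M : R).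
Let B : set (R * R) := [set z | sqnorm z <= M].
Hypotheses (M1 : 1 <= M) (B1 : m1 (~` B) = 0%E) (B2 : m2 (~` B) = 0%E).

Let mB : measurable B.
Proof.
rewrite (_ : B = setT `&` @sqnorm R @^-1` `]-oo, M]); first exact: (meas_sqnorm (f := id)).
by apply/seteqP; split => z /=; rewrite ?in_itv/= => // -[].
Qed.

(** The squared distance normalised to be at most 1 on [B], the range in which [frullani] applies;
    elsewhere it is cut off at 1 so that the kernels stay nonnegative. *)
Let x z w : R := sqnorm (z - w) / (4 * M).
Let M40 : 0 < 4 * M. Proof. by rewrite mulr_gt0// (lt_le_trans ltr01). Qed.
Let x0 z w : 0 <= x z w. Proof. by rewrite divr_ge0 ?sqnorm_ge0// ltW. Qed.
Let x1 z w : B z -> B w -> x z w <= 1.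
Proof.
rewrite /B/= => Bz Bw; rewrite /x ler_pdivrMr// mul1r (le_trans (sqnorm_sub_le _ _))//.
by move: Bz Bw; lra.
Qed.

Let phi t z w := (phit t (Num.min (x z w) 1))%:E.

Let mx d (T : measurableType d) (f g : T -> R * R) : measT f -> measT g ->
 measT (fun t => Num.min (x (f t) (g t)) 1).
Proof.
move=> mf mg; apply: measurable_minr => //; apply: measurable_funM => //; apply: meas_sqnorm.
by apply: meas_pairR; apply: measurable_funB; (apply: (meas_comp mfst) || apply: (meas_comp msnd)).
Qed.

Let phi0 t z w : (0 <= phi t z w)%E.
Proof. by rewrite lee_fin phit_ge0// ge_min lexx orbT. Qed.

Let mphi t : mk2 (phi t).
Proof.
split; last by move=> z w; exact: phi0.
efin; apply: meas_phit => //; apply: mx; [exact: mfst|exact: msnd].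
Qed.

(** The subtracted constant in [phit] contributes equally for all pairs of probability measures, so
    it cancels in the inequality below. *)
Lemma dbl_phi (m m' : probability (R * R)%type R) t : m (~` B) = 0%E -> m' (~` B) = 0%E -> 0 < t ->
 (dbl m m' (phi t) + (expR (- t) / t)%:E = (t^-1)%:E * dbl m m' (fun z w => (gk (t / (4 * M)) z w)%:E))%E.
Proof.
move=> n n' t0; have e0 : 0 <= expR (- t) / t by rewrite divr_ge0 ?expR_ge0 ?ltW.
have ti0 : 0 <= t^-1 by rewrite invr_ge0 ltW.
rewrite -{1}(dbl_cst m m' (expR (- t) / t)%:E) -dblD; [|exact: mphi|exact: mk2_cst].
rewrite -(dblZ m m' ti0 (mk2_gk _)).
apply: (@dbl_null _ _ _ _ _ m m' _ _ B B) => //.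
- split; last by move=> z w; rewrite adde_ge0.
 by apply: emeasurable_funD => //; case: (mphi t).
- split; last by move=> z w; rewrite mule_ge0// lee_fin expR_ge0.
 by apply: emeasurable_funM => //; case: (mk2_gk (t / (4 * M))).
move=> z w Bz Bw; rewrite /phi /gk -EFinD -EFinM min_l ?x1// /phit t0; congr EFin.
by rewrite -mulrDl subrK mulrC /x mulrA mulrAC.
Qed.

Lemma pd_phi t : (2%:E * dbl m1 m2 (phi t) <= dbl m1 m1 (phi t) + dbl m2 m2 (phi t))%E.
Proof.
have [t0|t0] := ltP 0 t; last first.
 have p0 : phi t = fun _ _ => 0%E by apply/funext => z; apply/funext => w; rewrite /phi /phit ltNge t0.
 by rewrite p0 !dbl_cst mule0 adde0.
have ti0 : 0 <= t^-1 by rewrite invr_ge0 ltW.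
pose g z w := (gk (t / (4 * M)) z w)%:E.
have kg : mk2 g by exact: mk2_gk.
have g0 m m' : (0 <= dbl m m' g)%E by exact: dbl_ge0.
have H : (2%:E * ((t^-1)%:E * dbl m1 m2 g) <= (t^-1)%:E * dbl m1 m1 g + (t^-1)%:E * dbl m2 m2 g)%E.
 rewrite muleCA -ge0_muleDr//; apply: lee_wpmul2l; first by rewrite lee_fin.
 exact: (pd_gk m1 m2 (divr_gt0 t0 M40)).
move: H; rewrite -(dbl_phi B1 B2 t0) -(dbl_phi B1 B1 t0) -(dbl_phi B2 B2 t0).
by apply: ereal_cancel2; exact: dbl_ge0.
Qed.

Let KL z w : B z -> B w ->
 (2%:E * KK z w + (ln (4 * M))%:E = negln (Num.min (x z w) 1%R) + ((sqnorm z)%:E + (sqnorm w)%:E))%E.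
Proof.
move=> Bz Bw; rewrite min_l ?x1// /negln /KK logkerE /x mulf_eq0 invr_eq0 (gt_eqF M40) orbF.
case: ifP => [_|/negbT zw]; first by rewrite !addye// mulry gtr0_sg// mul1e addye.
have s0 : 0 < sqnorm (z - w) by rewrite lt_def zw sqnorm_ge0.
transitivity ((2 * (- (ln (sqnorm (z - w)) / 2) + (sqnorm z + sqnorm w) / 2) + ln (4 * M))%:E) => //.
by rewrite ln_div ?posrE// -!EFinD; congr EFin; lra.
Qed.

Let mL : mk2 (fun z w => negln (Num.min (x z w) 1%R)).
Proof.
have E z w : negln (Num.min (x z w) 1%R) = (\int[@leb1 R]_t phi t z w)%E.
 by rewrite -frullani// ?ge_min ?lexx ?orbT// le_min x0 ler01.
split; last by move=> z w; rewrite E integral_ge0.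
apply: (@meas_ext _ _ _ _ (fun p => \int[@leb1 R]_t phi t p.1 p.2)%E); last by move=> p; rewrite E.
apply: (@meas_int_curry _ _ _ _ _ (@leb1 R) (fun p t => phi t p.1 p.2)) => // .
efin; apply: meas_phit; first exact: msnd.
by apply: mx; (apply: (meas_comp mfst) || apply: (meas_comp msnd)); exact: mfst.
Qed.

Let dblL (m m' : probability (R * R)%type R) : dbl m m' (fun z w => negln (Num.min (x z w) 1%R)) =
 (\int[@leb1 R]_t dbl m m' (phi t))%E.
Proof.
rewrite /dbl -(@int_swap _ _ _ _ _ m (@leb1 R) (fun z t => \int[m']_w phi t z w)%E); last 2 first.
- apply: (@meas_int_curry _ _ _ _ _ m' (fun p w => phi p.2 p.1 w)) => //.
 efin; apply: meas_phit.
  by apply: (meas_comp msnd); exact: mfst.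
 apply: mx; last exact: msnd.
 by apply: (meas_comp mfst); exact: mfst.
- by move=> z t; exact: integral_ge0.
apply: eq_integral => z _; rewrite (@int_swap _ _ _ _ _ (@leb1 R) m' (fun t w => phi t z w))//.
 by apply: eq_integral => w _; rewrite -frullani// ?ge_min ?lexx ?orbT// le_min x0 ler01.
efin; apply: meas_phit; first exact: mfst.
by apply: (@mx _ _ (fun=> z)) => //; exact: msnd.
Qed.

Let ms : measT (fun z : R * R => (sqnorm z)%:E : \bar R).
Proof. by efin; exact: (meas_sqnorm (f := id)). Qed.

Let mK : mk2 (@KK R).
Proof. by split; [apply: meas_KK; [exact: mfst|exact: msnd]|exact: KK_ge0]. Qed.

Let dblKL (m m' : probability (R * R)%type R) : m (~` B) = 0%E -> m' (~` B) = 0%E ->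
 (2%:E * dbl m m' (@KK R) + (ln (4 * M))%:E =
  dbl m m' (fun z w => negln (Num.min (x z w) 1%R)) + (\int[m]_z (sqnorm z)%:E + \int[m']_z (sqnorm z)%:E))%E.
Proof.
move=> n n'; have l0 : 0 <= ln (4 * M) by rewrite ln_ge0//; move: M1; lra.
have s0 z : (0 <= (sqnorm z)%:E :> \bar R)%E by rewrite lee_fin sqnorm_ge0.
have k1 := mk2_fst ms s0; have k2 := mk2_snd ms s0; have [mK' K0] := mK; have [mL' L0] := mL.
have k12 : mk2 (fun z w : R * R => (sqnorm z)%:E + (sqnorm w)%:E)%E.
 by split => [|z w]; [apply: emeasurable_funD; [exact: k1.1|exact: k2.1]|exact: adde_ge0].
rewrite -(dbl_fst m m') -(dbl_snd m m') -(dblD _ _ k1 k2) -dblD// -dblZ//.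
rewrite -[X in (_ + X)%E = _](dbl_cst m m') -dblD.
- apply: (@dbl_null _ _ _ _ _ m m' _ _ B B) => //.
 + by split => [|z w]; [apply: emeasurable_funD => //; exact: emeasurable_funM|rewrite adde_ge0 ?mule_ge0].
 + by split => [|z w]; [apply: emeasurable_funD => //; exact: k12.1|rewrite adde_ge0 ?L0//; exact: k12.2].
- by split => [|z w]; [exact: emeasurable_funM|exact: mule_ge0].
- exact: mk2_cst.
Qed.

Let int_bnd (m : probability (R * R)%type R) : m (~` B) = 0%E ->
 exists a : R, 0 <= a /\ (\int[m]_z (sqnorm z)%:E)%E = a%:E.
Proof.
move=> n; have s0 z : (0 <= (sqnorm z)%:E :> \bar R)%E by rewrite lee_fin sqnorm_ge0.
have h0 : (0 <= \int[m]_z (sqnorm z)%:E)%E by exact: integral_ge0.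
have h1 : (\int[m]_z (sqnorm z)%:E <= M%:E)%E.
 rewrite -(int_prob_cst m M%:E) (@int_null _ _ _ m _ (fun z => (Num.min (sqnorm z) M)%:E) B)//.
 - apply: ge0_le_integral => //.
  + by move=> z _; rewrite lee_fin le_min sqnorm_ge0 (le_trans ler01).
  + by efin; apply: measurable_minr => //; exact: (meas_sqnorm (f := id)).
  + by move=> z _; rewrite lee_fin ge_min lexx orbT.
 - by efin; apply: measurable_minr => //; exact: (meas_sqnorm (f := id)).
 - by move=> z; rewrite lee_fin le_min sqnorm_ge0 (le_trans ler01).
 - by move=> z Bz; rewrite min_l.
by case: (\int[m]_z _)%E h0 h1 => // a a0 _; exists a; rewrite -lee_fin.
Qed.

(** It turns a lower bound on the mutual energy with a candidate minimiser into a lower bound on the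
    energy of any competitor. *)
Lemma pd_KK : (2%:E * dbl m1 m2 (@KK R) <= dbl m1 m1 (@KK R) + dbl m2 m2 (@KK R))%E.
Proof.
have l0 : 0 <= ln (4 * M) by rewrite ln_ge0//; move: M1; lra.
have L : (2%:E * dbl m1 m2 (fun z w => negln (Num.min (x z w) 1%R)) <=
  dbl m1 m1 (fun z w => negln (Num.min (x z w) 1%R)) + dbl m2 m2 (fun z w => negln (Num.min (x z w) 1%R)))%E.
 have d0 m m' t : (0 <= dbl m m' (phi t))%E by exact: dbl_ge0.
 have md m m' : measT (fun t => dbl m m' (phi t)).
  apply: (@meas_int_curry _ _ _ _ _ m (fun t z => \int[m']_w phi t z w)%E) => [|t z]; last exact: integral_ge0.
  apply: (@meas_int_curry _ _ _ _ _ m' (fun p w => phi p.1 p.2 w)) => //.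
  efin; apply: meas_phit.
   by apply: (meas_comp mfst); exact: mfst.
  apply: mx; last exact: msnd.
  by apply: (meas_comp msnd); exact: mfst.
 rewrite !dblL -ge0_integralZl// -ge0_integralD//; apply: ge0_le_integral => //.
 - by move=> t _; exact: mule_ge0.
 - exact: emeasurable_funM.
 - exact: emeasurable_funD.
 - by move=> t _; exact: pd_phi.
have K0 m m' : (0 <= dbl m m' (@KK R))%E by exact: dbl_ge0.
have := dblKL B1 B2; have := dblKL B1 B1; have := dblKL B2 B2.
have [a [a0 ->]] : exists a : R, 0 <= a /\ (\int[m1]_z (sqnorm z)%:E)%E = a%:E by exact: int_bnd.
have [b [b0 ->]] : exists a : R, 0 <= a /\ (\int[m2]_z (sqnorm z)%:E)%E = a%:E by exact: int_bnd.
move=> e1 e2 e3; apply: ereal_cancel3 e1 e2 e3 L => //; exact: dbl_ge0.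
Qed.
End pd.
End gaussker.

(** * The circular law *)

Section discs.
Variable R : realType.
Notation C := R[i].

Lemma meas_sqn : measT (@sqnorm R).
Proof. exact: (meas_sqnorm (f := id)). Qed.

Definition dsc (u : R) : set (R * R) := [set w | sqnorm w < u].

Lemma meas_dsc u : measurable (dsc u).
Proof.
rewrite (_ : dsc u = setT `&` @sqnorm R @^-1` `]-oo, u[); first exact: meas_sqn.
by apply/seteqP; split => z /=; rewrite /dsc/= ?in_itv/= => // -[].
Qed.

Lemma mem_dsc u w : (w \in dsc u) = (sqnorm w < u).
Proof. by apply/idP/idP; rewrite inE. Qed.

Lemma int_mulind d (T : measurableType d) (m : {measure set T -> \bar R}) (A : set T) (f : T -> \bar R) :
 (\int[m]_(t in A) f t = \int[m]_t ((\1_A t)%:E * f t))%E.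
Proof.
rewrite integral_mkcond; apply: eq_integral => t _; rewrite patchE indicE.
by case: ifP => _; rewrite ?mul1e ?mul0e.
Qed.

Lemma leb2_dsc u : 0 < u -> leb2 (dsc u) = (u%:E * leb2 (dsc 1))%E.
Proof.
move=> u0; have s0 : Num.sqrt u != 0 by rewrite gt_eqF ?sqrtr_gt0.
rewrite -(int_indic (meas_dsc u)) -(int_indic (meas_dsc 1)) (int_scl2 s0)//; last first.
 by efin; exact: measurable_indic (meas_dsc u).
rewrite sqr_sqrtr ?ltW//; congr (_ * _)%E; apply: eq_integral => z _; rewrite !indicE; congr (nat_of_bool _)%:R%:E.
by apply/idP/idP; rewrite !inE /dsc/= sqnorm_scl2 sqr_sqrtr ?(ltW u0)// gtr_pMr.
Qed.

Lemma dsc1_fin : exists2 a : R, 0 <= a & leb2 (dsc 1) = a%:E.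
Proof.
have h1 : (leb2 (dsc 1) <= ((2 * 1) ^+ 2)%:E)%E.
 rewrite -(leb2_ball 0 ler01); le_meas; [exact: meas_dsc|exact: measurable_ball2|].
 move=> z /=; rewrite /dsc/= => z1; apply/ball2P; rewrite /= !sub0r !normrN.
 have h (x y : R) : x ^+ 2 + y ^+ 2 < 1 -> `|x| < 1.
  move=> /(le_lt_trans _) h; rewrite -(@ltr_pXn2r _ 2) ?nnegrE// expr1n real_normK ?num_real//.
  by apply: h; rewrite lerDl sqr_ge0.
 by split; [exact: h z1|rewrite (h _ z.1)// addrC].
have h0 : (0 <= leb2 (dsc 1))%E by exact: measure_ge0.
by case: (leb2 (dsc 1)) h1 h0 => // a _ a0; exists a; rewrite -?lee_fin.
Qed.

(** Equal to [- ln x] for [0 < x <= 1]; as an integral it is nonnegative for [x >= 0], where Tonelli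
    applies without separating cases. *)
Definition Einv (x : R) : \bar R := (\int[@leb1 R]_(s in `]x, 1%R]) (s^-1)%:E)%E.

Lemma mEinv : measT (fun s : R => (s^-1)%:E : \bar R).
Proof. by efin; exact: (meas_invR (@measurable_id _ _ setT)). Qed.

Lemma EinvE x : 0 < x -> x <= 1 -> Einv x = (- ln x)%:E.
Proof.
move=> x0 x1; rewrite -int_inv// /Einv -!int_leb1 ?integral_itv_obnd_cbnd//; by apply: measurable_funTS; exact: mEinv.
Qed.

Lemma meas_lt d (T : measurableType d) (f : T -> R) u : measT f -> measurable [set t | f t < u].
Proof.
move=> mf; rewrite (_ : [set t | f t < u] = setT `&` f @^-1` `]-oo, u[); first exact: mf.
by apply/seteqP; split => z /=; rewrite ?in_itv/= => // -[].
Qed.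

(** If [f] has the distribution of [a] times a uniform variable law on [[0, 1]], exchanging
    integrals leaves the integral of [(a u) / u] over [x < u <= 1]. *)
Lemma int_Einv d (T : measurableType d) (m : {sigma_finite_measure set T -> \bar R}) (D : set T) (f : T -> R) (a x : R) :
 measurable D -> measT f -> 0 <= a -> 0 <= x -> x <= 1 ->
 (forall u, 0 < u -> u <= 1 -> m (D `&` [set t | f t < u]) = (a * u)%:E) ->
 (\int[m]_(t in D) Einv (Num.max x (f t)) = (a * (1 - x))%:E)%E.
Proof.
move=> mD mf a0 x0 x1 H.
pose k (u : R) := \1_(`]x, 1%R]%classic : set R) u * u^-1.
have k0 u : 0 <= k u.
 rewrite /k indicE mem_setE in_itv/=; case: (boolP (x < u <= 1)) => [/andP[xu _]|_]; last by rewrite mul0r.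
 by rewrite mul1r invr_ge0 (le_trans x0)// ltW.
have mk : measT k.
 by apply: measurable_funM; [exact: measurable_indic|exact: (meas_invR (@measurable_id _ _ setT))].
pose h t u : \bar R := if f t < u then (\1_D t * k u)%:E else 0%E.
have h0 t u : (0 <= h t u)%E by rewrite /h; case: ifP => // _; rewrite lee_fin mulr_ge0.
have mh : measT (fun p : T * R => h p.1 p.2).
 apply: measurable_fun_ifT; [|efin; apply: measurable_funM|exact: measurable_cst].
 - by apply: measurable_fun_ltr; [exact: (meas_comp mf mfst)|exact: msnd].
 - by apply: (@meas_comp _ _ _ _ _ _ (\1_D : T -> R)); [exact: measurable_indic|exact: mfst].
 - exact: (meas_comp mk msnd).
transitivity (\int[m]_t \int[@leb1 R]_u h t u)%E.
 rewrite int_mulind; apply: eq_integral => t _; rewrite /Einv int_mulind.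
 have m1 : measT (fun u : R => (\1_(`]Num.max x (f t), 1%R]%classic : set R) u)%:E * (u^-1)%:E)%E.
  by apply: emeasurable_funM; [efin; exact: measurable_indic|exact: mEinv].
 have p1 u : (0 <= (\1_(`]Num.max x (f t), 1%R]%classic : set R) u)%:E * (u^-1)%:E :> \bar R)%E.
  rewrite -EFinM lee_fin indicE mem_setE in_itv/=; case: (boolP (_ < u <= 1)) => [/andP[xu _]|_]; last by rewrite mul0r.
  by rewrite mul1r invr_ge0 (le_trans x0)// ltW// (le_lt_trans _ xu)// le_max lexx.
 rewrite -ge0_integralZl//.
 apply: eq_integral => u _; rewrite /h /k -!EFinM [X in (_ * (X * _))%:E]indicE [X in if _ then (_ * (X * _))%:E else _]indicE !mem_setE !in_itv/= gt_max.
 by case: (f t < u); rewrite ?andbT// andbF/= mul0r mulr0.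
rewrite (@int_swap _ _ _ _ _ m (@leb1 R) h)//.
transitivity (\int[@leb1 R]_(u in `]x, 1%R]) a%:E)%E; last first.
 by rewrite integral_cst// EFinM; congr (_ * _)%E; rewrite [LHS]leb1_itv/= lte_fin;
  move: x1; rewrite le_eqVlt => /orP[/eqP->|->]; rewrite ?ltxx ?subrr// -EFinB.
rewrite [RHS]int_mulind; apply: eq_integral => u _.
transitivity (\int[m]_t ((k u)%:E * (\1_(D `&` [set t | f t < u]) t)%:E))%E.
 apply: eq_integral => t _; rewrite /h !indicE in_setI.
 have -> : (t \in [set t | f t < u]) = (f t < u) by apply/idP/idP; rewrite inE.
 by case: (f t < u); rewrite ?andbT ?andbF ?mule0// -EFinM mulrC.
have mDu : measurable (D `&` [set t | f t < u]) by apply: measurableI => //; exact: meas_lt.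
have mI : measT (fun t => (\1_(D `&` [set t | f t < u]) t)%:E : \bar R) by efin; exact: measurable_indic.
rewrite ge0_integralZl ?lee_fin//.
rewrite integral_indic// setIT /k indicE mem_setE in_itv/=.
have [/andP[xu u1]|_] := boolP (x < u <= 1); last by rewrite mul0r !mul0e.
have u0 : 0 < u by exact: le_lt_trans xu.
by rewrite H// mul1r mul1e -EFinM mulrCA mulVf ?mulr1// gt_eqF.
Qed.

Lemma int01_negln : (\int[@leb1 R]_(t in `]0%R, 1%R[) (- ln t)%:E = 1)%E.
Proof.
transitivity (\int[@leb1 R]_(t in `]0%R, 1%R[) Einv (Num.max 0%R (id t)))%E.
 apply: eq_integral => t; rewrite inE/= in_itv/= => /andP[t0 t1].
 by rewrite max_r ?(ltW t0)// EinvE// ltW.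
rewrite (@int_Einv _ _ (@leb1 R) `]0%R, 1%R[%classic id 1 0)//.
 by rewrite subr0 mul1r.
move=> u u0 u1; rewrite mul1r; transitivity (@leb1 R `]0, u[%classic); last by rewrite leb1_itv/= lte_fin u0 -EFinB subr0.
congr leb1; apply/seteqP; split => t /=; rewrite !in_itv/=; first by move=> [/andP[-> _] ->].
by move=> /andP[-> tu]; rewrite tu (lt_le_trans tu).
Qed.

(** The value is extracted from the Gaussian integral: the superlevel sets of [exp(- |z|^2)] are
    discs of squared radius [- ln t], so [pi] equals the area of the unit disc times the integral of
    [- ln t] over []0, 1[], which is 1. *)
Lemma leb2_dsc1 : leb2 (dsc 1) = pi%:E.
Proof.
have [a a0 aE] := dsc1_fin; rewrite -[RHS]int_sqgauss aE.
have mg : measT (fun z : R * R => (expR (- sqnorm z))%:E).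
 by efin; apply: meas_expN => //; exact: meas_sqn.
have := @layer_cake _ _ R (@leb2 R) (fun z : R * R => (expR (- sqnorm z))%:E) (cst 1%E) mg (measurable_cst _).
have e0 (z : R * R) : (0 <= (expR (- sqnorm z))%:E)%E by rewrite lee_fin expR_ge0.
have c0 (z : R * R) : (0 <= cst 1%E z :> \bar R)%E by [].
move=> /(_ e0 c0); under eq_integral do rewrite mule1.
move=> ->; rewrite -[LHS]mule1 -[X in (_ * X)%E = _]int01_negln -ge0_integralZl//; last 2 first.
- by apply: measurable_funTS; efin; apply: measurableT_comp => //; exact: measurable_ln.
- by move=> t /=; rewrite in_itv/= => /andP[_ t1]; rewrite lee_fin oppr_ge0 ln_le0// ltW.
rewrite int_mulind.
have E t : t != 0 -> ((\1_(`]0%R, 1%R[%classic : set R) t)%:E * (a%:E * (- ln t)%:E) =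
  \int[leb2]_(x in [set x : R * R | (0 <= t)%R /\ (t%:E < (expR (- sqnorm x))%:E)%E]) cst 1 x)%E.
 move=> t0; rewrite indicE mem_setE in_itv/=; have [/andP[tp t1]|tn] := boolP (0 < t < 1).
  have hI : (\int[leb2]_(_ in dsc (- ln t)) 1 = leb2 (dsc (- ln t)))%E by rewrite integral_cst ?mul1e//; exact: meas_dsc.
  rewrite (_ : [set x | _] = dsc (- ln t)); first by rewrite hI leb2_dsc ?aE ?oppr_gt0 ?ln_lt0 ?tp// mul1e muleC.
  apply/seteqP; split => x /=; rewrite /dsc/= lte_fin (ltW tp) -[X in X < expR _]lnK ?posrE// ltr_expR; first by move=> [_]; rewrite ltrNr.
  by rewrite ltrNr.
 rewrite mul0e (_ : [set x | _] = set0) ?integral_set0//; apply/seteqP; split => x //= -[tp].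
 rewrite lte_fin => te; move/negP: tn; apply; rewrite lt_def t0 tp/=.
 by rewrite (lt_le_trans te)// expR_le1 oppr_le0 sqnorm_ge0.
set F := fun t : R => (\int[leb2]_(x in [set x : R * R | (0 <= t)%R /\ (t%:E < (expR (- sqnorm x))%:E)%E]) cst 1 x)%E in E *.
set G := fun t : R => ((\1_(`]0%R, 1%R[%classic : set R) t)%:E * (a%:E * (- ln t)%:E))%E in E *.
have mG : measT G.
 apply: emeasurable_funM; first by efin; exact: measurable_indic.
 apply: emeasurable_funM => //; efin; apply: measurableT_comp => //; exact: measurable_ln.
have mF : measT F.
 apply: (meas_ext (f := fun t : R => if t == 0 then F 0%R else G t)); last by move=> t; case: eqP => [->//|/eqP /E].
 apply: measurable_fun_ifT => //; apply: (@measurable_fun_bool _ _ _ _ true).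
 by rewrite (_ : _ @^-1` _ = [set 0%R]) ?setTI//; apply/seteqP; split => t /= /eqP.
apply/esym; apply: (@int_null _ _ _ _ F G (~` [set 0%R])).
- exact: measurableC.
- by rewrite setCK; exact: (@lebesgue_measure_set1 R 0%R).
- exact: mF.
- exact: mG.
- by move=> t; apply: integral_ge0.
- move=> t; rewrite /G indicE mem_setE in_itv/=; case: (boolP (0 < t < 1)) => [/andP[_ t1]|_]; last by rewrite mul0e.
 by rewrite mul1e -EFinM lee_fin mulr_ge0// oppr_ge0 ln_le0// ltW.
- by move=> t /eqP /E.
Qed.

Lemma leb2_dscE u : 0 <= u -> leb2 (dsc u) = (pi * u)%:E.
Proof.
rewrite le_eqVlt => /orP[/eqP<-|u0]; last by rewrite leb2_dsc// leb2_dsc1 -EFinM mulrC.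
rewrite (_ : dsc 0 = set0) ?measure0 ?mulr0//; apply/seteqP; split => w //=.
by rewrite /dsc/= ltNge sqnorm_ge0.
Qed.

Lemma circle_null (c : R) : measurable [set w | sqnorm w = c] /\ leb2 [set w | sqnorm w = c] = 0%E.
Proof.
have mC : measurable [set w : R * R | sqnorm w = c].
 rewrite (_ : [set w | _] = setT `&` @sqnorm R @^-1` [set c]); first exact: meas_sqn.
 by apply/seteqP; split => z //= -[].
split => //; have [c0|c0] := ltP c 0.
 rewrite (_ : [set w | _] = set0) ?measure0//; apply/seteqP; split => w //= h.
 by move: c0; rewrite -h ltNge sqnorm_ge0.
have p0 := @pi_gt0 R.
null_le; apply/lee_addgt0Pr => e e0; rewrite add0e.
pose d := e / pi; have d0 : 0 < d by rewrite divr_gt0// pi_gt0.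
have sub : (leb2 [set w : R * R | sqnorm w = c] + leb2 (dsc c) <= leb2 (dsc (c + d)))%E.
 rewrite -measureU//; [|exact: meas_dsc|].
  le_meas; [apply: measurableU => //; exact: meas_dsc|exact: meas_dsc|].
  by rewrite /dsc => w /= [->|h]; rewrite ?ltrDl// (lt_trans h)// ltrDl.
 by apply/seteqP; split => w //=; rewrite /dsc/= => -[->]; rewrite ltxx.
move: sub; rewrite !leb2_dscE// ?addr_ge0 ?(ltW d0)//.
have : (0 <= leb2 [set w : R * R | sqnorm w = c])%E by exact: measure_ge0.
case: (leb2 _) => // x _ h; have {}h : x + pi * c <= pi * (c + d) by rewrite -lee_fin.
have : x <= e by move: h; rewrite mulrDr /d mulrCA divff ?mulr1 ?gt_eqF//; lra.
by rewrite -lee_fin.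
Qed.

Local Notation D := (dsc 1).

Lemma int_D_cst (c : R) : (\int[leb2]_(w in D) c%:E = (pi * c)%:E)%E.
Proof.
have := leb2_dscE ler01; rewrite mulr1 => e.
rewrite integral_cst ?EFinM; [rewrite muleC; congr (_ * _)%E; exact: e|exact: meas_dsc].
Qed.

Lemma int_D_Einv s : 0 <= s -> s <= 1 -> (\int[leb2]_(w in D) Einv (Num.max s (sqnorm w)) = (pi * (1 - s))%:E)%E.
Proof.
move=> s0 s1; apply: int_Einv => //; [exact: meas_dsc|exact: meas_sqn|exact: pi_ge0|].
move=> u u0 u1; rewrite -(leb2_dscE (ltW u0)); congr leb2; apply/seteqP; split => w /=; first by case.
by rewrite /dsc/= => h; split => //; rewrite (lt_le_trans h).
Qed.

Lemma int_D_sq : (\int[leb2]_(w in D) (sqnorm w)%:E = (pi / 2)%:E)%E.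
Proof.
pose h (w : R * R) (u : R) : \bar R := if sqnorm w < u then (\1_(`]0%R, 1%R]%classic : set R) u)%:E else 0%E.
have h0 w u : (0 <= h w u)%E by rewrite /h; case: ifP => // _; rewrite lee_fin.
have mh : measT (fun p : (R * R) * R => h p.1 p.2).
 apply: measurable_fun_ifT; [|efin|exact: measurable_cst].
 - by apply: measurable_fun_ltr; [exact: (meas_comp meas_sqn mfst)|exact: msnd].
 - apply: (@meas_comp _ _ _ _ _ _ (\1_(`]0%R, 1%R]%classic : set R) : R -> R)); [exact: measurable_indic|exact: msnd].
have half : (\int[@leb1 R]_(u in `]0%R, 1%R]) u%:E = (2^-1)%:E)%E.
 rewrite -int_leb1//.
 rewrite integral_itv_obnd_cbnd; last by efin; exact: measurable_id.
 have D2 (s : R) : is_derive s (1 : R) (fun s => s ^+ 2 / 2) s.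
  by apply: is_derive_eq; rewrite /GRing.scale /= ?mulr1; field.
 have c2 (s : R) : {for s, continuous (fun s : R => s ^+ 2 / 2)}.
  by apply: differentiable_continuous; apply/derivable1_diffP; case: (D2 s).
 rewrite (@continuous_FTC2 R _ (fun s => s ^+ 2 / 2))//.
 - by rewrite expr1n mul1r expr0n mul0r sube0.
 - by apply: continuous_subspaceT => x; exact: cvg_id.
 - split; [by move=> s _; case: (D2 s)|apply: cvg_at_right_filter; exact: c2|apply: cvg_at_left_filter; exact: c2].
 - by move=> s _; rewrite derive1E; have := D2 s => ?; rewrite derive_val.
have E : (\int[leb2]_(w in D) (1 - sqnorm w)%:E = (pi / 2)%:E)%E.
 transitivity (\int[leb2]_w \int[@leb1 R]_u h w u)%E.
  rewrite int_mulind; apply: eq_integral => w _; rewrite indicE mem_dsc; case: ltP => w1.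
   rewrite mul1e; transitivity (leb1 `]sqnorm w, 1%R]%classic); first by rewrite leb1_itv/= lte_fin w1.
   rewrite -[X in leb1 X]setIT -integral_indic//; apply: eq_integral => u _; rewrite /h !indicE !mem_setE !in_itv/=.
   by case: ifP => // wu; rewrite (le_lt_trans _ wu) ?sqnorm_ge0.
  rewrite mul0e; apply/esym; apply: integral0_eq => u _; rewrite /h indicE mem_setE in_itv/=.
  case: ifP => // wu; rewrite (_ : (u <= 1) = false) ?andbF//; apply/negbTE; rewrite -ltNge (le_lt_trans _ wu)//.
 rewrite (@int_swap _ _ _ _ _ (@leb2 R) (@leb1 R) h)// [RHS]EFinM -half -ge0_integralZl//; last 2 first.
 - by move=> u /=; rewrite in_itv/= => /andP[u0 _]; rewrite lee_fin ltW.
 - by rewrite lee_fin pi_ge0.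
 rewrite [RHS]int_mulind; apply: eq_integral => u _; rewrite indicE mem_setE in_itv/=.
 have [/andP[u0 u1]|un] := boolP (0 < u <= 1); last first.
  by rewrite mul0e; apply: integral0_eq => w _; rewrite /h indicE mem_setE in_itv/= (negbTE un) if_same.
 rewrite mul1e -EFinM -(leb2_dscE (ltW u0)) -[X in _ = leb2 X]setIT -integral_indic; [|exact: measurableT|exact: meas_dsc].
 apply: eq_integral => w _; rewrite /h !indicE mem_setE in_itv/= u0 u1.
 by rewrite mem_dsc; case: ltP.
have := int_D_cst 1; have -> : (\int[leb2]_(w in D) 1%:E = \int[leb2]_(w in D) ((sqnorm w)%:E + (1 - sqnorm w)%:E))%E.
 by apply: eq_integral => w _; rewrite -EFinD addrC subrK.
rewrite ge0_integralD//; last 5 first.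
- exact: meas_dsc.
- by move=> w _; rewrite lee_fin sqnorm_ge0.
- by apply: measurable_funTS; efin; exact: meas_sqn.
- by move=> w; rewrite /dsc/= lee_fin subr_ge0 => /ltW.
- by apply: measurable_funTS; efin; apply: measurable_funB => //; exact: meas_sqn.
rewrite E; have : (0 <= \int[leb2]_(w in D) (sqnorm w)%:E)%E by apply: integral_ge0 => w _; rewrite lee_fin sqnorm_ge0.
case: (\int[leb2]_(w in D) _)%E => // x _ [] xh; congr EFin; move: xh; lra.
Qed.

Lemma prod_seq_const (I : Type) (s : seq I) (c : C) : \prod_(i <- s) c = c ^+ size s.
Proof. by elim: s => [|a s IH]; rewrite ?big_nil ?expr0// big_cons IH -exprS. Qed.

Lemma unity_roots k : (0 < k)%N -> exists2 rs : seq C, size rs = k &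
 (forall r, r \in rs -> nsq r = 1) /\ (forall z w : C, \prod_(r <- rs) (z - r * w) = z ^+ k - w ^+ k).
Proof.
move=> k0; have [rs rsE] := closed_field_poly_normal ('X^k - 1 : {poly C}).
have sP : size ('X^k - 1 : {poly C}) = k.+1 by rewrite size_XnsubC.
have lP : lead_coef ('X^k - 1 : {poly C}) = 1 by exact: (monicP (monicXnsubC 1 k0)).
move: rsE; rewrite lP scale1r => rsE.
have srs : size rs = k by move: sP; rewrite rsE size_prod_XsubC => -[].
exists rs => //; split=> [r rin|z w].
 have : root ('X^k - 1 : {poly C}) r by rewrite rsE root_prod_XsubC.
 rewrite /root !hornerE subr_eq0 => /eqP /(congr1 (@nsq R)); rewrite nsqX nsq1 => /eqP.
 by rewrite pexpr_eq1 ?nsq_ge0// => /eqP.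
have [->|w0] := eqVneq w 0.
 rewrite expr0n eqn0Ngt k0/= subr0; under eq_bigr do rewrite mulr0 subr0.
 by rewrite prod_seq_const srs.
have : ('X^k - 1 : {poly C}).[z / w] = \prod_(r <- rs) (z / w - r).
 by rewrite rsE horner_prod; apply: eq_bigr => r _; rewrite !hornerE.
rewrite !hornerE => /(congr1 ( *%R (w ^+ k))).
rewrite mulrBr mulr1 expr_div_n mulrCA divff ?expf_neq0// mulr1 => ->.
have -> : w ^+ k = \prod_(r <- rs) w by rewrite prod_seq_const srs.
rewrite -big_split/=; apply: eq_bigr => r _.
by rewrite mulrBr mulrCA divff// mulr1 (mulrC w).
Qed.

Lemma rot_bound (a b q : R) k (z w : C) : (0 < k)%N -> normc z = a -> normc w = b -> 0 <= q -> q < 1 ->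
 Num.min a b <= q * Num.max a b ->
 (1 - q) * Num.max a b ^+ k <= normc (z ^+ k - w ^+ k) <= 2 * Num.max a b ^+ k.
Proof.
move=> k0 za wb q0 q1.
wlog ab : a b z w za wb / b <= a.
 move=> H; have [h|h] := orP (le_total b a); first exact: (H a b z w).
 by rewrite normc_sub; rewrite minC maxC; exact: (H b a w z).
have a0 : 0 <= a by rewrite -za normc_ge0.
have b0 : 0 <= b by rewrite -wb normc_ge0.
rewrite min_r// max_l// => bq; have ba : b ^+ k <= q * a ^+ k.
 apply: (@le_trans _ _ ((q * a) ^+ k)); first by rewrite lerXn2r ?nnegrE// mulr_ge0.
 by rewrite exprMn ler_wpM2r ?exprn_ge0// -[leRHS]expr1 ler_wiXn2l// ltW.
have ba' : b ^+ k <= a ^+ k by rewrite lerXn2r ?nnegrE.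
apply/andP; split.
 have := normc_lbD (z ^+ k) (- w ^+ k); rewrite normcN !normcX za wb; lra.
by have := normc_tri (z ^+ k) 0 (w ^+ k); rewrite subr0 sub0r normcN !normcX za wb; lra.
Qed.

Definition lmax (z w : R * R) : R := ln (Num.max (sqnorm z) (sqnorm w)).
(** The term [ln 4] makes this nonnegative off the diagonal. That its mean over the disc is [ln 4]
    expresses that the circular average of [ln |z - w|^2] in the argument of [w] is
    [ln max(|z|^2, |w|^2)]. *)
Definition NN (z w : R * R) : R := ln 4 + lmax z w - ln (sqnorm (z - w)).

Lemma meas_NN z : measT (NN z).
Proof.
have mln := @measurable_ln R.
apply: measurable_funB; [apply: measurable_funD => //|]; apply: (meas_comp mln).
 by apply: measurable_maxr => //; exact: meas_sqn.
by apply: meas_sqnorm; apply: meas_pairR; apply: measurable_funB.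
Qed.

Lemma NN_ge0 z w : z != w -> 0 <= NN z w.
Proof.
move=> zw; have p0 : 0 < sqnorm (z - w) by rewrite lt_def sqnorm_eq0 subr_eq0 zw sqnorm_ge0.
have le4 : sqnorm (z - w) <= 4 * Num.max (sqnorm z) (sqnorm w).
 apply: le_trans (sqnorm_sub_le z w) _.
 have h1 : sqnorm z <= Num.max (sqnorm z) (sqnorm w) by rewrite le_max lexx.
 have h2 : sqnorm w <= Num.max (sqnorm z) (sqnorm w) by rewrite le_max lexx orbT.
 lra.
have m0 : 0 < Num.max (sqnorm z) (sqnorm w) by move: p0 le4; lra.
by rewrite /NN /lmax -lnM ?posrE// subr_ge0 ler_ln ?posrE// mulr_gt0.
Qed.

Lemma ln_prod_seq (I : eqType) (s : seq I) (f : I -> R) : (forall i, i \in s -> 0 < f i) ->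
 ln (\prod_(i <- s) f i) = \sum_(i <- s) ln (f i) /\ 0 < \prod_(i <- s) f i.
Proof.
elim: s => [|i s IH] H; first by rewrite !big_nil ln1 ltr01.
have [|e p] := IH; first by move=> j js; apply: H; rewrite inE js orbT.
have i0 : 0 < f i by apply: H; rewrite inE eqxx.
by rewrite !big_cons lnM ?posrE// e mulr_gt0.
Qed.

(** The points of the disc whose modulus stays away, by a ratio [q], from that of [z]; a rotation
    invariant set. *)
Definition Aq (q : R) (z : R * R) : set (R * R) := [set w | sqnorm w < 1 /\
 (0 < Num.max (sqnorm z) (sqnorm w)) && (Num.min (sqnorm z) (sqnorm w) <= q ^+ 2 * Num.max (sqnorm z) (sqnorm w))].

Lemma nsq_rot r w : nsq r = 1 -> sqnorm (ct (r * tc w)) = sqnorm w :> R.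
Proof. by move=> r1; rewrite -nsq_tc ctK nsqM r1 mul1r nsq_tc. Qed.

Lemma sum_seq_const (I : Type) (s : seq I) (c : R) : \sum_(i <- s) c = (size s)%:R * c.
Proof. by elim: s => [|a s IH]; rewrite ?big_nil ?mul0r// big_cons IH /= -natr1 mulrDl mul1r addrC. Qed.

(** Over the [k]-th roots of unity the product of [z - r w] telescopes to [z^k - w^k], whose modulus
    is [max(|z|, |w|)^k] up to factors between [1 - q] and 2. The sum is therefore [k ln 4] with an
    error bounded independently of [k]. *)
Lemma NN_sum q z w rs k : 0 <= q -> q < 1 -> Aq q z w -> (0 < k)%N -> size rs = k -> (forall r, r \in rs -> nsq r = 1) ->
 (forall z w : C, \prod_(r <- rs) (z - r * w) = z ^+ k - w ^+ k) ->
 k%:R * ln 4 - 2 * ln 2 <= \sum_(r <- rs) NN z (ct (r * tc w)) <= k%:R * ln 4 - 2 * ln (1 - q).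
Proof.
move=> q0 q1 [_ /andP[m0 mq]] k0 sk r1 rE.
pose a := normc (tc z); pose b := normc (tc w).
have aE : sqnorm z = a ^+ 2 by rewrite -nsq_tc normc_nsq.
have bE : sqnorm w = b ^+ 2 by rewrite -nsq_tc normc_nsq.
have a0 : 0 <= a by exact: normc_ge0. have b0 : 0 <= b by exact: normc_ge0.
have mE : Num.max (sqnorm z) (sqnorm w) = Num.max a b ^+ 2.
 by rewrite aE bE; case: (leP a b) => h; [rewrite max_r//|rewrite max_l//]; rewrite ler_sqr ?nnegrE// ltW.
have miE : Num.min (sqnorm z) (sqnorm w) = Num.min a b ^+ 2.
 by rewrite aE bE; case: (leP a b) => h; [rewrite min_l//|rewrite min_r//]; rewrite ler_sqr ?nnegrE// ltW.
have M0 : 0 < Num.max a b.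
 rewrite lt_def; apply/andP; split; last by rewrite le_max a0.
 by apply: contraTneq m0 => h; rewrite mE h expr0n ltxx.
have bq : Num.min a b <= q * Num.max a b.
 rewrite -(@ler_pXn2r _ 2)// ?nnegrE ?le_min ?a0 ?b0 ?mulr_ge0 ?(ltW M0)//.
 by rewrite exprMn -mE -miE.
have /andP[lo hi] := rot_bound k0 (erefl a) (erefl b) q0 q1 bq.
set P := normc _ in lo hi; have q10 : 0 < 1 - q by rewrite subr_gt0.
have P0 : 0 < P by apply: lt_le_trans lo; rewrite mulr_gt0// exprn_gt0.
have sE r : r \in rs -> sqnorm (z - ct (r * tc w)) = nsq (tc z - r * tc w).
 by move=> _; rewrite sqnorm_sub ctK.
have pE : \prod_(r <- rs) sqnorm (z - ct (r * tc w)) = P ^+ 2.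
 rewrite -normc_nsq -rE; have nsqp (s : seq C) (f : C -> C) : nsq (\prod_(r <- s) f r) = \prod_(r <- s) nsq (f r).
  by elim: s => [|x s IH]; rewrite ?big_nil ?nsq1// !big_cons nsqM IH.
 by rewrite nsqp big_seq [RHS]big_seq; apply: eq_bigr => r /sE.
have pos r : r \in rs -> 0 < sqnorm (z - ct (r * tc w)).
 move=> rin; rewrite lt_def sqnorm_ge0 andbT; apply/eqP => h.
 have : \prod_(r <- rs) sqnorm (z - ct (r * tc w)) = 0 by rewrite (big_rem r rin)/= h mul0r.
 by rewrite pE => /eqP; rewrite sqrf_eq0 gt_eqF.
have [lE _] := ln_prod_seq pos.
have -> : \sum_(r <- rs) NN z (ct (r * tc w)) = k%:R * (ln 4 + 2 * ln (Num.max a b)) - 2 * ln P.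
 rewrite /NN big_split/= sumrN -lE pE lnXn// -[_ *+ 2]mulr_natl; congr (_ - _).
 rewrite big_seq (eq_bigr (fun=> ln 4 + 2 * ln (Num.max a b))).
  by rewrite -big_seq sum_seq_const sk.
 by move=> r /r1 r11; rewrite /lmax nsq_rot// mE lnXn// -[_ *+ 2]mulr_natl.
have l1 : ln (1 - q) + k%:R * ln (Num.max a b) <= ln P.
 rewrite mulr_natl -lnXn// -lnM ?posrE ?exprn_gt0// ler_ln ?posrE// mulr_gt0// exprn_gt0//.
have l2 : ln P <= ln 2 + k%:R * ln (Num.max a b).
 by rewrite mulr_natl -lnXn// -lnM ?posrE ?exprn_gt0// ler_ln ?posrE// mulr_gt0// exprn_gt0.
apply/andP; split; lra.
Qed.

Lemma Aq_neq q z w : 0 <= q -> q < 1 -> Aq q z w -> z != w.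
Proof.
move=> q0 q1 [_ /andP[m0 mq]]; apply/eqP => zw; move: m0 mq; rewrite zw maxxx minxx => m0.
by rewrite leNgt gtr_pMl// exprn_ilt1.
Qed.

Lemma meas_Aq q z : measurable (Aq q z).
Proof.
have ms := meas_sqn.
have mM : measT (fun w => Num.max (sqnorm z) (sqnorm w)) by exact: measurable_maxr.
have mm : measT (fun w => Num.min (sqnorm z) (sqnorm w)) by exact: measurable_minr.
rewrite (_ : Aq q z = dsc 1 `&` ([set w | 0 - Num.max (sqnorm z) (sqnorm w) < 0] `&`
  ~` [set w | q ^+ 2 * Num.max (sqnorm z) (sqnorm w) - Num.min (sqnorm z) (sqnorm w) < 0])).
 apply: measurableI; first exact: meas_dsc.
 apply: measurableI; first by apply: meas_lt; exact: measurable_funB.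
 by apply: measurableC; apply: meas_lt; apply: measurable_funB => //; exact: measurable_funM.
apply/seteqP; split => w; rewrite /Aq /dsc/= sub0r oppr_lt0 subr_lt0.
 by move=> [-> /andP[-> h]]; split => //; split => //; rewrite ltNge h.
by move=> [-> [-> /negP]]; rewrite -leNgt => ->.
Qed.

Lemma arch_le0 (y c : R) : (forall k, (0 < k)%N -> k%:R * y <= c) -> y <= 0.
Proof.
move=> H; rewrite leNgt; apply/negP => y0.
have c0 : 0 <= c by apply: le_trans (H 1%N _) => //; rewrite mul1r ltW.
have := archi_boundP (divr_ge0 c0 (ltW y0)); rewrite ltr_pdivrMr// => h.
have k0 : (0 < Num.Def.archi_bound (c / y))%N.
 by rewrite lt0n; apply: contraTneq h => ->; rewrite mul0r -leNgt.
by have := lt_le_trans h (H _ k0); rewrite ltxx.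
Qed.

(** Rotations preserve area and [Aq q z], so [k] times the integral of [NN] is the integral of the
    sum over rotated points. It differs from [k ln 4] times the area by a bounded amount for every
    [k], hence equality. *)
Lemma int_Aq q z : 0 <= q -> q < 1 ->
 (\int[leb2]_(w in Aq q z) (NN z w)%:E = \int[leb2]_(w in Aq q z) (ln 4)%:E)%E.
Proof.
move=> q0 q1; have mA := meas_Aq q z.
have [m m0 mE] : exists2 m : R, 0 <= m & leb2 (Aq q z) = m%:E.
 have h1 : (leb2 (Aq q z) <= (pi * 1)%:E)%E.
  by rewrite -(leb2_dscE ler01); le_meas => //; [exact: meas_dsc|move=> w []].
 have h0 : (0 <= leb2 (Aq q z))%E by exact: measure_ge0.
 by case: (leb2 _) h0 h1 => // m m0 _; exists m.
have ic (c : R) : (\int[leb2]_(w in Aq q z) c%:E = (c * m)%:E)%E by rewrite integral_cst// EFinM; congr (_ * _)%E.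
have mN := meas_NN z.
have N0 w : Aq q z w -> 0 <= NN z w by move=> /(Aq_neq q0 q1) /NN_ge0.
have [x x0 xE] : exists2 x : R, 0 <= x & (\int[leb2]_(w in Aq q z) (NN z w)%:E)%E = x%:E.
 have h1 : (\int[leb2]_(w in Aq q z) (NN z w)%:E <= \int[leb2]_(w in Aq q z) (1%:R * ln 4 - 2 * ln (1 - q))%:E)%E.
  apply: ge0_le_integral => //.
  - by apply: measurable_funTS; exact/measurable_EFinP.
  - move=> w Aw; have := @NN_sum q z w [:: 1] 1 q0 q1 Aw isT erefl.
   rewrite big_seq1 mul1r tcK => H; rewrite lee_fin; apply: (proj2 (andP (H _ _))).
    by move=> r; rewrite inE => /eqP ->; exact: nsq1.
   by move=> z' w'; rewrite big_seq1 mul1r.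
 move: h1; rewrite ic.
 have h0 : (0 <= \int[leb2]_(w in Aq q z) (NN z w)%:E)%E by apply: integral_ge0 => w /N0; rewrite lee_fin.
 by case: (\int[leb2]_(w in _) (NN z w)%:E)%E h0 => // x x0 _; exists x.
rewrite xE ic; congr EFin.
pose F w : \bar R := ((\1_(Aq q z) w)%:E * (NN z w)%:E)%E.
have mF : measT F.
 by apply: emeasurable_funM; efin => //; exact: measurable_indic.
have F0 w : (0 <= F w)%E.
 rewrite /F indicE; case: (boolP (w \in _)); rewrite ?mul0e// inE => /N0; by rewrite mul1e lee_fin.
have xF : (\int[leb2]_w F w)%E = x%:E by rewrite -xE [RHS]int_mulind.
have mrot r : measT (fun w : R * R => F (ct (r * tc w))).
 by apply: (meas_comp mF); exact: meas_scl_fun.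
have kx (k : nat) : (0 < k)%N -> (k%:R * ln 4 - 2 * ln 2) * m <= k%:R * x /\ k%:R * x <= (k%:R * ln 4 - 2 * ln (1 - q)) * m.
 move=> k0; have [rs sk [r1 rE]] := unity_roots k0.
 have E : (k%:R * x)%:E = (\int[leb2]_w \sum_(r <- rs) F (ct (r * tc w)%R))%E.
  rewrite ge0_integral_sum//.
  rewrite big_seq (eq_bigr (fun=> x%:E)); last first.
   move=> r rin; rewrite -xF -[RHS](@int_caffine R r 0)//; last by rewrite -nsq_eq0 r1// oner_neq0.
   by rewrite r1// mul1e; apply: eq_integral => w _; rewrite addr0.
  by rewrite -big_seq sumEFin sum_seq_const sk.
 have Fr w : (\sum_(r <- rs) F (ct (r * tc w)%R) = (\1_(Aq q z) w)%:E * (\sum_(r <- rs) NN z (ct (r * tc w)%R))%:E)%E.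
  rewrite /F; under eq_bigr do rewrite -EFinM.
  rewrite sumEFin -EFinM; congr EFin; rewrite mulr_sumr big_seq [RHS]big_seq; apply: eq_bigr => r rin; congr (_ * _).
  by rewrite !indicE; congr (nat_of_bool _)%:R; apply/idP/idP; rewrite !inE /Aq/= nsq_rot//; exact: r1.
 have l2 : 0 <= k%:R * ln 4 - 2 * ln 2 :> R.
  have -> : ln 4 = ln 2 + ln 2 :> R by rewrite -lnM ?posrE// -natrM.
  have h1 : 0 <= ln 2 :> R by rewrite ln_ge0// ler1n.
  have : ln 2 <= k%:R * ln 2 :> R by rewrite ler_peMl// ler1n.
  lra.
 have mS : measurable_fun (Aq q z) (fun w => (\sum_(r <- rs) NN z (ct (r * tc w)))%:E).
  apply: measurable_funTS; efin; apply: measurable_sum => r.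
  by apply: (meas_comp mN); exact: meas_scl_fun.
 rewrite -!lee_fin E; under eq_integral do rewrite Fr.
 rewrite -int_mulind -!ic; split; apply: ge0_le_integral => //.
 - by move=> w Aw; rewrite lee_fin; case/andP: (NN_sum q0 q1 Aw k0 sk r1 rE).
 - by move=> w Aw; rewrite lee_fin; case/andP: (NN_sum q0 q1 Aw k0 sk r1 rE) => h _; exact: le_trans h.
 - by move=> w Aw; rewrite lee_fin; case/andP: (NN_sum q0 q1 Aw k0 sk r1 rE).
apply/eqP; rewrite eq_le; apply/andP; split; rewrite -subr_le0.
 by apply: (@arch_le0 _ (- 2 * ln (1 - q) * m)) => k /kx []; lra.
by apply: (@arch_le0 _ (2 * ln 2 * m)) => k /kx []; lra.
Qed.

(** As [q] increases to 1 the sets [Aq] exhaust the disc minus the null circle [|w| = |z|]. The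
    maximum with 0 can alter [NN] only at [w = z]. *)
Lemma int_NN z : (\int[leb2]_(w in D) (Num.max (NN z w) 0)%:E = (pi * ln 4)%:E)%E.
Proof.
have [mC C0] := circle_null (sqnorm z).
set N := [set w : R * R | sqnorm w = sqnorm z] in mC C0.
pose q n : R := 1 - n.+2%:R^-1.
have q0 n : 0 <= q n by rewrite subr_ge0 invf_le1// ler1n.
have q1 n : q n < 1 by rewrite ltrBlDr ltrDl invr_gt0.
have qm : {homo q : n m / (n <= m)%N >-> n <= m}.
 by move=> n m nm; rewrite lerB// lef_pV2 ?posrE// ler_nat.
pose F n := Aq (q n) z.
have UF : D `\` N = \bigcup_n F n.
 apply/seteqP; split => w.
  move=> [/= w1 wz].
  have mM : Num.min (sqnorm z) (sqnorm w) < Num.max (sqnorm z) (sqnorm w).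
   by case: (ltgtP (sqnorm z) (sqnorm w)) => // e; case: wz; rewrite /N/= e.
  have mi0 : 0 <= Num.min (sqnorm z) (sqnorm w) by rewrite le_min !sqnorm_ge0.
  set M := Num.max _ _ in mM *; set mi := Num.min _ _ in mM mi0 *.
  have M0 : 0 < M by exact: le_lt_trans mM.
  have d0 : 0 < M - mi by rewrite subr_gt0.
  have c0 : 0 <= 2 * M / (M - mi) by rewrite divr_ge0 ?mulr_ge0 ?(ltW d0)// ltW.
  exists (Num.Def.archi_bound (2 * M / (M - mi))) => //; split => //=; rewrite -/M -/mi M0/=.
  have := archi_boundP c0; set n := Num.Def.archi_bound _; rewrite ltr_pdivrMr// => h.
  have e0 : 0 < n.+2%:R^-1 :> R by rewrite invr_gt0.
  have h2 : 2 * M * n.+2%:R^-1 <= M - mi.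
   rewrite ler_pdivrMr// (mulrC (M - mi)); apply: le_trans (ltW h) _.
   by rewrite ler_wpM2r ?(ltW d0)// ler_nat (leq_trans _ (leqnSn _))// leqnSn.
  move: h2 e0; rewrite /q; move: (n.+2%:R^-1) => e h2 e0.
  by have : mi <= (1 - e) ^+ 2 * M by nra.
 move=> [n _ Fw]; split; first by case: Fw.
 move=> /= Nw; case: Fw => _ /andP[M0 h]; move: h M0; rewrite Nw minxx maxxx leNgt => + s0.
 by rewrite gtr_pMl// exprn_ilt1.
have mF n : measurable (F n) by exact: meas_Aq.
have ndF : nondecreasing_seq F.
 move=> n m nm; apply/subsetPset => w [w1 /andP[M0 h]]; split => //; rewrite M0/= (le_trans h)//.
 by rewrite ler_wpM2r ?(ltW M0)// lerXn2r ?nnegrE// qm.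
have D0 (f : R * R -> \bar R) : measT f -> (forall w, 0 <= f w)%E ->
  (\int[leb2]_(w in F n) f w)%E @[n --> \oo] --> (\int[leb2]_(w in D) f w)%E.
 move=> mf f0; rewrite (@ge0_negligible_integral _ _ _ _ D N)//; last 2 first.
 - exact: meas_dsc.
 - exact: measurable_funTS.
 by rewrite UF; apply: ge0_nondecreasing_set_cvg_integral => // n; exact: measurable_funTS.
have mN : measT (fun w => (Num.max (NN z w) 0)%:E : \bar R).
 by efin; apply: measurable_maxr => //; exact: meas_NN.
have c1 := D0 _ mN (fun w => _); have {c1} c1 : (\int[leb2]_(w in F n) (Num.max (NN z w) 0)%:E)%E @[n --> \oo] --> (\int[leb2]_(w in D) (Num.max (NN z w) 0)%:E)%E.
 by apply: c1 => w; rewrite lee_fin le_max lexx orbT.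
have l4 : 0 <= ln 4 :> R by rewrite ln_ge0// ler1n.
have c2 := D0 (cst (ln 4)%:E) (measurable_cst _) (fun=> _); have {c2} c2 : (\int[leb2]_(w in F n) (ln 4)%:E)%E @[n --> \oo] --> (\int[leb2]_(w in D) (ln 4)%:E)%E.
 exact: c2.
rewrite -int_D_cst; apply: cvg_unique c1 _ => //.
apply: cvg_trans c2; apply: near_eq_cvg; near=> n.
rewrite -(int_Aq z (q0 n) (q1 n)); apply: eq_integral => w; rewrite inE => Fw.
by rewrite max_l// NN_ge0// (Aq_neq (q0 n) (q1 n) Fw).
Unshelve. all: by end_near. Qed.

Lemma lmax_le (z w : R * R) : 0 <= sqnorm z + sqnorm w - lmax z w.
Proof.
rewrite /lmax; have := sqnorm_ge0 z; have := sqnorm_ge0 w => w0 z0.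
have [M0|M0] := ltP 0 (Num.max (sqnorm z) (sqnorm w)).
 have := ln_sublinear M0; have : Num.max (sqnorm z) (sqnorm w) <= sqnorm z + sqnorm w by rewrite ge_max lerDl lerDr z0 w0.
 set M := Num.max _ _; set l := ln M; lra.
by rewrite ln0// subr0 addr_ge0.
Qed.

Lemma int_D_KK_aux z : (2%:E * \int[leb2]_(w in D) KK z w = \int[leb2]_(w in D) (sqnorm z + sqnorm w - lmax z w)%:E)%E.
Proof.
have mD := meas_dsc 1.
have mK : measT (KK z) by exact: (meas_KK (f := fun=> z)).
have mL : measT (fun w => (sqnorm z + sqnorm w - lmax z w)%:E).
 efin; apply: measurable_funB; first by apply: measurable_funD => //; exact: meas_sqn.
 by apply: (meas_comp (@measurable_ln R)); apply: measurable_maxr => //; exact: meas_sqn.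
have mN : measT (fun w => (Num.max (NN z w) 0)%:E : \bar R).
 by efin; apply: measurable_maxr => //; exact: meas_NN.
have l4 : 0 <= ln 4 :> R by rewrite ln_ge0// ler1n.
have L0 w : (0 <= (sqnorm z + sqnorm w - lmax z w)%:E :> \bar R)%E by rewrite lee_fin lmax_le.
have N0 w : (0 <= (Num.max (NN z w) 0)%:E :> \bar R)%E by rewrite lee_fin le_max lexx orbT.
have [mC C0] := circle_null (sqnorm z).
have H : (\int[leb2]_(w in D) (2%:E * KK z w + (ln 4)%:E) = \int[leb2]_(w in D) ((Num.max (NN z w) 0)%:E + (sqnorm z + sqnorm w - lmax z w)%:E))%E.
 apply: ge0_ae_eq_integral => //.
 - by apply: measurable_funTS; apply: emeasurable_funD => //; exact: emeasurable_funM.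
 - by apply: measurable_funTS; exact: emeasurable_funD.
 - by move=> w _; rewrite adde_ge0// mule_ge0// KK_ge0.
 - by move=> w _; rewrite adde_ge0.
 exists [set w | sqnorm w = sqnorm z]; split => // w /= h; apply: contrapT => wz; apply: h => _.
 have zw : z != w by apply/eqP => zw; apply: wz; rewrite zw.
 have p0 : (sqnorm (z - w) == 0) = false by rewrite sqnorm_eq0 subr_eq0 (negbTE zw).
 rewrite (max_l (NN_ge0 zw)) /KK logkerE p0 /NN.
 transitivity ((2 * (- (ln (sqnorm (z - w)) / 2) + (sqnorm z + sqnorm w) / 2) + ln 4)%:E) => //.
 by rewrite -EFinD; congr EFin; lra.
have K0 w : D w -> (0 <= 2%:E * KK z w)%E by move=> _; rewrite mule_ge0// KK_ge0.
have mK2 : measurable_fun D (fun w => 2%:E * KK z w)%E by apply: measurable_funTS; exact: emeasurable_funM.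
have c0 w : D w -> (0 <= (cst (ln 4)%:E : R * R -> \bar R) w)%E by [].
have mc : measurable_fun D (cst (ln 4)%:E : R * R -> \bar R) by exact: measurable_cst.
move: H; rewrite (ge0_integralD leb2 mD K0 mK2 c0 mc) (ge0_integralD leb2 mD (fun w _ => N0 w) (measurable_funTS mN) (fun w _ => L0 w) (measurable_funTS mL)).
rewrite int_NN [X in (_ + X = _)%E](int_D_cst (ln 4)) ge0_integralZl//; last 2 first.
- exact: measurable_funTS.
- by move=> w _; exact: KK_ge0.
move=> /(congr1 (fun y => y - (pi * ln 4)%:E)%E); rewrite addeK// => ->.
by rewrite addeAC subee// add0e.
Qed.

Lemma meas_Einv x : 0 <= x -> measT (fun w : R * R => Einv (Num.max x (sqnorm w))).
Proof.
move=> x0; have mM : measT (fun w : R * R => Num.max x (sqnorm w)).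
 by apply: measurable_maxr => //; exact: meas_sqn.
apply: (meas_ext (f := fun w : R * R => if Num.max x (sqnorm w) == 0 then Einv 0 else (Num.max (- ln (Num.max x (sqnorm w))) 0)%:E)).
 apply: measurable_fun_ifT => //.
  apply: (@measurable_fun_bool _ _ _ _ true).
  rewrite (_ : _ @^-1` _ = (fun w : R * R => Num.max x (sqnorm w)) @^-1` [set 0]); first exact: mM.
  by apply/seteqP; split => t /= /eqP.
 efin; apply: measurable_maxr => //; apply: measurableT_comp => //.
 exact: (meas_comp (@measurable_ln R) mM).
move=> w; case: eqP => [->//|/eqP M0].
have {}M0 : 0 < Num.max x (sqnorm w) by rewrite lt_def M0 le_max x0.
have [M1|M1] := leP (Num.max x (sqnorm w)) 1.
 by rewrite EinvE// max_l// oppr_ge0 ln_le0.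
rewrite max_r; last by rewrite oppr_le0 ln_ge0// ltW.
rewrite /Einv set_itv_ge ?integral_set0// bnd_simp -leNgt; exact: ltW.
Qed.

(** The potential of the circular law is the constant [3 / 4] on the closed disc: with [- ln max]
    written through [Einv], the terms in [|z|^2] cancel. *)
Lemma int_D_KK_in z : sqnorm z <= 1 -> (\int[leb2]_(w in D) KK z w = (pi * (3 / 4))%:E)%E.
Proof.
move=> z1; have mD := meas_dsc 1; have z0 := sqnorm_ge0 z.
have [mC C0] := circle_null 0.
have mL : measT (fun w => (sqnorm z + sqnorm w - lmax z w)%:E).
 efin; apply: measurable_funB; first by apply: measurable_funD => //; exact: meas_sqn.
 by apply: (meas_comp (@measurable_ln R)); apply: measurable_maxr => //; exact: meas_sqn.
have mE := meas_Einv z0.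
have ms : measT (fun w : R * R => (sqnorm w)%:E) by efin; exact: meas_sqn.
have E0 w : (0 <= Einv (Num.max (sqnorm z) (sqnorm w)))%E.
 apply: integral_ge0 => u /=; rewrite in_itv/= => /andP[h _]; rewrite lee_fin invr_ge0 ltW// (le_lt_trans _ h)//.
 by rewrite le_max z0.
have H : (\int[leb2]_(w in D) (sqnorm z + sqnorm w - lmax z w)%:E = \int[leb2]_(w in D) (((sqnorm z)%:E + (sqnorm w)%:E) + Einv (Num.max (sqnorm z) (sqnorm w))))%E.
 apply: ge0_ae_eq_integral => //.
 - exact: measurable_funTS.
 - by apply: measurable_funTS; apply: emeasurable_funD => //; exact: emeasurable_funD.
 - by move=> w _; rewrite lee_fin lmax_le.
 - by move=> w _; rewrite adde_ge0// adde_ge0// lee_fin sqnorm_ge0.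
 exists [set w | sqnorm w = 0]; split => // w /= h; apply: contrapT => wz; apply: h => w1.
 have w0 : 0 < sqnorm w by rewrite lt_def sqnorm_ge0 andbT; exact/eqP.
 rewrite EinvE ?lt_max ?w0 ?orbT// -?EFinD// ge_max z1/=; exact: ltW.
have H2 : (\int[leb2]_(w in D) (((sqnorm z)%:E + (sqnorm w)%:E) + Einv (Num.max (sqnorm z) (sqnorm w))) = (pi * sqnorm z + pi / 2 + pi * (1 - sqnorm z))%:E)%E.
 rewrite ge0_integralD//; last 3 first.
 - by move=> w _; rewrite adde_ge0// lee_fin sqnorm_ge0.
 - by apply: measurable_funTS; exact: emeasurable_funD.
 - exact: measurable_funTS.
 rewrite ge0_integralD//; last 2 first.
 - by move=> w _; rewrite lee_fin sqnorm_ge0.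
 - exact: measurable_funTS.
 by rewrite int_D_cst int_D_sq int_D_Einv// -!EFinD.
have := int_D_KK_aux z; rewrite H H2.
have : (0 <= \int[leb2]_(w in D) KK z w)%E by apply: integral_ge0 => w _; exact: KK_ge0.
case: (\int[leb2]_(w in D) KK z w)%E => [x|_|//]; last by rewrite mulry gtr0_sg// mul1e.
move=> _ [] xh; congr EFin; move: xh; lra.
Qed.

(** Outside the disc the maximum is [|z|^2] throughout. By [ln x <= x - 1] the value is at least
    that on the disc. *)
Lemma int_D_KK_out z : 1 <= sqnorm z -> (\int[leb2]_(w in D) KK z w = (pi * ((sqnorm z + 1 / 2 - ln (sqnorm z)) / 2))%:E)%E.
Proof.
move=> z1; have mD := meas_dsc 1; have z0 := sqnorm_ge0 z.
have ms : measT (fun w : R * R => (sqnorm w)%:E) by efin; exact: meas_sqn.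
have l0 : 0 <= sqnorm z - ln (sqnorm z) by rewrite subr_ge0 ltW// ln_sublinear// (lt_le_trans _ z1).
have H : (\int[leb2]_(w in D) (sqnorm z + sqnorm w - lmax z w)%:E = \int[leb2]_(w in D) ((sqnorm z - ln (sqnorm z))%:E + (sqnorm w)%:E))%E.
 apply: eq_integral => w; rewrite mem_dsc => w1; rewrite -EFinD /lmax max_l ?(le_trans (ltW w1))//.
 by rewrite addrAC.
have H2 : (\int[leb2]_(w in D) ((sqnorm z - ln (sqnorm z))%:E + (sqnorm w)%:E) = (pi * (sqnorm z - ln (sqnorm z)) + pi / 2)%:E)%E.
 rewrite ge0_integralD//; last 2 first.
 - by move=> w _; rewrite lee_fin sqnorm_ge0.
 - exact: measurable_funTS.
 by rewrite int_D_cst int_D_sq -!EFinD.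
have := int_D_KK_aux z; rewrite H H2.
have : (0 <= \int[leb2]_(w in D) KK z w)%E by apply: integral_ge0 => w _; exact: KK_ge0.
case: (\int[leb2]_(w in D) KK z w)%E => [x|_|//]; last by rewrite mulry gtr0_sg// mul1e.
move=> _ [] xh; congr EFin; move: xh; lra.
Qed.
End discs.

(** * Polar sets and balayage *)

Section restr.
Variable R : realType.
Local Notation T := (R * R)%type.
Implicit Types (m : {measure set T -> \bar R}) (mu : probability T R).

Lemma ex_prob m : m setT = 1%E -> exists P : probability T R, forall A, P A = m A.
Proof.
move=> m1; exists (mnormalize m (dirac ((0, 0) : T))) => A.
change ((if (m setT == 0)%E || (m setT == +oo)%E then fun U => dirac ((0, 0) : T) U else fun U => (m U * (fine (m setT))^-1%:E)%E) A = m A).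
by rewrite m1 onee_eq0/= invr1 mule1.
Qed.

Lemma int_mrestr m (D : set T) (mD : measurable D) (f : T -> \bar R) : measT f -> (forall x, 0 <= f x)%E ->
 (\int[mrestr m mD]_x f x = \int[m]_(x in D) f x)%E.
Proof.
move=> mf f0; rewrite (@ge0_negligible_integral _ _ _ (mrestr m mD) setT (~` D))//; last 2 first.
- exact: measurableC.
- by change (m (~` D `&` D) = 0%E); rewrite setICl measure0.
rewrite setTD setCK; apply: eq_measure_integral => A mA AD.
by rewrite /mrestr; congr (m _); apply/setIidPl.
Qed.

Lemma restr_prob m (A : set T) (c : R) : measurable A -> m A = c%:E -> 0 < c ->
 exists P : probability T R, (forall B, P B = ((c^-1)%:E * m (B `&` A))%E) /\
  (forall f, measT f -> (forall x, 0 <= f x)%E -> \int[P]_x f x = (c^-1)%:E * \int[m]_(x in A) f x)%E.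
Proof.
move=> mA mAc c0; have ci0 : 0 <= c^-1 by rewrite invr_ge0 ltW.
have [|P PE] := @ex_prob (mscale (NngNum ci0) (mrestr m mA)).
 by change ((c^-1)%:E * m (setT `&` A) = 1)%E; rewrite setTI mAc -EFinM mulVf// gt_eqF.
exists P; split => [B|f mf f0]; first by rewrite PE.
transitivity (\int[mscale (NngNum ci0) (mrestr m mA)]_x f x)%E.
 by apply: eq_measure_integral => B mB _; exact: PE.
by rewrite ge0_integral_mscale// int_mrestr.
Qed.

Lemma bdd_B (M : R) : measurable [set z : T | sqnorm z <= M].
Proof.
rewrite (_ : [set z | _] = setT `&` @sqnorm R @^-1` `]-oo, M]); first exact: (meas_sqn (R := R)).
by apply/seteqP; split => z /=; rewrite ?in_itv/= => // -[].
Qed.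

Lemma closed_B (M : R) : closed [set z : T | sqnorm z <= M].
Proof.
rewrite (_ : [set z | _] = @sqnorm R @^-1` [set x | x <= M]); last by [].
apply: closed_comp => [z _|]; last exact: closed_le.
have h1 : ((fun z : T => z.1 * z.1 + z.2 * z.2) x @[x --> z]) --> z.1 * z.1 + z.2 * z.2.
 by apply: cvgD; apply: cvgM; (exact: cvg_fst || exact: cvg_snd).
exact: h1.
Qed.

Lemma mK2 : mk2 (@KK R).
Proof. by split; [apply: meas_KK; [exact: mfst|exact: msnd]|exact: KK_ge0]. Qed.

Lemma meas_pot mu : measT (fun z => \int[mu]_w KK z w)%E.
Proof. exact: (mk2_int mu mK2). Qed.

(** If [N] had positive mass, a closed part of it inside the bounded set would too; the normalised
    restriction of [mu] to that part is supported in [N] and has finite energy, since the kernel is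
    nonnegative. *)
Lemma polar_null (N : set T) mu (M : R) : polar N -> mu (~` [set z | sqnorm z <= M]) = 0%E ->
 (dbl mu mu (@KK R) < +oo)%E -> mu N = 0%E.
Proof.
move=> [mN pN] muB fin; set B := [set z | _] in muB; have mB : measurable B := bdd_B M.
apply/eqP; apply: contraT => N0; have {}N0 : (0 < mu N)%E by rewrite lt0e N0 measure_ge0.
have mufin A : measurable A -> exists2 x : R, mu A = x%:E & 0 <= x.
 move=> mA; have h0 : (0 <= mu A)%E by [].
 have h1 : (mu A <= 1)%E by exact: probability_le1.
 by case: (mu A) h0 h1 => // x x0 _; exists x.
have [x xE x0] := mufin N mN; rewrite xE lte_fin in N0.
have muT : (mu setT < +oo)%E by rewrite probability_setT ltry.
have x20 : 0 < x / 2 by rewrite divr_gt0.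
have [F [Q [cF oO FN NO small]]] := measure_regular muT mN x20.
have mF : measurable F by exact: closed_measurable2.
have mO : measurable Q by exact: open_measurable2.
have mFB : measurable (F `&` B) by exact: measurableI.
have [y yE y0] := mufin _ mFB.
have yp : 0 < y.
 have : (mu N <= mu (F `&` B) + mu (~` B) + mu (Q `\` F))%E.
  apply: (@le_trans _ _ (mu ((F `&` B) `|` ~` B `|` (Q `\` F)))).
   le_meas => //; [by do 2?apply: measurableU => //; [exact: measurableC|exact: measurableD]|].
   move=> z Nz; have [Fz|Fz] := pselect (F z); last by right; split => //; exact: NO.
   by have [Bz|Bz] := pselect (B z); left; [left|right].
  have mBC : measurable (~` B) by exact: measurableC.
  apply: (le_trans (measureU2 _ _ _)); [by apply: measurableU|by exact: measurableD|].
  by apply: leeD => //; apply: measureU2.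
 rewrite xE yE; rewrite [mu (~` B)]muB adde0 => h; have {h} : (x%:E <= y%:E + (x / 2)%:E)%E by apply: le_trans h _; exact: leeD.
 by rewrite -EFinD lee_fin; lra.
have [rho [rB rI]] := @restr_prob mu _ y mFB yE yp.
have rin : probs_in N rho.
 apply: (@probs_inI _ N (F `&` B) M); [by apply: closedI => //; exact: closed_B|by move=> z []; auto|by move=> z []|].
 by rewrite rB setICl measure0 mule0.
have rR := RmuE rin.
have : Rmu rho = +oo%E.
 rewrite /Rmu (pN _ rin) addye// gt_eqF// (lt_le_trans (ltNye 0))//.
 by apply: integral_ge0 => z _; rewrite lee_fin sqnorm_ge0.
rewrite rR => H; suff : (\int[rho]_z \int[rho]_w KK z w < +oo)%E by rewrite H ltxx.
rewrite rI; [|exact: meas_pot|by move=> z; apply: integral_ge0 => w _; exact: KK_ge0].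
have yi : 0 <= y^-1 by rewrite invr_ge0.
apply: (@le_lt_trans _ _ ((y^-1)%:E * \int[mu]_z ((y^-1)%:E * \int[mu]_w KK z w))%E).
 apply: lee_wpmul2l; first by rewrite lee_fin.
 have mp : measT (fun z => (y^-1)%:E * \int[mu]_w KK z w)%E by apply: emeasurable_funM => //; exact: meas_pot.
 have p0 z : (0 <= \int[mu]_w KK z w)%E by apply: integral_ge0 => w _; exact: KK_ge0.
 apply: (@le_trans _ _ (\int[mu]_(z in F `&` B) ((y^-1)%:E * \int[mu]_w KK z w))%E).
  apply: ge0_le_integral => //.
  - by move=> z _; apply: integral_ge0 => w _; exact: KK_ge0.
  - by apply: measurable_funTS; exact: meas_pot.
  - exact: measurable_funTS.
  - move=> z _; rewrite rI; [|exact: (mk2_curry z mK2)|by move=> w; exact: KK_ge0].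
   apply: lee_wpmul2l; first by rewrite lee_fin.
   by apply: ge0_subset_integral => //; [exact: (mk2_curry z mK2)|move=> w _; exact: KK_ge0].
 by apply: ge0_subset_integral => //; move=> z _; rewrite mule_ge0.
rewrite ge0_integralZl//; [|exact: meas_pot|by move=> z _; apply: integral_ge0 => w _; exact: KK_ge0].
by rewrite lte_mul_pinfty ?mule_ge0 ?lte_mul_pinfty// ?lee_fin// ltry.
Qed.

Local Notation D := (dsc (1 : R)).

Lemma scl_KK (a : R) (z w : T) : 1 <= a -> sqnorm z < 1 -> sqnorm w < 1 ->
 (KK (scl2 a z) (scl2 a w) <= KK z w + (a ^+ 2)%:E)%E.
Proof.
move=> a1 z1 w1; have a0 : 0 < a by exact: lt_le_trans a1.
rewrite /KK !logkerE scl2B !sqnorm_scl2 mulf_eq0 expf_eq0/= gt_eqF//=.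
case: eqP => [_|/eqP zw]; first by rewrite !addye.
have p0 : 0 < sqnorm (z - w) by rewrite lt_def zw sqnorm_ge0.
rewrite -!EFinD lee_fin lnM ?posrE ?exprn_gt0// lnXn//.
have : 0 <= ln a by rewrite ln_ge0.
have : 1 <= a ^+ 2 by rewrite exprn_ege1.
have := sqnorm_ge0 z; have := sqnorm_ge0 w; move: (a ^+ 2) (ln a) => A l; nra.
Qed.

(** The uniform law on the disc of radius [a] has finite energy: it is the image of the circular law
    under dilation by [a], which raises the kernel by at most [a^2]. *)
Lemma leb_polar (N : set T) (a : R) : polar N -> 1 <= a -> leb2 (N `&` dsc (a ^+ 2)) = 0%E.
Proof.
move=> pN a1; have a0 : 0 < a by exact: lt_le_trans a1.
have an0 : a != 0 by rewrite gt_eqF.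
have aa0 : 0 < a ^+ 2 by rewrite exprn_gt0.
have c0 : 0 < pi * a ^+ 2 by rewrite mulr_gt0// pi_gt0.
have [om [oB oI]] := @restr_prob leb2 _ _ (meas_dsc (a ^+ 2)) (leb2_dscE (ltW aa0)) c0.
have ci0 : 0 <= (pi * a ^+ 2)^-1 by rewrite invr_ge0 ltW.
have : om N = 0%E.
 apply: (@polar_null N om (a ^+ 2)) => //.
  rewrite oB (_ : _ `&` _ = set0) ?measure0 ?mule0//; apply/seteqP; split => z //=.
  by rewrite /dsc/= => -[h /ltW].
 have I2 (f : T -> \bar R) : measT f -> (forall x, 0 <= f x)%E ->
   (\int[om]_x f x = (pi^-1)%:E * \int[leb2]_(x in D) f (scl2 a x))%E.
  move=> mf f0; rewrite oI// int_mulind (@int_scl2 _ a _ an0).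
  - rewrite muleA -EFinM invfM -mulrA mulVf ?gt_eqF// mulr1 [in RHS]int_mulind; congr (_ * _)%E.
   apply: eq_integral => z _; congr (_%:E * _)%E; rewrite !indicE !mem_dsc sqnorm_scl2.
   by rewrite gtr_pMr.
  - by apply: emeasurable_funM => //; efin; apply: measurable_indic; exact: meas_dsc.
  - by move=> z; rewrite mule_ge0// lee_fin.
 have pi0 : 0 < (pi : R) := pi_gt0 R.
 have pi0' : 0 <= (pi : R)^-1 by rewrite invr_ge0 ltW.
 have mD := meas_dsc (1 : R).
 have inner z : sqnorm z < 1 -> (\int[om]_w KK (scl2 a z) w <= (3 / 4 + a ^+ 2)%:E)%E.
  move=> z1; rewrite I2; [|exact: (mk2_curry _ mK2)|by move=> w; exact: KK_ge0].
  have mKz := mk2_curry z mK2.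
  have mKs : measT (fun w => KK (scl2 a z) (scl2 a w)).
   exact: (meas_comp (mk2_curry (scl2 a z) mK2) (meas_scl2 a)).
  apply: (@le_trans _ _ ((pi^-1)%:E * \int[leb2]_(w in D) (KK z w + (a ^+ 2)%:E))%E).
   apply: lee_wpmul2l; first by rewrite lee_fin.
   apply: ge0_le_integral => //.
   - by move=> w _; exact: KK_ge0.
   - exact: measurable_funTS.
   - by apply: measurable_funTS; exact: emeasurable_funD.
   - by move=> w w1; exact: scl_KK.
  rewrite ge0_integralD//; [|by move=> w _; exact: KK_ge0|exact: measurable_funTS|by move=> w _; rewrite lee_fin ltW].
  rewrite int_D_KK_in ?(ltW z1)// int_D_cst -EFinD -EFinM lee_fin -mulrDr mulrA mulVf ?mul1r// gt_eqF//.
 have mpo := meas_pot om.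
 have po0 z : (0 <= \int[om]_w KK z w)%E by apply: integral_ge0 => w _; exact: KK_ge0.
 rewrite /dbl I2//.
 apply: (@le_lt_trans _ _ ((pi^-1)%:E * \int[leb2]_(z in D) (3 / 4 + a ^+ 2)%:E)%E); last by rewrite int_D_cst -EFinM ltry.
 apply: lee_wpmul2l; first by rewrite lee_fin.
 apply: ge0_le_integral => //; first by apply: measurable_funTS; exact: (meas_comp mpo (meas_scl2 a)).
move=> /eqP; rewrite oB mule_eq0 => /orP[]; last by move=> /eqP.
by rewrite eqe invr_eq0 gt_eqF.
Qed.

(** A polar set containing the exterior of a disc would have positive area. *)
Lemma polar_far (N : set T) (r : R) : polar N -> exists2 z, ~ N z & r <= sqnorm z.
Proof.
move=> pN; have [mN _] := pN; apply: contrapT => H.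
pose a := 1 + `|r|; have a1 : 1 <= a by rewrite lerDl.
have ra : r <= a ^+ 2 by rewrite (le_trans (ler_norm r))//; have := normr_ge0 r; rewrite /a; nra.
have := leb_polar pN (_ : 1 <= a + 1); have -> : 1 <= a + 1 by rewrite (le_trans a1)// lerDl.
move=> /(_ isT) N0.
have : (leb2 (dsc ((a + 1) ^+ 2)) <= leb2 (dsc (a ^+ 2)) + leb2 (N `&` dsc ((a + 1) ^+ 2)))%E.
 have mI : measurable (N `&` dsc ((a + 1) ^+ 2)) by apply: measurableI => //; exact: meas_dsc.
 apply: le_trans (measureU2 _ (meas_dsc _) mI); le_meas; [exact: meas_dsc|by apply: measurableU => //; exact: meas_dsc|].
 move=> z zd; have [h|h] := ltP (sqnorm z) (a ^+ 2); [by left|right; split => //].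
 by apply: contrapT => Nz; apply: H; exists z => //; exact: le_trans h.
have p0 := pi_gt0 R.
rewrite N0 adde0 !leb2_dscE ?sqr_ge0// lee_fin ler_pM2l// ; apply/negP; rewrite -ltNge.
by move: a1; nra.
Qed.
End restr.

Section logpot.
Variable R : realType.
Local Notation T := (R * R)%type.
Local Notation D := (dsc (1 : R)).
Implicit Types m : {measure set T -> \bar R}.

Lemma int_mrestr_any m (A : set T) (mA : measurable A) (f : T -> \bar R) : measT f ->
 (\int[mrestr m mA]_x f x = \int[m]_(x in A) f x)%E.
Proof.
move=> mf; rewrite integralE [RHS]integralE; congr (_ - _)%E; apply: int_mrestr.
- exact: measurable_funepos.
- by move=> x; rewrite funeposE le_max lexx orbT.
- exact: measurable_funeneg.
- by move=> x; rewrite funenegE le_max lexx orbT.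
Qed.

Lemma meas_sqE : measT (fun z : T => (sqnorm z)%:E : \bar R).
Proof. by efin; exact: meas_sqn. Qed.

Lemma sqE_ge0 (z : T) : (0 <= (sqnorm z)%:E :> \bar R)%E.
Proof. by rewrite lee_fin sqnorm_ge0. Qed.

Lemma int_logker_KK m (c M : R) z : m setT = c%:E -> 0 <= c -> (\int[m]_w (sqnorm w)%:E = M%:E)%E ->
 (\int[m]_w logker z w = \int[m]_w KK z w - ((sqnorm z * c + M) / 2)%:E)%E.
Proof.
move=> mc c0 mM; have z0 := sqnorm_ge0 z.
have hm : measT (fun w : T => (sqnorm z + sqnorm w) / 2).
 by apply: measurable_funM => //; apply: measurable_funD => //; exact: meas_sqn.
have hi : (\int[m]_w ((sqnorm z + sqnorm w) / 2)%:E = ((sqnorm z * c + M) / 2)%:E)%E.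
 transitivity (\int[m]_w ((2^-1)%:E * ((sqnorm z)%:E + (sqnorm w)%:E)))%E.
  by apply: eq_integral => w _; rewrite -EFinD -EFinM mulrC.
 rewrite ge0_integralZl//; last 2 first.
 - by apply: emeasurable_funD => //; exact: meas_sqE.
 - by move=> w _; rewrite adde_ge0// lee_fin sqnorm_ge0.
 rewrite ge0_integralD//; [|by move=> w _; exact: sqE_ge0|exact: meas_sqE].
 have ic : (\int[m]__ (sqnorm z)%:E = (sqnorm z * c)%:E)%E by rewrite integral_cst// EFinM; congr (_ * _)%E.
 by rewrite ic mM -EFinD -EFinM mulrC.
rewrite -hi -int_sub_ge0//.
- by apply: eq_integral => w _; rewrite logker_KK.
- exact: (mk2_curry z (mK2 R)).
- by move=> w; exact: KK_ge0.
- by move=> w; rewrite divr_ge0// addr_ge0 ?sqnorm_ge0.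
- by rewrite hi ltry.
Qed.

Lemma le_int_null d (S : measurableType d) (m : {measure set S -> \bar R}) (A : set S) (f g : S -> \bar R) : measurable A -> m (~` A) = 0%E ->
 measT f -> measT g -> (forall x, 0 <= f x)%E -> (forall x, 0 <= g x)%E ->
 (forall x, A x -> f x <= g x)%E -> (\int[m]_x f x <= \int[m]_x g x)%E.
Proof.
move=> mA A0 mf mg f0 g0 fg.
rewrite (@ge0_negligible_integral _ _ _ m setT (~` A) f)//; [|exact: measurableC].
rewrite (@ge0_negligible_integral _ _ _ m setT (~` A) g)//; [|exact: measurableC].
by rewrite setTD setCK; apply: ge0_le_integral => //; exact: measurable_funTS.
Qed.

(** Stated with an extended real [t] and [m setT] possibly infinite, because it serves to prove that
    a balayage measure is finite. The threshold 16 makes [|z - w|^2] lie between [|z|^2 / 4] and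
    [4 |z|^2], with positive logarithm, for [|w| <= 1]. *)
Lemma int_log_far m (A : set T) z : measurable A -> (forall w, A w -> sqnorm w <= 1) -> m (~` A) = 0%E ->
 16 <= sqnorm z -> exists2 t : \bar R, (\int[m]_w logker z w = - t)%E &
 (((ln (sqnorm z) - ln 4) / 2)%:E * m setT <= t)%E /\ (t <= ((ln (sqnorm z) + ln 4) / 2)%:E * m setT)%E.
Proof.
move=> mA A1 mA0 z16.
pose g w : R := Num.max (ln (sqnorm (z - w)) / 2) 0.
have bnd w : A w -> sqnorm z / 4 <= sqnorm (z - w) <= sqnorm z * 4.
 move=> /A1 w1; have h1 := sqnorm_sub_le z w; have h2 := sqnorm_sub_le (z - w) (- w).
 move: h2; rewrite opprK subrK sqnormN => h2; have := sqnorm_ge0 w; lra.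
have z0 : 0 < sqnorm z by apply: lt_le_trans z16.
have l4 : 0 < ln 4 :> R by rewrite ln_gt0// ltr1n.
have l16 : ln 4 + ln 4 <= ln (sqnorm z) by rewrite -lnM ?posrE// -natrM ler_ln ?posrE.
have gb w : A w -> (ln (sqnorm z) - ln 4) / 2 <= g w <= (ln (sqnorm z) + ln 4) / 2 /\ logker z w = (- g w)%:E.
 move=> /bnd /andP[h1 h2].
 have p0 : 0 < sqnorm (z - w) by apply: lt_le_trans h1; rewrite divr_gt0.
 have k1 : ln (sqnorm z) - ln 4 <= ln (sqnorm (z - w)) by rewrite -ln_div ?posrE// ler_ln ?posrE// divr_gt0.
 have k2 : ln (sqnorm (z - w)) <= ln (sqnorm z) + ln 4 by rewrite -lnM ?posrE// ler_ln ?posrE// mulr_gt0.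
 have gE : g w = ln (sqnorm (z - w)) / 2 by rewrite /g max_l//; move: k1 l16 l4; lra.
 rewrite gE; split; first by apply/andP; split; lra.
 by rewrite logkerE gt_eqF.
have mg : measT (fun w => (g w)%:E : \bar R).
 efin; apply: measurable_maxr => //; apply: measurable_funM => //.
 apply: (meas_comp (@measurable_ln R)); apply: meas_sqnorm; apply: meas_pairR; apply: measurable_funB => //.
have g0 w : (0 <= (g w)%:E :> \bar R)%E by rewrite lee_fin le_max lexx orbT.
have ae (f h : T -> \bar R) : (forall w, A w -> f w = h w) -> ae_eq m setT f h.
 move=> fh; exists (~` A); split => //; first exact: measurableC.
 by move=> w /= h1 Aw; apply: h1 => _; exact: fh.
have mlog : measT (logker z) by exact: (meas_logker (f := fun=> z)).
exists (\int[m]_w (g w)%:E)%E.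
 rewrite -integral_ge0N; last by move=> w _; exact: g0.
 apply: ae_eq_integral => //; first exact: measurableT_comp.
 by apply: ae => w Aw; rewrite (gb w Aw).2.
have cE (k : R) : (\int[m]__ k%:E = k%:E * m setT)%E by rewrite integral_cst.
rewrite -!cE; split; apply: (@le_int_null _ _ m A) => //.
- by move=> w; rewrite lee_fin divr_ge0// subr_ge0; move: l16 l4; lra.
- by move=> w Aw; rewrite lee_fin; case/andP: (gb w Aw).1.
- by move=> w; rewrite lee_fin divr_ge0// addr_ge0 ?(ltW l4)//; move: l16 l4; lra.
- by move=> w Aw; rewrite lee_fin; case/andP: (gb w Aw).1.
Qed.

Lemma ex_restr m (A : set T) : measurable A -> exists m' : {measure set T -> \bar R},
 (forall B, m' B = m (B `&` A)) /\ (forall f, measT f -> (\int[m']_x f x = \int[m]_(x in A) f x)%E).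
Proof. by move=> mA; exists (mrestr m mA); split => // f mf; exact: int_mrestr_any. Qed.

Lemma ex_restr_leb (A : set T) : measurable A -> exists m' : {measure set T -> \bar R},
 (forall B, m' B = leb2 (B `&` A)) /\ (forall f, measT f -> (\int[m']_x f x = \int[leb2]_(x in A) f x)%E).
Proof. exact: (ex_restr leb2). Qed.

Lemma ex_sum (k : R) m1 m2 : 0 <= k -> exists m : {measure set T -> \bar R},
 (forall A, m A = (k%:E * m1 A + m2 A)%E) /\
 (forall f, measT f -> (forall x, 0 <= f x)%E -> (\int[m]_x f x = k%:E * \int[m1]_x f x + \int[m2]_x f x)%E).
Proof.
move=> k0; exists (measure_add (mscale (NngNum k0) m1) m2); split; first by move=> A; exact: measure_addE.
by move=> f mf f0; rewrite ge0_integral_measure_add// ge0_integral_mscale.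
Qed.

Lemma int_D_V (V : set T) (f : T -> \bar R) : measurable V -> V `<=` D -> measT f -> (forall x, 0 <= f x)%E ->
 (\int[leb2]_(w in D) f w = \int[leb2]_(w in V) f w + \int[leb2]_(w in D `\` V) f w)%E.
Proof.
move=> mV VD mf f0; have mD := meas_dsc (1 : R).
have DE : D = V `|` D `\` V.
 by apply/seteqP; split => w; [have [] := pselect (V w); [left|right]|case => [/VD|[]]].
rewrite {1}DE ge0_integral_setU//; [by exact: measurableD|exact: measurable_funTS|].
by apply/disj_setPS => w [/= Vw []].
Qed.
End logpot.

Section balayage.
Variable R : realType.
Local Notation T := (R * R)%type.
Local Notation D := (dsc (1 : R)).
Variables (V : set T) (nu : {measure set T -> \bar R}).
Hypotheses (oV : open V) (VD : V `<=` @unit_disk R) (bal : is_balayage V nu).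
Let B1 : set T := [set z | sqnorm z <= 1].
Let mV : measurable V. Proof. exact: open_measurable2. Qed.
Let mD : measurable D. Proof. exact: meas_dsc. Qed.
Let mB1 : measurable B1. Proof. exact: bdd_B. Qed.
Let p0 : 0 < (pi : R). Proof. exact: pi_gt0. Qed.

Lemma bal_disc : nu (~` B1) = 0%E.
Proof.
have [n0 _] := bal; have cB : closed B1 by exact: closed_B.
have VB : closure V `<=` B1.
 by rewrite [X in _ `<=` X](closure_id _).1//; apply: closureS => z /VD /ltW.
null_le; rewrite -n0; le_meas.
- exact: measurableC.
- apply: measurableC; apply: measurableD; first by apply: closed_measurable2; exact: closed_closure.
 by apply: open_measurable2; exact: open_interior.
- by move=> z /= Bz [/VB].
Qed.

Lemma bal_V : nu V = 0%E.
Proof.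
have [n0 _] := bal.
null_le; rewrite -n0; le_meas => //.
- apply: measurableC; apply: measurableD; first by apply: closed_measurable2; exact: closed_closure.
 by apply: open_measurable2; exact: open_interior.
- by move=> z Vz [_]; apply; exact: (open_nbhs_nbhs (conj oV Vz)).
Qed.

Lemma bal_polar N : polar N -> nu N = 0%E.
Proof. by have [_ [h _]] := bal; exact: h. Qed.

Lemma leb_V : exists2 mv : R, 0 <= mv & leb2 V = (pi * mv)%:E.
Proof.
have h1 : (leb2 V <= (pi * 1)%:E)%E by rewrite -(leb2_dscE ler01); le_meas.
have h0 : (0 <= leb2 V)%E by exact: measure_ge0.
case: (leb2 V) h0 h1 => // x x0 _; exists (x / pi); first by rewrite divr_ge0 ?(ltW p0).
by rewrite mulrC divfK// gt_eqF.
Qed.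

(** The defining identity at a far point [z] off the exceptional set, where the potential of [nu]
    and that of the area on [V], divided by [pi], are both estimated; [l] is [ln |z|^2]. *)
Lemma bal_far (mv : R) : leb2 V = (pi * mv)%:E -> 0 <= mv -> forall r : R, exists2 l : R, r <= l & exists t : R,
 [/\ (((l - ln 4) / 2)%:E * nu setT <= t%:E)%E, (t%:E <= ((l + ln 4) / 2)%:E * nu setT)%E,
  (l - ln 4) / 2 * mv <= t & t <= (l + ln 4) / 2 * mv].
Proof.
move=> mvE mv0 r; have [_ [_ [N [pN qe]]]] := bal.
have [z Nz zr] := polar_far (Num.max 16 (expR r)) pN.
have z16 : 16 <= sqnorm z by apply: le_trans zr; rewrite le_max lexx.
have zer : expR r <= sqnorm z by apply: le_trans zr; rewrite le_max lexx orbT.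
have z0 : 0 < sqnorm z by apply: lt_le_trans z16.
exists (ln (sqnorm z)); first by rewrite -[r]expRK ler_ln ?posrE ?expR_gt0.
have Vz : ~ V z by move=> /VD; rewrite /unit_disk/= ltNge (le_trans _ z16)// ler1n.
have {qe} := qe z Vz Nz.
have mlog : measT (logker z) by exact: (meas_logker (f := fun=> z)).
rewrite int_lebC//; last exact: measurable_funTS.
have [mr [mrE mrI]] := ex_restr_leb mV; rewrite -mrI//.
have [t1 -> [a1 a2]] := @int_log_far _ nu B1 z mB1 (fun w h => h) bal_disc z16.
have [|t2 -> [b1 b2]] := @int_log_far _ mr V z mV (fun w h => ltW (VD h)) _ z16.
 by rewrite mrE setICl measure0.
rewrite mrE setTI mvE -EFinM in b1 b2.
case: t2 b1 b2 => [t2| |]//; rewrite !lee_fin => b1 b2.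
rewrite -EFinN -EFinM => /eqP; rewrite eqe_oppLR => /eqP t1E; rewrite {}t1E in a1 a2.
exists (t2 / pi); move: a1 a2; rewrite (_ : (- (pi^-1 * - t2)%:E)%E = (t2 / pi)%:E); last by rewrite -EFinN mulrN opprK mulrC.
move=> a1 a2; split => //.
 by rewrite ler_pdivlMr//; move: b1; lra.
by rewrite ler_pdivrMr//; move: b2; lra.
Qed.

(** Both potentials are [- l / 2] times the mass up to a bounded error, and [l] is arbitrarily
    large. *)
Lemma bal_mass : nu setT = ((pi^-1)%:E * leb2 V)%E.
Proof.
have [mv mv0 mvE] := leb_V.
have l4 : 0 < ln 4 :> R by rewrite ln_gt0// ltr1n.
have [n n0 nE] : exists2 n : R, 0 <= n & nu setT = n%:E.
 have [l lr [t [h1 _ _ _]]] := bal_far mvE mv0 (ln 4 + 2).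
 have h0 : (0 <= nu setT)%E by exact: measure_ge0.
 case: (nu setT) h0 h1 => [n n0 _|_|//]; first by exists n.
 by rewrite mulry gtr0_sg ?mul1e//; move: lr; lra.
rewrite nE mvE -EFinM mulrA mulVf ?gt_eqF// mul1r; congr EFin.
have far r : exists2 l : R, r <= l & (l - ln 4) * n <= (l + ln 4) * mv /\ (l - ln 4) * mv <= (l + ln 4) * n.
 have [l lr [t [h1 h2 h3 h4]]] := bal_far mvE mv0 r; exists l => //.
 by move: h1 h2; rewrite nE -!EFinM !lee_fin => h1 h2; split; lra.
apply/eqP; rewrite eq_le; apply/andP; split; rewrite -subr_le0.
 apply: (@arch_le0 _ _ (ln 4 * (n + mv))) => k k0; have [l kl [h1 h2]] := far k%:R.
 have [y0|y0] := leP 0 (n - mv); last by apply: (@le_trans _ _ 0); [rewrite nmulr_lle0|rewrite mulr_ge0 ?addr_ge0 ?(ltW l4)].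
 by apply: (@le_trans _ _ (l * (n - mv))); [rewrite ler_wpM2r|lra].
apply: (@arch_le0 _ _ (ln 4 * (n + mv))) => k k0; have [l kl [h1 h2]] := far k%:R.
have [y0|y0] := leP 0 (mv - n); last by apply: (@le_trans _ _ 0); [rewrite nmulr_lle0|rewrite mulr_ge0 ?addr_ge0 ?(ltW l4)].
by apply: (@le_trans _ _ (l * (mv - n))); [rewrite ler_wpM2r|lra].
Qed.

Let mK z : measT (KK z : T -> \bar R). Proof. exact: (mk2_curry z (mK2 R)). Qed.

Let fin_sq (m : {measure set T -> \bar R}) (c : R) : m setT = c%:E -> m (~` B1) = 0%E ->
 exists2 M : R, 0 <= M & (\int[m]_w (sqnorm w)%:E)%E = M%:E.
Proof.
move=> mc m0; have h1 : (\int[m]_w (sqnorm w)%:E <= c%:E)%E.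
 have <- : (\int[m]__ 1 = c%:E)%E by rewrite integral_cst// mul1e.
 by apply: (@le_int_null _ _ _ m B1) => //; [exact: meas_sqE|exact: sqE_ge0].
have h0 : (0 <= \int[m]_w (sqnorm w)%:E)%E by apply: integral_ge0 => w _; exact: sqE_ge0.
by case: (\int[m]_w _)%E h0 h1 => // M M0 _; exists M.
Qed.

(** Half the growth of the second moment caused by the sweeping. It is also the constant by which
    the potential, taken with the kernel [KK], changes off [V]. *)
Definition bal_shift (mn mt : R) : R := (mn - pi^-1 * mt) / 2.

(* The equilibrium measure is obtained from the circular law by sweeping its part on V. *)
Lemma bal_energy : exists (sg : probability T R) (mn mt : R),
 [/\ (\int[nu]_w (sqnorm w)%:E)%E = mn%:E, (\int[leb2]_(w in V) (sqnorm w)%:E)%E = mt%:E,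
   sg V = 0%E /\ sg (~` B1) = 0%E,
   dbl sg sg (@KK R) = (3 / 4 + bal_shift mn mt)%:E &
   forall mu, probs_in (~` V) mu -> ((3 / 4 + bal_shift mn mt)%:E <= dbl mu mu (@KK R))%E].
Proof.
have [mv mv0 mvE] := leb_V; have nm := bal_mass; rewrite mvE -EFinM mulrA mulVf ?gt_eqF// mul1r in nm.
have [mn mn0 mnE] := fin_sq nm bal_disc.
have [mr [mrE mrI]] := ex_restr_leb mV.
have rT : mr (setT : set T) = (pi * mv)%:E by rewrite mrE setTI.
have rB : mr (~` B1) = 0%E.
 rewrite mrE (_ : _ `&` _ = set0) ?measure0//.
 by apply/seteqP; split => z //= -[+ /VD /ltW].
have [mt mt0 mtE] := fin_sq rT rB.
have mtE' : (\int[leb2]_(w in V) (sqnorm w)%:E)%E = mt%:E by rewrite -mtE mrI//; exact: meas_sqE.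
pose pin : R := pi^-1; have pin0 : 0 <= pin by rewrite invr_ge0 ltW.
have mDV : measurable (D `\` V) by exact: measurableD.
have [md [mdE mdI]] := ex_restr_leb mDV.
have [m0 [m0E m0I]] := ex_sum md nu pin0.
have DVE : leb2 (D `\` V) = (pi * (1 - mv))%:E.
 have : (leb2 D = leb2 V + leb2 (D `\` V))%E.
  rewrite -measureU//; last by rewrite setDIK.
  by congr leb2; apply/seteqP; split => w; [have [] := pselect (V w); [left|right]|case => [/VD|[]]].
 rewrite leb2_dscE// mvE mulr1; have : (0 <= leb2 (D `\` V))%E by exact: measure_ge0.
 by case: (leb2 (D `\` V)) => // x _ [] xE; congr EFin; move: xE; lra.
have [|sg sgE] := @ex_prob R m0.
 rewrite m0E mdE setTI DVE nm -EFinM -EFinD; congr EFin.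
 by rewrite /pin mulrA mulVf ?gt_eqF// mul1r subrK.
have sI f : measT f -> (forall x, 0 <= f x)%E ->
  (\int[sg]_x f x = pin%:E * \int[leb2]_(x in D `\` V) f x + \int[nu]_x f x)%E.
 move=> mf f0; transitivity (\int[m0]_x f x)%E; first by apply: eq_measure_integral => B mB _; exact: sgE.
 by rewrite m0I// mdI.
have [_ [_ [N [pN qe]]]] := bal; have [mN _] := pN.
(* Off [V] and the polar set the logarithmic potentials of [nu] and of the swept part agree, and so
   do the masses. Only second moments differ, so the potential is that of the circular law plus
   [bal_shift]: constant on the disc and at least as large outside. *)
have pot z : ~ V z -> ~ N z -> exists p : R, [/\ (\int[sg]_w KK z w = p%:E)%E, 3 / 4 + bal_shift mn mt <= p &
  (B1 z -> p = 3 / 4 + bal_shift mn mt)].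
 move=> Vz Nz; have {}qe := qe z Vz Nz.
 have mlog : measT (logker z) by exact: (meas_logker (f := fun=> z)).
 move: qe; rewrite int_lebC//; last exact: measurable_funTS.
 rewrite -mrI// (int_logker_KK z nm mv0 mnE) (int_logker_KK z rT _ mtE) ?mulr_ge0 ?(ltW p0)//.
 rewrite (mrI _ (mK z)).
 rewrite sI//; last by move=> w; exact: KK_ge0.
 have := int_D_V mV VD (mK z) (KK_ge0 z).
 have i0 (A : set T) : (0 <= \int[leb2]_(w in A) KK z w)%E by apply: integral_ge0 => w _; exact: KK_ge0.
 have n0 : (0 <= \int[nu]_w KK z w)%E by apply: integral_ge0 => w _; exact: KK_ge0.
 have [q [qE q34 qB]] : exists q : R, [/\ (\int[leb2]_(w in D) KK z w = (pi * q)%:E)%E, 3 / 4 <= q & B1 z -> q = 3 / 4].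
  have [z1|z1] := leP (sqnorm z) 1; first by exists (3 / 4); rewrite int_D_KK_in.
  exists ((sqnorm z + 1 / 2 - ln (sqnorm z)) / 2); rewrite int_D_KK_out ?(ltW z1)//; split => //.
   have h : ln (1 + (sqnorm z - 1)) <= sqnorm z - 1 by apply: le_ln1Dx; move: z1; lra.
   by move: h z1; rewrite [1 + _]addrC subrK; lra.
  by rewrite /B1/= leNgt z1.
 rewrite qE; move: (i0 V) (i0 (D `\` V)) n0.
 case: (\int[leb2]_(w in V) _)%E => [a| |]//; case: (\int[leb2]_(w in D `\` V) _)%E => [b| |]//.
 case: (\int[nu]_w _)%E => [c| |]//= _ _ _ [] e1 [] e2.
 have pc : pin * b + c = q + bal_shift mn mt.
  have pp : pin * pi = 1 by rewrite mulVf// gt_eqF.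
  rewrite (_ : c = pin * (a - (sqnorm z * (pi * mv) + mt) / 2) + (sqnorm z * mv + mn) / 2); last first.
   by move: e2; rewrite -/pin; lra.
  rewrite (_ : b = pi * q - a); last by move: e1; lra.
  have q1 : pin * (pi * q) = q by rewrite mulrA pp mul1r.
  have q2 : pin * (sqnorm z * (pi * mv)) = sqnorm z * mv by rewrite mulrCA (mulrA pin) pp mul1r.
  by rewrite /bal_shift -/pin; move: q1 q2; lra.
 exists (pin * b + c); rewrite -EFinM -EFinD pc; split => //; first by rewrite lerD2r.
 by move=> /qB ->.
pose c1 : R := 3 / 4 + bal_shift mn mt.
have sgV : sg V = 0%E.
 by rewrite sgE m0E mdE setIDA setDE -setIA (setIC D) setIA setICr set0I measure0 mule0 bal_V adde0.
have sgB : sg (~` B1) = 0%E.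
 rewrite sgE m0E mdE bal_disc adde0 (_ : _ `&` _ = set0) ?measure0 ?mule0//.
 by apply/seteqP; split => z //= -[+ [/ltW]].
have sgN : sg N = 0%E.
 rewrite sgE m0E mdE bal_polar// adde0.
 have /eqP := leb_polar pN (lexx 1); rewrite expr1n => /eqP h.
 have : (leb2 (N `&` (D `\` V)) <= leb2 (N `&` D))%E.
  by le_meas; [exact: measurableI|exact: measurableI|move=> w [? []]].
 by rewrite h measure_le0 => /eqP ->; rewrite mule0.
pose B' := B1 `\` (V `|` N).
have mVN : measurable (V `|` N) by exact: measurableU.
have mB' : measurable B' by exact: measurableD.
have null3 (mu : probability T R) : mu V = 0%E -> mu N = 0%E -> mu (~` (~` (V `|` N))) = 0%E.
 move=> h1 h2; rewrite setCK; null_le; rewrite -(adde0 0) -[X in (_ <= X + _)%E]h1 -[X in (_ <= _ + X)%E]h2.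
 exact: measureU2.
have sgB' : sg (~` B') = 0%E.
 null_le; rewrite -(adde0 0) -[X in (_ <= X + _)%E]sgB -[X in (_ <= _ + X)%E](null3 sg sgV sgN) setCK.
 rewrite /B' setDE setCI setCK; apply: measureU2 => //; exact: measurableC.
have mp := meas_pot.
have pot0 (mu : probability T R) z : (0 <= \int[mu]_w KK z w)%E by apply: integral_ge0 => w _; exact: KK_ge0.
have c10 : 0 <= c1.
 have [[z Bz]|H] := pselect (exists z, B' z); last first.
  have : sg setT = 0%E.
   by rewrite -sgB'; congr (sg _); apply/seteqP; split => // z _ Bz; apply: H; exists z.
  by rewrite probability_setT => /eqP; rewrite onee_eq0.
 case: Bz => Bz /not_orP[Vz Nz]; have [p [pE _ pc]] := pot z Vz Nz.
 by rewrite /c1 -pc// -lee_fin -pE.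
have Esg : dbl sg sg (@KK R) = c1%:E.
 rewrite -(int_prob_cst sg c1%:E); apply: (@int_null _ _ _ sg _ _ B') => //; [exact: mp|exact: pot0|].
 by move=> z [Bz /not_orP[Vz Nz]]; have [p [-> _ ->]] := pot z Vz Nz.
exists sg, mn, mt; split => // mu mup.
have [E|fin] := eqVneq (dbl mu mu (@KK R)) +oo%E; first by rewrite E leey.
have d0 : (0 <= dbl mu mu (@KK R))%E by apply: dbl_ge0; exact: mK2.
have [mu1 mu2] := mup; have [M M0 HM] := compact_bound mu1.
pose M1 := Num.max 1 M.
have muM : mu (~` [set z | sqnorm z <= M1]) = 0%E.
 null_le; rewrite -(suppC_null mu); le_meas.
 - by apply: measurableC; exact: bdd_B.
 - by apply: measurableC; apply: closed_measurable2; exact: closed_supp.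
 - by move=> z Hz /HM zM; apply: Hz; rewrite /= le_max zM orbT.
have sgM : sg (~` [set z | sqnorm z <= M1]) = 0%E.
 null_le; rewrite -sgB; le_meas.
 - by apply: measurableC; exact: bdd_B.
 - exact: measurableC.
 - by move=> z Hz z1; apply: Hz; rewrite /= le_max z1.
have muV : mu V = 0%E by apply: (probs_null mup) => //; rewrite setICl.
have muN : mu N = 0%E by apply: (polar_null pN muM); rewrite ltey.
have : (c1%:E <= dbl mu sg (@KK R))%E.
 rewrite -(int_prob_cst mu c1%:E); apply: (@le_int_null _ _ _ mu (~` (V `|` N))) => //; [exact: measurableC|exact: null3|exact: mp|exact: pot0|].
 by move=> z /not_orP[Vz Nz]; have [p [-> h _]] := pot z Vz Nz; rewrite lee_fin.
(* With [c1] the energy of [sg] and a lower bound of its mutual energy with [mu], positivity gives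
   [2 c1 <= I(mu) + c1], where [I(mu)] is the energy of [mu]. *)
have := @pd_KK R mu sg M1; rewrite le_max lexx => /(_ isT muM sgM); rewrite Esg.
case: (dbl mu mu _) d0 fin => [x| |]// x0 _; case: (dbl mu sg _) => [y| |]//; last by rewrite mulry gtr0_sg// mul1e.
by rewrite -EFinM -EFinD !lee_fin -/c1; lra.
Qed.

Lemma bal_RU : exists mn mt : R, [/\ (\int[nu]_w (sqnorm w)%:E)%E = mn%:E, (\int[leb2]_(w in V) (sqnorm w)%:E)%E = mt%:E,
  R_U V = (3 / 4 + bal_shift mn mt)%:E & exists sg : probability T R, [/\ sg V = 0%E, sg (~` B1) = 0%E & dbl sg sg (@KK R) = (3 / 4 + bal_shift mn mt)%:E]].
Proof.
have [sg [mn [mt [h1 h2 [h3 h4] h5 h6]]]] := bal_energy.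
exists mn, mt; split => //; last by exists sg.
have sgp : probs_in (~` V) sg.
 apply: (@probs_inI _ _ (B1 `&` ~` V) 1); [by apply: closedI; [exact: closed_B|exact: open_closedC]|by move=> z []|by move=> z []|].
 rewrite setCI setCK; null_le; rewrite -(adde0 0) -[X in (_ <= X + _)%E]h4 -[X in (_ <= _ + X)%E]h3.
 by apply: measureU2 => //; exact: measurableC.
apply/eqP; rewrite eq_le; apply/andP; split.
 by apply: ereal_inf_lbound; exists sg => //; rewrite (RmuE sgp).
by apply: le_ereal_inf_tmp => _ [mu mup <-]; rewrite (RmuE mup); exact: h6.
Qed.
End balayage.

(** * Energy along the approximating sequence *)

Section kappa.
Variable R : realType.
Local Notation T := (R * R)%type.

Lemma cont_sqnorm : continuous (@sqnorm R).
Proof.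
move=> z; have h1 : ((fun z : T => z.1 * z.1 + z.2 * z.2) x @[x --> z]) --> z.1 * z.1 + z.2 * z.2.
 by apply: cvgD; apply: cvgM; (exact: cvg_fst || exact: cvg_snd).
exact: h1.
Qed.

Definition outer_approx (U : set T) (Un : nat -> set T) := [/\ open U, U `<=` @unit_disk R, forall n, open (Un n),
 forall n, closure U `<=` Un n /\ Un n `<=` @unit_disk R & exists nu_ nu,
 [/\ forall n, is_balayage (Un n) (nu_ n), is_balayage U nu & weak_cvg nu_ nu]].

(** The swept measure of a suitable [Un n] avoids a neighbourhood of [U] and has energy barely above
    [R_U]; it is the measure to be smeared. *)
Lemma bal_shift_cvg (U : set T) (Un : nat -> set T) : outer_approx U Un ->
 exists2 r : R, R_U U = r%:E & forall e : R, 0 < e -> exists n (sg : probability T R),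
  [/\ sg (Un n) = 0%E, sg (~` [set z | sqnorm z <= 1]) = 0%E & (dbl sg sg (@KK R) <= (r + e)%:E)%E].
Proof.
move=> [oU UD oUn HUn [nu_ [nu [Hb Hbal W]]]].
have [mn [mt [h1 h2 h3 _]]] := bal_RU oU UD Hbal.
exists (3 / 4 + bal_shift mn mt) => // e e0.
(* This is [min(|z|^2, 1)]: bounded and continuous, and equal to [|z|^2] on the closed disc, which
   carries all the balayage measures. *)
pose f (z : T) : R := (sqnorm z + 1 - `|sqnorm z - 1|) / 2.
have fE z : sqnorm z <= 1 -> f z = sqnorm z.
 by move=> z1; rewrite /f ler0_norm ?subr_le0//; lra.
have f01 z : 0 <= f z <= 1.
 by rewrite /f; have z0 := sqnorm_ge0 z; have [z1|z1] := orP (le_total (sqnorm z) 1); [rewrite ler0_norm ?subr_le0//|rewrite ger0_norm ?subr_ge0//]; lra.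
have cf : continuous f.
 move=> z; apply: cvgMl; apply: cvgB; first by apply: cvgD; [exact: cont_sqnorm|exact: cvg_cst].
 by apply: cvg_norm; apply: cvgB; [exact: cont_sqnorm|exact: cvg_cst].
have bf : exists M : R, forall x, `|f x| <= M.
 by exists 1 => x; case/andP: (f01 x) => a b; rewrite ger0_norm.
have mf : measT (fun z => (f z)%:E : \bar R) by efin; exact: continuous_meas.
have fI (m : {measure set T -> \bar R}) : m (~` [set z | sqnorm z <= 1]) = 0%E -> (\int[m]_z (f z)%:E = \int[m]_z (sqnorm z)%:E)%E.
 move=> m0; apply: (@int_null _ _ _ m _ _ [set z | sqnorm z <= 1]) => //.
 - exact: bdd_B.
 - exact: meas_sqE.
 - by move=> z; rewrite lee_fin; case/andP: (f01 z).
 - by move=> z; exact: sqE_ge0.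
 - by move=> z /fE ->.
have := W f cf bf; rewrite (fI nu (bal_disc UD Hbal)) h1.
move=> /fine_cvgP[_ /cvgrPdist_lt /(_ e e0) [n _ /(_ n (leqnn n))]] /=.
have [mn' [mt' [k1 k2 k3 [sg [s1 s2 s3]]]]] := bal_RU (oUn n) (HUn n).2 (Hb n).
rewrite (fI _ (bal_disc (HUn n).2 (Hb n))) k1/= => dist.
exists n, sg; split => //; rewrite s3 lee_fin -addrA lerD2l /bal_shift.
(* The part swept away only grows from [U] to [Un n], and its second moment enters [bal_shift] with
   a minus sign. *)
have mtt : mt <= mt'.
 have UUn : U `<=` Un n by move=> z Uz; apply: (HUn n).1; exact: subset_closure.
 rewrite -lee_fin -h2 -k2; apply: ge0_subset_integral => //; [exact: open_measurable2|exact: open_measurable2| |].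
 - by apply: measurable_funTS; exact: meas_sqE.
 - by move=> z _; exact: sqE_ge0.
have : pi^-1 * mt <= pi^-1 * mt' by rewrite ler_wpM2l// invr_ge0 ltW// pi_gt0.
by move: dist; rewrite ltr_distl => /andP[]; lra.
Qed.
End kappa.

(** * Lower bound *)

Section jensen.
Variable R : realType.
Local Notation T := (R * R)%type.
Variables (U : set T) (P : probability T R) (A B E : R) (V : T -> R).
Hypotheses (mU : measurable U) (A0 : 0 < A) (PU : P U = 0%E).
Hypothesis PA : forall F : T -> \bar R, measT F -> (forall z, 0 <= F z)%E ->
 (\int[P]_z F z <= A%:E * \int[leb2]_z F z)%E.
Hypotheses (mV : measT V) (V0 : forall w, 0 <= V w).
Hypothesis HV : forall w, (\int[P]_z KK z w <= (V w)%:E)%E.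
Hypothesis HE : (\int[P]_z (V z)%:E <= E%:E)%E.
Hypothesis HB : (\int[P]_z (sqnorm z)%:E <= B%:E)%E.

Let Ts (s : seq T) := \sum_(w <- s) sqnorm w.
Let Vs (s : seq T) := \sum_(w <- s) V w.
(** Up to the constant [C0], minus the logarithm of [gw]: the cost of placing the next point at [z]
    when the points of [s] are fixed and [k] further points of law [P] are accounted for through
    [V]. *)
Let g (k : nat) (s : seq T) (z : T) : \bar R :=
 ((sqnorm z)%:E + \sum_(w <- s) (2%:E * KK z w) + ((2 * k%:R) * V z)%:E)%E.

(** The graph of [exp(- x)] lies above its tangent at [m]. The term in [x] is moved to the right so
    that both sides can be integrated when [x] is an infinite cost. *)
Lemma exp_tangent (x m : R) : expR (- m) * (1 + m) <= expR (- x) + expR (- m) * x.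
Proof.
have := expR_ge1Dx (m - x); rewrite -[m - x]opprK opprB => /(ler_wpM2l (expR_ge0 (- m))).
by rewrite -expRD (_ : - m + - (x - m) = - x); lra.
Qed.

Let gw (k n : nat) s z : R := expR (- (n%:R * sqnorm z)) * \prod_(w <- s) sqnorm (z - w) *
 expR (k%:R * (sqnorm z + Ts s) - k%:R * (ln A + B) - 2 * k%:R * (V z + Vs s) - k%:R * (k%:R - 1) * E).

Let C0 k s : R := (k%:R + 1) * Ts s - k%:R * (ln A + B) - 2 * k%:R * Vs s - k%:R * (k%:R - 1) * E.

Lemma jensen_pt k n s z m : (size s + k.+1 = n)%N ->
 ((expR (C0 k s) * (expR (- m) * (1 + m)))%:E <= (gw k n s z)%:E + (expR (C0 k s) * expR (- m))%:E * g k s z)%E.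
Proof.
move=> sn; have gw0 : 0 <= gw k n s z by rewrite !mulr_ge0 ?expR_ge0 ?prod_sq_ge0.
have c0 : 0 < expR (C0 k s) * expR (- m) by rewrite mulr_gt0 ?expR_gt0.
(* At a point already placed the cost is infinite and the right-hand side is [+oo]. *)
have [zs|zs] := boolP (z \in s).
 have -> : g k s z = +oo%E.
  rewrite /g (big_rem z zs)/= {1}/KK logkerE subrr (_ : sqnorm 0 == 0) ?sqnorm_eq0//=.
  rewrite mulry gtr0_sg// mul1e.
  have r0 : (0 <= \sum_(w <- rem z s) (2%:E * KK z w))%E by apply: sume_ge0 => w _; rewrite mule_ge0// KK_ge0.
  by rewrite !addye ?addey// gt_eqF// (lt_le_trans _ r0)// ltNye.
 by rewrite mulry gtr0_sg// mul1e addey// leey.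
have pos w : w \in s -> 0 < sqnorm (z - w).
 move=> ws; rewrite lt_def sqnorm_ge0 andbT sqnorm_eq0 subr_eq0; apply: contraNneq zs => ->//.
have [lE pp] := ln_prod_seq pos.
pose gr : R := sqnorm z + \sum_(w <- s) (- ln (sqnorm (z - w)) + (sqnorm z + sqnorm w)) + 2 * k%:R * V z.
have -> : g k s z = gr%:E.
 rewrite /g /gr !EFinD -sumEFin; congr (_ + _ + _)%E; rewrite big_seq [RHS]big_seq; apply: eq_bigr => w ws.
 rewrite /KK logkerE gt_eqF ?pos//.
 transitivity ((2 * (- (ln (sqnorm (z - w)) / 2) + (sqnorm z + sqnorm w) / 2))%:E) => //.
 by congr EFin; lra.
rewrite -EFinM -EFinD lee_fin.
have -> : gw k n s z = expR (C0 k s) * expR (- gr).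
 rewrite /gw -[X in _ * X * _]lnK ?posrE// lE -!expRD; congr expR.
 rewrite /gr /C0 -sn big_split/= sumrN big_split/= sum_seq_const -/(Ts s) natrD -natr1; ring.
by rewrite -[X in _ <= _ + X]mulrA -mulrDr ler_wpM2l ?expR_ge0//; exact: exp_tangent.
Qed.

Lemma meas_gw k n s : measT (gw k n s).
Proof.
have me := @measurable_expR R; have ms := @meas_sqn R.
apply: measurable_funM; first apply: measurable_funM.
- by apply: (meas_comp me); apply: measurableT_comp => //; exact: measurable_funM.
- by apply: meas_prod_sq; [exact: measurable_id|exact: mseq_cst].
- apply: (meas_comp me); apply: measurable_funB => //; apply: measurable_funB; last first.
  by apply: measurable_funM => //; exact: measurable_funD.
 by apply: measurable_funB => //; apply: measurable_funM => //; exact: measurable_funD.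
Qed.

(** Jensen's inequality for one variable: the tangent is taken at [m], an upper bound for the mean
    cost under [P], and the cost term is cancelled after integration. *)
Lemma jensen_step k n s : (size s + k.+1 = n)%N ->
 ((expR (C0 k s - (B + 2 * Vs s + 2 * k%:R * E)))%:E <= \int[P]_z (gw k n s z)%:E)%E.
Proof.
move=> sn; set m := B + _ + _.
have gw0 z : (0 <= (gw k n s z)%:E :> \bar R)%E by rewrite lee_fin !mulr_ge0 ?expR_ge0 ?prod_sq_ge0.
have mg1 : measT (fun z => (gw k n s z)%:E : \bar R) by efin; exact: meas_gw.
have mKw w : measT (fun z => KK z w : \bar R) by apply: meas_KK => //; exact: measurable_id.
have mK2w w : measT (fun z => 2%:E * KK z w : \bar R)%E by exact: emeasurable_funM.
have K20 (z w : T) : (0 <= 2%:E * KK z w)%E by rewrite mule_ge0// KK_ge0.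
have ms0 : measT (fun z => \sum_(w <- s) (2%:E * KK z w) : \bar R)%E by exact: emeasurable_sum.
have s0 z : (0 <= \sum_(w <- s) (2%:E * KK z w) :> \bar R)%E by exact: sume_ge0.
have kV0 z : (0 <= ((2 * k%:R) * V z)%:E :> \bar R)%E by rewrite lee_fin !mulr_ge0.
have mkV : measT (fun z => ((2 * k%:R) * V z)%:E : \bar R) by efin; exact: measurable_funM.
have mse := @meas_sqE R; have se := @sqE_ge0 R.
have g0 z : (0 <= g k s z)%E by rewrite /g !adde_ge0.
have mg : measT (g k s) by apply: emeasurable_funD => //; exact: emeasurable_funD.
have Ig : (\int[P]_z g k s z <= m%:E)%E.
 rewrite /g ge0_integralD//; [|by move=> z _; rewrite adde_ge0|exact: emeasurable_funD].
 rewrite ge0_integralD// ge0_integral_sum// /m !EFinD; apply: leeD; first apply: leeD => //.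
  rewrite /Vs EFinM -sumEFin ge0_sume_distrr; [|by move=> w _; rewrite lee_fin].
  have two0 : (0 <= 1 + 1 :> \bar R)%E by rewrite adde_ge0.
  by apply: lee_sum => w _; rewrite ge0_integralZl//; [apply: lee_wpmul2l; [exact: two0|exact: HV]|move=> z _; exact: KK_ge0].
 under eq_integral do rewrite EFinM.
 have mVE : measT (fun z => (V z)%:E : \bar R) by exact/measurable_EFinP.
 have V0E z : setT z -> (0 <= (V z)%:E :> \bar R)%E by move=> _; rewrite lee_fin.
 have kk0 : (0 <= (2 * k%:R)%:E :> \bar R)%E by rewrite lee_fin mulr_ge0.
 rewrite (ge0_integralZl P measurableT mVE V0E kk0) [leRHS]EFinM; exact: lee_wpmul2l.
pose c := expR (C0 k s) * expR (- m); have c0 : 0 < c by rewrite mulr_gt0 ?expR_gt0.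
have : ((expR (C0 k s) * (expR (- m) * (1 + m)))%:E <= \int[P]_z (gw k n s z)%:E + c%:E * \int[P]_z g k s z)%E.
 rewrite -ge0_integralZl//; last by rewrite lee_fin ltW.
 rewrite -ge0_integralD//; [|by move=> z _; rewrite mule_ge0// lee_fin ltW|exact: emeasurable_funM].
 rewrite -(int_prob_cst P (_)%:E).
 have [m1|m1] := leP 0 (1 + m); last first.
  apply: (@le_trans _ _ (\int[P]_z 0)%E).
   by rewrite !int_prob_cst lee_fin mulrA mulr_ge0_le0// ltW.
  by apply: ge0_le_integral => //; [apply: emeasurable_funD => //; exact: emeasurable_funM|move=> z _; rewrite adde_ge0// mule_ge0// lee_fin ltW].
 apply: ge0_le_integral => //.
 - by move=> z _; rewrite lee_fin mulrA mulr_ge0// ltW.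
 - by apply: emeasurable_funD => //; exact: emeasurable_funM.
 - by move=> z _; exact: jensen_pt.
have : (0 <= \int[P]_z (gw k n s z)%:E)%E by exact: integral_ge0.
have : (0 <= \int[P]_z g k s z)%E by exact: integral_ge0.
case: (\int[P]_z g k s z)%E Ig => // G Gm _; case: (\int[P]_z _)%E => [H _|_ _|//]; last by rewrite leey.
move: Gm; rewrite -EFinM -EFinD !lee_fin expRD -/m -/c mulrA -/c => Gm.
have : c * G <= c * m by rewrite ler_pM2l.
lra.
Qed.

(** Jensen over the [k] remaining points, one integral at a time. Each squared distance is written
    through [KK]. As [n = size s + k], the pair terms absorb all but one of the [n] copies of
    [|z|^2], which leaves [B] per point; [ln A] bounds the logarithm of the density of [P]. *)
Lemma jensen_Zp k s n : (size s + k = n)%N ->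
 ((expR (k%:R * Ts s - k%:R * (ln A + B) - 2 * k%:R * Vs s - k%:R * (k%:R - 1) * E))%:E <= Zp n%:R U k s)%E.
Proof.
elim: k s => [|k IH] s sn; first by rewrite !mul0r mulr0 mul0r !subr0 expR0.
rewrite ZpS.
have mz : measT (fun z => zw n%:R U z s) by apply: (@meas_zw R n%:R U _ _ id (fun=> s)) => //; exact: mseq_cst.
have mi : measT (\1_(~` U) : T -> R) by apply: measurable_indic; exact: measurableC.
have mgw' : measT (fun z => (\1_(~` U) z * gw k n s z)%:E : \bar R).
 by efin; apply: measurable_funM => //; exact: meas_gw.
have gw0 z : 0 <= gw k n s z by rewrite !mulr_ge0 ?expR_ge0 ?prod_sq_ge0.
have g0' z : (0 <= (\1_(~` U) z * gw k n s z)%:E :> \bar R)%E by rewrite lee_fin mulr_ge0.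
apply: (@le_trans _ _ (\int[leb2]_z (\1_(~` U) z * gw k n s z)%:E)%E); last first.
 apply: ge0_le_integral => //.
 - apply: emeasurable_funM; first exact/measurable_EFinP.
  by apply: (@meas_Zp R n%:R U k _ _ (fun z => z :: s)) => //; apply: mseqS; [exact: measurable_id|exact: mseq_cst].
 - move=> z _; have := IH (z :: s); rewrite /= addSnnS => /(_ sn) h.
  apply: le_trans (lee_wpmul2l _ h); last by rewrite lee_fin zw_ge0.
  by rewrite -EFinM lee_fin /zw /gw !mulrA /Ts /Vs !big_cons.
have := PA mgw' g0'; rewrite -lee_pdivrMl// => h; apply: le_trans h.
have -> : (\int[P]_z (\1_(~` U) z * gw k n s z)%:E = \int[P]_z (gw k n s z)%:E)%E.
 apply: (@int_null _ _ _ P _ _ (~` U)) => //; first exact: measurableC.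
 - by rewrite setCK.
 - by efin; exact: meas_gw.
 - by move=> z Uz; rewrite indicE mem_set// mul1r.
have Ai0 : (0 <= (A^-1)%:E :> \bar R)%E by rewrite lee_fin invr_ge0 ltW.
apply: le_trans (lee_wpmul2l Ai0 (jensen_step sn)).
rewrite -EFinM -[A^-1]lnK ?posrE ?invr_gt0// lnV ?posrE// -expRD lee_fin ler_expR /C0 -natr1; lra.
Qed.
End jensen.

(** * Smearing a minimiser over small discs *)

Section smear.
Variable R : realType.
Local Notation T := (R * R)%type.
Local Notation D := (dsc (1 : R)).
Variable d : R.
Hypotheses (d0 : 0 < d) (d1 : d <= 1).

Definition sm (x y : T) : T := (x.1 + d * y.1, x.2 + d * y.2).

Lemma meas_sm e (S : measurableType e) (f g : S -> T) : measT f -> measT g ->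
 measT (fun t => sm (f t) (g t)).
Proof.
move=> mf mg; apply: meas_pairR; apply: measurable_funD.
- exact: (meas_comp mfst mf).
- by apply: measurable_funM => //; exact: (meas_comp mfst mg).
- exact: (meas_comp msnd mf).
- by apply: measurable_funM => //; exact: (meas_comp msnd mg).
Qed.

Lemma smE x y : sm x y = ct ((d%:C)%C * tc y + tc x).
Proof. by rewrite /sm /ct /tc /=; case: x y => [x1 x2] [y1 y2]/=; congr (_, _); ring. Qed.

(** The cross term is at most [2 d] and the quadratic one at most [d^2 <= d]. *)
Lemma sm_bound x y : sqnorm x <= 1 -> sqnorm y < 1 -> sqnorm (sm x y) <= sqnorm x + 3 * d.
Proof.
rewrite /sqnorm /sm /=; move: x y => [x1 x2] [y1 y2]/= hx hy.
have h : 2 * (x1 * y1 + x2 * y2) <= 2 by have := sqr_ge0 (x1 - y1); have := sqr_ge0 (x2 - y2); lra.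
have h2 : d * (2 * (x1 * y1 + x2 * y2)) <= d * 2 by rewrite ler_pM2l.
have h3 : d * d * (y1 ^+ 2 + y2 ^+ 2) <= d * 1.
 apply: (@le_trans _ _ (d * d * 1)); first by rewrite ler_wpM2l ?mulr_ge0 ?(ltW d0)// ltW.
 by rewrite mulr1 ler_pM2l.
lra.
Qed.

(* Both sides are shifted so as to be nonnegative. *)
Lemma KK_sm w x y : let z := scl2 d^-1 (w - x) in
 (KK w (sm x y) + ((sqnorm z + sqnorm y) / 2)%:E = KK z y + ((sqnorm w + sqnorm (sm x y)) / 2 - ln d)%:E)%E.
Proof.
move=> z; have dn : d != 0 by rewrite gt_eqF.
have E : w - sm x y = scl2 d (z - y).
 rewrite /z -scl2B; rewrite /scl2 /sm /=; by apply/pair_equal_spec; split => /=; field.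
rewrite /KK !logkerE E sqnorm_scl2 mulf_eq0 expf_eq0/= (negbTE dn)/=.
case: eqP => [_|/eqP zy]; first by rewrite !addye.
have p0 : 0 < sqnorm (z - y) by rewrite lt_def zy sqnorm_ge0.
rewrite -!EFinD; congr EFin; rewrite lnM ?posrE ?exprn_gt0// lnXn//; lra.
Qed.

Variables (om : probability T R).
Hypothesis omB : om (~` D) = 0%E.
Hypothesis omI : forall f : T -> \bar R, measT f -> (forall x, 0 <= f x)%E ->
 (\int[om]_x f x = (pi^-1)%:E * \int[leb2]_(x in D) f x)%E.

Let p0 : 0 < (pi : R). Proof. exact: pi_gt0. Qed.
Let mKz z : measT (KK z : T -> \bar R). Proof. exact: (mk2_curry z (mK2 R)). Qed.

Let om_sq : (\int[om]_y (sqnorm y)%:E = (2^-1)%:E)%E.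
Proof.
rewrite omI; [|exact: meas_sqE|exact: sqE_ge0].
by rewrite int_D_sq -EFinM mulrA mulVf ?mul1r// gt_eqF.
Qed.

Let Wx x w := (\int[om]_y KK w (sm x y))%E.

(** With [z = (w - x) / d] the smeared kernel is reduced to the explicit potential of the unit disc.
    The first bound makes potentials of the smeared law finite everywhere; the second says that
    smearing raises the kernel by at most [3 d / 2]. *)
Lemma Wx_bound x w : sqnorm x <= 1 ->
 (Wx x w <= (1 / 2 - ln d + (sqnorm w + sqnorm x + 3 * d) / 2)%:E)%E /\
 (Wx x w <= KK w x + (3 * d / 2)%:E)%E.
Proof.
move=> x1; pose z := scl2 d^-1 (w - x).
have msm : measT (sm x) by apply: (@meas_sm _ _ (fun=> x) id).
have mKs : measT (fun y => KK w (sm x y)) by exact: (meas_comp (mKz w) msm).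
have mss : measT (fun y => (sqnorm (sm x y))%:E : \bar R) by exact: (meas_comp (@meas_sqE R) msm).
have ld : 0 <= - ln d by rewrite oppr_ge0 ln_le0.
have pz : (Wx x w + (((sqnorm z + 1 / 2) / 2)%:E) <= \int[om]_y KK z y + ((sqnorm w + (sqnorm x + 3 * d)) / 2 - ln d)%:E)%E.
 have i1 : (\int[om]_y ((sqnorm z + sqnorm y) / 2)%:E = ((sqnorm z + 1 / 2) / 2)%:E)%E.
  under eq_integral do rewrite mulrDl EFinD.
  rewrite ge0_integralD//; last 3 first.
  - by move=> y _; rewrite lee_fin divr_ge0// sqnorm_ge0.
  - by move=> y _; rewrite lee_fin divr_ge0// sqnorm_ge0.
  - by efin; apply: measurable_funM => //; exact: meas_sqn.
  rewrite int_prob_cst; under eq_integral do rewrite mulrC EFinM.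
  rewrite ge0_integralZl//; [|exact: meas_sqE|by move=> y _; exact: sqE_ge0].
  by rewrite om_sq -EFinM -EFinD; congr EFin; lra.
 rewrite -i1 /Wx -ge0_integralD//; last 3 first.
 - by move=> y _; exact: KK_ge0.
 - by move=> y _; rewrite lee_fin divr_ge0// addr_ge0// sqnorm_ge0.
 - by efin; apply: measurable_funM => //; apply: measurable_funD => //; exact: meas_sqn.
 under eq_integral do rewrite KK_sm.
 have r0 : 0 <= (sqnorm w + (sqnorm x + 3 * d)) / 2 - ln d.
  by have := sqnorm_ge0 w; have := sqnorm_ge0 x; move: ld d0; lra.
 rewrite -[X in (_ <= _ + X)%E](int_prob_cst om) -ge0_integralD//; [|by move=> y _; exact: KK_ge0].
 apply: (@le_int_null _ _ _ om D) => //.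
 - exact: meas_dsc.
 - apply: emeasurable_funD => //; efin; apply: measurable_funB => //; apply: measurable_funM => //.
  by apply: measurable_funD => //; exact/measurable_EFinP.
 - exact: emeasurable_funD.
 - by move=> y; rewrite adde_ge0 ?KK_ge0// lee_fin addr_ge0// divr_ge0// addr_ge0// sqnorm_ge0.
 - by move=> y; rewrite adde_ge0 ?KK_ge0.
 - move=> y y1; apply: leeD => //; rewrite lee_fin lerD2r ler_pM2r// lerD2l.
  exact: sm_bound.
have [q [qE q1 q2]] : exists q : R, [/\ (\int[om]_y KK z y = q%:E)%E, q <= sqnorm z / 2 + 1 / 4 + 1 / 2 &
  0 < sqnorm z -> q <= sqnorm z / 2 + 1 / 4 - ln (sqnorm z) / 2].
 rewrite omI//; last by move=> y; exact: KK_ge0.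
 have lnb : 0 < sqnorm z -> ln (sqnorm z) <= sqnorm z - 1.
  move=> z0; have h : ln (1 + (sqnorm z - 1)) <= sqnorm z - 1 by apply: le_ln1Dx; lra.
  by move: h; rewrite [1 + _]addrC subrK.
 have [z1|z1] := leP (sqnorm z) 1.
  exists (3 / 4); split; [by rewrite int_D_KK_in// -EFinM mulrA mulVf ?mul1r// gt_eqF|by have := sqnorm_ge0 z; lra|].
  by move=> /lnb; lra.
 exists ((sqnorm z + 1 / 2 - ln (sqnorm z)) / 2); split.
 - by rewrite int_D_KK_out ?(ltW z1)// -EFinM mulKf// gt_eqF.
 - by have : 0 <= ln (sqnorm z) by [rewrite ln_ge0// ltW]; lra.
 - by lra.
have W0 : (0 <= Wx x w)%E by apply: integral_ge0 => y _; exact: KK_ge0.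
move: pz; rewrite qE -EFinD; case: (Wx x w) W0 => [W| |]// _; rewrite -EFinD !lee_fin => pz; split; first lra.
rewrite /KK logkerE; case: eqP => [_|/eqP wx]; first by rewrite !addye// leey.
have wx0 : 0 < sqnorm (w - x) by rewrite lt_def wx sqnorm_ge0.
have zE : sqnorm z = d^-1 ^+ 2 * sqnorm (w - x) by rewrite /z sqnorm_scl2.
have di : 0 < d^-1 by rewrite invr_gt0.
have lz : ln (sqnorm z) = ln (sqnorm (w - x)) - 2 * ln d.
 by rewrite zE lnM ?posrE ?exprn_gt0// lnXn// lnV ?posrE//; lra.
have z0 : 0 < sqnorm z by rewrite zE mulr_gt0// exprn_gt0.
by rewrite -!EFinD lee_fin; have := q2 z0; lra.
Qed.

(* The law of x + d y, for x and y independent of respective laws sg and om. *)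
Lemma smear_prob (sg : probability T R) : exists P : probability T R,
 forall f : T -> \bar R, measT f -> (forall x, 0 <= f x)%E ->
 (\int[P]_z f z = \int[sg]_x \int[om]_y f (sm x y))%E.
Proof.
have mphi : measT (fun p : T * T => sm p.1 p.2) by apply: meas_sm; [exact: mfst|exact: msnd].
pose m0 : {measure set T -> \bar R} := pushforward ((sg : {sigma_finite_measure set T -> \bar R}) \x (om : {sigma_finite_measure set T -> \bar R}))%E (fun p : T * T => sm p.1 p.2).
pose m := m0 mphi.
have [|P PE] := @ex_prob R m.
 change (((sg : {sigma_finite_measure set T -> \bar R}) \x om)%E ((fun p : T * T => sm p.1 p.2) @^-1` setT) = 1%E).
 rewrite preimage_setT -setXTT; transitivity (sg setT * om setT)%E; first exact: product_measure1E.
 by rewrite !probability_setT mule1.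
exists P => f mf f0; transitivity (\int[m]_z f z)%E; first by apply: eq_measure_integral => B mB _; exact: PE.
rewrite ge0_integral_pushforward//.
have mfs : measT (fun p : T * T => f (sm p.1 p.2)) by exact: (meas_comp mf mphi).
by rewrite -[RHS](@fubini_tonelli1 _ _ _ _ _ sg om _ mfs (fun p => f0 _)).
Qed.

(** The smeared law has density at most [1 / (pi d^2)], charges no part of [U] since [sg] does not
    charge [V], and its energy exceeds that of [sg] by at most [3 d]. The density bound costs only a
    term linear in [n]. *)
Lemma smear_lower (U V : set T) (sg : probability T R) (E0 : R) : measurable U ->
 sg V = 0%E -> measurable V -> sg (~` [set z | sqnorm z <= 1]) = 0%E -> dbl sg sg (@KK R) = E0%:E ->
 (forall x y, ~ V x -> sqnorm y < 1 -> ~ U (sm x y)) ->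
 forall n : nat, ((expR (- (n%:R * (ln (pi^-1 * d^-1 ^+ 2) + 4)) - n%:R * (n%:R - 1) * (E0 + 3 * d)))%:E <= Zp n%:R U n [::])%E.
Proof.
move=> mU sgV mV sgB dE VU n.
have [P PI] := smear_prob sg.
set B1 := [set z | sqnorm z <= 1] in sgB; have mB1 : measurable B1 := bdd_B 1.
have mD := meas_dsc (1 : R).
have in0 (f : T -> \bar R) x : (forall x, 0 <= f x)%E -> (0 <= \int[om]_y f (sm x y))%E by move=> f0; exact: integral_ge0.
have min (f : T -> \bar R) : measT f -> (forall x, 0 <= f x)%E -> measT (fun x => \int[om]_y f (sm x y))%E.
 move=> mf f0; apply: (@meas_int_curry _ _ _ _ _ om (fun x y => f (sm x y))) => //.
 by apply: (meas_comp mf); apply: meas_sm; [exact: mfst|exact: msnd].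
pose A := pi^-1 * d^-1 ^+ 2; have A0 : 0 < A by rewrite mulr_gt0 ?exprn_gt0 ?invr_gt0.
have PA (F : T -> \bar R) : measT F -> (forall z, 0 <= F z)%E -> (\int[P]_z F z <= A%:E * \int[leb2]_z F z)%E.
 move=> mF F0; rewrite PI//.
 apply: (@le_trans _ _ (\int[sg]__ (A%:E * \int[leb2]_z F z))%E); last by rewrite int_prob_cst.
 have L0 : (0 <= A%:E * \int[leb2]_z F z)%E by rewrite mule_ge0 ?integral_ge0// lee_fin ltW.
 apply: ge0_le_integral => //; [by move=> x _; exact: in0|exact: min|].
 move=> x _; have mFx : measT (fun y => F (sm x y)) by exact: (meas_comp mF (@meas_sm _ _ (fun=> x) id (measurable_cst _) (@measurable_id _ _ _))).
 rewrite omI// /A EFinM -muleA; apply: lee_wpmul2l; first by rewrite lee_fin invr_ge0 ltW.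
 have dn : ((d%:C)%C : R[i]) != 0 by rewrite eq_complex/= gt_eqF.
 have := @int_caffine R (d%:C)%C (tc x) F dn mF F0.
 rewrite (_ : nsq (d%:C)%C = d ^+ 2); last by rewrite /nsq /sqnorm/= expr0n addr0.
 move=> <-; rewrite muleA -EFinM exprVn mulVf ?mul1e ?expf_neq0 ?gt_eqF//.
 under [in leRHS]eq_integral do rewrite -smE.
 by apply: ge0_subset_integral => //; exact: measurable_funTS.
have PU : P U = 0%E.
 have mi : measT (fun z => (\1_U z)%:E : \bar R) by efin; exact: measurable_indic.
 have -> : P U = (\int[P]_z (\1_U z)%:E)%E by rewrite integral_indic// setIT.
 have i0 z : (0 <= (\1_U z)%:E :> \bar R)%E by rewrite lee_fin.
 have mi2 := min _ mi i0; have mi3 x := in0 _ x i0.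
 rewrite PI//; have -> : (\int[sg]_x \int[om]_y (\1_U (sm x y))%:E = \int[sg]_x 0)%E; last by rewrite integral0.
 apply: (@int_null _ _ _ sg _ _ (~` V)) => //; [exact: measurableC|by rewrite setCK|].
 move=> x Vx; rewrite -(integral0 om setT); apply: (@int_null _ _ _ om _ _ D) => //.
  by apply: (meas_comp mi); apply: (@meas_sm _ _ (fun=> x) id).
 by move=> y y1; rewrite indicE memNset//; exact: VU.
have PB : P (~` [set z | sqnorm z <= 1 + 3 * d]) = 0%E.
 set G := ~` _; have mG : measurable G by apply: measurableC; exact: bdd_B.
 have mi : measT (fun z => (\1_G z)%:E : \bar R) by efin; exact: measurable_indic.
 have -> : P G = (\int[P]_z (\1_G z)%:E)%E by rewrite integral_indic// setIT.
 have i0 z : (0 <= (\1_G z)%:E :> \bar R)%E by rewrite lee_fin.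
 have mi2 := min _ mi i0; have mi3 x := in0 _ x i0.
 rewrite PI//; have -> : (\int[sg]_x \int[om]_y (\1_G (sm x y))%:E = \int[sg]_x 0)%E; last by rewrite integral0.
 apply: (@int_null _ _ _ sg _ _ B1) => //.
 move=> x x1; rewrite -(integral0 om setT); apply: (@int_null _ _ _ om _ _ D) => //.
  by apply: (meas_comp mi); apply: (@meas_sm _ _ (fun=> x) id).
 by move=> y y1; rewrite indicE memNset//; apply; rewrite /= (le_trans (sm_bound x1 y1))// lerD2r.
have mWx x : measT (Wx x).
 apply: (@meas_int_curry _ _ _ _ _ om (fun w y => KK w (sm x y))) => [|w y]; last exact: KK_ge0.
 by apply: meas_KK; [exact: mfst|apply: (@meas_sm _ _ (fun=> x)) => //; exact: msnd].
have W0 x w : (0 <= Wx x w)%E by apply: integral_ge0 => y _; exact: KK_ge0.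
pose Vb w : \bar R := (\int[P]_z KK w z)%E.
have Vb0 w : (0 <= Vb w)%E by apply: integral_ge0 => y _; exact: KK_ge0.
have mVb : measT Vb by exact: meas_pot.
have VbE w : Vb w = (\int[sg]_x Wx x w)%E by rewrite /Vb PI//; exact: KK_ge0.
have mW2 w : measT (fun x => Wx x w).
 apply: (@meas_int_curry _ _ _ _ _ om (fun x y => KK w (sm x y))) => [|x y]; last exact: KK_ge0.
 by apply: (@meas_KK _ _ _ (fun=> w)) => //; apply: meas_sm; [exact: mfst|exact: msnd].
have ld : 0 <= - ln d by rewrite oppr_ge0 ln_le0.
have Vbf w : exists2 v : R, 0 <= v & Vb w = v%:E.
 have : (Vb w <= (1 / 2 - ln d + (sqnorm w + 1 + 3 * d) / 2)%:E)%E.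
  rewrite VbE -(int_prob_cst sg (_)%:E); apply: (@le_int_null _ _ _ sg B1) => //.
  - by move=> x; rewrite lee_fin; have := sqnorm_ge0 w; move: ld d0; lra.
  - move=> x x1; apply: le_trans (Wx_bound w x1).1 _; rewrite lee_fin; move: x1; rewrite /B1/=; lra.
 by case: (Vb w) (Vb0 w) => // v v0 _; exists v.
(* [jensen_Zp] wants a real potential; finiteness is the first bound of [Wx_bound]. *)
pose V' w := fine (Vb w).
have V'E w : Vb w = (V' w)%:E by rewrite /V'; have [v _ ->] := Vbf w.
have V'0 w : 0 <= V' w by rewrite -lee_fin -V'E.
have mV' : measT V' by exact: measurableT_comp.
have HV w : (\int[P]_z KK z w <= (V' w)%:E)%E.
 by rewrite -V'E /Vb; under eq_integral do rewrite KKC.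
have h3 : 0 <= 3 * d / 2 by rewrite divr_ge0// mulr_ge0// ltW.
have HE : (\int[P]_z (V' z)%:E <= (E0 + 3 * d)%:E)%E.
 have -> : (\int[P]_z (V' z)%:E = \int[sg]_u \int[om]_v Vb (sm u v))%E.
  by rewrite -PI//; apply: eq_integral => z _; rewrite V'E.
 (* Both arguments of the kernel are smeared, each at a cost of [3 d / 2]. *)
 have step u : B1 u -> (\int[om]_v Vb (sm u v) <= \int[sg]_x KK u x + (3 * d)%:E)%E.
  move=> u1; have msu : measT (sm u) by apply: (@meas_sm _ _ (fun=> u) id).
  have -> : (\int[om]_v Vb (sm u v) = \int[sg]_x \int[om]_v Wx x (sm u v))%E.
   under eq_integral do rewrite VbE.
   rewrite (@int_swap _ _ _ _ _ om sg (fun v x => Wx x (sm u v)))//.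
   apply: (@meas_int_curry _ _ _ _ _ om (fun p y => KK (sm u p.1) (sm p.2 y))) => [|p y]; last exact: KK_ge0.
   apply: meas_KK.
    apply: (@meas_sm _ _ (fun=> u)) => //; apply: (meas_comp mfst); exact: mfst.
   apply: meas_sm; last exact: msnd.
   by apply: (meas_comp msnd); exact: mfst.
  have -> : (3 * d)%:E = (3 * d / 2 + 3 * d / 2)%:E by congr EFin; lra.
  have mKu := mk2_curry u (mK2 R).
  have mI : measT (fun x => \int[om]_v Wx x (sm u v))%E.
   apply: (@meas_int_curry _ _ _ _ _ om (fun x v => Wx x (sm u v))) => //.
   apply: (@meas_int_curry _ _ _ _ _ om (fun p y => KK (sm u p.2) (sm p.1 y))) => [|p y]; last exact: KK_ge0.
   apply: meas_KK.
    apply: (@meas_sm _ _ (fun=> u)) => //; apply: (meas_comp msnd); exact: mfst.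
   apply: meas_sm; last exact: msnd.
   by apply: (meas_comp mfst); exact: mfst.
  rewrite -(int_prob_cst sg (3 * d / 2 + _)%:E) -ge0_integralD//; last 2 first.
  - by move=> x _; exact: KK_ge0.
  - by move=> x _; rewrite lee_fin addr_ge0.
  apply: (@le_int_null _ _ _ sg B1) => //.
  - exact: emeasurable_funD.
  - by move=> x; exact: integral_ge0.
  - by move=> x; rewrite adde_ge0 ?KK_ge0// lee_fin addr_ge0.
  move=> x x1.
  have mKs : measT (fun v => KK x (sm u v)) by exact: (meas_comp (mKz x) msu).
  apply: (@le_trans _ _ (\int[om]_v (KK x (sm u v) + (3 * d / 2)%:E))%E).
   apply: ge0_le_integral => //.
   - exact: (meas_comp (mWx x) msu).
   - exact: emeasurable_funD.
   - by move=> v _; rewrite KKC; exact: (Wx_bound (sm u v) x1).2.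
  rewrite ge0_integralD//; [|by move=> v _; exact: KK_ge0].
  rewrite int_prob_cst EFinD addeA; apply: leeD => //; rewrite (KKC u).
  exact: (Wx_bound x u1).2.
 have mp := meas_pot sg.
 have pp0 u : (0 <= \int[sg]_x KK u x)%E by apply: integral_ge0 => x _; exact: KK_ge0.
 have h30 : 0 <= 3 * d by rewrite mulr_ge0// ltW.
 apply: (@le_trans _ _ (\int[sg]_u (\int[sg]_x KK u x + (3 * d)%:E))%E).
  apply: (@le_int_null _ _ _ sg B1) => //; [exact: min|exact: emeasurable_funD|by move=> u; exact: in0|by move=> u; rewrite adde_ge0].
 rewrite ge0_integralD// int_prob_cst EFinD; apply: leeD => //; by rewrite -dE.
(* The smeared law lives where [|z|^2 <= 1 + 3 d <= 4]. *)
have HB : (\int[P]_z (sqnorm z)%:E <= 4%:E)%E.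
 rewrite -(int_prob_cst P 4%:E); apply: (@le_int_null _ _ _ P [set z | sqnorm z <= 1 + 3 * d]) => //.
 - exact: bdd_B.
 - exact: meas_sqE.
 - by move=> z; exact: sqE_ge0.
 - by move=> z /= zz; rewrite lee_fin (le_trans zz)//; move: d1; lra.
have := @jensen_Zp R U P A 4 (E0 + 3 * d) V' mU A0 PU PA mV' V'0 HV HE HB n [::] n (add0n n).
by rewrite !big_nil !mulr0 sub0r subr0.
Qed.
End smear.

(** * Upper bound *)

Section pairs.
Variable R : realType.
Local Notation T := (R * R)%type.
Implicit Types (z w : T) (s t : seq T).

(** This is [exp(- 2 KK z w)]; [Wq] and [EE] take the product and the sum over unordered pairs, so
    [Wq s = exp(- 2 EE s)]. Using [qk] keeps coincident points real-valued. *)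
Definition qk z w : R := sqnorm (z - w) * expR (- (sqnorm z + sqnorm w)).
Fixpoint Wq s : R := if s is z :: s' then \prod_(w <- s') qk z w * Wq s' else 1.
Fixpoint EE s : \bar R := if s is z :: s' then (\sum_(w <- s') KK z w + EE s')%E else 0%E.
Definition sqsum s : R := \sum_(w <- s) sqnorm w.

Lemma qk_ge0 z w : 0 <= qk z w.
Proof. by rewrite mulr_ge0 ?sqnorm_ge0 ?expR_ge0. Qed.

Lemma Wq_ge0 s : 0 <= Wq s.
Proof. by elim: s => //= z s IH; rewrite mulr_ge0// prodr_ge0// => w _; exact: qk_ge0. Qed.

Lemma EE_ge0 s : (0 <= EE s)%E.
Proof. by elim: s => //= z s IH; rewrite adde_ge0// sume_ge0// => w _; exact: KK_ge0. Qed.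

Lemma prod_qk z s : \prod_(w <- s) qk z w = \prod_(w <- s) sqnorm (z - w) * expR (- ((size s)%:R * sqnorm z + sqsum s)).
Proof.
rewrite /sqsum; elim: s => [|w s IH]; first by rewrite !big_nil mul0r addr0 oppr0 expR0 mul1r.
rewrite !big_cons IH /qk mulrACA -expRD; congr (_ * expR _); rewrite /= -natr1; ring.
Qed.

Lemma KK_qk z w : 0 < qk z w -> KK z w = (- (ln (qk z w) / 2))%:E.
Proof.
rewrite /qk pmulr_lgt0 ?expR_gt0// => zw; rewrite /KK logkerE gt_eqF// -EFinD lnM ?posrE ?expR_gt0// expRK.
by congr EFin; lra.
Qed.

Lemma Wq_EE s : 0 < Wq s -> EE s = (- (ln (Wq s) / 2))%:E.
Proof.
elim: s => [|z s IH] /=; first by rewrite ln1 mul0r oppr0.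
move=> h; have W0 : 0 < Wq s.
 by rewrite lt_def Wq_ge0 andbT; apply: contraTneq h => ->; rewrite mulr0 ltxx.
have P0 : 0 < \prod_(w <- s) qk z w by move: h; rewrite pmulr_lgt0.
have pos w : w \in s -> 0 < qk z w.
 move=> ws; rewrite lt_def qk_ge0 andbT; apply: contraTneq P0 => e.
 by rewrite (big_rem w ws)/= e mul0r ltxx.
rewrite IH// lnM ?posrE// (ln_prod_seq pos).1 mulrDl opprD EFinD; congr (_ + _)%E.
rewrite mulr_suml -sumrN -sumEFin big_seq [RHS]big_seq; apply: eq_bigr => w /pos; exact: KK_qk.
Qed.

(** Half of the quadratic growth survives the logarithm. This confines the points of a tuple of
    small energy. *)
Lemma KK_lower z w : (((sqnorm z + sqnorm w) / 4 - 1)%:E <= KK z w)%E.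
Proof.
rewrite /KK logkerE; case: eqP => [_|/eqP zw]; first by rewrite addye// leey.
have p0 : 0 < sqnorm (z - w) by rewrite lt_def zw sqnorm_ge0.
rewrite -EFinD lee_fin.
have l4 : ln 4 <= 2 :> R.
 have -> : 4 = 2 * 2 :> R by rewrite -natrM.
 rewrite lnM ?posrE//; have : ln (1 + 1) <= 1 :> R by apply: le_ln1Dx; rewrite (lt_trans (ltrN10 _)).
 by rewrite -[1 + 1]/(2 : R); lra.
have : ln (1 + (sqnorm (z - w) / 4 - 1)) <= sqnorm (z - w) / 4 - 1.
 by apply: le_ln1Dx; rewrite ltrBrDl addrN divr_gt0.
rewrite [1 + _]addrC subrK ln_div ?posrE//.
by have := sqnorm_sub_le z w; lra.
Qed.

Lemma EE_lower s : ((((size s)%:R - 1) / 4 * sqsum s - (size s)%:R * ((size s)%:R - 1) / 2)%:E <= EE s)%E.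
Proof.
elim: s => [|z s IH] /=; first by rewrite /sqsum big_nil mulr0 !mul0r subr0.
have h : ((((size s)%:R * sqnorm z + sqsum s) / 4 - (size s)%:R)%:E <= \sum_(w <- s) KK z w)%E.
 rewrite /sqsum; elim: s {IH} => [|w s IHs]; first by rewrite !big_nil !mul0r addr0 mul0r subr0.
 rewrite !big_cons; apply: le_trans (leeD (KK_lower z w) IHs); rewrite -EFinD lee_fin /= -natr1; lra.
apply: le_trans (leeD h IH); rewrite -EFinD lee_fin /sqsum big_cons -natr1; lra.
Qed.

Lemma EE_filter (p : pred T) s : (EE [seq z <- s | p z] <= EE s)%E.
Proof.
elim: s => //= z s IH.
have S0 : (0 <= \sum_(w <- s) KK z w)%E by apply: sume_ge0 => w _; exact: KK_ge0.
case: (p z) => /=; last by apply: le_trans IH _; rewrite leeDr.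
apply: leeD => //; elim: s {IH S0} => [|w s IH]; first by rewrite !big_nil.
rewrite /= big_cons; case: (p w); rewrite ?big_cons; first exact: leeD.
by apply: le_trans IH _; rewrite leeDr// KK_ge0.
Qed.

(** Of the [n] factors [exp(- |z|^2)] of each point, [n - 1] go into its pairs and the last one
    ensures convergence, at the price of a factor [pi]. The factor [exp(k sqsum s)] corrects for the
    pairs that the points of [s] have yet to form. *)
Lemma Zp_upper (U : set T) (n : nat) (M : R) : measurable U -> 0 <= M ->
 (forall t, size t = n -> {in t, forall z, ~ U z} -> Wq t <= M) ->
 forall k s, (size s + k = n)%N -> {in s, forall z, ~ U z} ->
 ((Wq s)%:E * Zp n%:R U k s <= (expR (k%:R * sqsum s) * pi ^+ k * M)%:E)%E.
Proof.
move=> mU M0 HM; elim=> [|k IH] s sn sU.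
 by rewrite mule1 lee_fin mul0r expR0 !mul1r; apply: HM => //; rewrite -sn addn0.
have mz : measT (fun z => (zw n%:R U z s)%:E * Zp n%:R U k (z :: s))%E.
 apply: emeasurable_funM.
  by efin; apply: (@meas_zw R n%:R U _ _ id (fun=> s)) => //; exact: mseq_cst.
 by apply: (@meas_Zp R n%:R U k _ _ (fun z => z :: s)) => //; apply: mseqS; [exact: measurable_id|exact: mseq_cst].
have z0 z : (0 <= (zw n%:R U z s)%:E * Zp n%:R U k (z :: s))%E by rewrite mule_ge0 ?Zp_ge0// lee_fin zw_ge0.
rewrite ZpS -ge0_integralZl//; last by rewrite lee_fin Wq_ge0.
pose c := expR (k.+1%:R * sqsum s) * pi ^+ k * M.
have c0 : 0 <= c by rewrite !mulr_ge0 ?expR_ge0// exprn_ge0// pi_ge0.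
have me : measT (fun z : T => (expR (- sqnorm z))%:E : \bar R).
 by efin; apply: meas_expN => //; exact: meas_sqn.
have e0 z : (0 <= (expR (- sqnorm z))%:E :> \bar R)%E by rewrite lee_fin expR_ge0.
apply: (@le_trans _ _ (\int[leb2]_z (c%:E * (expR (- sqnorm z))%:E))%E); last first.
 have -> : expR (k.+1%:R * sqsum s) * pi ^+ k.+1 * M = c * pi by rewrite /c exprSr; ring.
 by rewrite ge0_integralZl// int_sqgauss -EFinM.
apply: ge0_le_integral => //.
- by move=> z _; rewrite mule_ge0// lee_fin Wq_ge0.
- exact: emeasurable_funM.
- exact: emeasurable_funM.
move=> z _; have [Uz|Uz] := pselect (U z).
 by rewrite /zw indicE memNset ?mul0r ?mul0e ?mule0; [exact: mule_ge0|apply].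
have sU' : {in z :: s, forall w, ~ U w} by move=> w; rewrite inE => /orP[/eqP ->|/sU].
have := IH (z :: s); rewrite /= addSnnS => /(_ sn sU').
have zE : Wq s * zw n%:R U z s = expR (- (n%:R * sqnorm z) + ((size s)%:R * sqnorm z + sqsum s)) * (\prod_(w <- s) qk z w * Wq s).
 rewrite prod_qk /zw indicE mem_set// mul1r expRD expRN -/(expR _).
 have := expR_gt0 ((size s)%:R * sqnorm z + sqsum s); set x := expR _ => x0; rewrite (expRN (_ + _)) -/x; field.
 by rewrite !gt_eqF ?expR_gt0.
move=> h; rewrite muleA -EFinM zE [X in (X * _)%E]EFinM -muleA.
apply: le_trans (lee_wpmul2l _ h) _; first by rewrite lee_fin expR_ge0.
rewrite -!EFinM lee_fin; set a := - _ + _; set b := k%:R * _.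
have E1 : expR a * expR b = expR (k.+1%:R * sqsum s) * expR (- sqnorm z).
 rewrite -!expRD; congr expR; rewrite /a /b /sqsum big_cons -sn natrD -!natr1; lra.
have -> : expR a * (expR b * pi ^+ k * M) = (expR a * expR b) * (pi ^+ k * M) by ring.
rewrite E1 /c; set e1 := expR _; set e2 := expR _.
by have -> : e1 * pi ^+ k * M * e2 = e1 * e2 * (pi ^+ k * M) by ring.
Qed.
End pairs.

(* Nested quaternary codes of the points of the open square of half-side a. *)
Section codes.
Variable R : realType.
Local Notation T := (R * R)%type.
Variable a : R.
Hypothesis a0 : 0 < a.

Definition unitc (x : R) : R := (x + a) / (2 * a).
Definition fl (k : nat) (y : R) : nat := Num.truncn (2 ^+ k * y).
Fixpoint cod (k : nat) (z : T) : nat :=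
 if k is k'.+1 then (4 * cod k' z + (2 * odd (fl k (unitc z.1)) + odd (fl k (unitc z.2))))%N else 0%N.

Lemma codS k z : cod k.+1 z = (cod k z * 4 + (2 * odd (fl k.+1 (unitc z.1)) + odd (fl k.+1 (unitc z.2))))%N.
Proof. by rewrite mulnC. Qed.

Definition box (z : T) := `|z.1| < a /\ `|z.2| < a.

Lemma unitc_itv x : `|x| < a -> 0 <= unitc x < 1.
Proof.
rewrite ltr_norml => /andP[h1 h2]; rewrite /unitc; have a2 : 0 < 2 * a by rewrite mulr_gt0.
by rewrite divr_ge0 ?(ltW a2)//= ?ltr_pdivrMr// ?mul1r; move: h1 h2; lra.
Qed.

Lemma fl_half k y : 0 <= y -> fl k y = (fl k.+1 y)./2.
Proof.
move=> y0; have p k' : 0 <= 2 ^+ k' * y :> R by rewrite mulr_ge0// exprn_ge0.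
apply: truncn_def; have /andP[h1 h2] := truncn_itv (p k.+1); move: h1 h2; rewrite -/(fl k.+1 y).
set m := fl k.+1 y; rewrite exprS -mulrA -!natr1.
have -> : m%:R = (odd m)%:R + 2 * (m./2)%:R :> R by rewrite -{1}(odd_double_half m) natrD -muln2 natrM mulrC.
have o1 : (odd m)%:R <= 1 :> R by case: (odd m).
have o0 : 0 <= (odd m)%:R :> R by case: (odd m).
move: o0 o1; move: ((odd m)%:R) ((m./2)%:R) (2 ^+ k * y) => o h x o0 o1 h1 h2.
by apply/andP; split; lra.
Qed.

Lemma fl0 y : 0 <= y < 1 -> fl 0 y = 0%N.
Proof. by move=> /andP[h1 h2]; apply: truncn_def; rewrite expr0 mul1r h1. Qed.

Lemma digit_lt (b c : bool) : (2 * b + c < 4)%N. Proof. by case: b; case: c. Qed.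

Lemma cod_div k z : cod k z = (cod k.+1 z %/ 4)%N.
Proof. by rewrite codS divnMDl// divn_small ?addn0// digit_lt. Qed.

(** Codes are nested: the shorter one is a prefix, in base 4, of the longer one. *)
Lemma cod_divi k i z : cod k z = (cod (k + i) z %/ 4 ^ i)%N.
Proof.
elim: i => [|i IH]; first by rewrite addn0 divn1.
by rewrite IH addnS (cod_div (k + i)) -divnMA expnS.
Qed.

Lemma cod_lt k z : (cod k z < 4 ^ k)%N.
Proof.
elim: k => [|k IH] //; rewrite codS expnS.
move: IH (digit_lt (odd (fl k.+1 (unitc z.1))) (odd (fl k.+1 (unitc z.2)))).
move: (4 ^ k)%N (cod k z) (2 * _ + _)%N => p q r; lia.
Qed.

Lemma cod_fl k z w : box z -> box w -> cod k z = cod k w ->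
 fl k (unitc z.1) = fl k (unitc w.1) /\ fl k (unitc z.2) = fl k (unitc w.2).
Proof.
move=> [z1 z2] [w1 w2]; elim: k => [|k IH]; first by rewrite !fl0// unitc_itv.
move=> e; have e4 : cod k z = cod k w by rewrite (cod_div k z) (cod_div k w) e.
have [h1 h2] := IH e4.
have o1 : odd (fl k.+1 (unitc z.1)) = odd (fl k.+1 (unitc w.1)) /\ odd (fl k.+1 (unitc z.2)) = odd (fl k.+1 (unitc w.2)).
 move: e; rewrite !codS e4 => /eqP; rewrite eqn_add2l => /eqP.
 by do 4 case: (odd _).
have fe x y : `|x| < a -> `|y| < a -> fl k (unitc x) = fl k (unitc y) -> odd (fl k.+1 (unitc x)) = odd (fl k.+1 (unitc y)) ->
  fl k.+1 (unitc x) = fl k.+1 (unitc y).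
 move=> /unitc_itv/andP[x0 _] /unitc_itv/andP[y0 _]; rewrite (fl_half k x0) (fl_half k y0) => hh oo.
 by rewrite -(odd_double_half (fl k.+1 (unitc x))) hh oo odd_double_half.
by split; apply: fe => //; [exact: o1.1|exact: o1.2].
Qed.

Lemma cod_close k z w : box z -> box w -> cod k z = cod k w -> `|z.1 - w.1| <= 2 * a / 2 ^+ k /\ `|z.2 - w.2| <= 2 * a / 2 ^+ k.
Proof.
move=> bz bw /(cod_fl bz bw)[]; case: bz => z1 z2; case: bw => w1 w2.
have p2 : 0 < 2 ^+ k :> R by rewrite exprn_gt0.
have h x y : `|x| < a -> `|y| < a -> fl k (unitc x) = fl k (unitc y) -> `|x - y| <= 2 * a / 2 ^+ k.
 move=> /unitc_itv/andP[x0 _] /unitc_itv/andP[y0 _] e.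
 have /andP[h1 h2] := truncn_itv (mulr_ge0 (ltW p2) x0).
 have /andP[h3 h4] := truncn_itv (mulr_ge0 (ltW p2) y0).
 move: h1 h2 h3 h4; rewrite -!/(fl k _) e -natr1; set m := (fl _ _)%:R.
 have -> : x - y = 2 * a * (unitc x - unitc y) by rewrite /unitc; field; rewrite gt_eqF.
 rewrite normrM gtr0_norm ?mulr_gt0// => h1 h2 h3 h4.
 rewrite ler_pM2l ?mulr_gt0// ler_norml -(mul1r (2 ^+ k)^-1) -mulNr ler_pdivrMr// ler_pdivlMr// ?mulrBl.
 by rewrite !(mulrC _ (2 ^+ k)); apply/andP; split; lra.
by move=> e1 e2; split; exact: h.
Qed.
End codes.

(** * Regularised kernels and double sums *)

Section kernels.
Variable R : realType.
Local Notation T := (R * R)%type.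
Implicit Types (z w : T) (s : seq T).

(* A regularisation of KK + 1: nonnegative, Lipschitz on boxes, increasing to KK + 1 as e -> 0. *)
Definition hh (e : R) z w : R := (sqnorm z + sqnorm w) / 2 - ln (sqnorm (z - w) + e) / 2 + 1.

Lemma hhC e z w : hh e z w = hh e w z.
Proof. by rewrite /hh sqnorm_subC addrC (addrC (sqnorm z)) addrC. Qed.

Lemma hh_ge0 e z w : 0 < e -> e <= 1 -> 0 <= hh e z w.
Proof.
move=> e0 e1; have p := sqnorm_ge0 (z - w); set x := sqnorm (z - w) + e.
have x0 : 0 < x by rewrite ltr_wpDl.
have l2 : ln 2 <= 1 :> R.
 have : ln (1 + 1) <= 1 :> R by apply: le_ln1Dx; rewrite (lt_trans (ltrN10 _)).
 by rewrite -[1 + 1]/(2 : R).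
have : ln (1 + (x / 2 - 1)) <= x / 2 - 1 by apply: le_ln1Dx; rewrite ltrBrDl addrN divr_gt0.
rewrite [1 + _]addrC subrK ln_div ?posrE// => h.
by have := sqnorm_sub_le z w; rewrite /hh -/x; move: h l2; rewrite /x; lra.
Qed.

Lemma hh_KK e z w : 0 < e -> ((hh e z w)%:E <= KK z w + 1)%E.
Proof.
move=> e0; rewrite /KK logkerE; case: eqP => [_|/eqP zw]; first by rewrite !addye// leey.
have p0 : 0 < sqnorm (z - w) by rewrite lt_def zw sqnorm_ge0.
rewrite -!EFinD lee_fin /hh.
have : ln (sqnorm (z - w)) <= ln (sqnorm (z - w) + e) by rewrite ler_ln ?posrE// ?lerDl ?ltW// addr_gt0.
lra.
Qed.

Lemma hh_mono e e' z w : 0 < e' -> e' <= e -> hh e z w <= hh e' z w.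
Proof.
move=> e0 ee; have p := sqnorm_ge0 (z - w).
have : ln (sqnorm (z - w) + e') <= ln (sqnorm (z - w) + e).
 by rewrite ler_ln ?posrE ?lerD2l//; apply: ltr_wpDl => //; exact: lt_le_trans ee.
rewrite /hh; lra.
Qed.

Lemma ln_lip (x y e : R) : 0 < e -> e <= x -> e <= y -> ln x - ln y <= `|x - y| / e.
Proof.
move=> e0 ex ey; have x0 := lt_le_trans e0 ex; have y0 := lt_le_trans e0 ey.
rewrite -ln_div ?posrE//; have : ln (1 + (x / y - 1)) <= x / y - 1.
 by apply: le_ln1Dx; rewrite ltrBrDl addrN divr_gt0.
rewrite [1 + _]addrC subrK => h; apply: le_trans h _.
have -> : x / y - 1 = (x - y) / y by rewrite mulrBl divff// gt_eqF.
apply: (@le_trans _ _ (`|x - y| / y)); first by rewrite ler_wpM2r ?invr_ge0 ?(ltW y0)// ler_norm.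
by rewrite ler_wpM2l// lef_pV2.
Qed.

Lemma sq_lip (b d x y : R) : `|x| <= b -> `|y| <= b -> `|x - y| <= d -> `|x ^+ 2 - y ^+ 2| <= 2 * b * d.
Proof.
move=> xb yb xy; rewrite subr_sqr normrM mulrC; apply: ler_pM => //.
by apply: le_trans (ler_normD _ _) _; lra.
Qed.

Definition near2 (d : R) z w := `|z.1 - w.1| <= d /\ `|z.2 - w.2| <= d.

Lemma hh_lip (a e d : R) z w z' w' : 0 < e -> 0 < a -> 0 <= d ->
 (forall x, x \in [:: z; w; z'; w'] -> `|x.1| <= a /\ `|x.2| <= a) -> near2 d z z' -> near2 d w w' ->
 hh e z w <= hh e z' w' + (4 * a + 8 * a / e) * d.
Proof.
move=> e0 a0 d0 H [z1 z2] [w1 w2].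
have [zz1 zz2] := H z (mem_head _ _).
have [ww1 ww2] : `|w.1| <= a /\ `|w.2| <= a by apply: H; rewrite !inE eqxx orbT.
have [zz1' zz2'] : `|z'.1| <= a /\ `|z'.2| <= a by apply: H; rewrite !inE eqxx !orbT.
have [ww1' ww2'] : `|w'.1| <= a /\ `|w'.2| <= a by apply: H; rewrite !inE eqxx !orbT.
have sz : sqnorm z - sqnorm z' <= 4 * a * d.
 have := sq_lip zz1 zz1' z1; have := sq_lip zz2 zz2' z2; rewrite /sqnorm !ler_norml => /andP[_ h1] /andP[_ h2]; lra.
have sw : sqnorm w - sqnorm w' <= 4 * a * d.
 have := sq_lip ww1 ww1' w1; have := sq_lip ww2 ww2' w2; rewrite /sqnorm !ler_norml => /andP[_ h1] /andP[_ h2]; lra.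
have nb (x y : R) : `|x| <= a -> `|y| <= a -> `|x - y| <= 2 * a.
 by move=> h1 h2; apply: le_trans (ler_normB _ _) _; lra.
have nd (x y x' y' : R) : `|x - x'| <= d -> `|y - y'| <= d -> `|(x - y) - (x' - y')| <= 2 * d.
 move=> h1 h2; have -> : (x - y) - (x' - y') = (x - x') - (y - y') by ring.
 by apply: le_trans (ler_normB _ _) _; lra.
have szw : `|sqnorm (z' - w') - sqnorm (z - w)| <= 16 * a * d.
 have q1 := sq_lip (nb _ _ zz1' ww1') (nb _ _ zz1 ww1) (nd _ _ _ _ (_ : `|z'.1 - z.1| <= d) (_ : `|w'.1 - w.1| <= d)).
 have q2 := sq_lip (nb _ _ zz2' ww2') (nb _ _ zz2 ww2) (nd _ _ _ _ (_ : `|z'.2 - z.2| <= d) (_ : `|w'.2 - w.2| <= d)).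
 have {}q1 : `|(z'.1 - w'.1) ^+ 2 - (z.1 - w.1) ^+ 2| <= 2 * (2 * a) * (2 * d) by apply: q1; rewrite distrC.
 have {}q2 : `|(z'.2 - w'.2) ^+ 2 - (z.2 - w.2) ^+ 2| <= 2 * (2 * a) * (2 * d) by apply: q2; rewrite distrC.
 have -> : sqnorm (z' - w') - sqnorm (z - w) = ((z'.1 - w'.1) ^+ 2 - (z.1 - w.1) ^+ 2) + ((z'.2 - w'.2) ^+ 2 - (z.2 - w.2) ^+ 2).
  by rewrite /sqnorm /=; ring.
 by apply: le_trans (ler_normD _ _) _; lra.
have l := @ln_lip (sqnorm (z' - w') + e) (sqnorm (z - w) + e) e e0.
have {l} l : ln (sqnorm (z' - w') + e) - ln (sqnorm (z - w) + e) <= 16 * a * d / e.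
 apply: le_trans (l _ _) _; rewrite ?lerDr ?sqnorm_ge0// ler_pM2r ?invr_gt0//.
 by rewrite (_ : _ + e - _ = sqnorm (z' - w') - sqnorm (z - w))//; ring.
rewrite /hh; move: l; rewrite (_ : (4 * a + 8 * a / e) * d = 4 * a * d + 16 * a * d / e / 2); last by field; rewrite gt_eqF.
lra.
Qed.

Lemma meas_hh e d (S : measurableType d) (f g : S -> T) : measT f -> measT g ->
 measT (fun t => hh e (f t) (g t)).
Proof.
move=> mf mg; apply: measurable_funD => //; apply: measurable_funB.
 by apply: measurable_funM => //; apply: measurable_funD; exact: meas_sqnorm.
apply: measurable_funM => //; apply: (meas_comp (@measurable_ln R)); apply: measurable_funD => //.
apply: meas_sqnorm; apply: meas_pairR; apply: measurable_funB; by
 [exact: (meas_comp mfst mf)|exact: (meas_comp mfst mg)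
 |exact: (meas_comp msnd mf)|exact: (meas_comp msnd mg)].
Qed.

Definition dsum (h : T -> T -> R) s : R := \sum_(z <- s) \sum_(w <- s) h z w.

Lemma dsum_cons (h : T -> T -> R) z s : (forall z w, h z w = h w z) ->
 dsum h (z :: s) = h z z + 2 * (\sum_(w <- s) h z w) + dsum h s.
Proof.
move=> hC; rewrite /dsum !big_cons; under [X in _ + X = _]eq_bigr do rewrite big_cons hC.
by rewrite big_split/= mulr_natl mulr2n !addrA.
Qed.

(** The double sum counts each pair twice and also the diagonal, which the regularisation makes
    finite: it costs at most [c] per point. The shift by 1 contributes at most the square of the
    number of points. *)
Lemma dsum_EE e c s : 0 < e -> (forall z, z \in s -> hh e z z <= c) ->
 ((dsum (hh e) s)%:E <= 2%:E * EE s + ((size s)%:R ^+ 2 + (size s)%:R * c)%:E)%E.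
Proof.
move=> e0; elim: s => [|z s IH] H; first by rewrite /dsum big_nil /= mule0 add0e expr0n mul0r addr0.
have {}IH := IH (fun w ws => H w (mem_behead (ws : w \in behead (z :: s)))); have hz := H z (mem_head _ _).
have hs : ((\sum_(w <- s) hh e z w)%:E <= \sum_(w <- s) KK z w + (size s)%:R%:E)%E.
 rewrite -sumEFin -(mulr_natr 1) mul1r; elim: s {IH H} => [|w s IHs]; first by rewrite !big_nil adde0.
 rewrite !big_cons (_ : (size (w :: s))%:R = 1 + (size s)%:R); last by rewrite /= -natr1 addrC.
 rewrite (EFinD 1) addeACA; apply: leeD => //.
 exact: hh_KK.
rewrite (dsum_cons _ _ (hhC e)) /= ge0_muleDr ?EE_ge0//; last by apply: sume_ge0 => w _; exact: KK_ge0.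
have S0 : (0 <= \sum_(w <- s) KK z w)%E by apply: sume_ge0 => w _; exact: KK_ge0.
have E0 := EE_ge0 s.
move: hs S0 E0 IH; case: (\sum_(w <- s) KK z w)%E => [S| |]//; case: (EE s) => [E| |]//; rewrite -?EFinM -?EFinD ?lee_fin => hs _ _ h.
- rewrite -(natr1 (size s)); move: h hs hz; move: ((size s)%:R) (\sum_(w <- s) hh e z w) => n x; lra.
all: by rewrite mulry gtr0_sg// mul1e ?addye ?addey// ?addye ?leey.
Qed.
End kernels.

Section misc.
Variable R : realType.

(** One ultrafilter gives simultaneous limits for all code lengths and all cells, with no diagonal
    extraction. *)
Lemma ultra_lim (G : set_system nat) (x : nat -> R) : UltraFilter G -> (forall m, 0 <= x m <= 1) ->
 exists l : R, x @ G --> l.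
Proof.
move=> UG x01; have GI : (x @ G) `[0, 1]%classic by apply: (@filterE _ G) => m /=; rewrite in_itv /= x01.
have [l [_ lC]] := @segment_compact R 0 1 (x @ G) _ GI.
exists l => A Al; rewrite nbhs_filterE /=.
have [//|GC] := in_ultra_setVsetC (x @^-1` A) UG.
by have [y [nA /nA]] := lC (~` A) A GC Al.
Qed.

Lemma cvg_leall (G : set_system nat) (x y : nat -> R) (l l' : R) : ProperFilter G -> x @ G --> l -> y @ G --> l' ->
 (forall m, x m <= y m) -> l <= l'.
Proof. by move=> PG h1 h2 h; apply: (ler_cvg_to h1 h2); apply: (@filterE _ G). Qed.

Lemma cvg_uniq (G : set_system nat) (x : nat -> R) (l l' : R) : ProperFilter G -> x @ G --> l -> x @ G --> l' -> l = l'.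
Proof.
by move=> PG h1 h2; apply/eqP; rewrite eq_le; apply/andP; split; [apply: cvg_leall h1 h2 _|apply: cvg_leall h2 h1 _].
Qed.

Lemma ex_unif : exists P : probability (measurableTypeR R) R, P (~` `[0, 1[%classic) = 0%E /\
 forall a b : R, 0 <= a -> a <= b -> b <= 1 -> P `[a, b[%classic = (b - a)%:E.
Proof.
have [P PE] : exists P : probability (measurableTypeR R) R,
  forall A, measurable A -> P A = lebesgue_measure (A `&` `[0, 1]%classic).
 exists (uniform_prob (@ltr01 R)) => A mA; have := integral_indic (uniform_prob (@ltr01 R)) measurableT mA.
 have mf : measT (fun x => (\1_A x : R)%:E).
  by efin; exact: measurable_indic.
 rewrite setIT => <-; rewrite (integral_uniform _ mf) => [|x]; last by rewrite lee_fin.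
 by rewrite subr0 invr1 mul1e integral_indic.
exists P; split.
 rewrite PE; last exact: measurableC.
 rewrite (_ : _ `&` _ = [set 1]) ?lebesgue_measure_set1//.
 apply/seteqP; split => x /=; rewrite !in_itv/=; last by move=> ->; rewrite ltxx andbF ler01 lexx.
 by move=> [/negP]; rewrite negb_and -leNgt -ltNge => /orP[h /andP[]|h /andP[_ h2]]; [rewrite leNgt h|apply/eqP; rewrite eq_le h h2].
move=> a b a0 ab b1; rewrite PE//= (_ : _ `&` _ = `[a, b[%classic).
 rewrite lebesgue_measure_itv/= lte_fin; case: ltP => // ba.
 by rewrite (_ : b = a) ?subrr//; apply/eqP; rewrite eq_le ab ba.
apply/seteqP; split => x /=; rewrite !in_itv/=; first by case.
move=> /andP[h1 h2]; rewrite h1 h2 (le_trans a0 h1); split => //=.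
exact: ltW (lt_le_trans h2 b1).
Qed.

Lemma pow2_lt (C e : R) : 0 < e -> exists k, C / 2 ^+ k < e.
Proof.
move=> e0; have [k hk] : exists k : nat, C / e < k%:R by exists (Num.truncn (C / e)).+1; exact: truncnS_gt.
exists k; rewrite ltr_pdivrMr ?exprn_gt0// mulrC -ltr_pdivrMr//; apply: lt_le_trans hk _.
by rewrite -natrX ler_nat ltnW// ltn_expl.
Qed.

Lemma geom_lim (x : nat -> R) (C : R) : (forall k i, `|x k - x (k + i)%N| <= C / 2 ^+ k) ->
 exists l : R, x @ \oo --> l /\ forall k, `|x k - l| <= C / 2 ^+ k.
Proof.
move=> h; have [l hl] : exists l : R, x @ \oo --> l.
 apply/cvg_ex; apply: cauchy_cvg; apply: cauchy_exP => e e0; have [k hk] := pow2_lt C e0.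
 exists (x k); exists k => // j /= kj; rewrite -ball_normE /ball_ /=; apply: le_lt_trans hk.
 by rewrite -(subnKC kj).
exists l; split => // k; have hn : (fun j => `|x k - x j|) @ \oo --> `|x k - l|.
 by apply: cvg_norm; apply: cvgB => //; exact: cvg_cst.
by apply: (cvgr_to_le hn); exists k => // j /= kj; rewrite -(subnKC kj).
Qed.

(** Regrouping by cell, the number in cell [b] being a difference of cumulative counts. *)
Lemma count_codes (c : (R * R)%type -> nat) (g : nat -> R) N s : (forall z, (c z < N)%N) ->
 \sum_(z <- s) g (c z) = \sum_(b < N) g b * ((count (fun z => c z < b.+1)%N s)%:R - (count (fun z => c z < b)%N s)%:R).
Proof.
move=> cN; elim: s => [|z s IH]; first by rewrite big_nil big1// => b _; rewrite subrr mulr0.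
rewrite big_cons IH /= (bigD1 (Ordinal (cN z)))//= [RHS](bigD1 (Ordinal (cN z)))//= leqnn ltnn add0n natrD mulrBr mulrBr mulrDr mulr1 -!addrA; congr (_ + (_ + (_ + _))).
apply: eq_bigr => b; rewrite -val_eqE/= => ne; rewrite ltnS leq_eqVlt eq_sym (negbTE ne)/= !natrD.
by congr (_ * _); ring.
Qed.
End misc.

(** * The limit law of the codes *)

Section climit.
Variable R : realType.
Local Notation T := (R * R)%type.
Variables (a : R) (V : set T) (t : nat -> seq T) (G : set_system nat) (F : nat -> nat -> R).
Hypotheses (a0 : 0 < a) (tV : forall m z, z \in t m -> box a z /\ V z) (tm : forall m, (m < size (t m))%N).
Context (UG : UltraFilter G).
(** The empirical distribution function of the codes of length [k]; its limit [F k] along the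
    ultrafilter plays the same role for the limit law. *)
Definition cnt k b m : R := (count (fun z => cod a k z < b)%N (t m))%:R / (size (t m))%:R.
Hypothesis hF : forall k b, cnt k b @ G --> F k b.

Lemma size_gt0R m : 0 < (size (t m))%:R :> R.
Proof. by rewrite ltr0n (leq_ltn_trans _ (tm m)). Qed.

Lemma F_cst k b (x : R) : (forall m, cnt k b m = x) -> F k b = x.
Proof.
move=> h; apply: (@cvg_uniq _ G (cnt k b)) => //.
by rewrite (_ : cnt k b = fun=> x); [exact: cvg_cst|apply/funext].
Qed.

Lemma F_0 k : F k 0 = 0.
Proof. by apply: F_cst => m; rewrite /cnt (eq_count (a2 := pred0)) ?count_pred0 ?mul0r// => z; rewrite ltn0. Qed.

Lemma F_1 k : F k (4 ^ k) = 1.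
Proof.
apply: F_cst => m; rewrite /cnt (eq_count (a2 := predT)) ?count_predT ?divff// ?gt_eqF ?size_gt0R// => z.
exact: cod_lt.
Qed.

Lemma F_mono k b b' : (b <= b')%N -> F k b <= F k b'.
Proof.
move=> bb; apply: (@cvg_leall _ G (cnt k b) (cnt k b')) => // m.
rewrite /cnt ler_pM2r ?invr_gt0 ?size_gt0R// ler_nat; apply: sub_count => z /=; move=> h; exact: leq_trans h bb.
Qed.

Lemma F_div k i b : F (k + i) (b * 4 ^ i) = F k b.
Proof.
apply: (@cvg_uniq _ G (cnt k b)) => //.
rewrite (_ : cnt k b = cnt (k + i) (b * 4 ^ i)) //; apply/funext => m; rewrite /cnt; congr (_%:R / _).
by apply: eq_count => z; rewrite (cod_divi a k i) ltn_divLR// expn_gt0.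
Qed.

Definition adm k b : set T := [set z | [/\ box a z, V z & cod a k z = b]].
(** A point of [V] chosen in each cell. The default for a cell without such points is harmless, as
    [adm_rep] shows that its limit mass is 0. *)
Definition rep k b : T := xget (0, 0) (adm k b).

Lemma rep_adm k b z : adm k b z -> adm k b (rep k b).
Proof. by move=> h; exact: (xgetPex (0, 0) (ex_intro _ z h)). Qed.

Lemma adm_rep k b : F k b < F k b.+1 -> adm k b (rep k b).
Proof.
move=> h; have [[z /rep_adm//]|ne] := pselect (exists z, adm k b z).
suff e : F k b.+1 = F k b by move: h; rewrite e ltxx.
apply: (@cvg_uniq _ G (cnt k b)) => //.
rewrite (_ : cnt k b = cnt k b.+1) //; apply/funext => m; rewrite /cnt; congr (_%:R / _).
apply: eq_in_count => z zt /=; rewrite [RHS]ltnS [RHS]leq_eqVlt; case: eqP => //= e; case: ne; exists z.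
by have [h1 h2] := tV zt; split.
Qed.

(** The quantile function of [F k]: a uniform [u] selects a cell with its limit probability, and
    consistently for all [k]. *)
Definition Bk k u : nat := find (fun b => u < F k b.+1) (iota 0 (4 ^ k)).

Lemma Bk_spec k u : 0 <= u < 1 -> [/\ F k (Bk k u) <= u, u < F k (Bk k u).+1 & (Bk k u < 4 ^ k)%N].
Proof.
move=> /andP[u0 u1]; have h : has (fun b => u < F k b.+1) (iota 0 (4 ^ k)).
 apply/hasP; exists (4 ^ k).-1; last by rewrite prednK ?expn_gt0// F_1.
 by rewrite mem_iota add0n leq0n/= prednK ?expn_gt0.
have l : (Bk k u < 4 ^ k)%N by move: (h); rewrite has_find size_iota.
have := nth_find 0%N h; rewrite nth_iota// add0n => hB; split => //.
case E : (Bk k u) => [|b]; first by rewrite F_0.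
have := @before_find _ 0%N (fun b => u < F k b.+1) (iota 0 (4 ^ k)) b; rewrite -/(Bk k u) E ltnSn => /(_ isT).
by rewrite nth_iota ?add0n; [rewrite leNgt => ->|apply: leq_ltn_trans l; rewrite E].
Qed.

Lemma Bk_uniq k u b : 0 <= u < 1 -> F k b <= u -> u < F k b.+1 -> Bk k u = b.
Proof.
move=> /(Bk_spec k)[h1 h2 _] h3 h4; apply/eqP; rewrite eqn_leq; apply/andP; split; rewrite leqNgt; apply/negP => /(F_mono k) h.
 by have := lt_le_trans h4 (le_trans h h1); rewrite ltxx.
by have := lt_le_trans h2 (le_trans h h3); rewrite ltxx.
Qed.

Lemma Bk_div k i u : 0 <= u < 1 -> (Bk (k + i) u %/ 4 ^ i)%N = Bk k u.
Proof.
move=> u01; have [h1 h2 _] := Bk_spec (k + i) u01; apply/esym/Bk_uniq => //.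
 by rewrite -(F_div k i); apply: le_trans h1; apply: F_mono; exact: leq_divM.
by rewrite -(F_div k i); apply: lt_le_trans h2 _; apply: F_mono; rewrite ltn_ceil// expn_gt0.
Qed.

(** The function [g (Bk k u)] written as a finite sum of indicators of intervals, which makes
    measurability and integration immediate; it vanishes off [[0, 1[]. *)
Definition step (g : nat -> R) k (u : R) : R := \sum_(b < 4 ^ k) g b * \1_(`[F k b, F k b.+1[%classic) u.

Lemma step_in g k u : 0 <= u < 1 -> step g k u = g (Bk k u).
Proof.
move=> u01; have [h1 h2 h3] := Bk_spec k u01; rewrite /step (bigD1 (Ordinal h3))//= big1 => [|b ne].
 by rewrite indicE mem_set ?mulr1 ?addr0//= in_itv /= h1 h2.
rewrite indicE memNset ?mulr0//= in_itv /= => /andP[l1 l2]; move: ne; rewrite -val_eqE/= (Bk_uniq u01 l1 l2).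
by rewrite eqxx.
Qed.

Lemma step_out g k u : ~~ (0 <= u < 1) -> step g k u = 0.
Proof.
move=> n; rewrite /step big1// => b _; rewrite indicE memNset ?mulr0//= in_itv/= => /andP[l1 l2].
move: n; rewrite -(F_0 k) (le_trans (F_mono k _) l1)//= -(F_1 k) => /negP; apply.
by apply: lt_le_trans l2 _; exact: F_mono.
Qed.

Lemma meas_step g k : measT (step g k).
Proof.
apply: measurable_sum => b; apply: measurable_funM => //; apply: measurable_indic; exact: measurable_itv.
Qed.

Lemma int_step (P : probability (measurableTypeR R) R) g k :
 (forall a b : R, 0 <= a -> a <= b -> b <= 1 -> P `[a, b[%classic = (b - a)%:E) -> (forall b, 0 <= g b) ->
 (\int[P]_u (step g k u)%:E = (\sum_(b < 4 ^ k) g b * (F k b.+1 - F k b))%:E)%E.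
Proof.
move=> hP g0; rewrite -sumEFin.
under eq_integral do rewrite -sumEFin.
rewrite ge0_integral_sum//; last 2 first.
- by move=> b; efin; apply: measurable_funM => //; apply: measurable_indic; exact: measurable_itv.
- by move=> b x _; rewrite lee_fin mulr_ge0.
apply: eq_bigr => b _; under eq_integral do rewrite EFinM.
rewrite ge0_integralZl_EFin//; last by efin; apply: measurable_indic; exact: measurable_itv.
have h1 : 0 <= F k b by rewrite -(F_0 k); exact: F_mono.
have h2 : F k b.+1 <= 1 by rewrite -(F_1 k); exact: F_mono.
by rewrite integral_indic//= setIT hP ?F_mono.
Qed.

(** The random point at resolution [k], as a function of a uniform variable. The cells being nested,
    the sequence is uniformly Cauchy in [k]. *)
Definition fk k u : T := (step (fun b => (rep k b).1) k u, step (fun b => (rep k b).2) k u).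

Lemma fk_in k u : 0 <= u < 1 -> fk k u = rep k (Bk k u) /\ adm k (Bk k u) (fk k u).
Proof.
move=> u01; have e : fk k u = rep k (Bk k u) by rewrite /fk !step_in// -surjective_pairing.
have [h1 h2 _] := Bk_spec k u01; rewrite e; split => //; exact: adm_rep (le_lt_trans h1 h2).
Qed.

Lemma fk_close k i u : near2 (2 * a / 2 ^+ k) (fk k u) (fk (k + i) u).
Proof.
have [u01|u01] := boolP (0 <= u < 1); last first.
 by rewrite /fk !step_out//; split; rewrite subrr normr0 divr_ge0 ?exprn_ge0// mulr_ge0// ltW.
have [_ [b1 _ c1]] := fk_in k u01; have [_ [b2 _ c2]] := fk_in (k + i) u01.
by apply: cod_close => //; rewrite c1 (cod_divi a k i) c2 Bk_div.
Qed.

(** The limit stays in [V] because [V] is closed; this is why representatives are taken in [V]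
    instead of cell centres. *)
Lemma ex_flim : closed V -> exists f : R -> T, [/\ measT f, forall k u, near2 (2 * a / 2 ^+ k) (fk k u) (f u) &
 forall u, 0 <= u < 1 -> [/\ V (f u), `|(f u).1| <= a & `|(f u).2| <= a]].
Proof.
move=> cV.
have [f1 h1] := choice (fun u => @geom_lim R (fun k => (fk k u).1) (2 * a) (fun k i => (fk_close k i u).1)).
have [f2 h2] := choice (fun u => @geom_lim R (fun k => (fk k u).2) (2 * a) (fun k i => (fk_close k i u).2)).
exists (fun u => (f1 u, f2 u)); split.
- apply: meas_pairR.
  by apply: (@measurable_fun_cvg _ _ _ setT (fun k u => (fk k u).1)) => [k|u _]; [exact: meas_step|exact: (h1 u).1].
 by apply: (@measurable_fun_cvg _ _ _ setT (fun k u => (fk k u).2)) => [k|u _]; [exact: meas_step|exact: (h2 u).1].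
- by move=> k u; split; [exact: (h1 u).2|exact: (h2 u).2].
move=> u u01; have bk k : box a (fk k u) by have [_ []] := fk_in k u01.
split.
- apply: (@closed_cvg _ _ \oo _ (fun k => fk k u) V cV).
  by apply: nearW => k; have [_ []] := fk_in k u01.
 rewrite (_ : (fun k => fk k u) = (fun k => ((fk k u).1, (fk k u).2))); last by apply/funext.
 exact: cvg_pair (h1 u).1 (h2 u).1.
- have hn : (fun k => `|(fk k u).1|) @ \oo --> `|f1 u| by apply: cvg_norm; exact: (h1 u).1.
 by apply: (cvgr_to_le hn); apply: nearW => k; exact: ltW (bk k).1.
- have hn : (fun k => `|(fk k u).2|) @ \oo --> `|f2 u| by apply: cvg_norm; exact: (h2 u).1.
 by apply: (cvgr_to_le hn); apply: nearW => k; exact: ltW (bk k).2.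
Qed.

Definition pk k b := F k b.+1 - F k b.
Definition esum_k e k := \sum_(b < 4 ^ k) (\sum_(b' < 4 ^ k) hh e (rep k b) (rep k b') * pk k b') * pk k b.

(** For the empirical measures, moving each point to the representative of its cell costs a
    Lipschitz error; [dsum_EE] compares the result with the energy. Division by the squared number
    of points makes the diagonal disappear, and the bound passes to the ultralimit. *)
Lemma esum_le e k c : 0 < e -> e <= 1 -> \oo `<=` G -> (forall m, EE (t m) <= ((size (t m))%:R ^+ 2 * c / 2)%:E)%E ->
 esum_k e k <= c + 1 + (4 * a + 8 * a / e) * (2 * a / 2 ^+ k).
Proof.
move=> e0 e1 hG hE; set L := _ * (_ / _); pose C := 2 * a ^+ 2 + `|ln e| + 1.
pose q b m : R := cnt k b.+1 m - cnt k b m.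
pose A m := \sum_(b < 4 ^ k) (\sum_(b' < 4 ^ k) hh e (rep k b) (rep k b') * q b' m) * q b m.
have cq b : q b @ G --> pk k b by apply: cvgB.
have cA : A @ G --> esum_k e k.
 apply: cvg_big => [|b _]; first exact: add_continuous.
 apply: cvgM => //; apply: cvg_big => [|b' _]; first exact: add_continuous.
 by apply: cvgM => //; exact: cvg_cst.
(* The ultrafilter refines convergence to infinity, so the diagonal term of order [1 / m] tends to 0
   along it. *)
have cB : (fun m => c + 1 + L + C * harmonic m) @ G --> c + 1 + L + C * 0.
 apply: cvgD; first exact: cvg_cst.
 by apply: cvgM; [exact: cvg_cst|move=> W /(@cvg_harmonic R); exact: hG].
rewrite -[leRHS]addr0 -(mulr0 C); apply: cvg_leall cA cB _ => m.
set n : R := (size (t m))%:R; have n0 : 0 < n by exact: size_gt0R.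
have hd z : z \in t m -> hh e z z <= C.
 move=> /tV[[b1 b2] _]; rewrite /hh /C subrr /sqnorm /= expr0n/= !addr0 add0r.
 have s (x : R) : `|x| < a -> x ^+ 2 <= a ^+ 2.
  by rewrite ltr_norml => /andP[]; nra.
 have := s _ b1; have := s _ b2; have := ler_norm (- ln e); rewrite normrN.
 have := normr_ge0 (ln e); move: (`|ln e|) (ln e) => y x; lra.
have t2 : (0 <= 2%:E :> \bar R)%E by rewrite lee_fin.
have hD := le_trans (dsum_EE e0 hd) (leeD (lee_wpmul2l t2 (hE m)) (lexx _)).
have AE : n ^+ 2 * A m = \sum_(z <- t m) \sum_(w <- t m) hh e (rep k (cod a k z)) (rep k (cod a k w)).
 rewrite (@count_codes R (cod a k) (fun b => \sum_(w <- t m) hh e (rep k b) (rep k (cod a k w))) (4 ^ k)); last exact: cod_lt.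
 rewrite /A mulr_sumr; apply: eq_bigr => b _.
 rewrite (@count_codes R (cod a k) (fun b' => hh e (rep k b) (rep k b')) (4 ^ k)); last exact: cod_lt.
 have qE b' : n * q b' m = (count (fun z => cod a k z < b'.+1)%N (t m))%:R - (count (fun z => cod a k z < b')%N (t m))%:R.
  by rewrite /q /cnt -/n -mulrBl mulrC divfK// gt_eqF.
 rewrite -qE expr2 mulrACA; congr (_ * _); rewrite mulr_sumr; apply: eq_bigr => b' _.
 by rewrite -qE mulrCA.
have hB : n ^+ 2 * A m <= dsum (hh e) (t m) + n ^+ 2 * L.
 have -> : n ^+ 2 * L = \sum_(z <- t m) \sum_(w <- t m) L.
  by rewrite !big_const_seq !count_predT !iter_addr_0 -mulrnA -mulr_natl natrM expr2.
 rewrite AE /dsum -big_split/= big_seq [leRHS]big_seq; apply: ler_sum => z zt.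
 rewrite -big_split/= big_seq [leRHS]big_seq; apply: ler_sum => w wt.
 have [bz Vz] := tV zt; have [bw Vw] := tV wt.
 have [b1 _ c1] := rep_adm (And3 bz Vz erefl : adm k (cod a k z) z).
 have [b2 _ c2] := rep_adm (And3 bw Vw erefl : adm k (cod a k w) w).
 apply: hh_lip => //; first by rewrite divr_ge0 ?exprn_ge0// mulr_ge0// ltW.
 - by move=> x; rewrite !inE => /or4P[] /eqP ->; split; apply: ltW; (exact: b1.1 || exact: b1.2 || exact: b2.1 || exact: b2.2 || exact: bz.1 || exact: bz.2 || exact: bw.1 || exact: bw.2).
 - exact: cod_close.
 - exact: cod_close.
have {}hD : dsum (hh e) (t m) <= n ^+ 2 * c + (n ^+ 2 + n * C).
 by move: hD; rewrite -EFinM -EFinD lee_fin; rewrite -/n => h; apply: le_trans h _; lra.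
have n2 : 0 < n ^+ 2 by rewrite exprn_gt0.
rewrite -(ler_pM2l n2); apply: le_trans (le_trans hB (lerD hD (lexx _))) _.
have C0 : 0 <= C by rewrite !addr_ge0// mulr_ge0// sqr_ge0.
have : n * C <= n ^+ 2 * (C * harmonic m).
 rewrite expr2 -mulrA ler_pM2l// mulrCA -[leLHS]mulr1 ler_wpM2l//= ler_pdivlMr ?mul1r//.
 by rewrite ler_nat tm.
lra.
Qed.
End climit.

(** * Energy of the limit law *)

Section energy_limit.
Variable R : realType.
Local Notation T := (R * R)%type.
Local Notation MR := (measurableTypeR R).

Lemma prob_law (P : probability MR R) (f : MR -> T) : measT f -> exists mu : probability T R,
 (forall A, mu A = P (f @^-1` A)) /\
 forall g : T -> \bar R, measT g -> (forall x, 0 <= g x)%E -> (\int[mu]_z g z = \int[P]_u g (f u))%E.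
Proof.
move=> mf; pose m0 : {measure set T -> \bar R} := pushforward P f.
pose m := m0 mf.
have [|mu muE] := @ex_prob R m.
 by change (P (f @^-1` setT) = 1%E); rewrite preimage_setT probability_setT.
exists mu; split; first exact: muE.
move=> g mg g0; transitivity (\int[m]_z g z)%E; first by apply: eq_measure_integral => B mB _; exact: muE.
by rewrite ge0_integral_pushforward.
Qed.

Lemma mct d (S : measurableType d) (m : {measure set S -> \bar R}) (g : nat -> S -> \bar R) (f : S -> \bar R) :
 (forall n, measT (g n)) -> (forall n x, 0 <= g n x)%E ->
 (forall x a b, (a <= b)%N -> (g a x <= g b x)%E) -> (forall x, g n x @[n --> \oo] --> f x) ->
 (\int[m]_x g n x @[n --> \oo] --> \int[m]_x f x)%E.
Proof.
move=> mg g0 gm gf; have := @cvg_monotone_convergence _ _ _ m setT measurableT g mg (fun n x _ => g0 n x) (fun x _ => gm x).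
rewrite (eq_integral f)// => x _; exact/cvg_lim.
Qed.

Lemma hh_cvg (z w : T) : ((hh (harmonic n) z w)%:E @[n --> \oo] --> KK z w + 1)%E.
Proof.
rewrite /KK logkerE; case: eqP => [zw|/eqP zw].
 rewrite !addye//; apply/cvgeryP/cvgryPge => A.
 exists (Num.truncn (expR (2 * A))) => // n /= hn; rewrite /hh zw add0r /=.
 have h : expR (2 * A) <= n.+1%:R.
  by apply: ltW; apply: lt_le_trans (truncnS_gt _) _; rewrite ler_nat.
 have : 2 * A <= ln n.+1%:R by rewrite -ler_expR lnK// posrE.
 rewrite lnV ?posrE//; have := sqnorm_ge0 z; have := sqnorm_ge0 w; lra.
have p0 : 0 < sqnorm (z - w) by rewrite lt_def zw sqnorm_ge0.
rewrite -!EFinD; apply: cvg_EFin; first exact: nearW.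
rewrite [X in _ --> X](_ : _ = (sqnorm z + sqnorm w) / 2 - ln (sqnorm (z - w) + 0) / 2 + 1); last by rewrite addr0; lra.
apply: cvgD; last exact: cvg_cst.
apply: cvgB; first exact: cvg_cst.
apply: cvgM; last exact: cvg_cst.
apply: (@continuous_cvg _ _ _ \oo _ (fun n => sqnorm (z - w) + harmonic n) (@ln R)).
 by apply: continuous_ln; rewrite addr0.
by apply: cvgD; [exact: cvg_cst|exact: cvg_harmonic].
Qed.

Lemma mk2_hh e : 0 < e -> e <= 1 -> mk2 (fun z w : T => (hh e z w)%:E).
Proof.
move=> e0 e1; split; last by move=> z w; rewrite lee_fin hh_ge0.
by efin; apply: meas_hh; [exact: mfst|exact: msnd].
Qed.

(** Monotone convergence along [e = 1 / (n + 1)]; the constant 1, which kept the regularised kernels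
    nonnegative, integrates to 1 and is subtracted at the end. *)
Lemma dbl_hh_KK (mu : probability T R) c :
 (forall e, 0 < e -> e <= 1 -> (dbl mu mu (fun z w => (hh e z w)%:E) <= (c + 1)%:E)%E) ->
 (dbl mu mu (@KK R) <= c%:E)%E.
Proof.
move=> H; have hk n : mk2 (fun z w : T => (hh (harmonic n) z w)%:E).
 by apply: mk2_hh; rewrite //= invf_le1// ler1n.
have hm z w a b : (a <= b)%N -> ((hh (harmonic a) z w)%:E <= (hh (harmonic b) z w)%:E :> \bar R)%E.
 by move=> ab; rewrite lee_fin; apply: hh_mono => //=; rewrite lef_pV2 ?posrE// ler_nat.
have h1 : (dbl mu mu (fun z w => (hh (harmonic n) z w)%:E) @[n --> \oo] --> dbl mu mu (fun z w => KK z w + 1))%E.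
 apply: mct => [n|n z|z a b ab|z].
 - exact: mk2_int.
 - by apply: integral_ge0 => w _; exact: (hk n).2.
 - apply: ge0_le_integral => //; try exact: (mk2_curry _ (hk _)).
  + by move=> w _; exact: (hk a).2.
  + by move=> w _; exact: hm.
 - apply: mct => [n|n w|w a b|w]; [exact: (mk2_curry _ (hk n))|exact: (hk n).2|exact: hm|exact: hh_cvg].
have : (dbl mu mu (fun z w => KK z w + 1) <= (c + 1)%:E)%E.
 rewrite -(cvg_lim _ h1)//; apply: lime_le; first exact: cvgP h1.
 by apply: nearW => n; apply: H; rewrite //= invf_le1// ler1n.
rewrite dblD; [|exact: mK2|exact: mk2_cst].
by rewrite dbl_cst EFinD leeD2rE.
Qed.

(** The competitor in the definition of [R_U] is the law of the limit point [f u], with [u] uniform.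
    Its regularised energy is compared with that of the step functions at resolution [k], which the
    tuples control. *)
Lemma compactness (a c : R) (U : set T) (t : nat -> seq T) : 0 < a -> open U ->
 (forall m z, z \in t m -> box a z /\ ~ U z) -> (forall m, (m < size (t m))%N) ->
 (forall m, EE (t m) <= ((size (t m))%:R ^+ 2 * c / 2)%:E)%E -> (R_U U <= c%:E)%E.
Proof.
move=> a0 oU tV tm hE; have cV : closed (~` U) by exact: open_closedC.
have [G [UG hG]] := @ultraFilterLemma nat \oo _.
have c01 kb m : 0 <= cnt a t kb.1 kb.2 m <= 1.
 rewrite /cnt divr_ge0//= ler_pdivrMr ?(@size_gt0R R t tm m)// mul1r ler_nat; exact: count_size.
have [F0 hF0] := choice (fun kb => ultra_lim UG (c01 kb)).
pose F k b := F0 (k, b); have hF k b : cnt a t k b @ G --> F k b := hF0 (k, b).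
have [P [P0 Pab]] := ex_unif R.
have [f [mf fn fV]] := ex_flim a0 tV tm UG hF cV.
have [mu [muE muI]] := @prob_law P f mf.
set B := `[0, 1[%classic in P0; have mB : @measurable _ MR B by exact: measurable_itv.
have inB u : B u -> 0 <= u < 1 by rewrite /B /= in_itv.
have pV : probs_in (~` U) mu.
 apply: (@probs_inI R _ (~` U `&` [set z | sqnorm z <= 2 * a ^+ 2]) (2 * a ^+ 2)).
 - by apply: closedI => //; exact: closed_B.
 - by move=> z [].
 - by move=> z [].
 rewrite muE; apply: (@subset_measure0 _ _ _ P _ (~` B)).
 - rewrite -[X in measurable X]setTI; apply: mf => //; apply: measurableC; apply: measurableI; last exact: bdd_B.
  exact: closed_measurable2.
 - exact: measurableC.
 - move=> u h Bu; apply: h; have [h1 h2 h3] := fV u (inB u Bu); split => //=.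
  have s (x : R) : `|x| <= a -> x ^+ 2 <= a ^+ 2 by rewrite ler_norml => /andP[]; nra.
  by have := s _ h2; have := s _ h3; rewrite /sqnorm; lra.
 - exact: P0.
apply: (@le_trans _ _ (dbl mu mu (@KK R))).
 by rewrite /dbl -(RmuE pV); apply: ereal_inf_lbound; exists mu.
apply: dbl_hh_KK => e e0 e1; pose L := 4 * a + 8 * a / e; have [mh h0] := mk2_hh e0 e1.
have L0 : 0 <= L by rewrite addr_ge0// ?divr_ge0// ?mulr_ge0// ltW.
have mhf (z : MR -> T) : measT z -> forall w, measT (fun v => (hh e w (z v))%:E).
 by move=> mz w; efin; apply: meas_hh => //; exact: measurable_cst.
have -> : dbl mu mu (fun z w => (hh e z w)%:E) = (\int[P]_u \int[P]_v (hh e (f u) (f v))%:E)%E.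
 rewrite /dbl muI; last by move=> z; apply: integral_ge0.
  by apply: eq_integral => u _; rewrite muI//; exact: (mk2_curry _ (mk2_hh e0 e1)).
 exact: (mk2_int mu (mk2_hh e0 e1)).
(* Two Lipschitz errors [L * ep] occur: from points to representatives, and from representatives to
   the limit. At resolution [k] their sum is below [d]. *)
apply/lee_addgt0Pr => d d0; have [k hk] := pow2_lt (L * (2 * a) * 2) d0.
pose ep := 2 * a / 2 ^+ k; pose rp := rep a (~` U) k.
have ep0 : 0 <= ep by rewrite divr_ge0 ?exprn_ge0// mulr_ge0// ltW.
pose g b := \sum_(b' < 4 ^ k) hh e (rp b) (rp b') * pk F k b'.
have p0 b : 0 <= pk F k b by rewrite subr_ge0 (F_mono tm UG hF).
have g0 b : 0 <= g b by apply: sumr_ge0 => i _; rewrite mulr_ge0// hh_ge0.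
have LE0 : 0 <= L * ep by exact: mulr_ge0.
have st0 q u : (forall b, 0 <= q b) -> 0 <= step F q k u.
 by move=> q0; apply: sumr_ge0 => i _; rewrite mulr_ge0.
have mstep q : measT (fun u : MR => (step F q k u + L * ep)%:E).
 by efin; apply: measurable_funD => //; exact: meas_step.
have istep q : (forall b, 0 <= q b) -> (\int[P]_u (step F q k u + L * ep)%:E = (\sum_(b < 4 ^ k) q b * pk F k b + L * ep)%:E)%E.
 move=> q0; under eq_integral do rewrite EFinD.
 rewrite ge0_integralD//; [|by move=> u _; rewrite lee_fin st0|by efin; exact: meas_step].
 by rewrite (int_step a0 tm UG hF) // integral_cst//= probability_setT mule1.
apply: (@le_trans _ _ (\int[P]_u (step F g k u + L * ep)%:E)%E).
 have mff : measT (fun p : MR * MR => (hh e (f p.1) (f p.2))%:E).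
  by efin; apply: meas_hh; apply: (meas_comp mf); [exact: mfst|exact: msnd].
 apply: (@le_int_null _ _ _ P B) => //.
 - exact: (meas_int_curry P mff).
 - by move=> u; apply: integral_ge0.
 - by move=> u; rewrite lee_fin addr_ge0// st0.
 move=> u /inB u01; rewrite (step_in a0 tm UG hF)//.
 have hq b : 0 <= hh e (rp (Bk F k u)) (rp b) by exact: hh_ge0.
 rewrite -(istep _ hq); apply: (@le_int_null _ _ _ P B) => //; first exact: mhf.
  by move=> v; rewrite lee_fin addr_ge0// st0.
 move=> v /inB v01; rewrite lee_fin (step_in a0 tm UG hF)//.
 have [eu [bu _ _]] := fk_in a0 tV tm UG hF k u01; have [ev [bv _ _]] := fk_in a0 tV tm UG hF k v01.
 have [_ fu1 fu2] := fV u u01; have [_ fv1 fv2] := fV v v01.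
 rewrite /rp -eu -ev; apply: hh_lip => //.
 - move=> x; rewrite !inE => /or4P[] /eqP ->; split => //; apply: ltW; (exact: bu.1 || exact: bu.2 || exact: bv.1 || exact: bv.2).
 - by have [n1 n2] := fn k u; split; rewrite distrC.
 - by have [n1 n2] := fn k v; split; rewrite distrC.
rewrite istep//; have := esum_le a0 tV tm UG hF k e0 e1 hG hE; rewrite /esum_k -/rp -/ep -/L -EFinD lee_fin => h.
apply: (@le_trans _ _ (c + 1 + L * ep + L * ep)); first by rewrite lerD2r.
have : L * (2 * a) * 2 / 2 ^+ k = L * ep + L * ep by rewrite /ep; ring.
move: hk => /ltW; lra.
Qed.
End energy_limit.

(** * Exponential rates *)

Section rates.
Variable R : realType.
Local Notation T := (R * R)%type.
Implicit Types (U V : set T) (s t : seq T).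

Lemma sqnorm_box (M : R) z : 0 <= M -> sqnorm z <= M -> box (M + 1) z.
Proof.
rewrite /sqnorm => M0 h; have s (x : R) : x ^+ 2 <= M -> `|x| < M + 1.
 by move=> xM; rewrite ltNge; apply/negP; rewrite -real_normK ?num_real// in xM; move=> l; nra.
by have := sqr_ge0 z.1; have := sqr_ge0 z.2; split; apply: s; lra.
Qed.

Lemma size_filter_far (M : R) s : 0 < M ->
 (size s)%:R - sqsum s / M <= (size [seq z <- s | sqnorm z <= M])%:R.
Proof.
move=> M0; rewrite /sqsum; elim: s => [|z s IH] /=; first by rewrite big_nil mul0r subr0.
rewrite big_cons mulrDl; have := sqnorm_ge0 z; case: (lerP (sqnorm z) M) => h z0; rewrite /= -?natr1.
 have : 0 <= sqnorm z / M by apply: divr_ge0 => //; exact: ltW.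
 by move: IH; lra.
have : 1 <= sqnorm z / M by rewrite ler_pdivlMr// mul1r ltW.
by move: IH; lra.
Qed.

(* An energy bound n^2 c / 2 keeps all but a small fraction of the n points in a fixed box. *)
Lemma bounded_sublist U (c c1 : R) : 0 <= c -> c < c1 -> exists2 a : R, 0 < a & forall (m : nat) s,
 (2 * m + 4 <= size s)%N -> (EE s <= ((size s)%:R ^+ 2 * c / 2)%:E)%E -> (forall z, z \in s -> ~ U z) ->
 exists t, [/\ (m < size t)%N, (forall z, z \in t -> box a z /\ ~ U z) & (EE t <= ((size t)%:R ^+ 2 * c1 / 2)%:E)%E].
Proof.
move=> c0 cc; have c10 : 0 < c1 by exact: le_lt_trans cc.
(* As [c = c1 (1 - 2 eta)], discarding a fraction [eta] of the points leaves a bound with [c1]. The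
   constant [C] bounds the mean of [|z|^2], from [EE_lower], and Markov's inequality then gives the
   radius. *)
pose eta := (c1 - c) / (2 * c1); pose C := 4 * c + 2.
have eta0 : 0 < eta by rewrite divr_gt0 ?subr_gt0 ?mulr_gt0.
have eta1 : eta <= 1 / 2 by rewrite ler_pdivrMr ?mulr_gt0//; lra.
have etac : c <= c1 * (1 - eta) ^+ 2.
 have : c = c1 * (1 - 2 * eta) by rewrite /eta; field; rewrite gt_eqF.
 by move=> {1}->; rewrite ler_pM2l//; nra.
have C0 : 0 < C by rewrite /C; lra.
pose M := C / eta; have M0 : 0 < M by rewrite divr_gt0.
exists (M + 1) => [|m s sm hE sU]; first by rewrite addr_gt0.
exists [seq z <- s | sqnorm z <= M].
set n : R := (size s)%:R in hE; have n4 : 2 * m%:R + 4 <= n by rewrite -natrM -natrD ler_nat.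
have m0 : 0 <= m%:R :> R by [].
have hS : sqsum s <= C * n.
 have := le_trans (EE_lower s) hE; rewrite -/n lee_fin => h.
 have p : 0 < (n - 1) / 4 by lra.
 rewrite -(ler_pM2l p); have : 0 <= c * n * (n - 2) by rewrite !mulr_ge0//; lra.
 by move: h; rewrite /C; nra.
have hn : (1 - eta) * n <= (size [seq z <- s | sqnorm z <= M])%:R.
 apply: le_trans (size_filter_far s M0); rewrite -/n mulrBl mul1r lerB// ler_pdivrMr//.
 by rewrite (_ : eta * n * M = C * n)// /M; field; rewrite gt_eqF.
split.
- rewrite -(ltr_nat R); apply: lt_le_trans hn; nra.
- by move=> z; rewrite mem_filter => /andP[h /sU]; split => //; exact: sqnorm_box (ltW M0) h.
apply: le_trans (EE_filter _ _) (le_trans hE _); rewrite lee_fin ler_pM2r ?invr_gt0//.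
set k := (size _)%:R in hn *; have e1 : 0 <= (1 - eta) * n by apply: mulr_ge0; lra.
apply: (@le_trans _ _ (((1 - eta) * n) ^+ 2 * c1)).
 by have := ler_wpM2l (sqr_ge0 n) etac; rewrite exprMn; lra.
by rewrite ler_pM2r// ler_sqr// nnegrE (le_trans e1).
Qed.

(** An intermediate [c1] between [c] and [R_U] pays for the points lost in [bounded_sublist]. The
    argument covers an infinite [R_U]. *)
Lemma Wq_upper U (c : R) : open U -> (c%:E < R_U U)%E ->
 \forall n \near \oo, forall t, size t = n -> {in t, forall z, ~ U z} -> Wq t <= expR (- (n%:R ^+ 2 * c)).
Proof.
move=> oU cR; apply: contrapT => nn.
have H N : exists t, [/\ (N <= size t)%N, (forall z, z \in t -> ~ U z) & (EE t < ((size t)%:R ^+ 2 * c / 2)%:E)%E].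
 apply: contrapT => h; apply: nn; exists N => // n Nn t tn tU; rewrite leNgt; apply/negP => l; apply: h.
 exists t; split => //; first by rewrite tn.
 have W0 := lt_trans (expR_gt0 _) l; rewrite (Wq_EE W0) lte_fin tn.
 by move: l; rewrite -ltr_ln ?posrE ?expR_gt0// expRK; lra.
have c0 : 0 <= c.
 have [t [_ _ h]] := H 1%N; have := le_lt_trans (EE_ge0 t) h; rewrite lte_fin => {}h.
 by rewrite leNgt; apply/negP => cn; have := sqr_ge0 ((size t)%:R : R); nra.
have [c1 cc1 c1R] : exists2 c1, c < c1 & (c1%:E < R_U U)%E.
 move: cR; case: (R_U U) => [r| |]// cR; last by exists (c + 1); rewrite ?ltrDl ?ltry.
 by exists ((c + r) / 2); move: cR; rewrite ?lte_fin; lra.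
have [a a0 ha] := bounded_sublist U c0 cc1.
have [t ht] := choice (fun m => let: ex_intro s (And3 h1 h2 h3) := H (2 * m + 4)%N in ha m s h1 (ltW h3) h2).
have := @compactness R a c1 U t a0 oU (fun m => let: And3 _ h _ := ht m in h)
 (fun m => let: And3 h _ _ := ht m in h) (fun m => let: And3 _ _ h := ht m in h).
by rewrite leNgt c1R.
Qed.

Lemma Zp_rate_upper U (c : R) : open U -> (c%:E < R_U U)%E ->
 \forall n \near \oo, (Zp n%:R U n [::] <= (pi ^+ n * expR (- (n%:R ^+ 2 * c)))%:E)%E.
Proof.
move=> oU /(Wq_upper oU); apply: filterS => n h.
have := @Zp_upper R U n _ (open_measurable2 oU) (expR_ge0 _) h n [::] (add0n n).
by rewrite /= mul1e /sqsum big_nil mulr0 expR0 mul1r; apply.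
Qed.

(** The compact closure of [U] keeps a positive distance from the complement of [V]. *)
Lemma smear_room U V : (forall z, closure U z -> `|z| <= 1) -> open V -> closure U `<=` V ->
 \forall d \near 0^'+, forall x y, ~ V x -> sqnorm y < 1 -> ~ U (sm d x y).
Proof.
move=> bU oV UV; have /compact_near_coveringP cU : compact (closure U).
 by apply: (@compact_box R 1) => //; exact: closed_closure.
have : \forall d \near (0 : R)^'+, closure U `<=` (fun z => ball z d `<=` V).
 apply: cU => z /UV Vz; have /nbhs_ballP[r /= r0 rV] := open_nbhs_nbhs (conj oV Vz).
 have r2 : 0 < r / 2 by rewrite divr_gt0.
 exists (ball z (r / 2), [set i | i < r / 2]) => /=.
  split; first exact: nbhsx_ballx.
  exact: nbhs_right_lt.
 move=> [z' i] [/= zz' ir] x xi; apply: rV; apply: (@ball_splitr _ _ z') => //; last exact: le_ball (ltW ir) _ xi.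
 exact: ball_sym.
move=> h; near=> d; move=> x y Vx y1 Us.
have d0 : 0 < d by near: d; exact: nbhs_right_gt.
apply: Vx; apply: (near h d _ (sm d x y)) => //; first exact: subset_closure.
have s (v w : R) : v ^+ 2 + w ^+ 2 < 1 -> `|d * v| < d.
 move=> vw; rewrite normrM gtr0_norm// -[ltRHS]mulr1 ltr_pM2l// ltNge; apply/negP => l.
 have : 1 <= v ^+ 2 by rewrite -real_normK ?num_real// expr_ge1.
 by have := sqr_ge0 w; lra.
by split; rewrite /ball/= /sm/= addrC addKr; [apply: (s _ y.2)|apply: (s _ y.1); rewrite addrC].
Unshelve. all: by end_near. Qed.

Lemma circular_law : exists om : probability T R, om (~` dsc 1) = 0%E /\
 forall f, measT f -> (forall x, 0 <= f x)%E -> (\int[om]_x f x = (pi^-1)%:E * \int[leb2]_(x in dsc 1) f x)%E.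
Proof.
have h : leb2 (dsc 1) = pi%:E :> \bar R by rewrite leb2_dscE// mulr1.
have [om [om1 om2]] := restr_prob (meas_dsc 1) h (pi_gt0 R).
by exists om; split => //; rewrite om1 setICl measure0 mule0.
Qed.

(** Order of choices: the index [n0] of the approximant, then the smearing radius [d], and only then
    [n], so that the term linear in [n], which involves [ln d], is negligible against [n^2]. *)
Lemma Zp_rate_lower U (Un : nat -> set T) : outer_approx U Un ->
 exists2 r : R, R_U U = r%:E & forall c, r < c ->
 \forall n \near \oo, ((expR (- (n%:R ^+ 2 * c)))%:E <= Zp n%:R U n [::])%E.
Proof.
move=> oa; have [r rE H] := bal_shift_cvg oa; have [oU _ oUn HUn _] := oa.
exists r => // c rc; have e0 : 0 < (c - r) / 4 by rewrite divr_gt0// subr_gt0.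
have [n0 [sg [sgU sgB sgE]]] := H _ e0; have [om [om1 om2]] := circular_law.
have [UV VD] := HUn n0.
have [E0 EE0 E0le] : exists2 E0, dbl sg sg (@KK R) = E0%:E & E0 <= r + (c - r) / 4.
 have := dbl_ge0 sg sg (@mK2 R); move: sgE; case: (dbl _ _ _) => [x| |]// h _; exists x => //; by rewrite -lee_fin.
have bU z : closure U z -> `|z| <= 1.
 move=> /UV /VD; rewrite /unit_disk/= /sqnorm => z1.
 have s (v w : R) : v ^+ 2 + w ^+ 2 < 1 -> `|v| <= 1.
  move=> vw; rewrite leNgt; apply/negP => l; have : 1 <= v ^+ 2 by rewrite -real_normK ?num_real// expr_ge1// ltW.
  by have := sqr_ge0 w; lra.
 rewrite (_ : `|z| = Num.max `|z.1| `|z.2|)// ge_max (s _ z.2)//= (s _ z.1)//; lra.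
(* With [d <= (c - r) / 12] one has [E0 + 3 d <= (c + r) / 2]; the other half of [c - r] absorbs the
   linear term. *)
have [d [d0 d1 de hd]] : exists d, [/\ 0 < d, d <= 1, d <= (c - r) / 12 & forall x y, ~ Un n0 x -> sqnorm y < 1 -> ~ U (sm d x y)].
 have h := smear_room bU (oUn n0) UV; suff : \forall d \near (0 : R)^'+, [/\ 0 < d, d <= 1, d <= (c - r) / 12 &
   forall x y, ~ Un n0 x -> sqnorm y < 1 -> ~ U (sm d x y)] by move=> /filter_ex.
 near=> d; split; [near: d; exact: nbhs_right_gt|near: d; exact: nbhs_right_le|near: d; apply: nbhs_right_le|].
  by rewrite divr_gt0// subr_gt0.
 exact: (near h).
pose A := ln (pi^-1 * d^-1 ^+ 2) + 4.
exists (Num.truncn (2 * `|A| / (c - r)) + 1)%N => // n /= hn.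
have hnA : 2 * `|A| <= n%:R * (c - r).
 rewrite -ler_pdivrMr ?subr_gt0//; apply: le_trans (ltW (truncnS_gt _)) _.
 by rewrite -addn1 ler_nat.
have hs := smear_lower d0 d1 om1 om2 (open_measurable2 oU) sgU (open_measurable2 (oUn n0)) sgB EE0 hd n; apply: le_trans hs.
rewrite lee_fin ler_expR -/A; have n0' : 0 <= n%:R :> R by [].
have hA : n%:R * A <= n%:R * (n%:R * (c - r) / 2).
 by rewrite ler_wpM2l//; apply: le_trans (ler_norm A) _; lra.
have E0p : 0 <= E0 by have := dbl_ge0 sg sg (@mK2 R); rewrite EE0 lee_fin.
have h1 : n%:R * (n%:R - 1) * (E0 + 3 * d) <= n%:R * n%:R * (E0 + 3 * d).
 by rewrite ler_wpM2r ?addr_ge0 ?mulr_ge0 ?(ltW d0)// ler_wpM2l//; lra.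
have h2 : n%:R * n%:R * (E0 + 3 * d) <= n%:R * n%:R * ((c + r) / 2) by rewrite ler_wpM2l ?mulr_ge0//; lra.
by rewrite -/A; lra.
Unshelve. all: by end_near. Qed.
End rates.

Lemma Zp_rate (R : realType) (U : set (R * R)) (Un : nat -> set (R * R)) : outer_approx U Un ->
 exists2 r : R, R_U U = r%:E & forall e, 0 < e -> \forall n \near \oo,
  exists z, [/\ 0 < z, Zp n%:R U n [::] = z%:E & `|r + (n%:R ^+ 2)^-1 * ln z| <= e].
Proof.
move=> oa; have [r rE H] := Zp_rate_lower oa; have [oU _ _ _ _] := oa.
exists r => // e e0; have e2 : 0 < e / 2 by rewrite divr_gt0.
have re : r < r + e by rewrite ltrDl.
have hl := H (r + e) re; have re2 : ((r - e / 2)%:E < R_U U)%E by rewrite rE lte_fin ltrBlDr ltrDl.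
have hu := Zp_rate_upper oU re2; near=> n.
have n1 : (0 < n)%N by near: n; exists 1%N.
have hn : ln pi <= n%:R * (e / 2).
 rewrite -ler_pdivrMr//; near: n; exists (Num.truncn (ln pi / (e / 2))).+1 => // n /= nn.
 by apply: le_trans (ltW (truncnS_gt _)) _; rewrite ler_nat.
have l : ((expR (- (n%:R ^+ 2 * (r + e))))%:E <= Zp n%:R U n [::])%E by near: n.
have u : (Zp n%:R U n [::] <= (pi ^+ n * expR (- (n%:R ^+ 2 * (r - e / 2))))%:E)%E by near: n.
move: l u; case: (Zp _ _ _ _) => [z| |]//; rewrite !lee_fin => l u; exists z.
have z0 : 0 < z := lt_le_trans (expR_gt0 _) l.
have n2 : 0 < n%:R ^+ 2 :> R by rewrite exprn_gt0// ltr0n.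
split => //; have pn : 0 < pi ^+ n :> R by rewrite exprn_gt0// pi_gt0.
have l1 : - (n%:R ^+ 2 * (r + e)) <= ln z by rewrite -[leLHS]expRK ler_ln ?posrE// expR_gt0.
have u1 : ln z <= n%:R * ln pi - n%:R ^+ 2 * (r - e / 2).
 rewrite -[X in _ <= _ - X]opprK opprK -[X in _ <= _ + X]expRK mulr_natl -lnXn ?pi_gt0// -lnM ?posrE ?expR_gt0//.
 by rewrite ler_ln ?posrE// mulr_gt0// expR_gt0.
have h : n%:R * ln pi <= n%:R ^+ 2 * (e / 2) by rewrite expr2 -mulrA ler_wpM2l.
have -> : r + (n%:R ^+ 2)^-1 * ln z = (n%:R ^+ 2 * r + ln z) / n%:R ^+ 2.
 by rewrite mulrDl mulrAC divff ?mul1r ?gt_eqF// [X in _ + X]mulrC.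
rewrite normrM [X in _ * X]gtr0_norm ?invr_gt0// ler_pdivrMr// ler_norml; apply/andP; split; lra.
Unshelve. all: by end_near. Qed.

(** The zero measure; the exceptional set is empty, and it is polar because no probability measure
    has empty support. *)
Lemma balayage_set0 (R : realType) : @is_balayage R set0 mzero.
Proof.
split=> //; split=> //; exists set0; split.
 split=> // mu [_]; rewrite subset0 => s0.
 have : (mu (~` supp mu) = 0)%E by exact: suppC_null.
 by rewrite s0 setC0 probability_setT => /eqP; rewrite onee_eq0.
by move=> z _ _; rewrite integral_measure_zero integral_set0 mule0.
Qed.

Theorem theorem1p4 (R : realType) (U : set (R * R))
    (Un : nat -> set (R * R))
    (nu_ : nat -> {measure set (R * R) -> \bar R})
    (nu : {measure set (R * R) -> \bar R}) :
  open U -> U `<=` @unit_disk R ->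
  (forall n, open (Un n)) ->
  (forall n, closure U `<=` Un n /\ Un n `<=` @unit_disk R) ->
  (forall n, is_balayage (Un n) (nu_ n)) ->
  is_balayage U nu ->
  weak_cvg nu_ nu ->
  ((n%:R ^+ 2)^-1 * ln (fine (@ginibre_prob R n (@no_eigs_in R n U))))%:E
    @[n --> \oo] --> (@R_empty R - R_U U)%E.
Proof.
move=> oU UD oUn HUn Hb Hbal W.
have [|r rE H] := @Zp_rate R U Un; first by split => //; exists nu_, nu.
(* The empty set is its own outer approximation, with constant zero balayage, so the same rate gives
   the denominator and the value of [R_empty]. *)
have [|r0 r0E H0] := @Zp_rate R set0 (fun=> set0).
 split; [exact: open0|exact: sub0set|by move=> _; exact: open0|by move=> _; rewrite closure0; split=> //; exact: sub0set|].
 by exists (fun=> mzero), mzero; split; [move=> _; exact: balayage_set0|exact: balayage_set0|move=> f _ _; exact: cvg_cst].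
have -> : @R_empty R = r0%:E by rewrite -r0E /R_empty /R_U setC0.
rewrite rE -EFinB; apply: cvg_EFin; first exact: nearW.
apply/cvgrPdist_le => e e0; have e2 : 0 < e / 2 by rewrite divr_gt0.
have h := H _ e2; have h0 := H0 _ e2; near=> n.
have n1 : (0 < n)%N by near: n; exists 1%N.
have [z [z0 zE hz]] : exists z, [/\ 0 < z, Zp n%:R U n [::] = z%:E & `|r + (n%:R ^+ 2)^-1 * ln z| <= e / 2] by near: n.
have [x [x0 xE hx]] : exists z, [/\ 0 < z, Zp n%:R set0 n [::] = z%:E & `|r0 + (n%:R ^+ 2)^-1 * ln z| <= e / 2] by near: n.
have [y y0 [yE PE]] := prob_ratio n1 oU.
have xy : y = x by move: yE; rewrite xE => -[].
rewrite /=; have -> : ginibre_prob (@no_eigs_in R n U) = (z / x)%:E.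
 move: PE; rewrite xy zE; case: (ginibre_prob _) => [p| |].
 - by rewrite -EFinM => -[<-]; rewrite mulfK// gt_eqF.
 - by rewrite mulyr gtr0_sg// mul1e.
 - by rewrite mulNyr gtr0_sg// mul1e.
rewrite ln_div ?posrE// mulrBr; move: hz hx; rewrite !ler_norml => /andP[z1 z2] /andP[x1 x2].
by apply/andP; split; lra.
Unshelve. all: by end_near. Qed.
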